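(* Let $n\in\mathbb{N}$, let $\mathcal{L}_n\subseteq\mathbb{S}^2$ be the $(2n)$-runged ladder $3$-graph, and let $\mathbb{F}_q$ be a finite field. Then the flag moduli space $\mathcal{M}(\mathcal{L}_n)$ has orbifold point count $$|\mathcal{M}(\mathcal{L}_n)(\mathbb{F}_q)|=\frac{q^{2n-3}-q^{n-2}+q^{n-1}+q-1}{(q-1)^2}.$$ In particular, the Legendrian $3$-component links of $2$-spheres $\Lambda(\mathcal{L}_n)$ and $\Lambda(\mathcal{L}_m)$ are Legendrian isotopic if and only if $n=m$.
   Context: **$N$-graphs.** An $N$-graph $G$ on a smooth surface $C$ is a set $\{G_i\}_{1\le i\le N-1}$ of embedded trivalent graphs $G_i\subseteq C$ (possibly empty or disconnected) such that $G_i$ and $G_{i+1}$ intersect only at hexagonal points, i.e. at isolated common vertices where the six incident half-edges alternately belong to $G_i$ and $G_{i+1}$. Edges of $G_i$ are $\tau_i$-edges, $\tau_i=(i,i+1)$. A face is the closure of a connected component of $C\setminus G$. **Ladder $3$-graph.** Let $L_n\subseteq\mathbb{S}^2$ be the bipartite ladder graph with $2n$ rungs whose left and right ends are identified, i.e. the prism graph over a $2n$-gon: a graph embedded in $\mathbb{S}^2$ with $4n$ trivalent vertices (two concentric cycles of length $2n$ joined by $2n$ rungs), whose complement has $2n+2$ components: $2n$ squares and two polar $2n$-gons. It is bipartite; color its vertices black and white. The $3$-graph $\mathcal{L}_n$ is obtained by replacing each vertex by a hexagonal vertex and doubling each edge into two parallel edges, one labeled $\tau_1$ and the other $\tau_2$,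 joining the two hexagonal vertices, such that, orienting edges from white to black, the $\tau_1$-copy is always on the left and the $\tau_2$-copy on the right (so that labels alternate around each vertex). $\mathcal{L}_n$ has no trivalent vertices other than hexagonal ones. **Flag moduli space and count.** For a $3$-graph $G\subseteq\mathbb{S}^2$ and a field $k$, $\widetilde{\mathcal{M}}(G)(k)$ is the set of assignments of a complete flag in $k^3$ to each face of $G$ such that the flags of two faces sharing a $\tau_i$-edge differ in exactly their $i$-dimensional subspace ($i=1,2$). $\mathcal{M}(G)=\widetilde{\mathcal{M}}(G)/\mathrm{PGL}_3$ is the quotient stack by the diagonal action, and its orbifold point count is $|\mathcal{M}(G)(\mathbb{F}_q)|=|\widetilde{\mathcal{M}}(G)(\mathbb{F}_q)|/|\mathrm{PGL}(3,\mathbb{F}_q)|$. **Legendrian weave.** $\Lambda(G)\subseteq (J^1\mathbb{S}^2,\ker(dz-\lambda_{\rm st}))$ is the embedded Legendrian surface whose front in $\mathbb{S}^2\times\mathbb{R}$ is obtained from the $3$ sheets $\mathbb{S}^2\times\{1\},\mathbb{S}^2\times\{2\},\mathbb{S}^2\times\{3\}$ (numbered by height) by making the $i$th and $(i+1)$st sheets cross transversely along each $\tau_i$-edge, with a transverse triple intersection of the three sheets at each hexagonal point (and a $D_4^-$-singularity at each other trivalent vertex, of which there are none here). For $G=\mathcal{L}_n$ it is a $3$-component link of Legendrian $2$-spheres. *)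

(* Defs.v *)
From HB Require Import structures.
From mathcomp Require Import all_boot all_order all_algebra all_fingroup all_solvable.
From mathcomp Require Import all_classical all_reals all_analysis.

Set Implicit Arguments.
Unset Strict Implicit.
Unset Printing Implicit Defensive.

Import Order.TTheory GRing.Theory Num.Theory.
Import numFieldNormedType.Exports.

Local Open Scope ring_scope.

(* A graph embedded in an oriented surface, up to orientation-preserving
   homeomorphism, is encoded by its rotation system. A dart is an edge with a
   chosen end, thought of as leaving that end; [opp] is the same edge leaving
   the other end, and [rot] is the next dart counterclockwise around the
   vertex. Vertices are the orbits of [rot] and, for a connected graph in the
   sphere, faces are the orbits of [face_next]. *)
Record plane_graph := PlaneGraph {
  dart :> finType;
  opp : dart -> dart;
  rot : dart -> dart;
  oppK : involutive opp;
  opp_neq : forall d, opp d != d;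
  rot_inj : injective rot }.

Arguments opp {p}.
Arguments rot {p}.

Section Faces.
Variable G : plane_graph.

(* Follows the boundary of the face lying on the right of a dart. *)
Definition face_next (d : G) : G := rot (opp d).

Definition face_set (d : G) : {set G} := [set e | fconnect face_next d e].

Definition face := {A : {set G} | A \in [set face_set d | d : G]}.

Definition right_face (d : G) : face :=
  exist _ (face_set d) (imset_f face_set (isT : d \in predT)).

Definition left_face (d : G) : face := right_face (opp d).

End Faces.

(* A 3-graph: darts carry the label tau_1 ([tau1 d]) or tau_2 ([~~ tau1 d]),
   each vertex being either a trivalent vertex of G_1 or of G_2, or a
   hexagonal point. *)
Record three_graph := ThreeGraph {
  tg_graph :> plane_graph;
  tau1 : pred tg_graph;
  tau1_opp : forall d, tau1 (opp d) = tau1 d;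
  tg_vertex : forall d : tg_graph,
    (fingraph.order rot d = 3 /\ tau1 (rot d) = tau1 d) \/
    (fingraph.order rot d = 6 /\ tau1 (rot d) = ~~ tau1 d) }.

(* Trivalent bipartite plane graphs; [white d] is the colour of the vertex
   that [d] leaves. *)
Record bicubic_graph := BicubicGraph {
  bg_graph :> plane_graph;
  white : pred bg_graph;
  white_opp : forall d, white (opp d) = ~~ white d;
  white_rot : forall d, white (rot d) = white d;
  bg_order : forall d : bg_graph, fingraph.order rot d = 3 }.

Section Doubling.
Variable B : bicubic_graph.

(* [(d, true)] and [(d, false)] are the tau_1- and tau_2-copies of [d]. With
   edges oriented from white to black and tau_1 on the left, the tau_2-copy
   comes first counterclockwise around a white vertex, and the tau_1-copy
   comes first around a black vertex. *)
Definition double_opp (x : B * bool) : B * bool := (opp x.1, x.2).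

Definition double_rot (x : B * bool) : B * bool :=
  (if x.2 == white x.1 then rot x.1 else x.1, ~~ x.2).

Lemma double_oppK : involutive double_opp.
Proof. by case=> d b; rewrite /double_opp /= oppK. Qed.

Lemma double_opp_neq x : double_opp x != x.
Proof. by case: x => d b; rewrite xpair_eqE negb_and opp_neq. Qed.

Lemma double_rot_inj : injective double_rot.
Proof.
move=> [d b] [e c]; rewrite /double_rot /= => -[+ /negb_inj bc].
rewrite -{c}bc.
case: (b =P white d) => hd; case: (b =P white e) => he E.
- by rewrite (rot_inj E).
- by case: he; rewrite -E white_rot.
- by case: hd; rewrite E white_rot.
- by rewrite E.
Qed.

Lemma double_order x : fingraph.order double_rot x = 6.
Proof.
have rot3 (d : B) : rot (rot (rot d)) = d.
  by have := iter_order (@rot_inj B) d; rewrite bg_order.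
have rotN (d : B) : rot d != d.
  apply/eqP => E; have := bg_order d.
  by rewrite (@order_cycle _ _ [:: d]) //= ?E ?eqxx ?mem_seq1.
have hex (y : B * bool) : y.2 == white y.1 -> fingraph.order double_rot y = 6.
  case: y => d b /= /eqP ->; set w := white d.
  have Nw : (~~ w == w) = false by case: w.
  have wr : white (rot d) = w by rewrite white_rot.
  have wrr : white (rot (rot d)) = w by rewrite !white_rot.
  pose p := [:: (d, w); (rot d, ~~ w); (rot d, w);
                (rot (rot d), ~~ w); (rot (rot d), w); (d, ~~ w)].
  have rrN : rot (rot d) != d.
    by apply: contra_neq (rotN d) => E; rewrite -{2}(rot3 d) E.
  apply: (@order_cycle _ _ p).
  - by rewrite /= /double_rot /= wr wrr -/w !eqxx Nw !negbK rot3 !eqxx.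
  - rewrite /= !inE !xpair_eqE !eqxx Nw (eq_sym w) Nw !(eq_sym d).
    rewrite !(negbTE (rotN _)) (eq_sym (rot d)) (negbTE (rotN _)).
    by rewrite (negbTE rrN).
  - by rewrite mem_head.
have [/hex//|xw] := boolP (x.2 == white x.1).
have E : fingraph.order double_rot (double_rot x) = fingraph.order double_rot x.
  by apply: eq_card => z; rewrite !inE -(same_fconnect1 double_rot_inj).
by rewrite -E hex //= (negbTE xw); case: (x.2) (white _) xw => [] [].
Qed.

Definition double_graph : plane_graph :=
  PlaneGraph double_oppK double_opp_neq double_rot_inj.

Lemma double_vertex (x : double_graph) :
  (fingraph.order rot x = 3 /\ (rot x).2 = x.2) \/
  (fingraph.order rot x = 6 /\ (rot x).2 = ~~ x.2).
Proof. by right; rewrite double_order. Qed.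

Definition double_three_graph : three_graph :=
  @ThreeGraph double_graph snd (fun=> erefl) double_vertex.

End Doubling.

Section Ladder.
Variable n : nat.

(* Vertices are pairs of a circle ([true] for the inner one) and a position in
   Z/2n, increasing counterclockwise; the darts leaving such a vertex are the
   rung ([None]) and those towards the next ([Some true]) and the previous
   ([Some false]) position. *)
Definition ladder_dart : finType := (bool * 'I_(2 * n) * option bool)%type.

Definition ladder_opp (d : ladder_dart) : ladder_dart :=
  let: (c, i, s) := d in
  match s with
  | None => (~~ c, i, None)
  | Some true => (c, ordS i, Some false)
  | Some false => (c, ord_pred i, Some true)
  end.

(* Counterclockwise, the order is rung, next, previous at an inner vertex and
   rung, previous, next at an outer one. *)
Definition ladder_rot (d : ladder_dart) : ladder_dart :=
  let: (c, i, s) := d in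
  (c, i, match s with
         | None => Some c
         | Some b => if b == c then Some (~~ b) else None
         end).

Definition ladder_white (d : ladder_dart) : bool := d.1.1 (+) odd d.1.2.

Lemma ladder_oppK : involutive ladder_opp.
Proof. by case=> [[c i] [[]|]] /=; rewrite ?negbK ?ordSK ?ord_predK. Qed.

Lemma ladder_opp_neq d : ladder_opp d != d.
Proof. by case: d => [[[] i] [[]|]]; rewrite !xpair_eqE /= ?andbF. Qed.

Lemma ladder_rot3 d : ladder_rot (ladder_rot (ladder_rot d)) = d.
Proof. by case: d => [[[] i] [[]|]]. Qed.

Lemma ladder_rot_inj : injective ladder_rot.
Proof. exact: (can_inj (g := ladder_rot \o ladder_rot) ladder_rot3). Qed.

Definition ladder_graph : plane_graph :=
  PlaneGraph ladder_oppK ladder_opp_neq ladder_rot_inj.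

Lemma ladder_white_ordS c (i : 'I_(2 * n)) :
  c (+) odd (ordS i) = ~~ (c (+) odd i).
Proof. by rewrite /= odd_mod ?mul2n ?odd_double //= addbN. Qed.

Lemma ladder_white_opp (d : ladder_graph) :
  ladder_white (opp d) = ~~ ladder_white d.
Proof.
case: d => [[c i] [[]|]]; rewrite /ladder_white.
- exact: ladder_white_ordS.
- by rewrite -[in RHS](ord_predK i) ladder_white_ordS negbK.
- by rewrite /= addNb.
Qed.

Lemma ladder_white_rot (d : ladder_graph) :
  ladder_white (rot d) = ladder_white d.
Proof. by case: d => [[c i] s]. Qed.

Lemma ladder_order (d : ladder_graph) : fingraph.order rot d = 3.
Proof.
apply: (@order_cycle _ _ [:: d; rot d; rot (rot d)]).
- by rewrite /= ladder_rot3 !eqxx.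
- by case: d => [[[] i] [[]|]]; rewrite /= !inE !xpair_eqE /= ?andbF.
- exact: mem_head.
Qed.

Definition ladder : bicubic_graph :=
  BicubicGraph ladder_white_opp ladder_white_rot ladder_order.

Definition ladder3 : three_graph := double_three_graph ladder.

End Ladder.

Section FiniteVspace.
Import VectorInternalTheory.
Variables (F : finFieldType) (vT : vectType F).

HB.instance Definition _ := [Countable of {vspace vT} by <:].
HB.instance Definition _ := [Finite of {vspace vT} by <:].

End FiniteVspace.

Section FlagModuli.
Variables (G : three_graph) (k : fieldType).

Definition is_flag (V : {vspace 'rV[k]_3} * {vspace 'rV[k]_3}) : bool :=
  [&& \dim V.1 == 1%N, \dim V.2 == 2%N & (V.1 <= V.2)%VS].

Definition flag := {V | is_flag V}.

Definition differ1 (f g : flag) : bool :=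
  ((val f).1 != (val g).1) && ((val f).2 == (val g).2).

Definition differ2 (f g : flag) : bool :=
  ((val f).1 == (val g).1) && ((val f).2 != (val g).2).

Definition framed_flag_moduli : pred {ffun face G -> flag} :=
  fun phi => [forall d : G,
    if tau1 d then differ1 (phi (left_face d)) (phi (right_face d))
    else differ2 (phi (left_face d)) (phi (right_face d))].

End FlagModuli.

Definition PGL3 (F : finFieldType) := ('GL_3[F] / 'Z('GL_3[F]))%g.

Definition orbifold_count (G : three_graph) (F : finFieldType) : rat :=
  #|framed_flag_moduli (G := G) (k := F)|%:R / #|PGL3 F|%:R.

Local Open Scope classical_set_scope.

Section Smooth.
Context {R : realType}.

Fixpoint Ck {U W : normedModType R} (k : nat) (f : U -> W) : Prop :=
  match k with
  | 0 => continuous f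
  | k'.+1 => (forall x v, derivable f x v) /\ forall v, Ck k' ('D_v f)
  end.

Definition smooth {U W : normedModType R} (f : U -> W) := forall k, Ck k f.

End Smooth.

(* Smooth maps defined on the sphere S^2 or on [0, 1] x S^2 are given by smooth
   extensions to the ambient vector space, of which only the restriction
   matters. *)
Section Legendrian.
Variable R : realType.

Let V := 'rV[R]_3.

Definition dot (u v : V) : R := \sum_i u 0 i * v 0 i.

Definition det3 (u v w : V) : R :=
  \det (\matrix_(i < 3, j < 3) (nth 0 [:: u; v; w] i) 0 j).

Definition sphere : set V := [set x | dot x x = 1].

Definition tangent (x : V) : set V := [set v | dot x v = 0].

(* Points (x, p, z) of R^3 x R^3 x R; the space J^1 S^2 = T^* S^2 x R is cut
   out by |x| = 1 and p . x = 0, covectors being identified with tangent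
   vectors by the scalar product, and its contact form is dz - p . dx. *)
Definition jet := (V * V * R)%type.

Definition J1S2 : set jet := [set y | sphere y.1.1 /\ tangent y.1.1 y.1.2].

Definition contact (y : jet) : set jet := [set w | w.2 = dot y.1.2 w.1.1].

Definition grad (f : V -> R) (x : V) : V :=
  \row_i 'D_(delta_mx 0 i) f x.

Definition jet1 (f : V -> R) (x : V) : jet :=
  (x, grad f x - dot x (grad f x) *: x, f x).

(* Legendrian embedding in J^1 S^2 of the disjoint union of c spheres. *)
Definition legendrian_embedding (c : nat) (phi : 'I_c -> V -> jet) : Prop :=
  [/\ forall a, smooth (phi a),
      forall a x, sphere x -> J1S2 (phi a x),
      forall a b x y, sphere x -> sphere y -> phi a x = phi b y ->
        a = b /\ x = y,
      forall a x v, sphere x -> tangent x v -> v != 0 -> 'D_v (phi a) x != 0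
    & forall a x v, sphere x -> tangent x v ->
        contact (phi a x) ('D_v (phi a) x)].

Definition link_image (c : nat) (phi : 'I_c -> V -> jet) : set jet :=
  \bigcup_a (phi a @` sphere).

(* Legendrian isotopy of c-component links of 2-spheres, seen as subsets of
   J^1 S^2. *)
Definition legendrian_isotopic (c : nat) (L0 L1 : set jet) : Prop :=
  exists phi : R -> 'I_c -> V -> jet,
    [/\ forall a, smooth (fun tx : R * V => phi tx.1 a tx.2),
        forall t, 0 <= t <= 1 -> legendrian_embedding (phi t),
        link_image (phi 0) = L0
      & link_image (phi 1) = L1].

(* The directions u, v, w in the tangent plane at x are pairwise distinct and
   in counterclockwise order as seen from outside the sphere: at least two of
   the three angles from u to v, v to w and w to u are smaller than pi. *)
Definition ccw (x u v w : V) : Prop :=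
  [\/ 0 < det3 x u v /\ 0 < det3 x v w,
      0 < det3 x v w /\ 0 < det3 x w u
    | 0 < det3 x w u /\ 0 < det3 x u v].

(* [gamma d] parametrizes over [0, 1] the edge of the dart [d], starting from
   the vertex that [d] leaves. *)
Definition smooth_embedding (G : plane_graph) (gamma : G -> R -> V) : Prop :=
  [/\ forall d, smooth (gamma d),
      forall d t, 0 <= t <= 1 ->
        [/\ sphere (gamma d t), (gamma d)^`() t != 0
          & gamma (opp d) t = gamma d (1 - t)],
      forall d e, gamma d 0 = gamma e 0 <-> fconnect rot d e,
      forall d e s t, 0 < s < 1 -> 0 <= t <= 1 -> gamma d s = gamma e t ->
        (e = d /\ t = s) \/ (e = opp d /\ t = 1 - s)
    & forall d i j, (0 < i < j)%N -> (j < fingraph.order rot d)%N ->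
        ccw (gamma d 0) ((gamma d)^`() 0) ((gamma (iter i rot d))^`() 0)
          ((gamma (iter j rot d))^`() 0)].

Definition edges (G : plane_graph) (gamma : G -> R -> V) (P : pred G) : set V :=
  [set x | exists d t, [/\ P d, 0 <= t <= 1 & gamma d t = x]].

(* The Legendrian weaves of a 3-graph G all of whose vertices are hexagonal.
   For such a G a weave is a 3-fold cover of the sphere, hence trivial, so
   its front consists of the graphs of three functions f_0, f_1, f_2 on the
   sphere. The first and second (resp. second and third) sheets by height meet
   exactly along the tau_1-edges (resp. tau_2-edges); where two sheets meet
   they are transverse, and where the three sheets meet their tangent planes
   intersect in a point only. *)
Definition legendrian_weave (G : three_graph) (L : set jet) : Prop :=
  exists (gamma : G -> R -> V) (f : 'I_3 -> V -> R),
    [/\ smooth_embedding gamma /\ (forall a, smooth (f a)),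
        forall x, sphere x ->
          edges gamma (@tau1 G) x <->
          (exists a b, [/\ a != b, f a x = f b x & forall c, f a x <= f c x]),
        forall x, sphere x ->
          edges gamma (predC (@tau1 G)) x <->
          (exists a b, [/\ a != b, f a x = f b x & forall c, f c x <= f a x]),
        (forall a b x, sphere x -> a != b -> f a x = f b x ->
          exists2 v, tangent x v & 'D_v (f a) x != 'D_v (f b) x) /\
        (forall x, sphere x -> (forall a b, f a x = f b x) ->
          forall v, tangent x v -> (forall a b, 'D_v (f a) x = 'D_v (f b) x) ->
          v = 0)
      & L = link_image (fun a => jet1 (f a))].

End Legendrian.

(* Main.v *)
(* Point count. The flag of each bigon is determined by the two adjacent faces,
   so a point of the framed moduli space consists of flags N and S at the poles
   and one flag at each square. Summing out every other square turns the number
   of choices, for given N and S, into the trace of the n-th power of a transfer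
   matrix. This matrix is q I + J - R if N = S (R being an equivalence relation
   with q classes of q elements), the identity on q - 1 flags if N and S are
   opposite, and it vanishes otherwise.

   Legendrian links. The map (x, p, z) |-> (x, p + z x) identifies J^1 S^2 with
   S^2 x R^3. The linking number of two components, being a degree, is invariant
   under isotopy; for two graphs it is, up to a factor coming from their
   parametrizations, the degree of the nowhere vanishing difference H of the two
   maps S^2 -> R^3. As H is tangent to the sphere exactly along n nested circles,
   Hopf's Umlaufsatz shows that this degree is n - 1 up to sign. One
   sheet of the weave meets both others in this way, hence an isotopy makes n - 1
   and m - 1 divide each other. Degrees are defined by counting sign patterns on
   fine grids, with cubical cochains standing for cohomology. *)

From HB Require Import structures.
From mathcomp Require Import all_boot all_order all_algebra.
From mathcomp Require Import all_fingroup all_solvable all_field.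
From mathcomp Require Import all_classical all_reals all_analysis.
From mathcomp Require Import ring lra zify.
Require Import Defs.

Set Implicit Arguments.
Unset Strict Implicit.
Unset Printing Implicit Defensive.

Import Order.TTheory GRing.Theory Num.Theory.
Import numFieldNormedType.Exports.

Local Open Scope ring_scope.
Local Open Scope classical_set_scope.

(** Two facts shape the argument about links. The components of an isotopy are followed through
    parametrizations that are merely continuous, so the degrees of these are unknown integers; hence
    divisibility in both directions rather than equality. Moreover, a weave is given by the heights
    of its sheets only, and which of the three functions cross along an edge has to be recovered. By
    transversality, curves of coincidence go straight on at hexagonal points, and there going
    straight on means following the boundary of a face of the prism. The functions left out on these
    curves colour the faces: the poles share a colour and the squares alternate between the two
    others. A colour of squares has n faces, whence the n circles; the sheet that meets both others
    along them is the one named by the polar colour.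

    The value n - 1 has this origin. On the circles, H turns like their tangents, hence like a
    polynomial with one root in each circle. Its n turns are counted in a frame that is defined off
    one pole and turns there itself, which corrects the count by one. *)

(** * Cubical cochains on a lattice and their products *)

Definition lattice := nat -> nat.

Definition next_cell (N d : nat) (x : lattice) : lattice :=
  fun j => (x j + (if j == d then N else 0))%N.

Lemma shiftC N M d e x : next_cell N d (next_cell M e x) = next_cell M e (next_cell N d x).
Proof. by apply/funext => j; rewrite /next_cell addnAC. Qed.

Lemma shift0 d x : next_cell 0 d x = x.
Proof. by apply/funext => j; rewrite /next_cell if_same addn0. Qed.

Lemma shiftD N M d x : next_cell N d (next_cell M d x) = next_cell (M + N) d x.
Proof. by apply/funext => j; rewrite /next_cell -addnA; case: eqP. Qed.

Definition cochain := seq nat -> lattice -> int.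

(* [cobord 1] is the coboundary of a cubical cochain, whose value on a cube
   spanned at [x] by an ordered list [D] of directions is [w D x]; [cobord N]
   is the same for cubes of side [N]. *)
Fixpoint cobord (N : nat) (D : seq nat) (w : cochain) (x : lattice) : int :=
  if D is d :: D' then
    w D' (next_cell N d x) - w D' x - cobord N D' (fun E => w (d :: E)) x
  else 0.

(* The product of the cochains [cobord 1 a] and [w], for the Kuhn
   triangulation of the cubes. *)
Fixpoint cup (D : seq nat) (a : lattice -> int) (w : cochain) (x : lattice) : int :=
  if D is d :: D' then
    (a (next_cell 1 d x) - a x) * w D' (next_cell 1 d x)
      - cup D' a (fun E => w (d :: E)) x
  else 0.

Fixpoint boxsum (N : nat) (D : seq nat) (f : lattice -> int) (x : lattice) : int :=
  if D is d :: D' then \sum_(i < N) boxsum N D' f (next_cell i d x) else f x.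

Lemma cupB D a (w w' : cochain) x :
  cup D a w x - cup D a w' x = cup D a (fun E y => w E y - w' E y) x.
Proof.
elim: D w w' => [|d D IH] w w' /=; first by rewrite subr0.
by rewrite -(IH (fun E => w (d :: E)) (fun E => w' (d :: E))); ring.
Qed.

Lemma cupBl D (a a' : lattice -> int) (w : cochain) x :
  cup D (fun y => a y - a' y) w x = cup D a w x - cup D a' w x.
Proof.
elim: D w => [|d D IH] w /=; first by rewrite subr0.
by rewrite (IH (fun E => w (d :: E))); ring.
Qed.

Lemma cup_shift D a w d x :
  cup D (fun y => a (next_cell 1 d y)) (fun E y => w E (next_cell 1 d y)) x
  = cup D a w (next_cell 1 d x).
Proof. by elim: D w => //= e D IH w; rewrite (IH (fun E => w (e :: E))) shiftC. Qed.

Lemma cobord_shift N M D w d x :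
  cobord N D (fun E y => w E (next_cell M d y)) x = cobord N D w (next_cell M d x).
Proof. by elim: D w => //= e D IH w; rewrite (IH (fun E => w (e :: E))) shiftC. Qed.

Lemma cobord_prod D (f : lattice -> int) w x :
  cobord 1 D (fun E y => f y * w E y) x = f x * cobord 1 D w x + cup D f w x.
Proof.
elim: D w => [|d D IH] w /=; first by rewrite mulr0 addr0.
by rewrite (IH (fun E => w (d :: E))); ring.
Qed.

Lemma cobordB N D (w w' : cochain) x :
  cobord N D (fun E y => w E y - w' E y) x = cobord N D w x - cobord N D w' x.
Proof.
elim: D w w' => [|d D IH] w w' /=; first by rewrite subr0.
by rewrite (IH (fun E => w (d :: E)) (fun E => w' (d :: E))); ring.
Qed.

Lemma cobord_sum N n D (w : 'I_n -> cochain) x :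
  cobord N D (fun E y => \sum_i w i E y) x = \sum_i cobord N D (w i) x.
Proof.
elim: D w => [|d D IH] w /=; first by rewrite big1.
rewrite (IH (fun i E => w i (d :: E))) -!sumrB.
by apply: eq_bigr => i _.
Qed.

(** The Leibniz rule for the product of the closed 1-cochain [cobord 1 a] with [w]: only the term
    with the coboundary of [w] is left, with a sign. *)
Lemma cobord_cup D a w x :
  cobord 1 D (fun E y => cup E a w y) x
  = - cup D a (fun E y => cobord 1 E w y) x.
Proof.
elim: D w x => [|d D IH] w x /=; first by rewrite oppr0.
rewrite cobordB IH.
rewrite (cobord_prod D (fun y => a (next_cell 1 d y) - a y)
           (fun E y => w E (next_cell 1 d y))) cobord_shift.
have -> : cup D (fun y => a (next_cell 1 d y) - a y) (fun E y => w E (next_cell 1 d y)) x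
    = cup D a w (next_cell 1 d x) - cup D a (fun E y => w E (next_cell 1 d y)) x.
  by rewrite cupBl cup_shift.
have -> : cup D a (fun E y => w E (next_cell 1 d y) - w E y
      - cobord 1 E (fun E0 => w (d :: E0)) y) x
    = cup D a (fun E y => w E (next_cell 1 d y)) x - cup D a w x
      - cup D a (fun E y => cobord 1 E (fun E0 => w (d :: E0)) y) x.
  by rewrite -!cupB.
by ring.
Qed.

(** Discrete Stokes formula: in each direction the differences between neighbouring unit cubes
    telescope, and only the faces of the box of side [N] remain. *)
Lemma boxsum_cobord N D (w : cochain) x :
  boxsum N D (cobord 1 D w) x
  = cobord N D (fun E y => boxsum N E (w E) y) x.
Proof.
elim: D w x => //= d D IH w x.
have -> : \sum_(i < N) boxsum N D
      (fun y => w D (next_cell 1 d y) - w D y - cobord 1 D (fun E => w (d :: E)) y)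
      (next_cell i d x)
    = \sum_(i < N) (boxsum N D (w D) (next_cell i.+1 d x)
        - boxsum N D (w D) (next_cell i d x))
      - \sum_(i < N) cobord N D (fun E y => boxsum N E (w (d :: E)) y) (next_cell i d x).
  rewrite -sumrB; apply: eq_bigr => i _; rewrite -IH.
  have boxB M E (f g : lattice -> int) y :
      boxsum M E (fun z => f z - g z) y = boxsum M E f y - boxsum M E g y.
    elim: E y => //= e E IHE y; rewrite -sumrB.
    by apply: eq_bigr => j _; rewrite IHE.
  rewrite !boxB; congr (_ - _ - _).
  rewrite -[(val i).+1]addn1 -shiftD.
  elim: {IH} D (next_cell i d x) (w D) => //= e D IHD y f.
  by apply: eq_bigr => j _; rewrite IHD shiftC.
congr (_ - _).
  pose f i := boxsum N D (w D) (next_cell i d x).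
  by rewrite -(big_mkord xpredT (fun i => f i.+1 - f i)) telescope_sumr // /f shift0.
rewrite [RHS](cobord_sum N (n := N) D
  (fun i E y => boxsum N E (w (d :: E)) (next_cell i d y))).
apply: eq_bigr => i _.
by rewrite (cobord_shift N i D (fun E => boxsum N E (w (d :: E)))).
Qed.

(** The product da_0 ... da_(m-1) a_m, which is up to sign a primitive of da_0 ... da_m. When the
    a_k are the sign bits of the coordinates of a map to R^(m+1) minus the origin, it stands for the
    pullback of a generator of the cohomology of the m-sphere. *)
Fixpoint cupn (m : nat) (a : nat -> lattice -> int) : cochain :=
  if m is m'.+1 then fun D x => cup D (a 0%N) (cupn m' (fun k => a k.+1)) x
  else fun _ x => a 0%N x.

Definition cell (D : seq nat) (x y : lattice) : Prop :=
  forall j, y j = x j \/ (j \in D /\ y j = (x j).+1).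

Lemma cell_refl D x : cell D x x.
Proof. by move=> j; left. Qed.

Lemma cell_shift D E d x y : d \in D -> {subset E <= D} -> d \notin E ->
  cell E (next_cell 1 d x) y -> cell D x y.
Proof.
move=> dD sED dE c j; have := c j; rewrite /next_cell.
have [->|_] := eqVneq j d.
  by rewrite (negbTE dE) addn1 => -[->|[]//]; right.
by rewrite addn0 => -[->|[/sED ? ->]]; [left|right].
Qed.

Lemma cup_eq0 D (a : lattice -> int) w x :
  (forall d E, perm_eq (d :: E) D ->
     a (next_cell 1 d x) = a x \/ w E (next_cell 1 d x) = 0) ->
  cup D a w x = 0.
Proof.
elim: D w => //= d D IH w w0; rewrite (IH (fun E => w (d :: E))) ?subr0.
  by have [->|->] := w0 d D (perm_refl _); rewrite ?subrr (mul0r, mulr0).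
move=> e E eED; apply: w0.
by rewrite (perm_catCA [:: e] [:: d]) perm_cons.
Qed.

Lemma cobord_const_eq0 D (a : lattice -> int) x :
  (forall d, d \in D -> a (next_cell 1 d x) = a x) -> cobord 1 D (fun=> a) x = 0.
Proof.
elim: D => //= d D IH ac; rewrite ac ?mem_head // subrr sub0r.
by rewrite IH ?oppr0 // => e eD; apply: ac; rewrite inE eD orbT.
Qed.

(** The coboundary is up to sign da_0 ... da_m, and the factor da_k vanishes on a cell where a_k is
    constant. This is what makes cochains of sign bits closed on fine grids. *)
Lemma cobord_cupn_eq0 m k a D x : uniq D -> (k <= m)%N ->
  (forall y, cell D x y -> a k y = a k x) -> cobord 1 D (cupn m a) x = 0.
Proof.
elim: m k a D x => [|m IH] [|k] a D x uD //= km ac.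
- apply: cobord_const_eq0 => d dD; apply: ac.
  by apply: (@cell_shift _ [::] d) => //; exact: cell_refl.
- rewrite cobord_cup cup_eq0 ?oppr0 // => d E /perm_mem dE; left; apply: ac.
  by apply: (@cell_shift _ [::] d); rewrite ?in_nil -?dE ?mem_head //; exact: cell_refl.
- rewrite cobord_cup cup_eq0 ?oppr0 // => d E dED; right.
  have dD : d \in D by rewrite -(perm_mem dED) mem_head.
  have sub : {subset E <= D}.
    by move=> e eE; rewrite -(perm_mem dED) inE eE orbT.
  have /andP[dE uE] : uniq (d :: E) by rewrite (perm_uniq dED).
  apply: (IH k) => // y cy.
  have c z : cell E (next_cell 1 d x) z -> cell D x z by exact: cell_shift.
  by rewrite !ac //; apply: c => //; exact: cell_refl.
Qed.

(** Each of the [m] directions of the cube is used up by one of the [m] differentials, so the one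
    along which nothing varies kills every term. This is the situation on the faces that a
    parametrization of the sphere collapses to a pole. *)
Lemma cupn_degenerate (P : lattice -> Prop) m a E d x : d \in E -> size E = m ->
  (forall e y, e \in E -> P y -> P (next_cell 1 e y)) ->
  (forall k y, P y -> a k (next_cell 1 d y) = a k y) -> P x ->
  cupn m a E x = 0.
Proof.
elim: m a E x => [|m IH] a E x dE; first by case: E dE.
move=> sE PE ad Px /=; apply: cup_eq0 => e F eFE.
have [->|de] := eqVneq e d; [by left; exact: ad|right].
have sub : {subset F <= E}.
  by move=> f fF; rewrite -(perm_mem eFE) inE fF orbT.
apply: IH; first by move: dE; rewrite -(perm_mem eFE) inE eq_sym (negbTE de).
- by move/perm_size: eFE; rewrite sE => -[].
- by move=> f y /sub; exact: PE.
- by move=> k y; exact: ad.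
- by apply: PE => //; rewrite -(perm_mem eFE) mem_head.
Qed.

Lemma boxsum_eq0 (P : lattice -> Prop) N E (f : lattice -> int) x :
  (forall e i y, e \in E -> P y -> P (next_cell i e y)) ->
  (forall y, P y -> f y = 0) -> P x -> boxsum N E f x = 0.
Proof.
move=> PE f0; elim: E x PE => [|e E IH] x PE Px /=; first exact: f0.
apply: big1 => i _; apply: IH => [d j y dE|].
  by apply: PE; rewrite inE dE orbT.
by apply: PE => //; exact: mem_head.
Qed.

(** Only values on a slice [P] stable under the steps in [E] enter the sum. This serves to freeze
    the last coordinate, which is the time of a homotopy. *)
Lemma eq_boxsum_cupn (P : lattice -> Prop) N m (a a' : nat -> lattice -> int) E x :
  (forall e i y, e \in E -> P y -> P (next_cell i e y)) ->
  (forall k y, P y -> a k y = a' k y) -> P x ->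
  boxsum N E (cupn m a E) x = boxsum N E (cupn m a' E) x.
Proof.
move=> PE aa' Px.
have cc F y : {subset F <= E} -> P y -> cupn m a F y = cupn m a' F y.
  elim: m a a' aa' F y => [|m IH] a a' aa' F y sF Py /=; first exact: aa'.
  have {}IH : forall G z, {subset G <= E} -> P z ->
      cupn m (fun k => a k.+1) G z = cupn m (fun k => a' k.+1) G z.
    by move=> G z sG Pz; apply: IH => // k w; exact: aa'.
  elim: F (cupn m _) (cupn m _) sF IH => //= f F IHF w w' sF ww'.
  have fE : f \in E by apply: sF; exact: mem_head.
  have sF' : {subset F <= E} by move=> g gF; apply: sF; rewrite inE gF orbT.
  rewrite !aa' ?ww' //; try exact: PE.
  congr (_ - _); apply: IHF => // G z sG; apply: ww' => g; rewrite inE.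
  by move=> /predU1P[-> //|]; exact: sG.
have : forall F y, {subset F <= E} -> P y ->
    boxsum N F (cupn m a E) y = boxsum N F (cupn m a' E) y.
  elim=> [|f F IH] y sF Py; first exact: cc.
  apply: eq_bigr => i _; apply: IH => [g gF|].
    by apply: sF; rewrite inE gF orbT.
  by apply: PE => //; apply: sF; exact: mem_head.
by apply.
Qed.

Lemma boxsum_cupn_period M N m a E d x :
  (forall k y, a k (next_cell M d y) = a k y) ->
  boxsum N E (cupn m a E) (next_cell M d x) = boxsum N E (cupn m a E) x.
Proof.
move=> ad; have shiftf F (f : lattice -> int) y : (forall z, f (next_cell M d z) = f z) ->
    boxsum N F f (next_cell M d y) = boxsum N F f y.
  move=> fd; elim: F y => //= e F IH y; apply: eq_bigr => i _.
  by rewrite shiftC IH.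
apply: shiftf => y; elim: m a E y ad => [|m IH] a E y ad //=.
set w := cupn m _; have {IH} : forall F z, w F (next_cell M d z) = w F z.
  by move=> F z; apply: IH.
elim: E (w) y => //= e E IH {}w y wd; rewrite ad shiftC ad wd.
by rewrite (IH (fun F => w (e :: F))).
Qed.

Lemma stokes m N a D x : uniq D ->
  (forall y, (forall j, x j <= y j)%N ->
     (forall j, j \in D -> y j < x j + N)%N ->
     (forall j, j \notin D -> y j = x j) ->
     exists2 k, (k <= m)%N & forall z, cell D y z -> a k z = a k y) ->
  cobord N D (fun E y => boxsum N E (cupn m a E) y) x = 0.
Proof.
move=> uD ac; rewrite -boxsum_cobord.
have box0 E y (f : lattice -> int) : uniq E ->
    (forall z, (forall j, y j <= z j)%N ->
      (forall j, j \in E -> z j < y j + N)%N ->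
      (forall j, j \notin E -> z j = y j) -> f z = 0) ->
    boxsum N E f y = 0.
  elim: E y => [|e E IH] y /=; first by move=> _; apply.
  move=> /andP[eE uE] f0; apply: big1 => i _; apply: IH => // z z1 z2 z3.
  have ze : z e = (y e + i)%N by rewrite z3 // /next_cell eqxx.
  apply: f0 => j.
  - by apply: leq_trans (z1 j); rewrite leq_addr.
  - rewrite inE; have [-> _|je /= jE] := eqVneq j e.
      by rewrite ze ltn_add2l.
    by have := z2 _ jE; rewrite /next_cell (negbTE je) addn0.
  - rewrite inE negb_or => /andP[je jE].
    by rewrite z3 // /next_cell (negbTE je) addn0.
apply: box0 => // y y1 y2 y3.
by have [k km ack] := ac y y1 y2 y3; apply: cobord_cupn_eq0 km ack.
Qed.

(** Directions 0 and 2 are the longitudes and 1 and 3 the latitudes of two spheres, and 4 is the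
    time of a homotopy. Faces normal to a longitude cancel by periodicity, those normal to a
    latitude are collapsed poles; so the sums over the first and the last instant agree. *)
Lemma stokes5 N (a : nat -> lattice -> int) :
  (forall y, (forall j, j < 5 -> y j < N)%N ->
     exists2 k, (k <= 4)%N & forall z, cell [:: 0; 1; 2; 3; 4]%N y z -> a k z = a k y) ->
  (forall k y, a k (next_cell N 0 y) = a k y) ->
  (forall k y, a k (next_cell N 2 y) = a k y) ->
  (forall k y, y 1%N = 0%N \/ y 1%N = N -> a k (next_cell 1 0 y) = a k y) ->
  (forall k y, y 3%N = 0%N \/ y 3%N = N -> a k (next_cell 1 2 y) = a k y) ->
  let w E := boxsum N E (cupn 4 a E) in
  w [:: 0; 1; 2; 3]%N (next_cell N 4 (fun=> 0%N)) = w [:: 0; 1; 2; 3]%N (fun=> 0%N).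
Proof.
move=> mesh p0 p2 d1 d3 w; set x := (fun=> 0%N).
have face d e y : (e = 1 /\ d = 0 \/ e = 3 /\ d = 2)%N -> y e = 0%N \/ y e = N ->
    forall E, e \notin E -> d \in E -> size E = 4%N -> w E y = 0.
  move=> de ye E eE dE sE; pose P z := z e = y e :> nat.
  have shP f i z : f \in E -> P z -> P (next_cell i f z).
    move=> fE; rewrite /P /next_cell; case: eqP fE eE => [<- ->//|_ _ _].
    by rewrite addn0.
  apply: (@boxsum_eq0 P) => // z Pz.
  apply: (@cupn_degenerate P _ _ _ d) => // [f t|k t Pt]; first exact: shP.
  move: ye; rewrite -Pt; case: de => -[-> ->]; [exact: d1|exact: d3].
have : cobord N [:: 0; 1; 2; 3; 4]%N w x = 0.
  apply: stokes => // y y0 y1 _.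
  apply: mesh => j j5; have := y1 j; rewrite /x add0n; apply.
  by move: j5; do 5?[case: j => [|j] //].
rewrite /cobord -/(w [:: 1; 2; 3; 4]%N) -/(w [:: 0; 2; 3; 4]%N)
  -/(w [:: 0; 1; 3; 4]%N) -/(w [:: 0; 1; 2; 4]%N) -/(w [:: 0; 1; 2; 3]%N).
have f1 y : y 1%N = 0%N \/ y 1%N = N -> w [:: 0; 2; 3; 4]%N y = 0.
  by move=> y1; apply: (face 0 1)%N y1 _ _ _ _ => //; left.
have f3 y : y 3%N = 0%N \/ y 3%N = N -> w [:: 0; 1; 2; 4]%N y = 0.
  by move=> y3; apply: (face 2 3)%N y3 _ _ _ _ => //; right.
rewrite (f1 x) ?(f3 x) ?(f1 (next_cell N 1 x)) ?(f3 (next_cell N 3 x)); try by [left|right].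
rewrite [w _ (next_cell N 0 x)]boxsum_cupn_period // [w _ (next_cell N 2 x)]boxsum_cupn_period //.
by move=> wE; apply: subr0_eq; rewrite -[RHS]wE /w; ring.
Qed.

Lemma stokes3 N (a : nat -> lattice -> int) :
  (forall y, (forall j, j < 3 -> y j < N)%N ->
     exists2 k, (k <= 2)%N & forall z, cell [:: 0; 1; 2]%N y z -> a k z = a k y) ->
  let w E := boxsum N E (cupn 2 a E) in
  let x : lattice := fun=> 0%N in
  (w [:: 1; 2]%N (next_cell N 0 x) - w [:: 1; 2]%N x)
  - (w [:: 0; 2]%N (next_cell N 1 x) - w [:: 0; 2]%N x)
  + (w [:: 0; 1]%N (next_cell N 2 x) - w [:: 0; 1]%N x) = 0.
Proof.
move=> mesh w x; rewrite -[RHS](@stokes 2 N a [:: 0; 1; 2]%N x isT).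
  by rewrite /cobord; ring.
move=> y y0 y1 _; apply: mesh => j j5; have := y1 j; rewrite /x add0n; apply.
by move: j5; do 3?[case: j => [|j] //].
Qed.

(** The product da db c summed over the squares of the grid. For the sign bits of three functions it
    counts, with orientation, the places where the first two change sign while the third is
    negative. *)
Definition deg2 (N : nat) (a b c : nat -> nat -> int) : int :=
  \sum_(i < N) \sum_(j < N)
    ((a i.+1 j - a i j) * (b i.+1 j.+1 - b i.+1 j)
     - (a i j.+1 - a i j) * (b i.+1 j.+1 - b i j.+1)) * c i.+1 j.+1.

Definition origin : lattice := fun=> 0%N.

Lemma boxsum01 N d e (a : nat -> lattice -> int) x :
  d != e ->
  boxsum N [:: d; e] (cupn 2 a [:: d; e]) x =
  deg2 N (fun i j => a 0%N (next_cell i d (next_cell j e x)))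
    (fun i j => a 1%N (next_cell i d (next_cell j e x)))
    (fun i j => a 2%N (next_cell i d (next_cell j e x))).
Proof.
move=> de; apply: eq_bigr => i _; apply: eq_bigr => j _ /=.
have eqd y : next_cell 1 d (next_cell i d y) = next_cell i.+1 d y by rewrite shiftD addn1.
have eqe y : next_cell 1 e (next_cell j e y) = next_cell j.+1 e y by rewrite shiftD addn1.
rewrite !(shiftC j i e d) !(shiftC 1 _ e d) !eqd !eqe.
by ring.
Qed.

(** The first two differentials live on the directions 0 and 1, which leaves 2 and 3 to the others.
    Where [r] fails, these vanish, as the remaining functions do not depend on the last two
    coordinates; where it holds they give the second degree, and [r] becomes the last factor of the
    first one. *)
Lemma link_factor_l N (a : nat -> lattice -> int) (p q : nat -> nat -> int)
    (r : nat -> nat -> bool) (c : nat -> nat -> nat -> int)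
    (c' : nat -> nat -> nat -> int) :
  (forall y, a 0%N y = p (y 0%N) (y 1%N)) ->
  (forall y, a 1%N y = q (y 0%N) (y 1%N)) ->
  (forall k y, a k.+2 y =
    if r (y 0%N) (y 1%N) then c k (y 2%N) (y 3%N) else c' k (y 0%N) (y 1%N)) ->
  boxsum N [:: 0; 1; 2; 3]%N (cupn 4 a [:: 0; 1; 2; 3]%N) origin =
  deg2 N p q (fun i j => (r i j)%:Z) * deg2 N (c 0%N) (c 1%N) (c 2%N).
Proof.
move=> a0 a1 a2; rewrite /deg2 big_distrl /=; apply: eq_bigr => i _.
rewrite big_distrl /=; apply: eq_bigr => j _.
rewrite big_distrr /=; apply: eq_bigr => k _.
rewrite big_distrr /=; apply: eq_bigr => l _.
rewrite !a0 !a1 !a2 /next_cell /origin /= !addn0 !add0n !addn1.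
rewrite !subrr !mul0r !subr0.
by case: (r i.+1 j.+1) => /=; ring.
Qed.

(** Exchanging two pairs of directions is an even permutation, so no sign appears. *)
Lemma link_factor_r N (a : nat -> lattice -> int) (p q : nat -> nat -> int)
    (r : nat -> nat -> bool) (c : nat -> nat -> nat -> int)
    (c' : nat -> nat -> nat -> int) :
  (forall y, a 0%N y = p (y 2%N) (y 3%N)) ->
  (forall y, a 1%N y = q (y 2%N) (y 3%N)) ->
  (forall k y, a k.+2 y =
    if r (y 2%N) (y 3%N) then c k (y 0%N) (y 1%N) else c' k (y 2%N) (y 3%N)) ->
  boxsum N [:: 0; 1; 2; 3]%N (cupn 4 a [:: 0; 1; 2; 3]%N) origin =
  deg2 N p q (fun i j => (r i j)%:Z) * deg2 N (c 0%N) (c 1%N) (c 2%N).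
Proof.
move=> a0 a1 a2; rewrite mulrC /deg2 big_distrl /=; apply: eq_bigr => i _.
rewrite big_distrl /=; apply: eq_bigr => j _.
rewrite big_distrr /=; apply: eq_bigr => k _.
rewrite big_distrr /=; apply: eq_bigr => l _.
rewrite !a0 !a1 !a2 /next_cell /origin /= !addn0 !add0n !addn1.
rewrite !subrr !mul0r !subr0.
by case: (r k.+1 l.+1) => /=; ring.
Qed.

Local Open Scope classical_set_scope.

(** * Grids finer than the changes of sign *)

Section Mesh.
Variables (R : realType) (X : pseudoMetricType R).

(** A Lebesgue number: a continuous function that does not vanish at a point keeps its sign nearby,
    and compactness makes the radius uniform. *)
Lemma sign_mesh (K : set X) m (q : nat -> X -> R) : compact K ->
  (forall k, (k <= m)%N -> continuous (q k)) ->
  (forall z, K z -> exists2 k, (k <= m)%N & q k z != 0) ->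
  exists2 e : R, 0 < e & forall z, K z ->
    exists2 k, (k <= m)%N & forall z', ball z e z' -> (q k z' < 0) = (q k z < 0).
Proof.
move=> /compact_near_coveringP cK cq q0.
have : \forall e \near 0^'+, K `<=` (fun z => exists2 k, (k <= m)%N &
    forall z', ball z e z' -> (q k z' < 0) = (q k z < 0)).
  apply: cK => z Kz; have [k km qk] := q0 z Kz.
  have : \forall z' \near z, (q k z' < 0) = (q k z < 0).
    have := cq k km z; move: qk; rewrite neq_lt => /orP[qk|qk] cqz.
      near=> z'; rewrite qk; near: z'.
      by move/cvgr_lt: cqz; apply.
    near=> z'; rewrite (lt_gtF qk) lt_gtF //; near: z'.
    by move/cvgr_gt: cqz; apply.
  move=> /nbhs_ballP[r /= r0 rz].
  exists (ball z (r / 2), [set e | 0 < e < r / 2]) => /=.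
    split; first by apply: nbhsx_ballx; rewrite divr_gt0.
    near=> e; apply/andP; split => //.
    by near: e; apply: nbhs_right_lt; rewrite divr_gt0.
  move=> [z' e] /= [zz' /andP[e0 er]]; exists k => // z'' z'z''.
  rewrite rz ?rz //; first by apply: le_ball zz'; lra.
  by rewrite (splitr r); apply: ball_triangle zz' _; apply: le_ball z'z''; lra.
move=> near_e; have [e [e0 ?]] : exists e : R, 0 < e /\
    K `<=` (fun z => exists2 k, (k <= m)%N &
      forall z', ball z e z' -> (q k z' < 0) = (q k z < 0)).
  have : \forall e \near 0^'+, 0 < e /\
    K `<=` (fun z => exists2 k, (k <= m)%N &
      forall z', ball z e z' -> (q k z' < 0) = (q k z < 0)).
    by near=> e; split => //; near: e.
  by move=> /filter_ex.
by exists e.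
Unshelve. all: by end_near. Qed.

End Mesh.

(** * Degrees of nonvanishing maps to three-space *)

Section Degree.
Variable R : realType.
Local Notation V := 'rV[R]_3.

Definition crd (k : nat) (x : V) : R := x 0 (inord k).

Definition vec3 (a b c : R) : V := \row_(j < 3) nth 0 [:: a; b; c] j.

Lemma crd_vec3 k a b c : (k < 3)%N -> crd k (vec3 a b c) = nth 0 [:: a; b; c] k.
Proof. by move=> k3; rewrite /crd mxE inordK. Qed.

Lemma crd0v a b c : crd 0 (vec3 a b c) = a. Proof. exact: crd_vec3. Qed.
Lemma crd1v a b c : crd 1 (vec3 a b c) = b. Proof. exact: crd_vec3. Qed.
Lemma crd2v a b c : crd 2 (vec3 a b c) = c. Proof. exact: crd_vec3. Qed.
Definition crdv := (crd0v, crd1v, crd2v).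

Lemma crdP (x y : V) : (forall k, (k < 3)%N -> crd k x = crd k y) -> x = y.
Proof.
move=> xy; apply/rowP => j; have := xy j (ltn_ord j); rewrite /crd.
by rewrite (inord_val j).
Qed.

Lemma crdE (x y : V) :
  crd 0 x = crd 0 y -> crd 1 x = crd 1 y -> crd 2 x = crd 2 y -> x = y.
Proof. by move=> e0 e1 e2; apply: crdP => -[|[|[|]]]. Qed.

Lemma crdD k x y : crd k (x + y) = crd k x + crd k y. Proof. by rewrite /crd mxE. Qed.
Lemma crdN k x : crd k (- x) = - crd k x. Proof. by rewrite /crd mxE. Qed.
Lemma crdZ k a x : crd k (a *: x) = a * crd k x. Proof. by rewrite /crd mxE. Qed.
Lemma crd_0 k : crd k 0 = 0. Proof. by rewrite /crd mxE. Qed.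
Definition crdL := (crdD, crdN, crdZ, crd_0).

Lemma dotE (x y : V) :
  dot x y = crd 0 x * crd 0 y + crd 1 x * crd 1 y + crd 2 x * crd 2 y.
Proof.
rewrite /dot !big_ord_recr big_ord0 /= add0r /crd.
by do !congr (_ + _); congr (_ * _); congr fun_of_matrix; apply/val_inj; rewrite /= inordK.
Qed.

Lemma crd_continuous k : continuous (crd k).
Proof. by move=> x; apply: coord_continuous. Qed.

Definition neg (x : R) : int := ((x < 0)%R : nat)%:Z.

(** The coordinates are taken in the order 2, 1, 0, so it is the negative half of the axis 0 whose
    preimages are counted. A coordinate that is zero counts as positive; no perturbation to a
    regular value takes place, since invariance comes from a cochain identity. *)
Definition deg3 (N : nat) (f : R -> R -> V) : int :=
  deg2 N (fun i j => neg (crd 2 (f (i%:R / N%:R) (j%:R / N%:R))))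
         (fun i j => neg (crd 1 (f (i%:R / N%:R) (j%:R / N%:R))))
         (fun i j => neg (crd 0 (f (i%:R / N%:R) (j%:R / N%:R)))).

Lemma eq_deg3 N (f g : R -> R -> V) : (forall s d, f s d = g s d) ->
  deg3 N f = deg3 N g.
Proof. by move=> fg; congr deg3; apply/funext => s; apply/funext => d. Qed.

Lemma deg3_cst N (f : R -> R -> V) :
  (forall s s' d, f s d = f s' d) -> deg3 N f = 0.
Proof.
move=> fc; rewrite /deg3 /deg2; apply: big1 => i _; apply: big1 => j _.
by rewrite !(fc (i.+1%:R / N%:R) (i%:R / N%:R)) !subrr mul0r mulr0 subrr mul0r.
Qed.

Definition unit_cube3 : set (R * R * R) :=
  [set z | [/\ 0 <= z.1.1 <= 1, 0 <= z.1.2 <= 1 & 0 <= z.2 <= 1]].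

Lemma unit_cube3_compact : compact unit_cube3.
Proof.
have -> : unit_cube3 = (`[0, 1] `*` `[0, 1]) `*` `[0, 1].
  apply/seteqP; split => z; rewrite /unit_cube3 /= !in_itv /=.
    by move=> [-> -> ->].
  by move=> [[-> ->] ->].
by do 2?apply: compact_setX; exact: segment_compact.
Qed.

Lemma mesh_ex (e : R) : 0 < e -> exists M, forall N, (M < N)%N -> N%:R^-1 < e.
Proof.
move=> e0; exists (Num.truncn e^-1) => N MN.
rewrite invf_plt ?posrE //; last by rewrite ltr0n; lia.
by apply: lt_le_trans (truncnS_gt _) _; rewrite ler_nat.
Qed.

Lemma ball_grid N (j k : nat) (e : R) : N%:R^-1 < e -> k = j \/ k = j.+1 ->
  ball (j%:R / N%:R : R) e (k%:R / N%:R).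
Proof.
move=> Ne [->|->]; rewrite /ball /= -mulrBl.
  by rewrite subrr mul0r normr0; apply: le_lt_trans Ne; rewrite invr_ge0.
by rewrite -natr1 opprD addNKr mulN1r normrN ger0_norm // invr_ge0.
Qed.

Lemma grid01 N j : (j < N)%N -> 0 <= (j%:R / N%:R : R) <= 1.
Proof.
move=> jN; rewrite divr_ge0 //= ler_pdivrMr ?ltr0n; last by lia.
by rewrite mul1r ler_nat ltnW.
Qed.

(** Stokes on the boundary of the cube: as [G] does not vanish, [sign_mesh] provides on every cell
    of a fine grid a coordinate of constant sign, and the cochain of sign bits is closed. *)
Lemma deg3_cube (G : R -> R -> R -> V) :
  continuous (fun z : R * R * R => G z.1.1 z.1.2 z.2) ->
  (forall s d t, 0 <= s <= 1 -> 0 <= d <= 1 -> 0 <= t <= 1 -> G s d t != 0) ->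
  exists M, forall N, (M < N)%N ->
   (deg3 N (G 1) - deg3 N (G 0))
   - (deg3 N (fun s t => G s 1 t) - deg3 N (fun s t => G s 0 t))
   + (deg3 N (fun s d => G s d 1) - deg3 N (fun s d => G s d 0)) = 0.
Proof.
move=> cG G0; pose q k (z : R * R * R) := crd (2 - k) (G z.1.1 z.1.2 z.2).
have cq k : (k <= 2)%N -> continuous (q k).
  by move=> _ z; apply: (continuous_comp (cG z)); exact: crd_continuous.
have q0 z : unit_cube3 z -> exists2 k, (k <= 2)%N & q k z != 0.
  move=> [s01 d01 t01]; apply: contrapT => nq; have := G0 _ _ _ s01 d01 t01.
  case/eqP; apply: crdP => k k3; rewrite crd_0; apply/eqP/negPn/negP => qk.
  by apply: nq; exists (2 - k)%N; rewrite ?leq_subr // /q subKn.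
have [e e0 qe] := sign_mesh unit_cube3_compact cq q0.
have [M MN] := mesh_ex e0; exists M => N /[dup] ltMN /MN Ne.
pose pt (y : lattice) : R * R * R :=
  (((y 0%N)%:R / N%:R, (y 1%N)%:R / N%:R), (y 2%N)%:R / N%:R).
pose a k y := neg (q k (pt y)).
have NN : (N%:R / N%:R = 1 :> R) by rewrite divff // pnatr_eq0; lia.
have := @stokes3 N a; cbv beta zeta; rewrite !boxsum01 // => stk.
rewrite -[RHS]stk; last first.
  move=> y yN; have Ky : unit_cube3 (pt y).
    by split; apply: grid01; apply: yN.
  have [k k2 qk] := qe _ Ky; exists k => // z cz; rewrite /a /neg qk //.
  have c j : z j = y j \/ z j = (y j).+1 by case: (cz j) => [|[]]; tauto.
  by do 2?split; apply: ball_grid.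
rewrite /deg3; congr (_ - _ - (_ - _) + (_ - _)); congr deg2;
  apply/funext => i; apply/funext => j;
  by rewrite /a /q /pt /next_cell /= ?addn0 ?add0n ?NN ?mul0r.
Qed.

(** The faces s = 0 and s = 1 cancel, and on the faces d = 0 and d = 1 the degree is zero because
    [G] is constant in s there. *)
Lemma deg3_homotopy (G : R -> R -> R -> V) :
  continuous (fun z : R * R * R => G z.1.1 z.1.2 z.2) ->
  (forall s d t, 0 <= s <= 1 -> 0 <= d <= 1 -> 0 <= t <= 1 -> G s d t != 0) ->
  (forall d t, G 1 d t = G 0 d t) ->
  (forall s s' t, G s 0 t = G s' 0 t) ->
  (forall s s' t, G s 1 t = G s' 1 t) ->
  exists M, forall N, (M < N)%N ->
    deg3 N (fun s d => G s d 1) = deg3 N (fun s d => G s d 0).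
Proof.
move=> cG G0 Gs Gd0 Gd1; have [M MN] := deg3_cube cG G0; exists M => N /MN.
rewrite (@eq_deg3 N (G 1) (G 0)) // subrr.
rewrite (@deg3_cst N (fun s t => G s 1 t)) ?(@deg3_cst N (fun s t => G s 0 t)) //.
by rewrite !subr0 add0r => /eqP; rewrite subr_eq0 => /eqP.
Qed.

End Degree.

(** * Degrees of five functions on a product of two spheres *)

Section Linking.
Variable R : realType.
Local Notation V := 'rV[R]_3.

Definition lnk (N : nat) (q : nat -> R -> R -> R -> R -> R) : int :=
  boxsum N [:: 0; 1; 2; 3]%N (cupn 4 (fun k y =>
    neg (q k ((y 0%N)%:R / N%:R) ((y 1%N)%:R / N%:R)
             ((y 2%N)%:R / N%:R) ((y 3%N)%:R / N%:R))) [:: 0; 1; 2; 3]%N) origin.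

Definition cube5_map (f : R -> R -> R -> R -> R -> R)
    (z : R * R * (R * R) * R) : R :=
  f z.1.1.1 z.1.1.2 z.1.2.1 z.1.2.2 z.2.

Definition unit_cube5 : set (R * R * (R * R) * R) :=
  [set z | [/\ 0 <= z.1.1.1 <= 1, 0 <= z.1.1.2 <= 1, 0 <= z.1.2.1 <= 1,
    0 <= z.1.2.2 <= 1 & 0 <= z.2 <= 1]].

Lemma unit_cube5_compact : compact unit_cube5.
Proof.
have -> : unit_cube5 = ((`[0, 1] `*` `[0, 1]) `*` (`[0, 1] `*` `[0, 1])) `*` `[0, 1].
  apply/seteqP; split => z; rewrite /unit_cube5 /= !in_itv /=.
    by move=> [-> -> -> -> ->].
  by move=> [[[-> ->] [-> ->]] ->].
by do 4?apply: compact_setX; exact: segment_compact.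
Qed.

Lemma lnk_homotopy (q : nat -> R -> R -> R -> R -> R -> R) :
  (forall k, continuous (cube5_map (q k))) ->
  (forall s d s' d' t, 0 <= s <= 1 -> 0 <= d <= 1 -> 0 <= s' <= 1 ->
     0 <= d' <= 1 -> 0 <= t <= 1 -> exists2 k, (k <= 4)%N & q k s d s' d' t != 0) ->
  (forall k s d s' d' t, q k (s + 1) d s' d' t = q k s d s' d' t) ->
  (forall k s d s' d' t, q k s d (s' + 1) d' t = q k s d s' d' t) ->
  (forall k s s1 d s' d' t, d = 0 \/ d = 1 -> q k s d s' d' t = q k s1 d s' d' t) ->
  (forall k s d s' s1 d' t, d' = 0 \/ d' = 1 -> q k s d s' d' t = q k s d s1 d' t) ->
  exists M, forall N, (M < N)%N ->
    lnk N (fun k s d s' d' => q k s d s' d' 1) =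
    lnk N (fun k s d s' d' => q k s d s' d' 0).
Proof.
move=> cq q0 p0 p2 d1 d3; pose Q k := cube5_map (q k).
have Q0 z : unit_cube5 z -> exists2 k, (k <= 4)%N & Q k z != 0.
  by case=> *; exact: q0.
have [e e0 qe] := sign_mesh unit_cube5_compact (fun k _ => cq k) Q0.
have [M MN] := mesh_ex e0; exists M => N /[dup] ltMN /MN Ne.
pose pt (y : lattice) : R * R * (R * R) * R :=
  (((y 0%N)%:R / N%:R, (y 1%N)%:R / N%:R),
   ((y 2%N)%:R / N%:R, (y 3%N)%:R / N%:R), (y 4%N)%:R / N%:R).
pose a k y := neg (Q k (pt y)).
have NN : (N%:R / N%:R = 1 :> R) by rewrite divff // pnatr_eq0; lia.
have addN j : ((j + N)%:R / N%:R = j%:R / N%:R + 1 :> R) by rewrite natrD mulrDl NN.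
have end01 (j : nat) : j = 0%N \/ j = N -> (j%:R / N%:R : R) = 0 \/ (j%:R / N%:R : R) = 1.
  by move=> [->|->]; [left; rewrite mul0r|right].
have := @stokes5 N a; cbv beta zeta => stk; rewrite /lnk.
have boxE t x : (x 4%N)%:R / N%:R = t :> R ->
    boxsum N [:: 0; 1; 2; 3]%N (cupn 4 a [:: 0; 1; 2; 3]%N) x =
    boxsum N [:: 0; 1; 2; 3]%N (cupn 4 (fun k y => neg (q k
      ((y 0%N)%:R / N%:R) ((y 1%N)%:R / N%:R) ((y 2%N)%:R / N%:R)
      ((y 3%N)%:R / N%:R) t)) [:: 0; 1; 2; 3]%N) x.
  move=> xt; apply: (@eq_boxsum_cupn (fun y => (y 4%N)%:R / N%:R = t :> R)) => //.
    by move=> f i z; rewrite /next_cell; case: eqP => [<- //|_ _]; rewrite addn0.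
  by move=> k y yt; rewrite /a /Q /cube5_map /= yt.
rewrite -(boxE 0) ?mul0r // -stk.
- rewrite (boxE 1); last by rewrite /next_cell /= add0n.
  by rewrite boxsum_cupn_period // => k y; rewrite /next_cell /= !addn0.
- move=> y yN; have Ky : unit_cube5 (pt y).
    by split; apply: grid01; apply: yN.
  have [k k2 qk] := qe _ Ky; exists k => // z cz; rewrite /a /neg qk //.
  have c j : z j = y j \/ z j = (y j).+1 by case: (cz j) => [|[]]; tauto.
  by do 4?split; apply: ball_grid.
- move=> k y; rewrite /a /Q /cube5_map /next_cell /= !addn0 addN; congr neg; exact: p0.
- move=> k y; rewrite /a /Q /cube5_map /next_cell /= !addn0 addN; congr neg; exact: p2.
- move=> k y /end01 y1; rewrite /a /Q /cube5_map /next_cell /= !addn0; congr neg; exact: d1.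
- move=> k y /end01 y1; rewrite /a /Q /cube5_map /next_cell /= !addn0; congr neg; exact: d3.
Qed.

Lemma lnk_factor_l N (q : nat -> R -> R -> R -> R -> R) (f g : R -> R -> V)
    (c : nat -> R -> R -> int) :
  (forall s d s' d', q 0%N s d s' d' = crd 2 (f s d)) ->
  (forall s d s' d', q 1%N s d s' d' = crd 1 (f s d)) ->
  (forall k s d s' d', neg (q k.+2 s d s' d') =
     if crd 0 (f s d) < 0 then neg (crd (2 - k) (g s' d')) else c k s d) ->
  lnk N q = deg3 N f * deg3 N g.
Proof.
move=> q0 q1 q2; rewrite /lnk.
rewrite (@link_factor_l N _
  (fun i j => neg (crd 2 (f (i%:R / N%:R) (j%:R / N%:R))))
  (fun i j => neg (crd 1 (f (i%:R / N%:R) (j%:R / N%:R))))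
  (fun i j => crd 0 (f (i%:R / N%:R) (j%:R / N%:R)) < 0)
  (fun k i j => neg (crd (2 - k) (g (i%:R / N%:R) (j%:R / N%:R))))
  (fun k i j => c k (i%:R / N%:R) (j%:R / N%:R))) //.
all: by move=> *; rewrite ?q0 ?q1 ?q2.
Qed.

Lemma lnk_factor_r N (q : nat -> R -> R -> R -> R -> R) (f g : R -> R -> V)
    (c : nat -> R -> R -> int) :
  (forall s d s' d', q 0%N s d s' d' = crd 2 (f s' d')) ->
  (forall s d s' d', q 1%N s d s' d' = crd 1 (f s' d')) ->
  (forall k s d s' d', neg (q k.+2 s d s' d') =
     if crd 0 (f s' d') < 0 then neg (crd (2 - k) (g s d)) else c k s' d') ->
  lnk N q = deg3 N f * deg3 N g.
Proof.
move=> q0 q1 q2; rewrite /lnk.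
rewrite (@link_factor_r N _
  (fun i j => neg (crd 2 (f (i%:R / N%:R) (j%:R / N%:R))))
  (fun i j => neg (crd 1 (f (i%:R / N%:R) (j%:R / N%:R))))
  (fun i j => crd 0 (f (i%:R / N%:R) (j%:R / N%:R)) < 0)
  (fun k i j => neg (crd (2 - k) (g (i%:R / N%:R) (j%:R / N%:R))))
  (fun k i j => c k (i%:R / N%:R) (j%:R / N%:R))) //.
all: by move=> *; rewrite ?q0 ?q1 ?q2.
Qed.

End Linking.

(** * Continuity of explicit formulas *)

Section Continuity.
Variables (R : realType) (T : topologicalType).
Implicit Types f g : T -> R.

Lemma contD f g : continuous f -> continuous g -> continuous (fun x => f x + g x).
Proof. by move=> cf cg x; apply: cvgD; [exact: cf|exact: cg]. Qed.

Lemma contN f : continuous f -> continuous (fun x => - f x).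
Proof. by move=> cf x; apply: cvgN; exact: cf. Qed.

Lemma contM f g : continuous f -> continuous g -> continuous (fun x => f x * g x).
Proof. by move=> cf cg x; apply: cvgM; [exact: cf|exact: cg]. Qed.

Lemma contV f : (forall x, f x != 0) -> continuous f -> continuous (fun x => (f x)^-1).
Proof. by move=> f0 cf x; apply: cvgV => //; exact: cf. Qed.

Lemma contX f n : continuous f -> continuous (fun x => f x ^+ n).
Proof.
move=> cf; elim: n => [|n IH]; first by move=> x; exact: cvg_cst.
have -> : (fun x => f x ^+ n.+1) = (fun x => f x * f x ^+ n).
  by apply/funext => x; rewrite exprS.
exact: contM.
Qed.

Lemma cont_comp (U : topologicalType) (h : U -> R) (f : T -> U) :
  continuous h -> continuous f -> continuous (fun x => h (f x)).
Proof. by move=> ch cf x; apply: (continuous_comp (cf x)); exact: ch. Qed.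

Lemma cont_comp2 (U W : topologicalType) (h : U -> W) (f : T -> U) :
  continuous h -> continuous f -> continuous (fun x => h (f x)).
Proof. by move=> ch cf x; apply: (continuous_comp (cf x)); exact: ch. Qed.

Lemma cont_pair (U W : topologicalType) (f : T -> U) (g : T -> W) :
  continuous f -> continuous g -> continuous (fun x => (f x, g x)).
Proof. by move=> cf cg x; apply: cvg_pair; [exact: cf|exact: cg]. Qed.

Lemma cont_max f g : continuous f -> continuous g ->
  continuous (fun x => Num.max (f x) (g x)).
Proof.
move=> cf cg x; exact: (@continuous_max R T f g x (cf x) (cg x)).
Qed.

Lemma cont_cst (U : topologicalType) (a : U) : continuous (fun _ : T => a).
Proof. by move=> x; exact: cvg_cst. Qed.

Lemma cont_crd k (F : T -> 'rV[R]_3) : continuous F -> continuous (fun x => crd k (F x)).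
Proof. by move=> cF; apply: cont_comp cF; exact: crd_continuous. Qed.

Lemma cont_rV (F : T -> 'rV[R]_3) :
  (forall k, (k < 3)%N -> continuous (fun x => crd k (F x))) -> continuous F.
Proof.
move=> cF x; apply/cvgrPdist_lt => e e0; near=> y.
rewrite /Num.Def.normr /= mx_normrE; apply/bigmax_ltP; split => // -[i j] _ /=.
rewrite ord1 !mxE; move: j; near: y; apply: filter_forall => j.
have := cF j (ltn_ord j) x; move/cvgrPdist_lt => /(_ e e0).
by rewrite /crd (inord_val j).
Unshelve. all: by end_near. Qed.

Lemma cont_vec3 f g h : continuous f -> continuous g -> continuous h ->
  continuous (fun x => vec3 (f x) (g x) (h x)).
Proof.
move=> cf cg ch; apply: cont_rV => -[|[|[|//]]] _.
- by under eq_fun do rewrite crd0v.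
- by under eq_fun do rewrite crd1v.
- by under eq_fun do rewrite crd2v.
Qed.

Lemma cont_vD (F G : T -> 'rV[R]_3) : continuous F -> continuous G ->
  continuous (fun x => F x + G x).
Proof. by move=> cf cg x; apply: cvgD; [exact: cf|exact: cg]. Qed.

Lemma cont_vN (F : T -> 'rV[R]_3) : continuous F -> continuous (fun x => - F x).
Proof. by move=> cf x; apply: cvgN; exact: cf. Qed.

Lemma cont_vZ f (F : T -> 'rV[R]_3) : continuous f -> continuous F ->
  continuous (fun x => f x *: F x).
Proof. by move=> cf cg x; apply: cvgZ; [exact: cf|exact: cg]. Qed.

End Continuity.

Lemma cont_fst (T U : topologicalType) : continuous (@fst T U).
Proof. by move=> x; exact: cvg_fst. Qed.

Lemma cont_snd (T U : topologicalType) : continuous (@snd T U).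
Proof. by move=> x; exact: cvg_snd. Qed.

Lemma cont_id (T : topologicalType) : continuous (fun x : T => x).
Proof. by move=> x; exact: cvg_id. Qed.

Ltac cont_hyp := match goal with
  | H : continuous ?f |- continuous ?f => exact: H
  end.

(* [contP], [contV] and [contR] decompose functions into a product, into
   vectors and into the reals. *)
Ltac contP := lazymatch goal with
  | |- continuous (fun x => x) => exact: cont_id
  | |- continuous fst => exact: cont_fst
  | |- continuous snd => exact: cont_snd
  | |- continuous (fun x => (@?a x, @?b x)) => apply: cont_pair; contP
  | |- continuous (fun x => fst (@?a x)) => apply: (cont_comp2 (@cont_fst _ _)); contP
  | |- continuous (fun x => snd (@?a x)) => apply: (cont_comp2 (@cont_snd _ _)); contP
  | |- _ => try cont_hyp
  end.

Ltac contV := lazymatch goal with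
  | |- continuous (fun _ => ?a) => exact: cont_cst
  | |- continuous (fun x => @?a x + @?b x) => apply: cont_vD; contV
  | |- continuous (fun x => - @?a x) => apply: cont_vN; contV
  | |- continuous (fun x => @?a x *: @?b x) => apply: cont_vZ; [contR | contV]
  | |- continuous (fun x => vec3 (@?a x) (@?b x) (@?c x)) => apply: cont_vec3; contR
  | |- _ => first [cont_hyp | contP]
  end
with contR := lazymatch goal with
  | |- continuous (fun _ => ?a) => exact: cont_cst
  | |- continuous (fun x => @?a x + @?b x) => apply: contD; contR
  | |- continuous (fun x => - @?a x) => apply: contN; contR
  | |- continuous (fun x => @?a x * @?b x) => apply: contM; contR
  | |- continuous (fun x => @?a x ^+ _) => apply: contX; contR
  | |- continuous (fun x => Num.max (@?a x) (@?b x)) => apply: cont_max; contR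
  | |- continuous (fun x => expR (@?a x)) => apply: (cont_comp (@continuous_expR _)); contR
  | |- continuous (fun x => cos (@?a x)) => apply: (cont_comp (@continuous_cos _)); contR
  | |- continuous (fun x => sin (@?a x)) => apply: (cont_comp (@continuous_sin _)); contR
  | |- continuous (fun x => crd _ (@?a x)) => apply: cont_crd; contV
  | |- _ => first [cont_hyp | contP]
  end.

(** * The linking number of two graphs over the sphere *)

Section Reduction.
Variable R : realType.
Local Notation V := 'rV[R]_3.

Definition uncurry2 (T : Type) (S : R -> R -> T) (z : R * R) : T := S z.1 z.2.

(** A map from the sphere to itself in spherical coordinates: s is the longitude, of period 1, and d
    the latitude, whose ends 0 and 1 are collapsed to the poles. *)
Record sphere_map (S : R -> R -> V) : Prop := SphereMap {
  sm_cont : continuous (uncurry2 S);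
  sm_unit : forall s d, dot (S s d) (S s d) = 1;
  sm_period : forall s d, S (s + 1) d = S s d;
  sm_south : forall s s', S s 0 = S s' 0;
  sm_north : forall s s', S s 1 = S s' 1 }.

(** The map (x, y) |-> (y_2, y_1, exp(y_0) x) embeds S^2 x R^3 as an open subset of R^5. These are
    the five coordinates of the difference of the images of two points, and the degree of this
    difference is the linking number of two surfaces. *)
Definition linkq (x y x' y' : V) (k : nat) : R :=
  match k with
  | 0 => crd 2 y - crd 2 y'
  | 1 => crd 1 y - crd 1 y'
  | k.+2 => expR (crd 0 y) * crd (2 - k) x - expR (crd 0 y') * crd (2 - k) x'
  end.

Lemma dot_ge0 (x : V) : 0 <= dot x x.
Proof. by rewrite dotE; nra. Qed.

Lemma unit_scale (x x' : V) (a b : R) : dot x x = 1 -> dot x' x' = 1 ->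
  0 <= a -> 0 <= b ->
  (forall k, (k < 3)%N -> a * crd k x - b * crd k x' = 0) -> a = b.
Proof.
move=> x1 x1' a0 b0 E; move: x1 x1'; rewrite !dotE => x1 x1'.
have e k : (k < 3)%N -> (a * crd k x) ^+ 2 = (b * crd k x') ^+ 2.
  by move=> /E /eqP; rewrite subr_eq0 => /eqP ->.
have : a ^+ 2 = b ^+ 2.
  rewrite -[LHS]mulr1 -x1 -[RHS]mulr1 -x1'.
  transitivity ((a * crd 0 x) ^+ 2 + (a * crd 1 x) ^+ 2 + (a * crd 2 x) ^+ 2).
    by ring.
  by rewrite !e //; ring.
by move=> /eqP; rewrite eqf_sqr => /predU1P[//|/eqP ab]; lra.
Qed.

Lemma linkq_neq0 (x y x' y' : V) : dot x x = 1 -> dot x' x' = 1 ->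
  (x, y) <> (x', y') -> exists2 k, (k <= 4)%N & linkq x y x' y' k != 0.
Proof.
move=> x1 x1' ne; apply: contrapT => nq; apply: ne.
have q0 k : (k <= 4)%N -> linkq x y x' y' k = 0.
  by move=> k4; apply/eqP/negPn/negP => qk; apply: nq; exists k.
have w0 k : (k < 3)%N ->
    expR (crd 0 y) * crd k x - expR (crd 0 y') * crd k x' = 0.
  by move=> k3; have := q0 (2 - k).+2; rewrite /= subKn //; apply; lia.
have ab := unit_scale x1 x1' (expR_ge0 _) (expR_ge0 _) w0.
have y0 : crd 0 y = crd 0 y' by exact: (expR_inj ab).
have := q0 0%N isT; have := q0 1%N isT; rewrite /= => /eqP.
rewrite subr_eq0 => /eqP y1 /eqP; rewrite subr_eq0 => /eqP y2.
congr pair; last exact: crdE.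
apply: crdP => k /w0 /eqP; rewrite ab -mulrBr mulf_eq0 gt_eqF ?expR_gt0 //=.
by rewrite subr_eq0 => /eqP.
Qed.

Definition reflect0 (x : V) : V := vec3 (- crd 0 x) (crd 1 x) (crd 2 x).

Section Graphs.
Variables (Sa Sb : R -> R -> V) (Fa Fb : V -> V).
Hypotheses (ma : sphere_map Sa) (mb : sphere_map Sb).
Hypotheses (cFa : continuous Fa) (cFb : continuous Fb).
Hypothesis Fab : forall x, dot x x = 1 -> Fa x != Fb x.

Let H x := Fa x - Fb x.

Let cH : continuous H. Proof. by rewrite /H; contV. Qed.

Let H0 x : dot x x = 1 -> H x != 0.
Proof. by move=> /Fab; rewrite /H subr_eq0. Qed.

Let X := (R * R * (R * R) * R)%type.

Let cSa : continuous (fun z : X => Sa z.1.1.1 z.1.1.2).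
Proof.
apply: (@cont_comp2 _ _ _ (uncurry2 Sa) (fun z : X => z.1.1)); last by contP.
exact: sm_cont ma.
Qed.

Let cSb : continuous (fun z : X => Sb z.1.2.1 z.1.2.2).
Proof.
apply: (@cont_comp2 _ _ _ (uncurry2 Sb) (fun z : X => z.1.2)); last by contP.
exact: sm_cont mb.
Qed.

Definition graph_link (k : nat) s d s' d' :=
  linkq (Sa s d) (Fa (Sa s d)) (Sb s' d') (Fb (Sb s' d')) k.

(* A homotopy through [a x - b x'] in the last three coordinates, where the
   signs of [a - b] and of the first coordinate of [h] agree. *)
Let coneq (h x x' : V) (a b : R) (k : nat) : R :=
  match k with
  | 0 => crd 2 h
  | 1 => crd 1 h
  | k.+2 => a * crd (2 - k) x - b * crd (2 - k) x'
  end.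

Let coneq_neq0 (h x x' : V) (a b : R) : dot x x = 1 -> dot x' x' = 1 ->
  h != 0 -> 0 <= a -> 0 <= b -> (crd 0 h != 0 -> a != b) ->
  exists2 k, (k <= 4)%N & coneq h x x' a b k != 0.
Proof.
move=> x1 x1' h0 a0 b0 ab; apply: contrapT => nq.
have q0 k : (k <= 4)%N -> coneq h x x' a b k = 0.
  by move=> k4; apply/eqP/negPn/negP => qk; apply: nq; exists k.
case/eqP: h0; apply: crdE; rewrite crd_0; last 2 first.
- exact: (q0 1%N).
- exact: (q0 0%N).
apply/eqP/negPn/negP => /ab/eqP; apply.
apply: (unit_scale x1 x1' a0 b0) => k k3.
by have := q0 (2 - k).+2; rewrite /= subKn //; apply; lia.
Qed.

Let pos x : R := Num.max x 0.

Let pos_ge0 x : 0 <= pos x. Proof. by rewrite /pos le_max lexx orbT. Qed.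

(** Both [a - b] and [pos u - pos (- u)], which is [u], have the sign of [u], and so does any
    mixture of them. *)
Let mix_neq (u a b t : R) : 0 <= t <= 1 ->
  (0 < u -> b < a) -> (u < 0 -> a < b) -> u != 0 ->
  (1 - t) * a + t * pos u != (1 - t) * b + t * pos (- u).
Proof.
move=> /andP[t0 t1] ub ua; have t1' : 0 <= 1 - t by lra.
have lt_mix a' b' c : a' < b' -> 0 < c -> (1 - t) * a' < (1 - t) * b' + t * c.
  move=> ab c0; have [->|tn0] := eqVneq t 0; first by rewrite mul0r; lra.
  have tc : 0 < t * c by rewrite mulr_gt0 // lt0r tn0.
  have : 0 <= (1 - t) * (b' - a') by rewrite mulr_ge0 // subr_ge0 ltW.
  by rewrite mulrBr; lra.
rewrite neq_lt => /orP[u0|u0].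
  have -> : pos u = 0 by rewrite /pos max_r // ltW.
  have -> : pos (- u) = - u by rewrite /pos max_l // oppr_ge0 ltW.
  by rewrite lt_eqF // mulr0 addr0 lt_mix ?oppr_gt0 // ua.
have -> : pos u = u by rewrite /pos max_l // ltW.
have -> : pos (- u) = 0 by rewrite /pos max_r // oppr_le0 ltW.
by rewrite gt_eqF // mulr0 addr0 lt_mix // ub.
Qed.

(** Subtracting [Fb] from both graphs keeps them disjoint: only points over the same x could meet,
    and their heights always differ by [H x]. The second graph becomes the zero section. The last
    three coordinates are then deformed into a positive multiple of -x' where coordinate 0 of [H] is
    negative, and of x where it is positive; in this form the degree factors. *)
Lemma graph_link_l : exists M, forall N, (M < N)%N ->
  lnk N graph_link
  = deg3 N (fun s d => H (Sa s d)) * deg3 N (fun s d => - Sb s d).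
Proof.
have [M1 E1] : exists M, forall N, (M < N)%N ->
    lnk N (fun k s d s' d' => linkq (Sa s d) (H (Sa s d)) (Sb s' d') 0 k)
    = lnk N graph_link.
  pose q k s d s' d' t := linkq (Sa s d) (Fa (Sa s d) - t *: Fb (Sa s d))
    (Sb s' d') ((1 - t) *: Fb (Sb s' d')) k.
  have [] := @lnk_homotopy R q.
  - move=> [|[|k]]; rewrite /q /linkq /cube5_map; contR; exact: cont_comp2.
  - move=> s d s' d' t _ _ _ _ _; apply: linkq_neq0; rewrite ?(sm_unit ma) ?(sm_unit mb) //.
    move=> [<-] /eqP; rewrite scalerBl scale1r -subr_eq0 opprB addrA subrK subr_eq0.
    by apply/negP/Fab; exact: sm_unit ma _ _.
  - by move=> *; rewrite /q (sm_period ma).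
  - by move=> *; rewrite /q (sm_period mb).
  - by move=> k s s1 d s' d' t [->|->]; rewrite /q ?(sm_south ma s s1) ?(sm_north ma s s1).
  - by move=> k s d s' s1 d' t [->|->]; rewrite /q ?(sm_south mb s' s1) ?(sm_north mb s' s1).
  move=> M EM; exists M => N /EM; rewrite /q.
  under [X in lnk N X]eq_fun do under eq_fun do under eq_fun do under eq_fun do
    under eq_fun do rewrite scale1r subrr scale0r.
  under [X in _ = lnk N X -> _]eq_fun do under eq_fun do under eq_fun do under eq_fun do
    under eq_fun do rewrite scale0r !subr0 scale1r.
  by move=> ->.
pose q k s d s' d' t := coneq (H (Sa s d)) (Sa s d) (Sb s' d')
  ((1 - t) * expR (crd 0 (H (Sa s d))) + t * pos (crd 0 (H (Sa s d))))
  ((1 - t) * 1 + t * pos (- crd 0 (H (Sa s d)))) k.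
have cHa := cont_comp2 cH cSa.
have [] := @lnk_homotopy R q.
- move=> [|[|k]]; rewrite /q /coneq /cube5_map /pos; contR.
- move=> s d s' d' t _ _ _ _ t01.
  have t0 : 0 <= 1 - t by lra.
  have t0' : 0 <= t by lra.
  apply: coneq_neq0; rewrite ?(sm_unit ma) ?(sm_unit mb) //.
  + by apply: H0; exact: sm_unit ma _ _.
  + by apply: addr_ge0; apply: mulr_ge0 => //; exact: expR_ge0.
  + by apply: addr_ge0; apply: mulr_ge0.
  + by apply: mix_neq => // u0; [rewrite expR_gt1|rewrite expR_lt1].
- by move=> *; rewrite /q (sm_period ma).
- by move=> *; rewrite /q (sm_period mb).
- by move=> k s s1 d s' d' t [->|->]; rewrite /q ?(sm_south ma s s1) ?(sm_north ma s s1).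
- by move=> k s d s' s1 d' t [->|->]; rewrite /q ?(sm_south mb s' s1) ?(sm_north mb s' s1).
move=> M2 E2; exists (maxn M1 M2) => N; rewrite gtn_max => /andP[/E1 <- /E2].
have -> : (fun k s d s' d' => q k s d s' d' 0) =
    (fun k s d s' d' => linkq (Sa s d) (H (Sa s d)) (Sb s' d') 0 k).
  apply/funext => -[|[|k]]; do 4!apply/funext => ?;
    by rewrite /q /= !crd_0 ?expR0 ?subr0 ?mul0r ?addr0 ?mul1r.
move=> <-; apply: (@lnk_factor_l R N _ (fun s d => H (Sa s d)) (fun s d => - Sb s d)
  (fun k s d => neg (crd 0 (H (Sa s d)) * crd (2 - k) (Sa s d)))) => //.
move=> k s d s' d'; rewrite /q /= subrr !mul0r !mul1r !add0r /pos.
case: ltP => u0.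
  rewrite ?mul0r sub0r max_l ?oppr_ge0 ?ltW // crdN /neg.
  by congr (nat_of_bool _)%:Z; rewrite mulNr opprK nmulr_rlt0 // oppr_lt0.
by rewrite max_r ?oppr_le0 // mul0r subr0.
Qed.

(** Here [Fa] is subtracted, and the part where coordinate 0 of [H] is positive counts, whence
    [reflect0]. For one and the same pair, both formulas together relate the degree of [H] along an
    arbitrary map [Sa] to the degree of [Sa]. *)
Lemma graph_link_r : exists M, forall N, (M < N)%N ->
  lnk N graph_link
  = deg3 N (fun s d => reflect0 (H (Sb s d))) * deg3 N Sa.
Proof.
have [M1 E1] : exists M, forall N, (M < N)%N ->
    lnk N (fun k s d s' d' => linkq (Sa s d) 0 (Sb s' d') (- H (Sb s' d')) k)
    = lnk N graph_link.
  pose q k s d s' d' t := linkq (Sa s d) ((1 - t) *: Fa (Sa s d))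
    (Sb s' d') (Fb (Sb s' d') - t *: Fa (Sb s' d')) k.
  have [] := @lnk_homotopy R q.
  - move=> [|[|k]]; rewrite /q /linkq /cube5_map; contR; exact: cont_comp2.
  - move=> s d s' d' t _ _ _ _ _; apply: linkq_neq0; rewrite ?(sm_unit ma) ?(sm_unit mb) //.
    move=> [->] /eqP; rewrite scalerBl scale1r (inj_eq (addIr _)).
    by apply/negP/Fab; exact: sm_unit mb _ _.
  - by move=> *; rewrite /q (sm_period ma).
  - by move=> *; rewrite /q (sm_period mb).
  - by move=> k s s1 d s' d' t [->|->]; rewrite /q ?(sm_south ma s s1) ?(sm_north ma s s1).
  - by move=> k s d s' s1 d' t [->|->]; rewrite /q ?(sm_south mb s' s1) ?(sm_north mb s' s1).
  move=> M EM; exists M => N /EM; rewrite /q /H.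
  under [X in lnk N X]eq_fun do under eq_fun do under eq_fun do under eq_fun do
    under eq_fun do rewrite scale1r subrr scale0r.
  under [X in _ = lnk N X -> _]eq_fun do under eq_fun do under eq_fun do under eq_fun do
    under eq_fun do rewrite scale0r !subr0 scale1r.
  under [X in _ -> lnk N X = _]eq_fun do under eq_fun do under eq_fun do under eq_fun do
    under eq_fun do rewrite opprB.
  by move=> ->.
pose q k s d s' d' t := coneq (H (Sb s' d')) (Sa s d) (Sb s' d')
  ((1 - t) * 1 + t * pos (crd 0 (H (Sb s' d'))))
  ((1 - t) * expR (- crd 0 (H (Sb s' d'))) + t * pos (- crd 0 (H (Sb s' d')))) k.
have cHb := cont_comp2 cH cSb.
have [] := @lnk_homotopy R q.
- move=> [|[|k]]; rewrite /q /coneq /cube5_map /pos; contR.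
- move=> s d s' d' t _ _ _ _ t01.
  have t0 : 0 <= 1 - t by lra.
  have t0' : 0 <= t by lra.
  apply: coneq_neq0; rewrite ?(sm_unit ma) ?(sm_unit mb) //.
  + by apply: H0; exact: sm_unit mb _ _.
  + by apply: addr_ge0; apply: mulr_ge0.
  + by apply: addr_ge0; apply: mulr_ge0 => //; exact: expR_ge0.
  + by apply: mix_neq => // u0; [rewrite expR_lt1 oppr_lt0|rewrite expR_gt1 oppr_gt0].
- by move=> *; rewrite /q (sm_period ma).
- by move=> *; rewrite /q (sm_period mb).
- by move=> k s s1 d s' d' t [->|->]; rewrite /q ?(sm_south ma s s1) ?(sm_north ma s s1).
- by move=> k s d s' s1 d' t [->|->]; rewrite /q ?(sm_south mb s' s1) ?(sm_north mb s' s1).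
move=> M2 E2; exists (maxn M1 M2) => N; rewrite gtn_max => /andP[/E1 <- /E2].
have -> : (fun k s d s' d' => q k s d s' d' 0) =
    (fun k s d s' d' => linkq (Sa s d) 0 (Sb s' d') (- H (Sb s' d')) k).
  apply/funext => -[|[|k]]; do 4!apply/funext => ?;
    by rewrite /q /= ?crd_0 ?crdN ?expR0 ?subr0 ?sub0r ?opprK ?mul0r ?addr0 ?mul1r.
move=> <-; apply: (@lnk_factor_r R N _ (fun s d => reflect0 (H (Sb s d))) Sa
  (fun k s d => neg (- (- crd 0 (H (Sb s d)) * crd (2 - k) (Sb s d))))) => //.
- by move=> *; rewrite /reflect0 crd2v.
- by move=> *; rewrite /reflect0 crd1v.
move=> k s d s' d'; rewrite /q /reflect0 crd0v /= subrr !mul0r !add0r !mul1r /pos oppr_lt0.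
case: ltP => u0.
  rewrite max_r ?oppr_le0 ?ltW // mul0r subr0 /neg.
  by rewrite pmulr_rlt0.
by rewrite mul0r sub0r max_l ?oppr_ge0 //.
Qed.

End Graphs.
End Reduction.

(** * Arguments of plane vectors *)

Section Angles.
Variable R : realType.
Local Notation P := (R * R)%type.
Implicit Types (w z m : P) (t : R).

Definition polar w t := exists2 r, 0 < r & w = (r * cos t, r * sin t).

Definition cmul w z : P := (w.1 * z.1 - w.2 * z.2, w.1 * z.2 + w.2 * z.1).
Definition cconj w : P := (w.1, - w.2).
Definition expi t : P := (cos t, sin t).
Definition sqn w : R := w.1 ^+ 2 + w.2 ^+ 2.

Lemma polar_expi t : polar (expi t) t.
Proof. by exists 1; rewrite ?mul1r. Qed.

Lemma polar_mul w z a b : polar w a -> polar z b -> polar (cmul w z) (a + b).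
Proof.
move=> [r r0 ->] [s s0 ->]; exists (r * s); first exact: mulr_gt0.
by rewrite /cmul cosD sinD /=; congr pair; ring.
Qed.

Lemma polar_scale w t a : 0 < a -> polar w t -> polar (a * w.1, a * w.2) t.
Proof.
by move=> a0 [r r0 ->]; exists (a * r); rewrite ?mulr_gt0 //= !mulrA.
Qed.

Lemma polar_opp w t : polar w t -> polar (- w.1, - w.2) (t + pi).
Proof. by move=> [r r0 ->]; exists r => //=; rewrite cosDpi sinDpi !mulrN. Qed.

Lemma sqn_ge0 w : 0 <= sqn w. Proof. by rewrite /sqn; nra. Qed.

Lemma sqn_gt0 w : (0 < sqn w) = (w != 0).
Proof.
rewrite lt0r sqn_ge0 andbT /sqn paddr_eq0 ?sqr_ge0 // !sqrf_eq0.
by case: w.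
Qed.

Lemma polar_neq0 w t : polar w t -> w != 0.
Proof.
move=> [r r0 ->]; rewrite -sqn_gt0 /sqn /= !exprMn -mulrDr cos2Dsin2 mulr1.
by rewrite exprn_gt0.
Qed.

Definition slit w := w.2 != 0 \/ 0 < w.1.

(* The principal determination, by the half-angle formula. *)
Definition Arg w : R := 2 * atan (w.2 / (Num.sqrt (sqn w) + w.1)).

Lemma slit_gt0 w : slit w -> 0 < Num.sqrt (sqn w) + w.1.
Proof.
move=> sw; have [w1|w1] := ltP 0 w.1; first by rewrite ltr_wpDl ?sqrtr_ge0.
have w2 : w.2 != 0 by case: sw => //; rewrite ltNge w1.
rewrite -ltrBlDr sub0r -[- _]ger0_norm ?oppr_ge0 // -sqrtr_sqr ltr_sqrt.
  by rewrite sqrrN /sqn ltrDl exprn_even_gt0.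
by rewrite sqn_gt0; apply: contra w2 => /eqP ->.
Qed.

Lemma Arg_polar w : slit w -> polar w (Arg w).
Proof.
move=> sw; have u0 := slit_gt0 sw; set r := Num.sqrt (sqn w) in u0 *.
have w0 : w != 0.
  by apply/eqP => w0; case: sw; rewrite w0 /= ?eqxx ?ltxx.
have r2 : r ^+ 2 = w.1 ^+ 2 + w.2 ^+ 2 by rewrite sqr_sqrtr // sqn_ge0.
have r0 : 0 < r by rewrite sqrtr_gt0 sqn_gt0.
exists r => //; rewrite /Arg -/r; set t := w.2 / _.
have c0 : 0 < 1 + t ^+ 2 by nra.
have c2 : cos (atan t) ^+ 2 = (1 + t ^+ 2)^-1.
  by rewrite cos_atan exprVn sqr_sqrtr // ltW.
have st : sin (atan t) = t * cos (atan t).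
  have cn0 : cos (atan t) != 0.
    by rewrite cos_atan invr_eq0 gt_eqF // sqrtr_gt0.
  by have := atanK t; rewrite /tan => tE; rewrite -[in RHS]tE tE -[X in X * _]tE divfK.
have ut : t * (r + w.1) = w.2 by rewrite divfK // gt_eqF.
have c21 : cos (atan t) ^+ 2 * (1 + t ^+ 2) = 1 by rewrite c2 mulVf // gt_eqF.
have e : 2 * r * cos (atan t) ^+ 2 = r + w.1.
  have tu : (1 + t ^+ 2) * (r + w.1) = 2 * r.
    apply: (mulfI (lt0r_neq0 u0)).
    transitivity ((r + w.1) ^+ 2 + (t * (r + w.1)) ^+ 2); first by ring.
    rewrite ut; have -> : w.2 ^+ 2 = r ^+ 2 - w.1 ^+ 2 by rewrite r2; ring.
    by ring.
  transitivity (cos (atan t) ^+ 2 * (1 + t ^+ 2) * (r + w.1)).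
    by rewrite -tu; ring.
  by rewrite c21 mul1r.
rewrite mulr_natl mulr2n cosD sinD st [in LHS](surjective_pairing w).
congr pair; last by rewrite -ut -e; ring.
have -> : w.1 = 2 * r * cos (atan t) ^+ 2 - r by rewrite e; ring.
set c := cos _ in c21 *.
transitivity (2 * r * c ^+ 2 - r * (c ^+ 2 * (1 + t ^+ 2))); last by ring.
by rewrite c21 mulr1.
Qed.

Lemma Arg_continuous (T : topologicalType) (f : T -> P) x :
  {for x, continuous f} -> slit (f x) -> {for x, continuous (fun y => Arg (f y))}.
Proof.
move=> cf sf.
have c1 : {for x, continuous (fun y => (f y).1)}.
  exact: (continuous_comp cf (@cont_fst _ _ _)).
have c2 : {for x, continuous (fun y => (f y).2)}.
  exact: (continuous_comp cf (@cont_snd _ _ _)).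
apply: cvgM; first exact: cvg_cst.
apply: (@continuous_comp _ _ _ (fun y => (f y).2 / (Num.sqrt (sqn (f y)) + (f y).1)) atan);
  last exact: continuous_atan.
apply: cvgM => //; apply: cvgV; first by rewrite gt_eqF // slit_gt0.
apply: cvgD => //.
apply: (@continuous_comp _ _ _ (fun y => sqn (f y)) Num.sqrt); last exact: sqrt_continuous.
have cX (g : T -> R) : {for x, continuous g} -> {for x, continuous (fun y => g y ^+ 2)}.
  move=> cg; have -> : (fun y => g y ^+ 2) = (fun y => g y * g y) by apply/funext => y.
  exact: cvgM.
by apply: cvgD; exact: cX.
Qed.

Definition lift_on (K : set R) (f : R -> P) (th : R -> R) :=
  (forall s, K s -> polar (f s) (th s)) /\ (forall s, K s -> {for s, continuous th}).

(* If the ratio [f / m] is never a nonpositive real number, a determination of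
   the argument of [m] provides one of [f]. *)
Lemma polar_ratio w m t : polar m t -> slit (cmul w (cconj m)) ->
  polar w (t + Arg (cmul w (cconj m))).
Proof.
move=> pm sw; have := polar_mul pm (Arg_polar sw).
have [r r0 mE] := pm; set u := cmul m _.
have -> : u = (r ^+ 2 * w.1, r ^+ 2 * w.2).
  have c : sin t ^+ 2 = 1 - cos t ^+ 2 by rewrite -(cos2Dsin2 t); ring.
  rewrite /u /cmul /cconj mE /=; congr pair; ring: c.
have r2 : 0 < (r ^+ 2)^-1 by rewrite invr_gt0 exprn_gt0.
move=> /(polar_scale r2) /=; rewrite !mulKf ?gt_eqF ?exprn_gt0 //.
by case: w {sw u}.
Qed.

(** Equality modulo 2 pi, expressed by the cosine so that no integer has to be chosen. *)
Lemma polar_eq w a b : polar w a -> polar w b -> cos (a - b) = 1.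
Proof.
move=> [r r0 ->] [s s0 [E1 E2]].
have n : r ^+ 2 = s ^+ 2.
  rewrite -[LHS]mulr1 -(cos2Dsin2 a) -[RHS]mulr1 -(cos2Dsin2 b) !mulrDr -!exprMn.
  by rewrite E1 E2.
have rs : r = s by move: n => /eqP; rewrite eqf_sqr => /predU1P[//|/eqP]; lra.
move: E1 E2; rewrite rs => /(mulfI (lt0r_neq0 s0)) E1 /(mulfI (lt0r_neq0 s0)) E2.
by rewrite cosB E1 E2 -!expr2 cos2Dsin2.
Qed.

(** The difference of two determinations, normalized to 0 at [a], has cosine 1 everywhere. By the
    intermediate value theorem it reaches neither [pi] nor [- pi], where the cosine is -1, and in
    between only 0 is possible. *)
Lemma lift_unique (a b : R) (f : R -> P) (th th' : R -> R) : a <= b ->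
  lift_on `[a, b] f th -> lift_on `[a, b] f th' ->
  th b - th a = th' b - th' a.
Proof.
move=> ab [p c] [p' c']; pose d s := th s - th' s - (th a - th' a).
have ca s : `[a, b] s -> cos (th s - th' s) = 1.
  by move=> s1; apply: polar_eq (p s s1) (p' s s1).
have sa s : `[a, b] s -> sin (th s - th' s) = 0.
  by move=> /ca c1; apply: cos1sin0; rewrite c1 normr1.
have aI : `[a, b]%classic a by rewrite /= in_itv /= lexx ab.
have bI : `[a, b]%classic b by rewrite /= in_itv /= lexx ab.
have cd s : `[a, b] s -> cos (d s) = 1.
  by move=> sI; rewrite cosB !ca // !sa // mulr1 mulr0 addr0.
have cont_d : {within `[a, b], continuous d}.
  apply: continuous_in_subspaceT => s /set_mem sI.
  by apply: cvgB; [apply: cvgB; [exact: c|exact: c']|exact: cvg_cst].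
have da : d a = 0 by rewrite /d subrr.
suff : d b = 0 by rewrite /d; lra.
have pi0 := pi_gt0 R.
have npi s : `[a, b] s -> d s <> pi /\ d s <> - pi.
  by move=> /cd cd1; split=> E; move: cd1; rewrite E ?cosN cospi; lra.
have lt_pi : `|d b| < pi.
  rewrite ltNge; apply/negP => dbpi; have [db|db] := lerP 0 (d b).
    have [|s sI] := IVT ab cont_d (v := pi).
      rewrite da (min_l db) (max_r db) ltW //=.
      by move: dbpi; rewrite ger0_norm.
    by move=> ds; case: (npi s).
  have [|s sI] := IVT ab cont_d (v := - pi).
    rewrite da (min_r (ltW db)) (max_l (ltW db)); apply/andP; split.
      by move: dbpi; rewrite ltr0_norm // lerNr.
    by rewrite oppr_le0 ltW.
  by move=> ds; case: (npi s).
have sb : sin (d b) = 0 by apply: cos1sin0; rewrite cd // normr1.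
apply/eqP/negPn/negP; rewrite neq_lt => /orP[db|db].
  have : 0 < sin (- d b).
    by apply: sin_gt0_pi; rewrite oppr_gt0 db /= -ltr0_norm.
  by rewrite sinN sb oppr0 ltxx.
have : 0 < sin (d b).
  by apply: sin_gt0_pi; rewrite db /= -[d b]gtr0_norm.
by rewrite sb ltxx.
Qed.

End Angles.

(** * Continuous arguments over a contractible compact set *)

Section Lift.
Variable R : realType.
Local Notation P := (R * R)%type.

Lemma polar_ex (w : P) : w != 0 -> exists t, polar w t.
Proof.
move=> w0; have [[w2 w1]|] := pselect (w.2 = 0 /\ w.1 <= 0).
  exists pi, (- w.1).
    rewrite oppr_gt0 lt_neqAle w1 andbT; apply: contra w0 => /eqP w10.
    by case: w w2 w10 {w1} => a b /= -> ->.
  by rewrite cospi sinpi mulr0 mulrN1 opprK -w2 -surjective_pairing.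
move=> n; exists (Arg w); apply: Arg_polar.
have [w2|w2] := eqVneq w.2 0; last by left.
by right; rewrite ltNge; apply/negP => w1; apply: n.
Qed.

Lemma cont_cmul (T : topologicalType) (f g : T -> P) :
  continuous f -> continuous g -> continuous (fun x => cmul (f x) (g x)).
Proof.
move=> cf cg; have c1 := cont_comp2 (@cont_fst _ _) cf.
have c2 := cont_comp2 (@cont_snd _ _) cf.
have d1 := cont_comp2 (@cont_fst _ _) cg.
have d2 := cont_comp2 (@cont_snd _ _) cg.
by rewrite /cmul; apply: cont_pair; contR.
Qed.

Lemma cont_cconj (T : topologicalType) (f : T -> P) :
  continuous f -> continuous (fun x => cconj (f x)).
Proof.
move=> cf; have c1 := cont_comp2 (@cont_fst _ _) cf.
have c2 := cont_comp2 (@cont_snd _ _) cf.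
by rewrite /cconj; apply: cont_pair; contR.
Qed.

(** Along the path [c (z, t)] the argument is followed from the common base point by adding the
    principal arguments of successive ratios. Compactness gives one number of steps that is good for
    all z in [K], so the result is a finite sum of continuous terms. *)
Lemma lift_star (T : pseudoMetricType R) (K : set T) (c : T * R -> T) (z0 : T)
    (f : T -> P) :
  compact K -> continuous c -> (forall z, c (z, 0) = z0) -> (forall z, c (z, 1) = z) ->
  continuous f -> (forall z, f z != 0) ->
  exists th : T -> R, forall z, K z -> polar (f z) (th z) /\ {for z, continuous th}.
Proof.
move=> cK cc c0 c1 cf f0; pose F z t := f (c (z, t)).
pose psi z s t := (cmul (F z s) (cconj (F z t))).1.
have KI : compact (K `*` `[0 : R, 1]).
  by apply: compact_setX => //; exact: segment_compact.
have cpsi : continuous (fun x : T * R * R => psi x.1.1 x.1.2 x.2).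
  apply: (@cont_comp2 _ _ _ (@fst R R)
    (fun x : T * R * R => cmul (F x.1.1 x.1.2) (cconj (F x.1.1 x.2)))).
    exact: cont_fst.
  apply: cont_cmul; last apply: cont_cconj.
    by apply: (cont_comp2 cf); apply: (cont_comp2 cc); contP.
  by apply: (cont_comp2 cf); apply: (cont_comp2 cc); contP.
have [e [e0 Pe]] : exists e : R, 0 < e /\ K `*` `[0, 1] `<=`
    (fun x => forall s, `|s - x.2| < e -> 0 < psi x.1 s x.2).
  suff Pe : \forall e \near 0^'+, K `*` `[0 : R, 1] `<=`
      (fun x => forall s, `|s - x.2| < e -> 0 < psi x.1 s x.2).
    have : \forall e \near 0^'+, 0 < e /\ K `*` `[0 : R, 1] `<=`
      (fun x => forall s, `|s - x.2| < e -> 0 < psi x.1 s x.2).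
      by near=> e; split => //; near: e.
    by move=> /filter_ex.
  move: KI => /compact_near_coveringP; apply => -[z t] [Kz It].
  have psi0 : 0 < psi z t t.
    have := f0 (c (z, t)); rewrite -sqn_gt0 /psi /F /cmul /cconj /sqn /=.
    by rewrite mulrN opprK !expr2.
  have : \forall x \near (z, t, t), 0 < psi x.1.1 x.1.2 x.2.
    by have := cpsi (z, t, t) => /cvgr_gt; apply.
  move=> /nbhs_ballP[r /= r0 rz].
  exists (ball (z, t) (r / 2), [set e | 0 < e < r / 2]) => /=.
    split; first by apply: nbhsx_ballx; rewrite divr_gt0.
    near=> e; apply/andP; split => //.
    by near: e; apply: nbhs_right_lt; rewrite divr_gt0.
  move=> [[z' t'] e] /= [[zz' tt'] /andP[e0 er]] s st'.
  apply: (rz (z', s, t')); split => /=; last by apply: le_ball tt'; lra.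
  split => /=; first by apply: le_ball zz'; lra.
  by rewrite (splitr r); apply: ball_triangle tt' _; rewrite /ball /= distrC; lra.
have [m me] := mesh_ex e0; have {me} := me m.+1 (ltnSn m).
set M := m.+1 => Me.
have M0 : M%:R != 0 :> R by rewrite pnatr_eq0.
pose st z k := cmul (F z (k.+1%:R / M%:R)) (cconj (F z (k%:R / M%:R))).
have slit_st z k : K z -> (k < M)%N -> slit (st z k).
  move=> Kz kM; right; apply: (Pe (z, k%:R / M%:R)).
    by split => //=; rewrite in_itv /=; exact: grid01.
  have -> : k.+1%:R / M%:R - k%:R / M%:R = M%:R^-1 :> R.
    by rewrite -mulrBl -natr1 addrAC subrr add0r mul1r.
  by rewrite /= ger0_norm ?invr_ge0.
have [t0 pt0] := polar_ex (f0 z0).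
exists (fun z => t0 + \sum_(k < M) Arg (st z k)) => z Kz; split.
  have pol k : (k <= M)%N ->
      polar (F z (k%:R / M%:R)) (t0 + \sum_(j < k) Arg (st z j)).
    elim: k => [_|k IH kM]; first by rewrite big_ord0 addr0 mul0r /F c0.
    rewrite big_ord_recr /= addrA; apply: polar_ratio; first by apply: IH; lia.
    exact: slit_st.
  by have := pol M (leqnn _); rewrite divff // /F c1.
have cF (a : R) : continuous (fun y => F y a).
  by apply: (cont_comp2 cf); apply: (cont_comp2 cc); apply: cont_pair; [exact: cont_id|exact: cont_cst].
have cst k : continuous (st ^~ k) by apply: cont_cmul; last apply: cont_cconj.
apply: cvgD; first exact: cvg_cst.
have : (M <= M)%N by []; elim: {-2}M => [_|k IH kM].
  by under eq_fun do rewrite big_ord0; rewrite big_ord0; exact: cvg_cst.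
under eq_fun do rewrite big_ord_recr /=; rewrite big_ord_recr /=.
apply: cvgD; first by apply: IH; lia.
exact: (@Arg_continuous R T (st ^~ k) z (cst k z) (slit_st z k Kz kM)).
Unshelve. all: by end_near. Qed.

End Lift.

(** * Hopf's Umlaufsatz *)

Section Umlaufsatz.
Variable R : realType.
Local Notation P := (R * R)%type.

Definition near_direction (v t : P) (e : R) : Prop := exists2 k, 0 < k &
  `|v.1 - k * t.1| <= e * k /\ `|v.2 - k * t.2| <= e * k.

Definition sub2 (v w : P) : P := (v.1 - w.1, v.2 - w.2).
Definition opp2 (v : P) : P := (- v.1, - v.2).

(* Secants of [c] near [s0] point in the direction of [T s0]. *)
Definition has_direction (c T : R -> P) : Prop := forall s0 e, 0 < e ->
  exists2 d, 0 < d & forall s t, s0 - d < s -> s < t -> t < s0 + d ->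
    near_direction (sub2 (c t) (c s)) (T s0) e.

Definition nu (w : P) : P := (w.1 / (`|w.1| + `|w.2|), w.2 / (`|w.1| + `|w.2|)).

Lemma norm1_gt0 (w : P) : w != 0 -> 0 < `|w.1| + `|w.2|.
Proof.
move=> w0; rewrite lt0r addr_ge0 // andbT paddr_eq0 // !normr_eq0.
by apply: contra w0; case: w => a b /= /andP[/eqP -> /eqP ->].
Qed.

Lemma nu_neq0 w : w != 0 -> nu w != 0.
Proof.
move=> w0; have n0 := norm1_gt0 w0; apply: contra w0 => /eqP[/eqP + /eqP].
rewrite !mulf_eq0 invr_eq0 !(gt_eqF n0) !orbF; case: w {n0} => a b /=.
by move=> /eqP -> /eqP ->.
Qed.

Lemma nu_opp w : nu (opp2 w) = opp2 (nu w).
Proof. by rewrite /nu /opp2 /= !normrN !mulNr. Qed.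

Lemma nu_scale w k : 0 < k -> nu (k * w.1, k * w.2) = nu w.
Proof.
move=> k0; rewrite /nu /= !normrM !(gtr0_norm k0) -mulrDr.
have e x n : k * x / (k * n) = x / n.
  by rewrite invfM mulrACA divff ?gt_eqF // mul1r.
by rewrite !e.
Qed.

Lemma polar_nu w t : w != 0 -> polar (nu w) t -> polar w t.
Proof.
move=> w0 pn; have n0 := norm1_gt0 w0; have := polar_scale n0 pn.
by rewrite /nu /= !(mulrC (_ + _)) !divfK ?gt_eqF // -surjective_pairing.
Qed.

Lemma nu_continuous w : w != 0 -> {for w, continuous nu}.
Proof.
move=> w0; have n0 := norm1_gt0 w0.
have c1 : {for w, continuous (@fst R R)} by exact: cvg_fst.
have c2 : {for w, continuous (@snd R R)} by exact: cvg_snd.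
have cn : {for w, continuous (fun z : P => (`|z.1| + `|z.2|)^-1)}.
  apply: cvgV; first by rewrite gt_eqF.
  by apply: cvgD; [exact: (cvg_norm c1)|exact: (cvg_norm c2)].
exact: (cvg_pair (cvgM c1 cn) (cvgM c2 cn)).
Qed.

Lemma near_direction_nu (T : P) (e : R) : T != 0 -> 0 < e ->
  exists2 d, 0 < d & forall v, near_direction v T d -> ball (nu T) e (nu v).
Proof.
move=> T0 e0; have cT := nu_continuous T0.
have /nbhs_ballP[r /= r0 rT] : nbhs T [set v | ball (nu T) e (nu v)].
  by apply: cT; exact: nbhsx_ballx.
exists (r / 2); first by rewrite divr_gt0.
move=> v [k k0 [v1 v2]]; rewrite -[nu v](nu_scale v (k := k^-1)) ?invr_gt0 //.
have small x t : `|x - k * t| <= r / 2 * k -> ball t r (k^-1 * x).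
  move=> xk; rewrite /ball /= distrC.
  have -> : k^-1 * x - t = k^-1 * (x - k * t) by rewrite mulrBr mulKf // gt_eqF.
  rewrite normrM gtr0_norm ?invr_gt0 // mulrC ltr_pdivrMr //.
  by apply: le_lt_trans xk _; nra.
by apply: rT; split; exact: small.
Qed.

Section Loop.
Variables c T : R -> P.
Hypotheses (cc : continuous c) (cT : continuous T).
Hypotheses (pc : forall s, c (s + 1) = c s) (pT : forall s, T (s + 1) = T s).
Hypothesis T0 : forall s, T s != 0.
Hypothesis injc : forall s t, s < t -> t < s + 1 -> c s <> c t.
Hypothesis dir : has_direction c T.

(** The retraction of the plane onto the triangle 0 <= s <= t <= 1. Composing with it turns
    functions on the triangle into functions on the plane, to which [lift_star] applies. *)
Let cl (z : P) : P :=
  (Num.min (Num.max z.1 0) 1, Num.min (Num.max z.2 (Num.min (Num.max z.1 0) 1)) 1).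

Let tri (z : P) := 0 <= z.1 /\ z.1 <= z.2 /\ z.2 <= 1.

Let cl_tri z : tri (cl z).
Proof.
rewrite /tri /cl /=; split; [|split].
- by rewrite le_min ler01 le_max lexx orbT.
- by rewrite [leRHS]minC le_min ge_min lexx orbT /= le_max lexx orbT.
- by rewrite ge_min lexx orbT.
Qed.

Let cl_id z : tri z -> cl z = z.
Proof.
case: z => s t; rewrite /tri /cl /= => -[s0 [st t1]].
by rewrite (max_l s0) (min_l (le_trans st t1)) (max_l st) (min_l t1).
Qed.

Let cl_cont : continuous cl.
Proof.
have cmin (f g : P -> R) : continuous f -> continuous g ->
    continuous (fun x => Num.min (f x) (g x)).
  by move=> cf cg x; exact: (@continuous_min R P f g x (cf x) (cg x)).
have c1 : continuous (fun z : P => Num.min (Num.max z.1 0) 1).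
  by apply: cmin; contR.
by apply: cont_pair => //; apply: cmin; contR.
Qed.

(** Hopf's secant map: the direction of the chord from c(s) to c(t), completed by the tangent on the
    diagonal and by the opposite tangent at the corner (0, 1), where the closed curve has come back
    to its start. *)
Let g (z : P) : P :=
  if z.1 == z.2 then nu (T z.1)
  else if (z.1 == 0) && (z.2 == 1) then opp2 (nu (T 0))
  else nu (sub2 (c z.2) (c z.1)).

Let sub2_neq0 v w : v <> w -> sub2 v w != 0.
Proof.
move=> vw; apply/eqP => -[/subr0_eq e1 /subr0_eq e2]; apply: vw.
by case: v w e1 e2 => ? ? [? ?] /= -> ->.
Qed.

Let g_neq0 z : tri z -> g z != 0.
Proof.
case: z => s t [/= s0 [st t1]]; rewrite /g /=.
case: (eqVneq s t) => [_|nst]; first by rewrite nu_neq0.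
case: ifP => [_|n01].
  by rewrite -nu_opp nu_neq0 //; apply: contra (T0 0) => /eqP[/eqP + /eqP];
    rewrite !oppr_eq0; case: (T 0) => a b /= /eqP -> /eqP ->.
apply: nu_neq0; apply: sub2_neq0 => e; have lst : s < t by rewrite lt_neqAle nst.
apply: (@injc s t) => //.
have [s00|s00] := eqVneq s 0; last by have : 0 < s by [rewrite lt0r s00]; lra.
by move: n01; rewrite s00 eqxx /= add0r => t1'; rewrite lt_neqAle t1' t1.
Qed.

Let G z := g (cl z).

Let opp2_ball (v w : P) e : ball v e w -> ball (opp2 v) e (opp2 w).
Proof. by case=> w1 w2; split; rewrite /ball /= -opprD normrN. Qed.

Let g_mod (z : P) (e : R) : tri z -> 0 < e ->
  exists2 d, 0 < d & forall u : P, tri u ->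
    `|u.1 - z.1| < d -> `|u.2 - z.2| < d -> ball (g z) e (g u).
Proof.
case: z => s t [/= s0 [st t1]] e0.
have [E|nst] := eqVneq s t.
  move: E t1 => <- {t st} t1; rewrite /g /= eqxx.
  have [r r0 rP] := near_direction_nu (T0 s) e0.
  have [d d0 dP] := dir s r0.
  have cnT : {for s, continuous (nu \o T)}.
    by apply: continuous_comp; [exact: cT|by apply: nu_continuous; exact: T0].
  have /nbhs_ballP[d' /= d'0 d'P] : nbhs s [set x | ball (nu (T s)) e (nu (T x))].
    by apply: cnT; exact: nbhsx_ballx.
  exists (Num.min (Num.min d d') (1 / 2)); first by rewrite !lt_min d0 d'0; lra.
  case=> x y [/= x0 [xy y1]]; rewrite !lt_min => /andP[/andP[b1 b1'] b1''].
  move=> /andP[/andP[b2 b2'] b2''].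
  case: (eqVneq x y) => [_|n].
    by apply: d'P; rewrite /ball /= distrC.
  case: ifP => [/andP[/eqP x00 /eqP y11]|_].
    by move: b1'' b2''; rewrite x00 y11 !ltr_norml; lra.
  move: b1 b2; rewrite !ltr_norml => b1 b2.
  by apply: rP; apply: dP; [lra|rewrite lt_neqAle n|lra].
have lst : s < t by rewrite lt_neqAle nst.
have [[s00 t11]|z01] := pselect (s = 0 /\ t = 1).
  rewrite /g /= (negbTE nst) s00 t11 !eqxx /=.
  have [r r0 rP] := near_direction_nu (T0 0) e0.
  have [d d0 dP] := dir 0 r0.
  exists (Num.min d (1 / 4)); first by rewrite !lt_min d0; lra.
  case=> x y [/= x0 [xy y1]]; rewrite !lt_min !ltr_norml.
  move=> /andP[b1 b1'] /andP[b2 b2'].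
  case: (eqVneq x y) => [E|n]; first by move: b1' b2'; rewrite E; lra.
  case: ifP => [_|n01]; first exact: ballxx.
  (* Near the corner, periodicity turns the chord into the reverse of a short one, from the
     parameter y - 1 to x, around 0. *)
  have -> : sub2 (c y) (c x) = opp2 (sub2 (c x) (c (y - 1))).
    by rewrite -(pc (y - 1)) subrK /opp2 /= !opprB.
  rewrite nu_opp; apply: opp2_ball; apply: rP; apply: dP; [by lra| |by lra].
  move: n01; have [->|x00] := eqVneq x 0.
    by move=> /= y11; rewrite subr_lt0 lt_neqAle y11.
  by have : 0 < x by [rewrite lt0r x00]; lra.
have ne : sub2 (c t) (c s) != 0.
  apply: sub2_neq0; apply: nesym; apply: injc => //.
  have [s00|s00] := eqVneq s 0; last by have : 0 < s by [rewrite lt0r s00]; lra.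
  by rewrite s00 add0r lt_neqAle t1 andbT; apply: contra_notN z01 => /eqP.
have csub : continuous (fun z : P => sub2 (c z.2) (c z.1)).
  have c1 := cont_comp2 cc (@cont_fst R R).
  have c2 := cont_comp2 cc (@cont_snd R R).
  have c11 := cont_comp2 (@cont_fst _ _) c1; have c12 := cont_comp2 (@cont_snd _ _) c1.
  have c21 := cont_comp2 (@cont_fst _ _) c2; have c22 := cont_comp2 (@cont_snd _ _) c2.
  by apply: cont_pair; contR.
have /nbhs_ballP[d /= d0 dP] :
    nbhs (s, t) [set z | ball (nu (sub2 (c t) (c s))) e (nu (sub2 (c z.2) (c z.1)))].
  have := continuous_comp (csub (s, t)) (nu_continuous ne).
  by apply; exact: nbhsx_ballx.
have r0 : 0 < (t - s) / 2 by rewrite divr_gt0 // subr_gt0.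
have r1 : 0 < (1 - (t - s)) / 2.
  rewrite divr_gt0 // subr_gt0 lt_neqAle; apply/andP; split; last by lra.
  by apply/eqP => E; apply: z01; lra.
exists (Num.min d (Num.min ((t - s) / 2) ((1 - (t - s)) / 2))).
  by rewrite !lt_min d0 r0 r1.
case=> x y [/= x0 [xy y1]]; rewrite !lt_min => /andP[b1 /andP[b1' b1'']].
move=> /andP[b2 /andP[b2' b2'']]; rewrite /g /= (negbTE nst).
have -> : (s == 0) && (t == 1) = false.
  by apply/negbTE/negP => /andP[/eqP ? /eqP ?]; apply: z01.
case: (eqVneq x y) => [E|_].
  by move: b1' b2'; rewrite E !ltr_norml; lra.
case: ifP => [/andP[/eqP x00 /eqP y11]|_].
  by move: b1'' b2''; rewrite x00 y11 !ltr_norml; lra.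
by apply: (dP (x, y)); split; rewrite /ball /= distrC.
Qed.

Let G_cont : continuous G.
Proof.
move=> z; apply/cvg_ballP => e e0; have [d d0 dP] := g_mod (cl_tri z) e0.
have : \forall z' \near z, ball (cl z) d (cl z').
  by apply: cl_cont; exact: nbhsx_ballx.
apply: filterS => z' [b1 b2].
by apply: dP; [exact: cl_tri|move: b1; rewrite /ball /= distrC|
  move: b2; rewrite /ball /= distrC].
Qed.

Hypothesis bottom : forall s, (c 0).2 <= (c s).2.

(** Short chords go up when leaving the lowest point and down when arriving at it, while both
    approximate the same tangent. *)
Lemma bottom_horizontal : (T 0).2 = 0.
Proof.
apply/eqP; rewrite -normr_eq0; apply/negPn/negP => n0.
have e0 : 0 < `|(T 0).2| / 2 by rewrite divr_gt0 // lt0r n0 normr_ge0.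
have [d d0 dP] := dir 0 e0.
have [k k0 [_ /=]] : near_direction (sub2 (c (d / 2)) (c 0)) (T 0) (`|(T 0).2| / 2).
  by apply: dP; lra.
have [l l0 [_ /=]] : near_direction (sub2 (c 0) (c (- (d / 2)))) (T 0) (`|(T 0).2| / 2).
  by apply: dP; lra.
have b1 := bottom (d / 2); have b2 := bottom (- (d / 2)).
rewrite !ler_norml => /andP[h1 h2] /andP[h3 h4].
have [t0|t0] := lerP 0 (T 0).2.
  by move: n0 h1 h2 h3 h4; rewrite ger0_norm // => n0 h1 h2 h3 h4;
    have : 0 < (T 0).2 by [rewrite lt0r n0]; nra.
by move: h1 h2 h3 h4; rewrite ltr0_norm // => h1 h2 h3 h4; nra.
Qed.

Hypothesis T1 : 0 < (T 0).1.

Let T2 := bottom_horizontal.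

Let nuT0 : nu (T 0) = (1, 0).
Proof.
by rewrite /nu T2 normr0 addr0 mul0r gtr0_norm // divff // gt_eqF.
Qed.

(** To leave [0, pi], the angle would have to take a value in [- pi/2, 0) or in (pi, 3 pi/2], where
    the sine is negative. *)
Let phi_range (phi : R -> R) :
  (forall s, `[0, 1]%classic s -> {for s, continuous phi}) -> phi 0 = 0 ->
  (forall s, `[0, 1]%classic s -> 0 <= sin (phi s)) ->
  forall s, `[0, 1]%classic s -> 0 <= phi s <= pi.
Proof.
move=> cphi p0 sphi s sI; have pi0 := pi_gt0 R.
have [/= s0 s1] : 0 <= s /\ s <= 1 by move: sI; rewrite /= in_itv /= => /andP.
have sub x : x \in `[0, s]%R -> `[0, 1]%classic x.
  by rewrite /= !in_itv /= => /andP[-> /= xs]; apply: le_trans s1.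
have cw : {within `[0, s], continuous phi}.
  by apply: continuous_in_subspaceT => x /set_mem xI; apply: cphi; exact: sub.
apply/andP; split; rewrite leNgt; apply/negP => ps.
  pose v := Num.max (phi s) (- (pi / 2)).
  have v0 : v < 0 by rewrite gt_max ps oppr_lt0 divr_gt0.
  have v1 : - (pi / 2) <= v by rewrite le_max lexx orbT.
  have [|x xI pv] := IVT s0 cw (v := v).
    by rewrite p0 (min_r (ltW ps)) (max_l (ltW ps)) le_max lexx /= ltW.
  have := sphi x (sub x xI); rewrite pv leNgt => /negP; apply.
  rewrite -[v]opprK sinN oppr_lt0; apply: sin_gt0_pi; lra.
pose v := Num.min (phi s) (pi + pi / 2).
have v0 : pi < v by rewrite lt_min ps; lra.
have v1 : v <= pi + pi / 2 by rewrite ge_min lexx orbT.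
have [|x xI pv] := IVT s0 cw (v := v).
  rewrite p0 min_l ?max_r; try by apply: ltW; lra.
  by rewrite ge_min lexx andbT; lra.
have := sphi x (sub x xI); rewrite pv leNgt => /negP; apply.
have -> : v = (v - pi) + pi by rewrite subrK.
rewrite sinDpi oppr_lt0; apply: sin_gt0_pi; lra.
Qed.

Let I01 (s : R) : `[0, 1]%classic s = (0 <= s <= 1).
Proof. by rewrite /= in_itv. Qed.

(* Hopf's argument: the secants from the lowest point turn by [pi], hence the
   secants to it turn by [pi] as well, and both paths together are homotopic
   to the path of tangents. *)
Lemma rotation_index_pos :
  (exists2 thT, lift_on `[0, 1] T thT & thT 1 - thT 0 = 2 * pi) /\
  exists2 e0, 0 < e0 & forall e, 0 < e -> e < e0 ->
    exists2 th, lift_on `[0, 1] (fun s => sub2 (c s) ((c 0).1, (c 0).2 + e)) th &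
      th 1 - th 0 = 2 * pi.
Proof.
have [] := @lift_star R P (`[0, 1] `*` `[0, 1]) (fun z => (z.2 * z.1.1, z.2 * z.1.2)) (0, 0) G.
- by apply: compact_setX; exact: segment_compact.
- by apply: cont_pair; contR.
- by move=> z; rewrite !mul0r.
- by case=> a b; rewrite !mul1r.
- exact: G_cont.
- by move=> z; exact/g_neq0/cl_tri.
move=> th Hth.
have pi0 := pi_gt0 R.
have Tp : T 1 = T 0 by rewrite -(pT 0) add0r.
have cp : c 1 = c 0 by rewrite -(pc 0) add0r.
have pth s t : 0 <= s -> s <= t -> t <= 1 -> polar (g (s, t)) (th (s, t)).
  move=> s0 st t1; have [|+ _] := Hth (s, t).
    by split; rewrite /= in_itv /=; lra.
  by rewrite /G cl_id.
have cth (f : R -> P) s : 0 <= (f s).1 <= 1 -> 0 <= (f s).2 <= 1 ->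
    continuous f -> {for s, continuous (th \o f)}.
  move=> f1 f2 cf; apply: continuous_comp; first exact: cf.
  by have [|_] := Hth (f s); [split; rewrite /= in_itv|].
have c0t : continuous (fun t : R => (0 : R, t)).
  by apply: cont_pair; [exact: cont_cst|exact: cont_id].
have ct1 : continuous (fun t : R => (t, 1 : R)).
  by apply: cont_pair; [exact: cont_id|exact: cont_cst].
have ctt : continuous (fun t : R => (t, t)) by apply: cont_pair; exact: cont_id.
have g00 : g (0, 0) = (1, 0) by rewrite /g /= eqxx nuT0.
have g01 : g (0, 1) = (-1, 0).
  by rewrite /g /= (eq_sym 0) oner_eq0 !eqxx /= nuT0 /opp2 oppr0.
have g0s s : 0 < s -> s < 1 -> g (0, s) = nu (sub2 (c s) (c 0)).
  by move=> s0 s1; rewrite /g /= (eq_sym 0) (gt_eqF s0) (lt_eqF s1) eqxx.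
have E00 : cos (th (0, 0)) = 1 /\ sin (th (0, 0)) = 0.
  have : cos (th (0, 0) - 0) = 1.
    apply: (@polar_eq _ (1, 0)); first by rewrite -g00; apply: pth.
    by exists 1; rewrite ?cos0 ?sin0 ?mulr1 ?mulr0.
  by rewrite subr0 => E; split=> //; apply: cos1sin0; rewrite E normr1.
have E01 : cos (th (0, 1)) = -1.
  have : cos (th (0, 1) - pi) = 1.
    apply: (@polar_eq _ (-1, 0)); first by rewrite -g01; apply: pth.
    by exists 1; rewrite ?cospi ?sinpi ?mulr1 ?mulr0 ?mul1r.
  by rewrite cosB cospi sinpi mulr0 addr0 mulrN1 => /eqP; rewrite eqr_oppLR => /eqP.
pose phi s := th (0, s) - th (0, 0).
have cosphi s : cos (phi s) = cos (th (0, s)).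
  by rewrite /phi cosB; case: E00 => -> ->; rewrite mulr1 mulr0 addr0.
have sinphi s : sin (phi s) = sin (th (0, s)).
  by rewrite /phi sinB; case: E00 => -> ->; rewrite mulr1 mulr0 subr0.
have cphi s : `[0, 1]%classic s -> {for s, continuous phi}.
  rewrite I01 => sI; apply: cvgB; last exact: cvg_cst.
  by apply: (cth (fun t => (0, t))) => //=; rewrite lexx ler01.
have ends (s : R) : 0 <= s <= 1 -> [\/ s = 0, s = 1 | 0 < s < 1].
  move=> /andP[s0 s1]; have [->|n0] := eqVneq s 0; first by constructor 1.
  have [->|n1] := eqVneq s 1; first by constructor 2.
  by constructor 3; rewrite lt0r n0 s0 lt_neqAle n1.
have phiI : forall s, `[0, 1]%classic s -> 0 <= phi s <= pi.
  apply: phi_range => //; first by rewrite /phi subrr.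
  move=> s; rewrite I01 => sI; rewrite sinphi.
  have := pth 0 s (lexx 0); case/andP: (sI) => s0 s1 /(_ s0 s1) [r r0 gE].
  rewrite -(pmulr_rge0 _ r0); move: gE => /(congr1 snd) /= <-.
  case: (ends s sI) => [->|->|/andP[s0' s1']]; rewrite ?g00 ?g01 //=.
  rewrite g0s //=; apply: divr_ge0; last by rewrite addr_ge0.
  by rewrite subr_ge0; exact: bottom.
have in0 : `[0, 1]%classic (0 : R) by rewrite I01 lexx ler01.
have in1 : `[0, 1]%classic (1 : R) by rewrite I01 lexx ler01.
have phi1 : phi 1 = pi.
  have /andP[p0 p1] := phiI 1 in1.
  have c1 : cos (phi 1) = -1 by rewrite cosphi.
  have s1 : sin (phi 1) = 0 by apply: cos1sin0; rewrite c1 normrN1.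
  apply/eqP/negPn/negP => np.
  have [p00|p00] := eqVneq (phi 1) 0; first by move: c1; rewrite p00 cos0; lra.
  have : 0 < sin (phi 1) by apply: sin_gt0_pi; rewrite lt0r p00 p0 lt_neqAle np.
  by rewrite s1 ltxx.
split.
  exists (fun s => th (s, s)).
    split=> s; rewrite I01 => sI; last by apply: (cth (fun t => (t, t))).
    have /= := pth s s; case/andP: (sI) => s0 s1 /(_ s0 (lexx _) s1).
    by rewrite /g /= eqxx; apply: polar_nu.
  have l1 : lift_on `[0, 1] (fun s => g (s, 1)) (fun s => th (s, 1)).
    split=> s; rewrite I01 => sI; last first.
      by apply: (cth (fun t => (t, 1))) => //=; rewrite lexx ler01.
    by case/andP: sI => s0 s1; apply: pth.
  (* The secants on the side t = 1 of the triangle are opposite to those on the side s = 0, so the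
     angle grows by pi on each of them. *)
  have l2 : lift_on `[0, 1] (fun s => g (s, 1)) (fun s => th (0, s) + pi).
    split=> s; rewrite I01 => sI; last first.
      apply: cvgD; last exact: cvg_cst.
      by apply: (cth (fun t => (0, t))) => //=; rewrite lexx ler01.
    have -> : g (s, 1) = opp2 (g (0, s)).
      case: (ends s sI) => [->|->|/andP[s0 s1]].
      - by rewrite g00 g01 /opp2 oppr0.
      - by rewrite g01 /g /= eqxx Tp nuT0 /opp2 opprK oppr0.
      - rewrite g0s // /g /= (lt_eqF s1) (gt_eqF s0) /= -nu_opp; congr nu.
        by rewrite cp /opp2 /sub2 /= !opprB.
    by apply: polar_opp; case/andP: sI => s0 s1; apply: pth.
  have := lift_unique ler01 l1 l2; move: phi1; rewrite /phi; lra.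
(* Where the curve is vertically above its lowest point, [q] is the distance from that point;
   everywhere it is positive. Its minimum thus keeps the new centre below all such points of the
   curve. *)
pose q s := (sub2 (c s) (c 0)).2 + `|cos (phi s)|.
have polc s : 0 < s -> s < 1 -> polar (sub2 (c s) (c 0)) (phi s).
  move=> s0 s1; apply: polar_nu.
    by apply: sub2_neq0; apply: nesym; apply: injc; lra.
  have [r r0 E] := pth 0 s (lexx _) (ltW s0) (ltW s1).
  by exists r => //; rewrite -g0s // E cosphi sinphi.
have q0 s : `[0, 1]%classic s -> 0 < q s.
  rewrite I01 => sI; rewrite /q.
  have [c0|c0] := eqVneq (cos (phi s)) 0; last first.
    by rewrite ltr_wpDl ?normr_gt0 // subr_ge0; exact: bottom.
  case: (ends s sI) => [s0|s1|/andP[s0 s1]].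
  - by move: c0; rewrite cosphi s0; case: E00 => -> _ /eqP; rewrite oner_eq0.
  - by move: c0; rewrite cosphi s1 E01 => /eqP; rewrite oppr_eq0 oner_eq0.
  - have [r r0 ->] := polc s s0 s1; rewrite ltr_wpDr //= mulr_gt0 //.
    have /phiI/andP[p0 p1] : `[0, 1]%classic s by rewrite I01.
    have : sin (phi s) != 0 by apply: contra_eqN (cos2Dsin2 (phi s)) => /eqP ->;
      rewrite c0 expr0n /= addr0 eq_sym oner_eq0.
    by move=> n0; rewrite lt0r n0 sin_ge0_pi // p0 p1.
have [x xI xmin] : exists2 x, x \in `[0, 1]%R & forall t, t \in `[0, 1]%R -> q x <= q t.
  apply: EVT_min => //; apply: continuous_in_subspaceT => s /set_mem sI.
  apply: cvgD; last first.
    apply: (@cvg_norm _ R^o).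
    by apply: (continuous_comp (cphi s sI)); exact: continuous_cos.
  apply: cvgB; last exact: cvg_cst.
  exact: (cont_comp2 (@cont_snd _ _) cc).
have xI' : `[0, 1]%classic x by [].
exists (q x); first exact: q0.
move=> e e0 eq; pose f s := sub2 (c s) ((c 0).1, (c 0).2 + e).
(* The circle of radius e around the new centre touches the horizontal at [c 0]. By the inscribed
   angle theorem, its point seen from [c 0] under the angle phi has the central angle 2 phi - pi/2.
   The curve is compared with this circle, whose equation r = 2 e sin phi reappears below in the
   critical case. *)
pose m s := expi (2 * phi s - pi / 2).
have mE s : m s = (sin (2 * phi s), - cos (2 * phi s)).
  rewrite /m /expi cosB sinB cos_pihalf sin_pihalf.
  by rewrite !mulr0 !mulr1 add0r sub0r.
have slit_fm s : `[0, 1]%classic s -> slit (cmul (f s) (cconj (m s))).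
  move=> sI; set C := cos (phi s); set S := sin (phi s).
  have CS : S ^+ 2 = 1 - C ^+ 2.
    by have := cos2Dsin2 (phi s); rewrite -/C -/S => <-; ring.
  have S0 : 0 <= S by exact/sin_ge0_pi/phiI.
  have [r [r0 wE rC]] : exists r, [/\ 0 <= r,
      sub2 (c s) (c 0) = (r * C, r * S) & C = 0 -> e < r].
    move: (sI); rewrite I01 => /ends[s0|s1|/andP[s0 s1]].
    - exists 0; split=> //; first by rewrite s0 !mul0r /sub2 !subrr.
      by rewrite /C cosphi s0; case: E00 => -> _ /eqP; rewrite oner_eq0.
    - exists 0; split=> //; first by rewrite s1 !mul0r cp /sub2 !subrr.
      by rewrite /C cosphi s1 E01 => /eqP; rewrite oppr_eq0 oner_eq0.
    - have [r r0 wE] := polc s s0 s1; exists r; split=> //; first exact: ltW.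
      move=> C0; have := xmin s sI; rewrite {2}/q wE /= -/C -/S C0 normr0 addr0.
      have : S ^+ 2 = 1 by rewrite CS C0; ring.
      by move=> /eqP; rewrite sqrf_eq1 => /orP[|]/eqP SE; rewrite ?SE; lra.
  have fE : f s = (r * C, r * S - e).
    have := wE; rewrite /f /sub2 /= => -[-> <-]; congr pair; ring.
  have -> : cmul (f s) (cconj (m s)) =
      (r * S + e * (1 - 2 * S ^+ 2), C * (r - 2 * e * S)).
    rewrite fE mE /cmul /cconj /= mulr_natl mulr2n cosD sinD -/C -/S.
    by congr pair; ring: CS.
  rewrite /slit /= mulf_eq0 negb_or.
  have [C0|C0] := eqVneq C 0.
    right; have re := rC C0; have S1 : S = 1.
      have : S ^+ 2 = 1 by rewrite CS C0; ring.
      by move=> /eqP; rewrite sqrf_eq1 => /orP[|]/eqP SE; rewrite ?SE; lra.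
    by rewrite S1; lra.
  have [rS|rS] := eqVneq (r - 2 * e * S) 0; last by left.
  right; have -> : r = 2 * e * S by apply/eqP; rewrite -subr_eq0 rS.
  by have -> : 2 * e * S * S + e * (1 - 2 * S ^+ 2) = e by ring.
exists (fun s => 2 * phi s - pi / 2 + Arg (cmul (f s) (cconj (m s)))).
  split=> s sI; first by apply: polar_ratio; [exact: polar_expi|exact: slit_fm].
  have cp2 : {for s, continuous (fun s => 2 * phi s - pi / 2)}.
    by apply: cvgB; [apply: cvgM; [exact: cvg_cst|exact: cphi]|exact: cvg_cst].
  apply: cvgD; first exact: cp2.
  apply: (@Arg_continuous _ _ (fun s => cmul (f s) (cconj (m s)))); last exact: slit_fm.
  have cf : continuous f.
    have c1 := cont_comp2 (@cont_fst _ _) cc; have c2 := cont_comp2 (@cont_snd _ _) cc.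
    by rewrite /f /sub2; apply: cont_pair; contR.
  have cm1 : {for s, continuous (fun s => (m s).1)}.
    by apply: (continuous_comp cp2); exact: continuous_cos.
  have cm2 : {for s, continuous (fun s => (m s).2)}.
    by apply: (continuous_comp cp2); exact: continuous_sin.
  have cf1 := cont_comp2 (@cont_fst _ _) cf; have cf2 := cont_comp2 (@cont_snd _ _) cf.
  have cm2' := cvgN cm2.
  have h1 : {for s, continuous (fun s => (f s).1 * (m s).1 - (f s).2 * - (m s).2)}.
    by apply: cvgB; apply: cvgM; [exact: cf1|exact: cm1|exact: cf2|exact: cm2'].
  have h2 : {for s, continuous (fun s => (f s).1 * - (m s).2 + (f s).2 * (m s).1)}.
    by apply: cvgD; apply: cvgM; [exact: cf1|exact: cm2'|exact: cf2|exact: cm1].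
  exact: (cvg_pair h1 h2).
have f01 : f 1 = f 0 by rewrite /f cp.
have m01 : m 1 = m 0.
  by rewrite !mE phi1 /phi subrr mulr0 mulr_natl cos2pi sin2pi cos0 sin0.
by rewrite f01 m01 phi1 {1}/phi subrr; lra.
Qed.

End Loop.
End Umlaufsatz.

(** * Winding numbers and their dependence on the centre *)

Section Winding.
Variable R : realType.
Local Notation P := (R * R)%type.

Lemma cont_opp2 (T : topologicalType) (f : T -> P) :
  continuous f -> continuous (fun x => opp2 (f x)).
Proof.
move=> cf; have c1 := cont_comp2 (@cont_fst _ _) cf.
have c2 := cont_comp2 (@cont_snd _ _) cf.
by apply: cont_pair; contR.
Qed.

Lemma cont_sub2 (T : topologicalType) (f g : T -> P) :
  continuous f -> continuous g -> continuous (fun x => sub2 (f x) (g x)).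
Proof.
move=> cf cg; have c1 := cont_comp2 (@cont_fst _ _) cf.
have c2 := cont_comp2 (@cont_snd _ _) cf.
have d1 := cont_comp2 (@cont_fst _ _) cg; have d2 := cont_comp2 (@cont_snd _ _) cg.
by apply: cont_pair; contR.
Qed.

Lemma itv01 (s : R) : `[0, 1]%classic s = (0 <= s <= 1).
Proof. by rewrite /= in_itv. Qed.

Lemma lift_reverse (f : R -> P) th : lift_on `[0, 1] f th ->
  lift_on `[0, 1] (fun s => f (1 - s)) (fun s => th (1 - s)).
Proof.
move=> [p ct]; split=> s; rewrite itv01 => s01.
  by apply: p; rewrite itv01; lra.
apply: (@continuous_comp R R R (fun s : R => 1 - s) th).
  by apply: cvgB; [exact: cvg_cst|exact: cvg_id].
by apply: ct; rewrite itv01; lra.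
Qed.

Lemma eq_lift (f g : R -> P) th : (forall s, f s = g s) ->
  lift_on `[0, 1] f th -> lift_on `[0, 1] g th.
Proof. by move=> /funext ->. Qed.

(** If the tangent at the lowest point goes to the left, the reversed curve is used. The angle [k]
    is 2 pi or -2 pi accordingly; what is kept is that it is nonzero and common to the tangent and
    to the vectors from centres slightly above the lowest point. *)
Lemma rotation_index (c T : R -> P) :
  continuous c -> continuous T ->
  (forall s, c (s + 1) = c s) -> (forall s, T (s + 1) = T s) ->
  (forall s, T s != 0) -> (forall s t, s < t -> t < s + 1 -> c s <> c t) ->
  has_direction c T -> (forall s, (c 0).2 <= (c s).2) ->
  exists2 k : R, k != 0 &
  (exists2 thT, lift_on `[0, 1] T thT & thT 1 - thT 0 = k) /\
  exists2 e0, 0 < e0 & forall e, 0 < e -> e < e0 ->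
    exists2 th, lift_on `[0, 1] (fun s => sub2 (c s) ((c 0).1, (c 0).2 + e)) th &
      th 1 - th 0 = k.
Proof.
move=> cc cT pc pT T0 injc dir bottom; have pi0 := pi_gt0 R.
have T2 := bottom_horizontal dir bottom.
have : (T 0).1 != 0.
  by apply: contra (T0 0) => /eqP T1; apply/eqP; rewrite [LHS]surjective_pairing T1 T2.
rewrite neq_lt => /orP[T1|T1]; last first.
  by exists (2 * pi); [rewrite mulf_neq0 ?gt_eqF|exact: rotation_index_pos].
pose c' s := c (- s); pose T' s := opp2 (T (- s)).
have pc' s : c' (s + 1) = c' s by rewrite /c' opprD -(pc (- s - 1)) subrK.
have pT' s : T' (s + 1) = T' s by rewrite /T' opprD -(pT (- s - 1)) subrK.
have cN : continuous (fun s : R => - s) by apply: contN; exact: cont_id.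
have [|||||||||[thT lT kT] [e0 e00 He]] := @rotation_index_pos R c' T'.
- exact: cont_comp2 cc cN.
- by apply: cont_opp2; exact: cont_comp2 cT cN.
- exact: pc'.
- exact: pT'.
- move=> s; apply: contra (T0 (- s)) => /eqP[/eqP + /eqP]; rewrite !oppr_eq0.
  by case: (T (- s)) => a b /= /eqP -> /eqP ->.
- by move=> s t st ts; apply: nesym; apply: injc; lra.
- move=> s0 e e1; have [d d0 dP] := dir (- s0) e e1; exists d => // s t h1 h2 h3.
  have [k k0 [k1 k2]] : near_direction (sub2 (c (- s)) (c (- t))) (T (- s0)) e.
    by apply: dP; lra.
  exists k => //; rewrite /c' /T' /sub2 /opp2 /=.
  by split; rewrite mulrN -normrN opprD !opprK opprB ?addrA -?opprD //; move: k1 k2.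
- by move=> s; rewrite /c' oppr0; exact: bottom.
- by rewrite /T' oppr0 /= oppr_gt0.
exists (- (2 * pi)); first by rewrite oppr_eq0 mulf_neq0 ?gt_eqF.
split.
  exists (fun s => thT (1 - s) + pi); last by rewrite subrr subr0; lra.
  have [p ct] := lift_reverse lT; split=> s sI.
    have <- : opp2 (T' (1 - s)) = T s.
      by rewrite /T' opprB -(pT (s - 1)) subrK /opp2 /= !opprK -surjective_pairing.
    exact: polar_opp (p s sI).
  by apply: cvgD; [exact: ct|exact: cvg_cst].
exists e0 => // e e1 e2; have [th l k] := He e e1 e2.
exists (fun s => th (1 - s)); last by rewrite subrr subr0; lra.
apply: eq_lift (lift_reverse l) => s /=.
by rewrite /c' oppr0 opprB -(pc (s - 1)) subrK.
Qed.

Definition unwound (c : R -> P) (w : P) : Prop :=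
  exists2 th, lift_on `[0, 1] (fun s => sub2 (c s) w) th & th 1 = th 0.

Lemma unwound_not (c : R -> P) w th k :
  lift_on `[0, 1] (fun s => sub2 (c s) w) th -> th 1 - th 0 = k -> k != 0 ->
  ~ unwound c w.
Proof.
move=> l kE k0 [th' l' p]; have := lift_unique ler01 l l'.
by rewrite p subrr kE => /eqP; rewrite (negbTE k0).
Qed.

Lemma unwound_ratio (c : R -> P) (f m : R -> P) th : continuous f -> continuous m ->
  f 1 = f 0 -> m 1 = m 0 -> lift_on `[0, 1] m th -> th 1 = th 0 ->
  (forall s, `[0, 1]%classic s -> slit (cmul (f s) (cconj (m s)))) ->
  exists2 th', lift_on `[0, 1] f th' & th' 1 = th' 0.
Proof.
move=> cf cm f1 m1 [p ct] th1 sl.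
exists (fun s => th s + Arg (cmul (f s) (cconj (m s)))); last by rewrite th1 f1 m1.
split=> s sI; first by apply: polar_ratio; [exact: p|exact: sl].
apply: cvgD; first exact: ct.
apply: (@Arg_continuous _ _ (fun s => cmul (f s) (cconj (m s)))); last exact: sl.
by apply: cont_cmul => //; exact: cont_cconj.
Qed.

(** Seen from a far point [w], all vectors to the curve have a positive product with [- w], so their
    argument is compared with a constant one. *)
Lemma unwound_far (c : R -> P) : continuous c -> c 1 = c 0 ->
  exists M, forall w, M < sqn w -> unwound c w.
Proof.
move=> cc c1.
have cn : continuous (fun s => sqn (c s)).
  have d1 := cont_comp2 (@cont_fst _ _) cc; have d2 := cont_comp2 (@cont_snd _ _) cc.
  by rewrite /sqn; contR.
have [|x xI xmax] := @EVT_max R (fun s => sqn (c s)) 0 1 ler01.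
  exact: continuous_subspaceT.
exists (sqn (c x)) => w Mw.
have w0 : opp2 w != 0.
  have : w != 0 by rewrite -sqn_gt0; apply: le_lt_trans Mw; exact: sqn_ge0.
  by apply: contra => /eqP[/eqP + /eqP]; case: (w) => a b /=;
    rewrite !oppr_eq0 => /eqP -> /eqP ->.
have [t pt] := polar_ex w0.
apply: (@unwound_ratio c _ (fun=> opp2 w) (fun=> t)) => //.
- by apply: cont_sub2 => //; exact: cont_cst.
- exact: cont_cst.
- by rewrite c1.
- by split=> s _ //; exact: cvg_cst.
move=> s sI; right; rewrite /cmul /cconj /sub2 /opp2 /=.
have := xmax s sI; move: Mw; rewrite /sqn /= => Mw Ms.
by have := sqr_ge0 ((c s).1 - w.1); have := sqr_ge0 ((c s).2 - w.2); nra.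
Qed.

(** Moving the centre by little compared with its distance from the curve multiplies each vector by
    a number of positive real part. *)
Lemma unwound_local (c : R -> P) w : continuous c -> c 1 = c 0 ->
  (forall s, `[0, 1]%classic s -> c s <> w) ->
  exists2 r, 0 < r & forall w1 w2, ball w r w1 -> ball w r w2 ->
    unwound c w1 -> unwound c w2.
Proof.
move=> cc c1 cw.
have cn : continuous (fun s => sqn (sub2 (c s) w)).
  have d1 := cont_comp2 (@cont_fst _ _) cc; have d2 := cont_comp2 (@cont_snd _ _) cc.
  by rewrite /sqn /sub2 /=; contR.
have [|x xI xmin] := @EVT_min R (fun s => sqn (sub2 (c s) w)) 0 1 ler01.
  exact: continuous_subspaceT.
set mu := sqn (sub2 (c x) w) in xmin.
have mu0 : 0 < mu.
  rewrite sqn_gt0; apply/eqP => -[/subr0_eq e1 /subr0_eq e2].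
  by apply: (cw x xI); case: (c x) w e1 e2 {cw cn xmin mu} => a b [a' b'] /= -> ->.
(* Because r is at most 1, the square of each coordinate of a displacement is at most mu / 32, which
   the quadratic estimate at the end absorbs. *)
pose r := Num.min 1 (mu / 32).
have r0 : 0 < r by rewrite lt_min ltr01 divr_gt0.
exists r => // w1 w2 [b11 b12] [b21 b22] [th l p].
have small (a b : R) : ball a r b -> (a - b) ^+ 2 <= mu / 32.
  rewrite /ball /= lt_min => /andP[h1 h2].
  have <- : `|a - b| ^+ 2 = (a - b) ^+ 2 by rewrite real_normK ?num_real.
  rewrite expr2; apply: le_trans (_ : `|a - b| * 1 <= _).
    by apply: ler_wpM2l => //; exact: ltW.
  by rewrite mulr1 ltW.
apply: (unwound_ratio c _ _ _ _ l p).
- by apply: cont_sub2 => //; exact: cont_cst.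
- by apply: cont_sub2 => //; exact: cont_cst.
- by rewrite c1.
- by rewrite c1.
move=> s sI; right; rewrite /cmul /cconj /sub2 /=.
have := xmin s sI; rewrite -/mu /sqn /sub2 /= => mus.
have := small _ _ b11; have := small _ _ b12; have := small _ _ b21.
have := small _ _ b22.
set a1 := (c s).1 - w.1 in mus *; set a2 := (c s).2 - w.2 in mus *.
set u1 := w.1 - w1.1; set u2 := w.2 - w1.2; set v1 := w.1 - w2.1; set v2 := w.2 - w2.2.
have -> : (c s).1 - w2.1 = a1 + v1 by rewrite /a1 /v1; ring.
have -> : (c s).2 - w2.2 = a2 + v2 by rewrite /a2 /v2; ring.
have -> : (c s).1 - w1.1 = a1 + u1 by rewrite /a1 /u1; ring.
have -> : (c s).2 - w1.2 = a2 + u2 by rewrite /a2 /u2; ring.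
move: a1 a2 u1 u2 v1 v2 mus => a1 a2 u1 u2 v1 v2 mus h1 h2 h3 h4.
have := sqr_ge0 (a1 / 2 + u1); have := sqr_ge0 (a2 / 2 + u2).
have := sqr_ge0 (a1 / 2 + v1); have := sqr_ge0 (a2 / 2 + v2).
have := sqr_ge0 (u1 + v1); have := sqr_ge0 (u2 + v2).
rewrite !sqrrD !exprMn; lra.
Qed.

Lemma connected_local_const (T : topologicalType) (Y : set T) (Q : T -> Prop) :
  connected Y ->
  (forall x, Y x -> exists2 U, nbhs x U & forall y z, U y -> Y y -> U z -> Y z -> Q y -> Q z) ->
  forall x y, Y x -> Y y -> Q x -> Q y.
Proof.
move=> cY loc x y Yx Yy Qx.
pose B := Y `&` [set z | Q z].
suff BY : B = Y by have : B y by [rewrite BY]; case.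
apply: cY; first by exists x.
  exists [set z | exists U : set T, [/\ open U, U z & forall t, U t -> Y t -> Q t]].
    rewrite openE => z [U [oU Uz UQ]]; rewrite /interior.
    have : nbhs z U by apply: open_nbhs_nbhs; split=> //; rewrite openE.
    by apply: filterS => t Ut; exists U.
  apply/seteqP; split=> z [Yz Qz]; split=> //; last by have [U [_ Uz]] := Qz; apply.
  have [U] := loc z Yz; rewrite nbhsE => -[W [oW Wz] WU] UQ.
  exists W; split=> // t Wt Yt; apply: (UQ z t) => //; exact: WU.
exists (~` [set z | exists U : set T, [/\ open U, U z & forall t, U t -> Y t -> ~ Q t]]).
  apply: open_closedC; rewrite openE => z [U [oU Uz UQ]]; rewrite /interior.
  have : nbhs z U by apply: open_nbhs_nbhs; split=> //; rewrite openE.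
    by apply: filterS => t Ut; exists U.
apply/seteqP; split=> z [Yz Qz]; split=> //.
  by move=> [U [_ Uz]] /(_ z Uz Yz).
apply: contrapT => nQ; apply: Qz; have [U] := loc z Yz.
rewrite nbhsE => -[W [oW Wz] WU] UQ; exists W; split=> // t Wt Yt Qt.
by apply: nQ; apply: (UQ t z) => //; exact: WU.
Qed.

End Winding.

(** * Model maps and their degrees *)

Section Model.
Variable R : realType.
Local Notation V := 'rV[R]_3.

Definition refl (u x : V) : V := x - (2 * dot u x / dot u u) *: u.

Lemma dot_gt0 (u : V) : (0 < dot u u) = (u != 0).
Proof.
rewrite lt0r dot_ge0 andbT; congr negb; apply/eqP/eqP => [|->].
  rewrite dotE => u0; apply: crdE; rewrite crd_0; nra.
by rewrite dotE !crd_0 !mul0r !addr0.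
Qed.

Lemma dotC (x y : V) : dot x y = dot y x.
Proof. by rewrite !dotE; ring. Qed.

Lemma dotDr (x y z : V) : dot x (y + z) = dot x y + dot x z.
Proof. by rewrite !dotE !crdL; ring. Qed.

Lemma dotZr a (x y : V) : dot x (a *: y) = a * dot x y.
Proof. by rewrite !dotE !crdL; ring. Qed.

Lemma dotNr (x y : V) : dot x (- y) = - dot x y.
Proof. by rewrite !dotE !crdL; ring. Qed.

Lemma dotDl (x y z : V) : dot (x + y) z = dot x z + dot y z.
Proof. by rewrite !dotE !crdL; ring. Qed.

Lemma dotZl a (x y : V) : dot (a *: x) y = a * dot x y.
Proof. by rewrite !dotE !crdL; ring. Qed.

Lemma dotNl (x y : V) : dot (- x) y = - dot x y.
Proof. by rewrite !dotE !crdL; ring. Qed.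

Lemma refl_dot u x y : u != 0 -> dot (refl u x) (refl u y) = dot x y.
Proof.
rewrite -dot_gt0 /refl => u0; have un : dot u u != 0 by rewrite gt_eqF.
rewrite !(dotDr, dotNr, dotZr, dotDl, dotNl, dotZl) (dotC x u).
by field.
Qed.

Lemma reflK u x : u != 0 -> refl u (refl u x) = x.
Proof.
rewrite -dot_gt0 => u0; have un : dot u u != 0 by rewrite gt_eqF.
rewrite /refl dotDr dotNr dotZr -addrA -opprD -scalerDl.
have -> : 2 * dot u x / dot u u + 2 * (dot u x - 2 * dot u x / dot u u * dot u u) / dot u u = 0.
  by field.
by rewrite scale0r subr0.
Qed.

Lemma refl_neq0 u x : u != 0 -> x != 0 -> refl u x != 0.
Proof. by move=> u0; rewrite -!dot_gt0 refl_dot. Qed.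

Lemma reflD u x y : refl u (x + y) = refl u x + refl u y.
Proof.
rewrite /refl dotDr mulrDr mulrDl scalerDl opprD addrACA //.
Qed.

Lemma reflZ u a x : refl u (a *: x) = a *: refl u x.
Proof. by rewrite /refl dotZr scalerBr scalerA; congr (_ - _ *: _); ring. Qed.

Lemma refl0 u : refl u 0 = 0.
Proof. by have := reflZ u 0 0; rewrite !scale0r. Qed.

Lemma cont_dot (T : topologicalType) (f g : T -> V) :
  continuous f -> continuous g -> continuous (fun x => dot (f x) (g x)).
Proof.
move=> cf cg; have -> : (fun x => dot (f x) (g x)) = (fun x => crd 0 (f x) * crd 0 (g x)
    + crd 1 (f x) * crd 1 (g x) + crd 2 (f x) * crd 2 (g x)).
  by apply/funext => x; rewrite dotE.
by contR.
Qed.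

Lemma cont_refl (T : topologicalType) (u f : T -> V) : (forall x, u x != 0) ->
  continuous u -> continuous f -> continuous (fun x => refl (u x) (f x)).
Proof.
move=> u0 cu cf; apply: cont_vD => //; apply: cont_vN; apply: cont_vZ => //.
apply: contM; first by apply: contM; [exact: cont_cst|exact: cont_dot].
by apply: contV; [move=> x; rewrite gt_eqF // dot_gt0|exact: cont_dot].
Qed.

Definition e3 : V := vec3 0 0 1.

(** The reflection in this vector takes [e3] to the point of longitude 2 pi s whose stereographic
    projection is d / (1 - d) times the unit vector of that angle. The vector turns from the
    vertical at d = 0 to the horizontal at d = 1. The same reflection serves as an orthonormal frame
    at the point. *)
Definition mirror (s d : R) : V :=
  vec3 (d * cos (2 * pi * s)) (d * sin (2 * pi * s)) (d - 1).

Lemma mirror_dot s d : dot (mirror s d) (mirror s d) = d ^+ 2 + (1 - d) ^+ 2.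
Proof.
rewrite dotE !crdv.
have := cos2Dsin2 (2 * pi * s); set c := cos _; set t := sin _ => ct.
transitivity (d ^+ 2 * (c ^+ 2 + t ^+ 2) + (1 - d) ^+ 2); first by ring.
by rewrite ct mulr1.
Qed.

Lemma mirror_neq0 s d : mirror s d != 0.
Proof. by rewrite -dot_gt0 mirror_dot; nra. Qed.

Lemma mirror_cont : continuous (uncurry2 mirror).
Proof. by rewrite /uncurry2 /mirror; contV. Qed.

Lemma cosD1 s : cos (2 * pi * (s + 1)) = cos (2 * pi * s) :> R.
Proof. by rewrite mulrDr mulr1 mulr_natl cosD2pi. Qed.

Lemma sinD1 s : sin (2 * pi * (s + 1)) = sin (2 * pi * s) :> R.
Proof. by rewrite mulrDr mulr1 mulr_natl sinD2pi. Qed.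

Lemma mirror_period s d : mirror (s + 1) d = mirror s d.
Proof. by rewrite /mirror cosD1 sinD1. Qed.

Definition sph0 (s d : R) : V := refl (mirror s d) e3.

Lemma crd2_refl3 s d : crd 2 (sph0 s d) * (d ^+ 2 + (1 - d) ^+ 2) = 2 * d - 1.
Proof.
rewrite /sph0 /refl !crdL mirror_dot dotE !crdv.
have n0 : d ^+ 2 + (1 - d) ^+ 2 != 0 by rewrite gt_eqF //; nra.
by field.
Qed.

Lemma crd1_refl3 s d : crd 1 (sph0 s d) * (d ^+ 2 + (1 - d) ^+ 2)
  = 2 * (d * (1 - d)) * sin (2 * pi * s).
Proof.
rewrite /sph0 /refl !crdL mirror_dot dotE !crdv.
have n0 : d ^+ 2 + (1 - d) ^+ 2 != 0 by rewrite gt_eqF //; nra.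
by field.
Qed.

Lemma crd0_refl3 s d : crd 0 (sph0 s d) * (d ^+ 2 + (1 - d) ^+ 2)
  = 2 * (d * (1 - d)) * cos (2 * pi * s).
Proof.
rewrite /sph0 /refl !crdL mirror_dot dotE !crdv.
have n0 : d ^+ 2 + (1 - d) ^+ 2 != 0 by rewrite gt_eqF //; nra.
by field.
Qed.

Lemma mirror_south s : mirror s 0 = vec3 0 0 (-1).
Proof. by rewrite /mirror !mul0r sub0r. Qed.

Lemma sph0_north s : sph0 s 1 = e3.
Proof.
by rewrite /sph0 /refl (_ : dot (mirror s 1) e3 = 0) ?mulr0 ?mul0r ?scale0r ?subr0 //
  dotE !crdv subrr !mulr0 mul0r !addr0.
Qed.

Lemma sph0_map : sphere_map sph0.
Proof.
split.
- apply: cont_refl; [move=> x; exact: mirror_neq0|exact: mirror_cont|exact: cont_cst].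
- move=> s d; rewrite refl_dot ?mirror_neq0 // dotE !crdv.
  by rewrite !mul0r !add0r mulr1.
- by move=> s d; rewrite /sph0 mirror_period.
- by move=> s s'; rewrite /sph0 !mirror_south.
- by move=> s s'; rewrite !sph0_north.
Qed.

Lemma refl_map (v : V) S : v != 0 -> sphere_map S -> sphere_map (fun s d => refl v (S s d)).
Proof.
move=> v0 [cS uS pS sS nS]; split.
- by apply: cont_refl => //; exact: cont_cst.
- by move=> s d; rewrite refl_dot.
- by move=> s d; rewrite pS.
- by move=> s s'; rewrite (sS s s').
- by move=> s s'; rewrite (nS s s').
Qed.

Lemma neg_pmul (a x : R) : 0 < a -> neg (x * a) = neg x.
Proof. by move=> a0; rewrite /neg pmulr_llt0. Qed.

(** The number of turns of eps exp(2 pi i n s) around 0, found from the crossings of the negative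
    real half-axis on the grid. *)
Definition turns (N n : nat) (eps : R) : int := \sum_(i < N)
  (neg (eps * sin (2 * pi * n%:R * (i.+1%:R / N%:R)))
   - neg (eps * sin (2 * pi * n%:R * (i%:R / N%:R))))
  * neg (eps * cos (2 * pi * n%:R * (i.+1%:R / N%:R))).

(** The changes of sign of [h] and the turns in the longitude separate. The factor [rho] may vanish
    at d = 1, which is the upper side of the last row of squares; the last hypothesis says that [h]
    does not change sign in that row. *)
Lemma deg3_model N n eps (f : R -> R -> V) (rho h : R -> R) : (1 < N)%N ->
  (forall d, 0 < d -> d < 1 -> 0 < rho d) ->
  (forall s d, crd 0 (f s d) = rho d * (eps * cos (2 * pi * n%:R * s))) ->
  (forall s d, crd 1 (f s d) = rho d * (eps * sin (2 * pi * n%:R * s))) ->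
  (forall s d, crd 2 (f s d) = h d) ->
  neg (h (N.-1%:R / N%:R)) = neg (h 1) ->
  deg3 N f = - (neg (h 1) - neg (h 0)) * turns N n eps.
Proof.
move=> N1 rho0 f0 f1 f2 h1; rewrite /deg3 /deg2 exchange_big /=.
have N0 : (N%:R : R) != 0 by rewrite pnatr_eq0; lia.
have NN : (N%:R / N%:R : R) = 1 by rewrite divff.
pose a (j : nat) := neg (h (j%:R / N%:R)).
transitivity (- \sum_(j < N) (a j.+1 - a j) * turns N n eps); last first.
  rewrite -mulr_suml -(big_mkord xpredT (fun j => a j.+1 - a j)) telescope_sumr //.
  by rewrite /a NN mul0r mulNr.
rewrite -sumrN; apply: eq_bigr => j _.
transitivity (- \sum_(i < N) (a j.+1 - a j) *
    ((neg (crd 1 (f (i.+1%:R / N%:R) (j.+1%:R / N%:R)))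
      - neg (crd 1 (f (i%:R / N%:R) (j.+1%:R / N%:R))))
     * neg (crd 0 (f (i.+1%:R / N%:R) (j.+1%:R / N%:R))))).
  rewrite -sumrN; apply: eq_bigr => i _; rewrite !f2 -/(a j.+1) -/(a j).
  by ring.
rewrite -mulr_sumr; have [jN|jN] := ltnP j.+1 N; last first.
  have -> : a j.+1 = a j.
    have -> : j = N.-1 :> nat by have := ltn_ord j; lia.
    by rewrite /a h1 prednK ?NN //; lia.
  by rewrite subrr !mul0r.
have r0 : 0 < rho (j.+1%:R / N%:R).
  apply: rho0; first by rewrite divr_gt0 // ltr0n; lia.
  by rewrite ltr_pdivrMr ?ltr0n ?mul1r ?ltr_nat //; lia.
congr (- (_ * _)); apply: eq_bigr => i _.
by rewrite !f0 !f1 !(mulrC (rho _)) !(neg_pmul _ r0).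
Qed.

Lemma sum_period n p (F : nat -> int) : (forall i, F (i + p)%N = F i) ->
  \sum_(i < n * p) F i = n%:Z * \sum_(i < p) F i.
Proof.
move=> Fp; have Fkp k i : F (i + k * p)%N = F i.
  by elim: k => [|k IH]; rewrite ?addn0 // mulSn (addnC p) addnA Fp.
elim: n => [|n IH]; first by rewrite mul0n big_ord0 mul0r.
rewrite mulSn addnC big_split_ord /= IH intS mulrDl mul1r addrC; congr (_ + _).
by apply: eq_bigr => i _; rewrite addnC Fkp.
Qed.

(** As 4 n divides N, the zeros of the sine are grid points, where it counts as positive. In a
    period of 4 M steps its sign bit changes twice, and [eps] times the cosine is negative at the
    end of just one of these steps. *)
Lemma turnsE N n M (eps : R) : (1 < M)%N -> (0 < n)%N -> N = (n * (4 * M))%N ->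
  eps = 1 \/ eps = -1 -> turns N n eps = n%:Z.
Proof.
move=> M1 n0 NE epsE; pose p := (4 * M)%N.
have pi0 := pi_gt0 R.
have p0 : (p%:R : R) != 0 by rewrite pnatr_eq0 /p; lia.
pose ang (i : nat) : R := 2 * pi * (i%:R / p%:R).
have angE i : 2 * pi * n%:R * (i%:R / N%:R) = ang i.
  have n1 : (n%:R : R) != 0 by rewrite pnatr_eq0; lia.
  by rewrite /ang NE natrM -/p; field; rewrite p0.
pose b i := neg (eps * sin (ang i)); pose e i := neg (eps * cos (ang i)).
have -> : turns N n eps = \sum_(i < n * p) (b i.+1 - b i) * e i.+1.
  transitivity (\sum_(i < N) (b i.+1 - b i) * e i.+1); last by rewrite NE.
  by apply: eq_bigr => i _; rewrite !angE.
have angp i : ang (i + p)%N = ang i + pi *+ 2.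
  have -> : pi *+ 2 = 2 * pi * (p%:R / p%:R) :> R by rewrite divff // mulr1 mulr_natl.
  by rewrite /ang [(i + p)%:R]natrD -mulrDr -[X in _ = _ * X]mulrDl.
have bp i : b (i + p)%N = b i by rewrite /b angp sinD2pi.
have ep i : e (i + p)%N = e i by rewrite /e angp cosD2pi.
rewrite (@sum_period n p (fun i => (b i.+1 - b i) * e i.+1)); last first.
  by move=> i; rewrite -addSn !bp ep.
suff -> : \sum_(i < p) (b i.+1 - b i) * e i.+1 = 1 by rewrite mulr1.
have angM i : ang i = pi * (i%:R / (2 * M)%:R).
  have m0 : ((2 * M)%:R : R) != 0 by rewrite pnatr_eq0; lia.
  have pE : (p%:R : R) = 2 * (2 * M)%:R by rewrite -natrM; congr (_%:R); rewrite /p; lia.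
  rewrite /ang pE; by move: ((2 * M)%:R : R) m0 => q q0; field.
have m0 : 0 < ((2 * M)%:R : R) by rewrite ltr0n; lia.
have lt_ang i : (i < 2 * M)%N -> (0 < i)%N -> 0 < ang i < pi.
  move=> iM i0; rewrite angM; apply/andP; split.
    by rewrite mulr_gt0 // divr_gt0 // ltr0n.
  rewrite -[ltRHS]mulr1 ltr_pM2l // ltr_pdivrMr // mul1r ltr_nat //.
have s_lo i : (i < 2 * M)%N -> (0 < i)%N -> 0 < sin (ang i).
  by move=> iM i0; apply: sin_gt0_pi; exact: lt_ang.
have ang0 : ang 0 = 0 by rewrite /ang !mul0r mulr0.
have angh : ang (2 * M) = pi by rewrite angM divff ?mulr1 // gt_eqF.
have angpp : ang p = pi *+ 2 by rewrite -[p]add0n angp ang0 add0r.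
have angD i : ang (2 * M + i) = ang i + pi.
  by rewrite -angh /ang [(2 * M + i)%:R]natrD -mulrDr -[X in _ = _ * X]mulrDl addrC.
have s_hi i : (2 * M < i)%N -> (i < p)%N -> sin (ang i) < 0.
  move=> iM ip; have -> : i = (2 * M + (i - 2 * M))%N by lia.
  by rewrite angD sinDpi oppr_lt0 s_lo //; lia.
have c1 : 0 < cos (ang 1).
  apply: cos_gt0_pihalf; have /andP[h1 _] := lt_ang 1%N ltac:(lia) isT.
  apply/andP; split; first by apply: lt_trans h1; rewrite oppr_lt0 divr_gt0.
  rewrite angM ltr_pM2l // mul1r ltf_pV2 ?posrE // ltr_nat; lia.
have ch : cos (ang (2 * M).+1) < 0.
  by rewrite -addn1 angD cosDpi oppr_lt0.
have range0 lo hi (F : nat -> int) : (forall i, (lo <= i < hi)%N -> F i = 0) ->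
  \sum_(lo <= i < hi) F i = 0.
  by move=> F0; rewrite big_nat_cond big1 // => i /andP[/F0].
rewrite -(big_mkord xpredT (fun i => (b i.+1 - b i) * e i.+1)).
have pE : p = (2 * M + 2 * M)%N by rewrite /p; lia.
case: epsE => epsE; rewrite epsE in b e bp ep *.
  have bE i : (i <= p)%N -> b i = (if (2 * M < i < p)%N then 1 else 0).
    move=> ip; rewrite /b mul1r /neg.
    case: ifP => [/andP[h1 h2]|h]; first by rewrite s_hi.
    suff : 0 <= sin (ang i) by rewrite leNgt => /negbTE ->.
    have [->|i0] := posnP i; first by rewrite ang0 sin0.
    have [h1|h1] := ltnP i (2 * M); first by rewrite ltW // s_lo.
    have [->|h2] := eqVneq i (2 * M)%N; first by rewrite angh sinpi.
    have -> : i = p by lia.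
    by rewrite angpp sin2pi.
  rewrite (big_cat_nat _ (n := (2 * M)%N)) //=; last by lia.
  rewrite range0; last by move=> i iM; rewrite !bE; try lia; rewrite !ifF ?subrr ?mul0r //; lia.
  rewrite add0r big_ltn; last by lia.
  rewrite !bE; try lia; rewrite ifT; last by lia.
  rewrite ifF; last by lia.
  rewrite [e _]/e mul1r /neg ch subr0 mulr1.
  rewrite (big_cat_nat _ (n := p.-1)) //=; try lia.
  rewrite range0; last by move=> i iM; rewrite !bE; try lia; rewrite !ifT ?subrr ?mul0r //; lia.
  rewrite big_ltn; last by lia.
  rewrite big_geq; last by lia.
  rewrite prednK; last by lia.
  by rewrite [e _]/e angpp cos2pi /neg mul1r ltr10 mulr0 !addr0.
have bE i : (i <= p)%N -> b i = (if (0 < i < 2 * M)%N then 1 else 0).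
  move=> ip; rewrite /b mulN1r /neg oppr_lt0.
  case: ifP => [/andP[h1 h2]|h]; first by rewrite s_lo.
  suff : sin (ang i) <= 0 by rewrite leNgt => /negbTE ->.
  have [->|i0] := posnP i; first by rewrite ang0 sin0.
  have [->|h1] := eqVneq i (2 * M)%N; first by rewrite angh sinpi.
  have [->|h2] := eqVneq i p; first by rewrite angpp sin2pi.
  by rewrite ltW // s_hi; lia.
rewrite big_ltn; last by lia.
rewrite !bE; try lia; rewrite (_ : (0 < 1 < 2 * M)%N = true) ?ltnn /=; last by lia.
rewrite [e _]/e mulN1r /neg oppr_lt0 c1 subr0 mulr1.
rewrite (big_cat_nat _ (n := (2 * M).-1)) //=; try lia.
rewrite range0; last by move=> i iM; rewrite !bE; try lia; rewrite !ifT ?subrr ?mul0r //; lia.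
rewrite big_ltn; last by lia.
rewrite prednK; last by lia.
rewrite [e _]/e angh cospi mulN1r opprK /neg ltr10 mulr0 !add0r.
rewrite range0 ?addr0 // => i iM.
by rewrite !bE; try lia; rewrite !ifF ?subrr ?mul0r //; lia.
Qed.

Lemma deg3_sph0 N M eps : (1 < M)%N -> N = (4 * M)%N -> eps = 1 \/ eps = -1 ->
  deg3 N (fun s d => eps *: sph0 s d) = (if eps == 1 then 1 else -1).
Proof.
move=> M1 NE epsE.
have q0 (d : R) : 0 < d ^+ 2 + (1 - d) ^+ 2 by nra.
have e0 : eps != 0 by case: epsE => ->; rewrite ?oppr_eq0 oner_eq0.
pose rho d : R := 2 * (d * (1 - d)) / (d ^+ 2 + (1 - d) ^+ 2).
pose h d : R := eps * ((2 * d - 1) / (d ^+ 2 + (1 - d) ^+ 2)).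
have div_q (x y d : R) : x * (d ^+ 2 + (1 - d) ^+ 2) = y -> x = y / (d ^+ 2 + (1 - d) ^+ 2).
  by move=> <-; rewrite mulfK // gt_eqF.
have N0 : 0 < (N%:R : R) by rewrite ltr0n; lia.
have negh d : 0 <= d -> neg (h d) = (if eps == 1 then neg (2 * d - 1) else neg (1 - 2 * d)).
  move=> d0; rewrite /h mulrA neg_pmul ?invr_gt0 //.
  case: epsE => ->; rewrite ?eqxx ?mul1r //.
  have -> : (-1 == 1 :> R) = false by rewrite lt_eqF //; apply: (@lt_trans _ _ 0); rewrite ?ltr01 ?oppr_lt0 ?ltr01.
  by rewrite mulN1r opprB.
rewrite (@deg3_model N 1 eps _ rho h); first last.
- have N1 : (N.-1%:R / N%:R : R) = 1 - N%:R^-1.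
    have -> : N.-1%:R = N%:R - 1 :> R by rewrite -subn1 natrB //; lia.
    by rewrite mulrBl divff ?gt_eqF // mul1r.
  have N4 : N%:R^-1 <= 1 / 4 :> R by rewrite mul1r lef_pV2 ?posrE // ler_nat; lia.
  rewrite !negh ?divr_ge0 // N1 /neg; case: ifP => _.
    by congr (nat_of_bool _)%:Z; apply/idP/idP; lra.
  by congr (nat_of_bool _)%:Z; apply/idP/idP; rewrite ?subr_lt0; have : 0 < N%:R^-1 :> R by [rewrite invr_gt0]; lra.
- by move=> s d; rewrite crdZ /h; congr (_ * _); apply: div_q; exact: crd2_refl3.
- move=> s d; rewrite crdZ mulr1 mulrCA; congr (_ * _); rewrite /rho mulrAC.
  by apply: div_q; exact: crd1_refl3.
- move=> s d; rewrite crdZ mulr1 mulrCA; congr (_ * _); rewrite /rho mulrAC.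
  by apply: div_q; exact: crd0_refl3.
- by move=> d d0 d1; rewrite divr_gt0 // !mulr_gt0 // subr_gt0.
- by lia.
rewrite (@turnsE N 1 M) // ?mul1n // mulr1 !negh // mulr1 mulr0 subr0 sub0r /neg.
case: ifP => _.
  have -> : (2 - 1 < 0 :> R) = false by apply/negbTE; rewrite -leNgt; lra.
  by have -> : (-1 < 0 :> R) = true by rewrite oppr_lt0 ltr01.
have -> : (1 - 2 < 0 :> R) = true by lra.
by rewrite ltr10.
Qed.

End Model.

(** * Stereographic coordinates and products of linear factors *)

Section Evaluation.
Variable R : realType.
Local Notation V := 'rV[R]_3.
Local Notation P := (R * R)%type.

Definition stereo (x : V) : P := (crd 0 x / (1 - crd 2 x), crd 1 x / (1 - crd 2 x)).

Lemma unit_e3 (x : V) : dot x x = 1 -> x != e3 R -> 0 < 1 - crd 2 x.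
Proof.
rewrite dotE => x1 xe; rewrite subr_gt0 lt_neqAle; apply/andP; split; last by nra.
apply: contra xe => /eqP x2; rewrite x2 in x1; apply/eqP/crdE; rewrite !crdv ?x2 //; nra.
Qed.

Lemma sph0_neq_e3 s d : d != 1 -> sph0 s d != e3 R.
Proof.
move=> d1; apply/eqP => /(congr1 (crd 2)); rewrite !crdv => E.
have := crd2_refl3 s d; rewrite E mul1r => h.
have /eqP : (1 - d) ^+ 2 = 0 by nra.
by rewrite expf_eq0 /= subr_eq0 eq_sym (negbTE d1).
Qed.

Lemma stereo_sph0 s d : d != 1 ->
  ((1 - d) * (stereo (sph0 s d)).1 = d * cos (2 * pi * s)) *
  ((1 - d) * (stereo (sph0 s d)).2 = d * sin (2 * pi * s)).
Proof.
move=> d1; have n0 := unit_e3 (sm_unit (sph0_map R) s d) (sph0_neq_e3 s d1).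
have h2 := crd2_refl3 s d; have h1 := crd1_refl3 s d; have h0 := crd0_refl3 s d.
have d1' : 1 - d != 0 by rewrite subr_eq0 eq_sym.
have q0 : d ^+ 2 + (1 - d) ^+ 2 != 0 by rewrite gt_eqF //; nra.
have e : (1 - crd 2 (sph0 s d)) * (d ^+ 2 + (1 - d) ^+ 2) = 2 * (1 - d) ^+ 2.
  by rewrite mulrBl h2; ring.
rewrite /stereo /=; split; rewrite mulrA; apply: (canLR (mulfK (lt0r_neq0 n0)));
  apply: (mulIf q0); rewrite -[RHS]mulrA e -[LHS]mulrA ?h0 ?h1; ring.
Qed.

(* The components of [H x] in an orthonormal frame at [x], the last vector of
   which is [x]; this frame does not extend continuously to the pole [e3]. *)
Definition framed (H : V -> V) (x : V) : V := refl (x - e3 R) (H x).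

Definition fst2 (v : V) : P := (crd 0 v, crd 1 v).

Lemma refl_scale (a : R) u x : a != 0 -> refl (a *: u) x = refl u x.
Proof.
move=> a0; have [->|u0] := eqVneq u 0; first by rewrite scaler0.
rewrite /refl dotZl dotZr scalerA; congr (_ - _ *: _).
have un : dot u u != 0 by rewrite gt_eqF // dot_gt0.
by rewrite dotZl; field; rewrite un.
Qed.

Lemma mirror_sph0 s d : d != 1 ->
  exists2 a, a != 0 & sph0 s d - e3 R = a *: mirror s d.
Proof.
move=> d1; exists (2 * (1 - d) / (d ^+ 2 + (1 - d) ^+ 2)).
  have n0 : d ^+ 2 + (1 - d) ^+ 2 != 0 by rewrite gt_eqF //; nra.
  have d1' : 1 - d != 0 by rewrite subr_eq0 eq_sym.
  by rewrite mulf_neq0 ?invr_eq0 // mulf_neq0 // pnatr_eq0.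
have -> : sph0 s d - e3 R = - (2 * dot (mirror s d) (e3 R) / dot (mirror s d) (mirror s d)) *: mirror s d.
  by rewrite /sph0 /refl addrAC subrr add0r scaleNr.
congr (_ *: _); rewrite mirror_dot dotE !crdv.
have n0 : d ^+ 2 + (1 - d) ^+ 2 != 0 by rewrite gt_eqF //; nra.
by field.
Qed.

Lemma framed_sph0 H s d : d != 1 ->
  framed H (sph0 s d) = refl (mirror s d) (H (sph0 s d)).
Proof.
by move=> /(mirror_sph0 s) [a a0 E]; rewrite /framed E refl_scale.
Qed.

(** The monic polynomial with roots [zs] at the point d / (1 - d) exp(2 pi i s), multiplied by (1 -
    d) to the power [size zs]; so it makes sense at the pole d = 1. *)
Fixpoint factors (zs : seq P) (s d : R) : P :=
  if zs is z :: zs' then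
    cmul (d * cos (2 * pi * s) - (1 - d) * z.1, d * sin (2 * pi * s) - (1 - d) * z.2)
      (factors zs' s d)
  else (1, 0).

Fixpoint sum_angles (zs : seq P) (th : P -> R) : R :=
  if zs is z :: zs' then th z + sum_angles zs' th else 0.

Lemma factors_polar (zs : seq P) (th : P -> R) s d : d < 1 ->
  (forall z, z \in zs -> polar (sub2 (stereo (sph0 s d)) z) (th z)) ->
  polar (factors zs s d) (sum_angles zs th).
Proof.
move=> d1; elim: zs => [|z zs IH] pz /=.
  by exists 1; rewrite // cos0 sin0 mulr1 mulr0.
apply: polar_mul; last by apply: IH => w wz; apply: pz; rewrite inE wz orbT.
have [|<- <-] := @stereo_sph0 s d; first by rewrite lt_eqF.
have := polar_scale (_ : 0 < 1 - d) (pz z (mem_head _ _)); rewrite /sub2 /=.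
by rewrite !mulrBr; apply; rewrite subr_gt0.
Qed.

Lemma cmul_eq0 (w z : P) : (cmul w z == 0) = (w == 0) || (z == 0).
Proof.
have sq : sqn (cmul w z) = sqn w * sqn z by rewrite /sqn /cmul /=; ring.
apply/idP/idP => [|/orP[]/eqP ->]; last 2 first.
- by rewrite /cmul /= !mul0r subrr addr0.
- by rewrite /cmul /= !mulr0 subrr addr0.
apply: contraTT; rewrite negb_or -!sqn_gt0 => /andP[w0 z0].
by rewrite sq mulr_gt0.
Qed.

Lemma factors_eq0 (zs : seq P) s d : factors zs s d = 0 ->
  exists2 z, z \in zs & d * cos (2 * pi * s) = (1 - d) * z.1 /\
                        d * sin (2 * pi * s) = (1 - d) * z.2.
Proof.
elim: zs => [|z zs IH] /=; first by move=> [/eqP]; rewrite oner_eq0.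
move/eqP; rewrite cmul_eq0 => /orP[/eqP[/subr0_eq e1 /subr0_eq e2]|/eqP/IH[w wz we]].
  by exists z; rewrite ?mem_head.
by exists w; rewrite // inE wz orbT.
Qed.

Lemma factors_cont (T : topologicalType) (zs : seq (T -> P)) (f g : T -> R) :
  (forall z, z \in zs -> continuous z) -> continuous f -> continuous g ->
  continuous (fun x => factors [seq z x | z <- zs] (f x) (g x)).
Proof.
move=> + cf cg; elim: zs => [|z zs IH] cz /=; first exact: cont_cst.
have cz' := cz z (mem_head _ _).
have c1 := cont_comp2 (@cont_fst _ _) cz'; have c2 := cont_comp2 (@cont_snd _ _) cz'.
apply: cont_cmul; first by apply: cont_pair; contR.
by apply: IH => w wz; apply: cz; rewrite inE wz orbT.
Qed.

Lemma factors_period zs s d : factors zs (s + 1) d = factors zs s d.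
Proof. by elim: zs => //= z zs ->; rewrite cosD1 sinD1. Qed.

Lemma factors_south zs s s' : factors zs s 0 = factors zs s' 0.
Proof. by elim: zs => //= z zs ->; rewrite !mul0r. Qed.

Lemma factors0 n s d : factors (nseq n 0) s d =
  (d ^+ n * cos (2 * pi * n%:R * s), d ^+ n * sin (2 * pi * n%:R * s)).
Proof.
elim: n => [|n /= ->]; first by rewrite /= mulr0 mul0r cos0 sin0 mulr1 mulr0.
have -> : 2 * pi * n.+1%:R * s = 2 * pi * s + 2 * pi * n%:R * s by rewrite -natr1; ring.
by rewrite cosD sinD /cmul !mulr0 !subr0 exprS /=; congr pair; ring.
Qed.

Definition rotate2 (w : P) (a : R) : P := cmul (expi a) w.

Lemma rot_eq0 w a : (rotate2 w a == 0) = (w == 0).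
Proof.
rewrite /rotate2 cmul_eq0; have /negbTE -> // : expi a != 0.
exact: polar_neq0 (polar_expi a).
Qed.

Lemma polar_mix (w z : P) t a : 0 <= a <= 1 -> polar w t -> polar z t ->
  polar ((1 - a) * w.1 + a * z.1, (1 - a) * w.2 + a * z.2) t.
Proof.
move=> a01 [r r0 ->] [s s0 ->]; exists ((1 - a) * r + a * s) => /=; last first.
  by rewrite !mulrDl !mulrA.
have [->|a0] := eqVneq a 0; first by rewrite subr0 mul1r mul0r addr0.
rewrite ltr_wpDl ?mulr_ge0 ?mulr_gt0 //; [lra|exact: ltW|].
by rewrite lt0r a0; lra.
Qed.

End Evaluation.

(** * The degree of a field with a prescribed tangential part *)

Section EvalModel.
Variable R : realType.
Local Notation V := 'rV[R]_3.
Local Notation P := (R * R)%type.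
Local Notation X := (R * R * R)%type.

Definition join (w : P) (c : R) : V := vec3 w.1 w.2 c.

Lemma join_neq0 w c : (join w c != 0) = (w != 0) || (c != 0).
Proof.
apply/idP/idP.
  apply: contraTT; rewrite negb_or !negbK => /andP[/eqP -> /eqP ->].
  by apply/eqP/crdE; rewrite !crdv crd_0.
move=> h; apply: contraTneq h => E; rewrite negb_or !negbK.
have := congr1 (crd 0) E; have := congr1 (crd 1) E; have := congr1 (crd 2) E.
by rewrite !crdv !crd_0 => -> w2 w1; rewrite eqxx andbT; apply/eqP;
  rewrite [w]surjective_pairing w1 w2.
Qed.

Lemma cont_join (T : topologicalType) (w : T -> P) (c : T -> R) :
  continuous w -> continuous c -> continuous (fun x => join (w x) (c x)).
Proof.
move=> cw cc; have c1 := cont_comp2 (@cont_fst _ _) cw.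
by have c2 := cont_comp2 (@cont_snd _ _) cw; rewrite /join; contV.
Qed.

Lemma cont_rot (T : topologicalType) (w : T -> P) (a : T -> R) :
  continuous w -> continuous a -> continuous (fun x => rotate2 (w x) (a x)).
Proof. by move=> cw ca; apply: cont_cmul => //; apply: cont_pair; contR. Qed.

(** A homotopy given by its components in the moving frame. At d = 1 the frame depends on s, so it
    is the reflected vector, and not its components, that has to be independent of s there. *)
Lemma stage eps (W : R -> R -> R -> V) : eps != 0 ->
  continuous (fun z : X => W z.1.1 z.1.2 z.2) ->
  (forall s d t, 0 <= s <= 1 -> 0 <= d <= 1 -> 0 <= t <= 1 -> W s d t != 0) ->
  (forall s d t, W (s + 1) d t = W s d t) ->
  (forall s s' t, W s 0 t = W s' 0 t) ->
  (forall s s' t, refl (mirror s 1) (W s 1 t) = refl (mirror s' 1) (W s' 1 t)) ->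
  exists M, forall N, (M < N)%N ->
    deg3 N (fun s d => eps *: refl (mirror s d) (W s d 1)) =
    deg3 N (fun s d => eps *: refl (mirror s d) (W s d 0)).
Proof.
move=> e0 cW W0 Wp Ws Wn.
apply: (@deg3_homotopy R (fun s d t => eps *: refl (mirror s d) (W s d t))).
- apply: cont_vZ; first exact: cont_cst.
  apply: cont_refl => //; first by move=> z; exact: mirror_neq0.
  apply: (@cont_comp2 _ _ _ (uncurry2 (@mirror R)) (fun z : X => z.1)); last by contP.
  exact: mirror_cont.
- move=> s d t s1 d1 t1; rewrite scaler_eq0 negb_or e0 /=.
  by apply: refl_neq0; [exact: mirror_neq0|exact: W0].
- by move=> d t; rewrite -[1]add0r mirror_period Wp.
- by move=> s s' t; rewrite !mirror_south (Ws s s').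
- by move=> s s' t; rewrite (Wn s s').
Qed.

Variables (H : V -> V) (zs : seq P) (L : V -> R) (eps : R).
Let n := size zs.
Hypotheses (eps1 : eps = 1 \/ eps = -1) (n_gt0 : (0 < n)%N).
Hypotheses (cH : continuous H) (cL : continuous L).
Let h (x : V) := dot (H x) x.
Hypothesis h_pole : 0 < h (e3 R).
Hypothesis h_zs : forall x z, dot x x = 1 -> x != e3 R -> z \in zs -> stereo x = z -> h x < 0.
Hypothesis angle : forall x, dot x x = 1 -> h x = 0 ->
  exists2 th : P -> R, (forall z, z \in zs -> polar (sub2 (stereo x) z) (th z)) &
    polar (fst2 (framed H x)) (L x + sum_angles zs th).

Let S := @sph0 R.
Let uS s d : dot (S s d) (S s d) = 1 := sm_unit (sph0_map R) s d.

Let Q s d := refl (mirror s d) (H (S s d)).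

Let hQ s d : crd 2 (Q s d) = h (S s d).
Proof.
rewrite /h -(refl_dot (H (S s d)) (S s d) (mirror_neq0 s d)) -/(Q s d).
by rewrite /S /sph0 reflK ?mirror_neq0 // dotE !crdv !mulr0 !add0r mulr1.
Qed.

Let cS : continuous (fun z : X => S z.1.1 z.1.2).
Proof.
apply: (@cont_comp2 _ _ _ (uncurry2 S) (fun z : X => z.1)); last by contP.
exact: sm_cont (sph0_map R).
Qed.

Let cm : continuous (fun z : X => mirror z.1.1 z.1.2).
Proof.
apply: (@cont_comp2 _ _ _ (uncurry2 (@mirror R)) (fun z : X => z.1)); last by contP.
exact: mirror_cont.
Qed.

Let cQ : continuous (fun z : X => Q z.1.1 z.1.2).
Proof.
apply: cont_refl => //; first by move=> z; exact: mirror_neq0.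
exact: (cont_comp2 cH cS).
Qed.

Let chS : continuous (fun z : X => h (S z.1.1 z.1.2)).
Proof. exact: (cont_dot (cont_comp2 cH cS) cS). Qed.

Let F (t s d : R) : P := factors [seq (t * z.1, t * z.2) | z <- zs] s d.

Let cF (f : X -> R) : continuous f -> continuous (fun z : X => F (f z) z.1.1 z.1.2).
Proof.
move=> cf; rewrite /F.
have -> : (fun z : X => factors [seq (f z * w.1, f z * w.2) | w <- zs] z.1.1 z.1.2)
  = (fun z : X => factors [seq w z | w <- [seq (fun z : X => (f z * w.1, f z * w.2)) | w <- zs]] z.1.1 z.1.2).
  by apply/funext => z; rewrite -map_comp.
apply: factors_cont; [|by contP|by contP].
move=> w /mapP[z zz ->]; apply: cont_pair; apply: contM => //; exact: cont_cst.
Qed.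

Let F1 s d : F 1 s d = factors zs s d.
Proof.
by rewrite /F; congr factors; rewrite -[RHS]map_id; apply: eq_map => -[a b] /=; rewrite !mul1r.
Qed.

Let F0 s d : F 0 s d = (d ^+ n * cos (2 * pi * n%:R * s), d ^+ n * sin (2 * pi * n%:R * s)).
Proof.
rewrite /F -factors0; congr factors; rewrite /n; elim: (zs) => //= z zs' ->.
by rewrite !mul0r.
Qed.

Let Fp t s d : F t (s + 1) d = F t s d. Proof. exact: factors_period. Qed.
Let Fs t s s' : F t s 0 = F t s' 0. Proof. exact: factors_south. Qed.

Let Feq0 t s d : 0 <= t -> 0 <= d <= 1 -> F t s d = 0 ->
  exists2 z, z \in zs & d * cos (2 * pi * s) = (1 - d) * (t * z.1) /\
     d * sin (2 * pi * s) = (1 - d) * (t * z.2).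
Proof. by move=> t0 d01 /factors_eq0[w /mapP[z zz ->]] E; exists z. Qed.

Let Fzs s d : 0 <= d -> d < 1 -> F 1 s d = 0 -> h (S s d) < 0.
Proof.
move=> d0 d1 /Feq0[]; rewrite ?ler01 ?d0 ?ltW // => z zz; rewrite !mul1r => -[e1 e2].
have dn : d != 1 by rewrite lt_eqF.
apply: (h_zs _ _ zz) => //; first exact: sph0_neq_e3.
have [f1 f2] := stereo_sph0 s dn; have d1' : 1 - d != 0 by rewrite subr_eq0 eq_sym.
rewrite [stereo _]surjective_pairing [z]surjective_pairing; congr pair;
  by apply: (mulfI d1'); rewrite ?f1 ?f2.
Qed.

Let bound : exists2 r, 0 < r & forall z, z \in zs -> sqn z < r ^+ 2.
Proof.
elim: (zs) => [|z zs' [r r0 rP]]; first by exists 1.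
exists (r + 1 + sqn z) => [|w]; first by have := sqn_ge0 z; lra.
rewrite inE => /predU1P[->|/rP]; have := sqn_ge0 z; last by nra.
by move: r0 => r0 z0; nra.
Qed.

Let e0 : eps != 0.
Proof. by case: eps1 => ->; rewrite ?oppr_eq0 oner_eq0. Qed.

Let d1_neq (d : R) : 0 <= d <= 1 -> d = 1 \/ 0 <= d < 1.
Proof.
by move=> /andP[d0 dl]; have [->|dn] := eqVneq d 1; [left|right; rewrite d0 lt_neqAle dn].
Qed.

Let S1 s : S s 1 = e3 R := sph0_north s.

Let Sp s d : S (s + 1) d = S s d := sm_period (sph0_map R) s d.
Let Ss s s' : S s 0 = S s' 0 := sm_south (sph0_map R) s s'.

Let refl_north s c : refl (mirror s 1) (join (0, 0) c) = c *: e3 R.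
Proof.
have -> : join (0, 0) c = c *: e3 R by apply: crdE; rewrite crdZ !crdv ?mulr0 ?mulr1.
by rewrite reflZ -[refl _ _]/(S s 1) S1.
Qed.

Let refl_south (s a b c : R) : refl (mirror s 0) (vec3 a b c) = vec3 a b (- c).
Proof.
rewrite mirror_south; apply: crdE; rewrite /refl !crdL !dotE !crdv; try ring.
by field.
Qed.

Let scale2 (a : R) (w : P) : P := (a * w.1, a * w.2).

Let scale2_eq0 a w : (scale2 a w == 0) = (a == 0) || (w == 0).
Proof.
apply/idP/idP => [/eqP[/eqP + /eqP]|/orP[]/eqP ->]; last 2 first.
- by rewrite /scale2 !mul0r.
- by rewrite /scale2 !mulr0.
by rewrite !mulf_eq0; case: (a == 0) => //=; case: w => x y /= /eqP -> /eqP ->.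
Qed.

Let cont_scale2 (a : X -> R) (w : X -> P) : continuous a -> continuous w ->
  continuous (fun z => scale2 (a z) (w z)).
Proof.
move=> ca cw; have c1 := cont_comp2 (@cont_fst _ _) cw.
by have c2 := cont_comp2 (@cont_snd _ _) cw; rewrite /scale2; apply: cont_pair; contR.
Qed.

(** By [angle], where the radial part vanishes the tangential part has the argument of exp(i L)
    times the polynomial with roots [zs], so it can be replaced by this product. Once L is removed,
    the roots are moved to 0 and the radial part is normalized, a model remains; the n turns of its
    monomial and the single turn of the frame contribute with opposite signs. The factor 1 - d makes
    the tangential part vanish at the pole, where the frame is discontinuous. *)
Lemma eval_model : exists M, forall N, (M < N)%N -> forall k, (1 < k)%N ->
  N = (n * (4 * k))%N ->
  deg3 N (fun s d => eps *: H (S s d)) = if eps == 1 then 1 - n%:Z else n%:Z - 1.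
Proof.
have [r r0 rP] := bound.
have cz1 : continuous (fun z : X => 1 - z.1.2) by contR.
have czt : continuous (fun z : X => 1 - z.2) by contR.
have cF1 : continuous (fun z : X => F 1 z.1.1 z.1.2) by apply: cF; exact: cont_cst.
have cLS : continuous (fun z : X => L (S z.1.1 z.1.2)) by exact: (cont_comp2 cL cS).
(* straight line homotopy to a rotated polynomial *)
have [M1 E1] : exists M, forall N, (M < N)%N ->
    deg3 N (fun s d => eps *: refl (mirror s d)
      (join (scale2 (1 - d) (rotate2 (F 1 s d) (L (S s d)))) (h (S s d)))) =
    deg3 N (fun s d => eps *: H (S s d)).
  pose W s d t := (1 - t) *: Q s d
    + t *: join (scale2 (1 - d) (rotate2 (F 1 s d) (L (S s d)))) (h (S s d)).
  have [] := @stage eps W e0.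
  - apply: cont_vD; first by apply: cont_vZ.
    apply: cont_vZ; first by contR.
    by apply: cont_join => //; apply: cont_scale2 => //; exact: cont_rot.
  - move=> s d t _ d01 t01; apply/eqP => W0.
    have hS : h (S s d) = 0.
      have := congr1 (crd 2) W0; rewrite /W crdD !crdZ hQ /join crd2v crd_0.
      by move=> e; rewrite -e; ring.
    have [d1|/andP[dg dl]] := d1_neq d01.
      by move: h_pole; rewrite -(S1 s) -d1 hS ltxx.
    have [th pz] := angle (uS s d) hS; rewrite framed_sph0 ?lt_eqF // -/(Q s d) => pQ.
    have pF := factors_polar dl pz.
    have pR : polar (scale2 (1 - d) (rotate2 (F 1 s d) (L (S s d)))) (L (S s d) + sum_angles zs th).
      apply: polar_scale; first by rewrite subr_gt0.
      by rewrite F1; apply: polar_mul => //; exact: polar_expi.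
    have /polar_neq0/eqP := polar_mix t01 pQ pR; apply; congr pair.
      by have := congr1 (crd 0) W0; rewrite /W crdD !crdZ /join crd0v crd_0.
    by have := congr1 (crd 1) W0; rewrite /W crdD !crdZ /join crd1v crd_0.
  - by move=> s d t; rewrite /W /Q mirror_period Sp Fp.
  - by move=> s s' t; rewrite /W /Q !mirror_south (Ss s s') (Fs 1 s s').
  - have n1 s t : refl (mirror s 1) (W s 1 t) = (1 - t) *: H (e3 R) + t *: (h (e3 R) *: e3 R).
      rewrite /W reflD !reflZ /Q reflK ?mirror_neq0 // S1; congr (_ + _ *: _).
      by rewrite /scale2 subrr !mul0r refl_north.
    by move=> s s' t; rewrite !n1.
  move=> M EM; exists M => N /EM E; etransitivity; last (etransitivity; first exact: E).
    by apply: eq_deg3 => s d; rewrite /W subrr scale0r add0r scale1r.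
  apply: eq_deg3 => s d; rewrite /W subr0 scale0r addr0 scale1r.
  by rewrite /Q reflK ?mirror_neq0.
have h1 : h (e3 R) != 0 by rewrite gt_eqF.
(* removal of the rotation *)
have [M2 E2] : exists M, forall N, (M < N)%N ->
    deg3 N (fun s d => eps *: refl (mirror s d)
      (join (scale2 (1 - d) (F 1 s d)) (h (S s d)))) =
    deg3 N (fun s d => eps *: refl (mirror s d)
      (join (scale2 (1 - d) (rotate2 (F 1 s d) (L (S s d)))) (h (S s d)))).
  pose W s d t := join (scale2 (1 - d) (rotate2 (F 1 s d) ((1 - t) * L (S s d)))) (h (S s d)).
  have [] := @stage eps W e0.
  - apply: cont_join => //; apply: cont_scale2 => //; apply: cont_rot => //.
    exact: contM.
  - move=> s d t _ d01 t01; rewrite join_neq0 scale2_eq0 rot_eq0 subr_eq0 -negb_and.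
    apply/negP => /andP[/orP[/eqP d1|/eqP z0] /eqP hS].
      by move: h1; rewrite -(S1 s) d1 hS eqxx.
    have [d1|/andP[dg dl]] := d1_neq d01.
      by move: h1; rewrite -(S1 s) -d1 hS eqxx.
    by have := Fzs dg dl z0; rewrite hS ltxx.
  - by move=> s d t; rewrite /W Sp Fp.
  - by move=> s s' t; rewrite /W (Ss s s') (Fs 1 s s').
  - by move=> s s' t; rewrite /W !S1 subrr /scale2 !mul0r !refl_north.
  move=> M EM; exists M => N /EM E; etransitivity; last (etransitivity; first exact: E).
    apply: eq_deg3 => s d; rewrite /W subrr mul0r /rotate2 /cmul /expi cos0 sin0.
    by rewrite !mul1r !mul0r subr0 addr0 -surjective_pairing.
  by apply: eq_deg3 => s d; rewrite /W subr0 mul1r.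
(* the last coordinate only matters at the zeros of the polynomial *)
pose q d := d - r * (1 - d).
have qz t z s d : 0 <= t <= 1 -> z \in zs -> 0 <= d -> d < 1 ->
    d * cos (2 * pi * s) = (1 - d) * (t * z.1) ->
    d * sin (2 * pi * s) = (1 - d) * (t * z.2) -> q d < 0.
  move=> /andP[t0 t1] zz d0 d1 e1 e2; rewrite /q subr_lt0.
  have : d ^+ 2 < (r * (1 - d)) ^+ 2.
    have -> : d ^+ 2 = (1 - d) ^+ 2 * (t ^+ 2 * sqn z).
      have -> : d ^+ 2 = (d * cos (2 * pi * s)) ^+ 2 + (d * sin (2 * pi * s)) ^+ 2.
        by rewrite !exprMn -mulrDr cos2Dsin2 mulr1.
      by rewrite e1 e2 /sqn; ring.
    rewrite exprMn [r ^+ 2 * _]mulrC ltr_pM2l; last by rewrite exprn_gt0 // subr_gt0.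
    apply: le_lt_trans (rP z zz); rewrite -[leRHS]mul1r ler_wpM2r ?sqn_ge0 //.
    by rewrite expr_le1.
  by rewrite ltr_sqr // nnegrE ?mulr_ge0 ?subr_ge0 ?(ltW r0) ?(ltW d1).
have cq : continuous (fun z : X => q z.1.2) by rewrite /q; contR.
have q1 : q 1 = 1 by rewrite /q subrr mulr0 subr0.
have [M3 E3] : exists M, forall N, (M < N)%N ->
    deg3 N (fun s d => eps *: refl (mirror s d) (join (scale2 (1 - d) (F 1 s d)) (q d))) =
    deg3 N (fun s d => eps *: refl (mirror s d)
      (join (scale2 (1 - d) (F 1 s d)) (h (S s d)))).
  pose W s d t := join (scale2 (1 - d) (F 1 s d)) ((1 - t) * h (S s d) + t * q d).
  have [] := @stage eps W e0.
  - apply: cont_join; first exact: cont_scale2.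
    apply: contD; first exact: contM.
    by apply: contM => //; contR.
  - move=> s d t _ d01 t01; rewrite join_neq0 scale2_eq0 subr_eq0 -negb_and.
    apply/negP => /andP[/orP[/eqP d1|/eqP z0] /eqP].
      rewrite -d1 S1 q1; move: t01 h_pole => /andP[t0 t1] hp; nra.
    have [d1|/andP[dg dl]] := d1_neq d01.
      rewrite d1 S1 q1; move: t01 h_pole => /andP[t0 t1] hp; nra.
    have hn := Fzs dg dl z0; have [||z zz [e1 e2]] := Feq0 _ _ z0; rewrite ?ler01 //.
    have qn : q d < 0 by apply: (qz 1 z s); rewrite ?ler01 ?lexx.
    by move: t01 hn qn => /andP[t0 t1] hn qn; nra.
  - by move=> s d t; rewrite /W Sp Fp.
  - by move=> s s' t; rewrite /W (Ss s s') (Fs 1 s s').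
  - by move=> s s' t; rewrite /W !S1 subrr /scale2 !mul0r !refl_north.
  move=> M EM; exists M => N /EM E; etransitivity; last (etransitivity; first exact: E).
    by apply: eq_deg3 => s d; rewrite /W subrr mul0r add0r mul1r.
  by apply: eq_deg3 => s d; rewrite /W subr0 mul0r addr0 mul1r.
have [M4 E4] : exists M, forall N, (M < N)%N ->
    deg3 N (fun s d => eps *: refl (mirror s d) (join (scale2 (1 - d) (F 0 s d)) (q d))) =
    deg3 N (fun s d => eps *: refl (mirror s d) (join (scale2 (1 - d) (F 1 s d)) (q d))).
  pose W s d t := join (scale2 (1 - d) (F (1 - t) s d)) (q d).
  have [] := @stage eps W e0.
  - by apply: cont_join => //; apply: cont_scale2 => //; exact: cF.
  - move=> s d t _ d01 t01; rewrite join_neq0 scale2_eq0 subr_eq0 -negb_and.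
    apply/negP => /andP[/orP[/eqP d1|/eqP z0] /eqP qd].
      by move: qd; rewrite -d1 q1 => /eqP; rewrite oner_eq0.
    have [d1|/andP[dg dl]] := d1_neq d01.
      by move: qd; rewrite d1 q1 => /eqP; rewrite oner_eq0.
    have [||z zz [e1 e2]] := Feq0 _ _ z0; rewrite // ?subr_ge0; first by case/andP: t01.
    have : q d < 0 by apply: (qz (1 - t) z s) => //; lra.
    by rewrite qd ltxx.
  - by move=> s d t; rewrite /W Fp.
  - by move=> s s' t; rewrite /W (Fs _ s s').
  - by move=> s s' t; rewrite /W subrr /scale2 !mul0r !refl_north.
  move=> M EM; exists M => N /EM E; etransitivity; last (etransitivity; first exact: E).
    by apply: eq_deg3 => s d; rewrite /W subrr.
  by apply: eq_deg3 => s d; rewrite /W subr0.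
pose W5 s d := join (scale2 (1 - d) (F 0 s d)) (2 * d - 1).
have W50 s d : 0 <= d <= 1 -> F 0 s d = 0 -> d = 0.
  move=> d01; rewrite F0 => -[f1 f2].
  have /eqP : (d ^+ n) ^+ 2 = 0.
    have -> : (d ^+ n) ^+ 2 = (d ^+ n * cos (2 * pi * n%:R * s)) ^+ 2
        + (d ^+ n * sin (2 * pi * n%:R * s)) ^+ 2.
      by rewrite !exprMn -mulrDr cos2Dsin2 mulr1.
    by rewrite f1 f2 expr0n addr0.
  by rewrite expf_eq0 /= expf_eq0 n_gt0 => /eqP.
have [M5 E5] : exists M, forall N, (M < N)%N ->
    deg3 N (fun s d => eps *: refl (mirror s d) (W5 s d)) =
    deg3 N (fun s d => eps *: refl (mirror s d) (join (scale2 (1 - d) (F 0 s d)) (q d))).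
  pose W s d t := join (scale2 (1 - d) (F 0 s d)) ((1 - t) * q d + t * (2 * d - 1)).
  have cF0 : continuous (fun z : X => F 0 z.1.1 z.1.2) by apply: cF; exact: cont_cst.
  have [] := @stage eps W e0.
  - apply: cont_join; first exact: cont_scale2.
    by apply: contD; apply: contM => //; contR.
  - move=> s d t _ d01 t01; rewrite join_neq0 scale2_eq0 subr_eq0 -negb_and.
    apply/negP => /andP[/orP[/eqP d1|/eqP z0] /eqP].
      by rewrite -d1 q1; lra.
    rewrite (W50 s d d01 z0) /q subr0 mulr1 sub0r mulr0 sub0r.
    by move: t01 r0 => /andP[t0 t1] r0'; nra.
  - by move=> s d t; rewrite /W Fp.
  - by move=> s s' t; rewrite /W (Fs 0 s s').
  - by move=> s s' t; rewrite /W subrr /scale2 !mul0r !refl_north.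
  move=> M EM; exists M => N /EM E; etransitivity; last (etransitivity; first exact: E).
    by apply: eq_deg3 => s d; rewrite /W subrr mul0r add0r mul1r.
  by apply: eq_deg3 => s d; rewrite /W subr0 mul0r addr0 mul1r.
(* untwisting of the frame; the north face contributes the degree of the
   sphere itself *)
have cW5 : continuous (fun z : X => W5 z.1.1 z.1.2).
  apply: cont_join; last by contR.
  by apply: cont_scale2 => //; apply: cF; exact: cont_cst.
pose G6 s d t := eps *: refl (mirror s (t * d)) (W5 s d).
have cG6 : continuous (fun z : X => G6 z.1.1 z.1.2 z.2).
  apply: cont_vZ; first exact: cont_cst.
  apply: (cont_refl _ _ cW5); first by move=> z; exact: mirror_neq0.
  apply: (@cont_comp2 _ _ _ (uncurry2 (@mirror R)) (fun z : X => (z.1.1, z.2 * z.1.2))).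
    exact: mirror_cont.
  by apply: cont_pair; contR.
have G60 s d t : 0 <= s <= 1 -> 0 <= d <= 1 -> 0 <= t <= 1 -> G6 s d t != 0.
  move=> _ d01 _; rewrite scaler_eq0 negb_or e0 /=; apply: refl_neq0; first exact: mirror_neq0.
  rewrite join_neq0 scale2_eq0 subr_eq0 -negb_and; apply/negP => /andP[/orP[/eqP d1|/eqP z0] /eqP].
    by rewrite -d1; lra.
  by rewrite (W50 s d d01 z0); lra.
have [M6 E6] := deg3_cube cG6 G60.
exists (maxn (maxn (maxn M1 M2) (maxn M3 M4)) (maxn (maxn M5 M6) 4)) => N.
rewrite !gtn_max => /andP[/andP[/andP[N1 N2] /andP[N3 N4]] /andP[/andP[N5 N6] N7]] k k1 NE.
rewrite -(E1 N N1) -(E2 N N2) -(E3 N N3) -(E4 N N4) -(E5 N N5).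
have := E6 N N6.
rewrite (@eq_deg3 _ N (fun d t => _) (fun d t => eps *: refl (mirror 0 (t * d)) (W5 0 d))); last first.
  by move=> d t; rewrite -[1]add0r mirror_period /W5 Fp.
rewrite subrr (@deg3_cst _ N (fun s t => eps *: refl (mirror s (t * 0)) (W5 s 0))); last first.
  by move=> s s' t; rewrite mulr0 !mirror_south /W5 (Fs 0 s s').
have -> : deg3 N (fun s t => eps *: refl (mirror s (t * 1)) (W5 s 1)) =
    deg3 N (fun s d => eps *: sph0 s d).
  apply: eq_deg3 => s t; rewrite mulr1 /W5 subrr /scale2 !mul0r /sph0; congr (_ *: refl _ _).
  by apply: crdE; rewrite !crdv //; lra.
rewrite (@deg3_sph0 R N (n * k) eps) //; last 2 first.
- by apply: (leq_trans k1); rewrite leq_pmull.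
- by rewrite NE mulnCA.
have -> : deg3 N (fun s d => eps *: refl (mirror s (1 * d)) (W5 s d)) =
    deg3 N (fun s d => eps *: refl (mirror s d) (W5 s d)).
  by apply: eq_deg3 => s d; rewrite mul1r.
rewrite (@deg3_model R N n eps (fun s d => eps *: refl (mirror s (0 * d)) (W5 s d))
  (fun d => d ^+ n * (1 - d)) (fun d => eps * (1 - 2 * d))); first last.
- have N0 : (0 < N)%N by lia.
  have N1' : (N.-1%:R / N%:R : R) = 1 - N%:R^-1.
    have -> : N.-1%:R = N%:R - 1 :> R by rewrite -subn1 natrB //; lia.
    by rewrite mulrBl divff ?mul1r // pnatr_eq0; lia.
  have N4' : N%:R^-1 <= 1 / 4 :> R by rewrite mul1r lef_pV2 ?posrE ?ltr0n // ler_nat; lia.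
  have N0' : 0 < N%:R^-1 :> R by rewrite invr_gt0 ltr0n.
  rewrite N1' /neg; case: eps1 => ->; congr (nat_of_bool _)%:Z; apply/idP/idP; lra.
- by move=> s d; rewrite mul0r crdZ /W5 /join refl_south crdv; ring.
- by move=> s d; rewrite mul0r crdZ /W5 /join refl_south /scale2 F0 crdv /=; ring.
- by move=> s d; rewrite mul0r crdZ /W5 /join refl_south /scale2 F0 crdv /=; ring.
- by move=> d d0 d1; rewrite mulr_gt0 ?exprn_gt0 // subr_gt0.
- by lia.
rewrite (turnsE k1 n_gt0 NE eps1).
have -> : eps * (1 - 2 * 1) = - eps by ring.
have -> : eps * (1 - 2 * 0) = eps by ring.
have n1 : (-1 == 1 :> R) = false by apply/eqP; lra.
case: eps1 => ->; rewrite ?opprK ?eqxx ?n1 /neg ?oppr_lt0 ltr01 ltr10 /=.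
  set D := deg3 _ _; lia.
set D := deg3 _ _; lia.
Qed.

End EvalModel.

(** * Directions under stereographic projection *)

Section Stereographic.
Variable R : realType.
Local Notation V := 'rV[R]_3.
Local Notation P := (R * R)%type.

Definition cross (x y : V) : V :=
  vec3 (crd 1 x * crd 2 y - crd 2 x * crd 1 y)
       (crd 2 x * crd 0 y - crd 0 x * crd 2 y)
       (crd 0 x * crd 1 y - crd 1 x * crd 0 y).

Definition unstereo (w : P) : V :=
  (1 + sqn w)^-1 *: vec3 (2 * w.1) (2 * w.2) (sqn w - 1).

Lemma stereoK x : dot x x = 1 -> x != e3 R -> unstereo (stereo x) = x.
Proof.
move=> x1 xe; have n0 := unit_e3 x1 xe; rewrite dotE in x1.
have d0 : 1 - crd 2 x != 0 by rewrite gt_eqF.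
have E : sqn (stereo x) = (1 + crd 2 x) / (1 - crd 2 x).
  rewrite /sqn /stereo /= !expr_div_n -mulrDl.
  have -> : crd 0 x ^+ 2 + crd 1 x ^+ 2 = (1 + crd 2 x) * (1 - crd 2 x).
    by rewrite -[1 in RHS]x1; nra.
  by field.
have E1 : (1 + sqn (stereo x))^-1 = (1 - crd 2 x) / 2.
  by rewrite E; field; rewrite d0 /=; have -> : 1 - crd 2 x + (1 + crd 2 x) = 2 by [ring];
    rewrite pnatr_eq0.
by apply: crdE; rewrite /unstereo crdZ !crdv E1 ?E /stereo /=; field.
Qed.

Lemma unstereo_unit w : dot (unstereo w) (unstereo w) = 1.
Proof.
have n0 : 1 + sqn w != 0 by rewrite gt_eqF // ltr_wpDr ?sqn_ge0.
rewrite dotE !crdZ !crdv.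
have -> (a : R) : a * (2 * w.1) * (a * (2 * w.1)) + a * (2 * w.2) * (a * (2 * w.2))
   + a * (sqn w - 1) * (a * (sqn w - 1)) = (a * (1 + sqn w)) ^+ 2 by rewrite /sqn; ring.
by rewrite mulVf // expr1n.
Qed.

Lemma cont_unstereo (T : topologicalType) (w : T -> P) :
  continuous w -> continuous (fun x => unstereo (w x)).
Proof.
move=> cw; have c1 := cont_comp2 (@cont_fst _ _) cw.
have c2 := cont_comp2 (@cont_snd _ _) cw.
have n0 x : 1 + sqn (w x) != 0 by rewrite gt_eqF // ltr_wpDr ?sqn_ge0.
have cs : continuous (fun x => sqn (w x)) by rewrite /sqn; contR.
rewrite /unstereo; apply: cont_vZ; first by apply: contV => //; contR.
by apply: cont_vec3; contR.
Qed.

Lemma cont_stereo (T : topologicalType) (f : T -> V) : continuous f ->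
  (forall x, dot (f x) (f x) = 1) -> (forall x, f x != e3 R) ->
  continuous (fun x => stereo (f x)).
Proof.
move=> cf f1 fe; have n0 x : 1 - crd 2 (f x) != 0 by rewrite gt_eqF // unit_e3.
have c k : continuous (fun x => crd k (f x)) by exact: cont_crd.
have c0 := c 0; have c1 := c 1; have c2 := c 2.
have ci : continuous (fun x => (1 - crd 2 (f x))^-1) by apply: contV => //; contR.
by rewrite /stereo; apply: cont_pair; contR.
Qed.

Definition has_direction3 (g T : R -> V) : Prop := forall s0 e, 0 < e ->
  exists2 d, 0 < d & forall s t, s0 - d < s -> s < t -> t < s0 + d ->
    exists2 k, 0 < k & forall i, (i < 3)%N ->
      `|crd i (g t) - crd i (g s) - k * crd i (T s0)| <= e * k.

(** The differential of [stereo] at [x], applied to [v]. *)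
Definition stereo_dir (x v : V) : P :=
  ((crd 0 v * (1 - crd 2 x) + crd 0 x * crd 2 v) / (1 - crd 2 x) ^+ 2,
   (crd 1 v * (1 - crd 2 x) + crd 1 x * crd 2 v) / (1 - crd 2 x) ^+ 2).

Lemma cont_near (f : R -> R) (s0 e : R) : continuous f -> 0 < e ->
  exists2 d, 0 < d & forall s, s0 - d < s -> s < s0 + d -> `|f s - f s0| <= e.
Proof.
move=> /(_ s0) /cvgrPdist_le /(_ e) cf e0.
have : \forall z \near s0, `|f s0 - f z| <= e by exact: cf.
move=> /nbhs_ballP[d /= d0 dP]; exists d => // s h1 h2.
by rewrite distrC; apply: dP; rewrite /ball /= ltr_norml; lra.
Qed.

(** A secant of a projected curve is a combination of two coordinate increments [v] and [w] whose
    coefficients [a] and [b] are nearly constant; this bounds the error. *)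
Lemma direction_step (a b v w v0 w0 a0 b0 k e e' m : R) : 0 < k -> 0 <= e' -> e' <= 1 ->
  `|v - k * v0| <= e' * k -> `|w - k * w0| <= e' * k ->
  `|a - a0| <= e' -> `|b - b0| <= e' ->
  `|v0| <= m -> `|w0| <= m -> `|a0| <= m -> `|b0| <= m ->
  e' * (4 * m + 2) <= e ->
  `|a * v + b * w - k * (a0 * v0 + b0 * w0)| <= e * k.
Proof.
move=> k0 e'0 e'1 hv hw ha hb v0m w0m a0m b0m ee.
have m0 : 0 <= m by exact: le_trans (normr_ge0 v0) v0m.
have one (x y x0 y0 : R) : `|y - k * y0| <= e' * k -> `|x - x0| <= e' -> `|y0| <= m ->
    `|x0| <= m -> `|x * y - k * (x0 * y0)| <= e' * (2 * m + 1) * k.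
  move=> hy hx hy0 hx0.
  have -> : x * y - k * (x0 * y0) = x * (y - k * y0) + k * (y0 * (x - x0)) by ring.
  apply: le_trans (ler_normD _ _) _; rewrite !normrM (gtr0_norm k0).
  have xm : `|x| <= m + 1.
    have -> : x = x0 + (x - x0) by ring.
    by apply: le_trans (ler_normD _ _) _; lra.
  have h1 : `|x| * `|y - k * y0| <= (m + 1) * (e' * k).
    by apply: ler_pM.
  have h2 : `|y0| * `|x - x0| <= m * e' by apply: ler_pM.
  have h3 : k * (`|y0| * `|x - x0|) <= k * (m * e') by rewrite ler_pM2l.
  by apply: le_trans (lerD h1 h3) _; lra.
have -> : a * v + b * w - k * (a0 * v0 + b0 * w0)
  = (a * v - k * (a0 * v0)) + (b * w - k * (b0 * w0)) by ring.
apply: le_trans (ler_normD _ _) _.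
apply: (@le_trans _ _ (e' * (4 * m + 2) * k)); last by rewrite ler_pM2r.
have := one _ _ _ _ hv ha v0m a0m; have := one _ _ _ _ hw hb w0m b0m; lra.
Qed.

Lemma stereo_direction (g T : R -> V) : continuous g ->
  (forall s, dot (g s) (g s) = 1) -> (forall s, g s != e3 R) ->
  has_direction3 g T ->
  has_direction (fun s => stereo (g s)) (fun s => stereo_dir (g s) (T s)).
Proof.
move=> cg g1 ge dir s0 e e0.
have n0 s : 1 - crd 2 (g s) != 0 by rewrite gt_eqF // unit_e3.
pose A s := (1 - crd 2 (g s))^-1; pose B i s := crd i (g s) * A s.
have cA : continuous A.
  have c2 : continuous (fun x => crd 2 (g x)) by exact: cont_crd.
  by apply: contV => //; contR.
have cB i : continuous (B i) by apply: contM => //; exact: cont_crd.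
have [m [m0 [T0m T1m T2m] Am [BA0m BA1m] [B0m B1m]]] : exists m, [/\ 0 <= m,
    [/\ `|crd 0 (T s0)| <= m, `|crd 1 (T s0)| <= m & `|crd 2 (T s0)| <= m],
    `|A s0| <= m, `|B 0 s0 * A s0| <= m /\ `|B 1 s0 * A s0| <= m &
    `|B 0 s0| <= m /\ `|B 1 s0| <= m].
  exists (`|crd 0 (T s0)| + `|crd 1 (T s0)| + `|crd 2 (T s0)| + `|A s0|
    + `|B 0 s0 * A s0| + `|B 1 s0 * A s0| + `|B 0 s0| + `|B 1 s0|).
  have := normr_ge0 (crd 0 (T s0)); have := normr_ge0 (crd 1 (T s0)).
  have := normr_ge0 (crd 2 (T s0)); have := normr_ge0 (A s0).
  have := normr_ge0 (B 0 s0 * A s0); have := normr_ge0 (B 1 s0 * A s0).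
  have := normr_ge0 (B 0 s0); have := normr_ge0 (B 1 s0).
  by do !split; lra.
pose e' := Num.min 1 (e / (4 * m + 2)).
have q0 : 0 < 4 * m + 2 by lra.
have e'0 : 0 < e' by rewrite lt_min ltr01 divr_gt0.
have e'1 : e' <= 1 by rewrite ge_min lexx.
have e'e : e' * (4 * m + 2) <= e by rewrite -ler_pdivlMr // ge_min lexx orbT.
pose e2 := e' / (2 * (m + 1)).
have m1 : 0 < m + 1 by lra.
have e20 : 0 < e2 by rewrite divr_gt0 // mulr_gt0.
have e2e : e2 * (2 * (m + 1)) = e' by rewrite divfK // gt_eqF // mulr_gt0.
have e2m : e2 <= e' by nra.
clearbody e2 e'.
have [d1 d10 D1] := dir s0 e' e'0.
have [d2 d20 D2] := cont_near s0 cA e20.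
have [d3 d30 D3] := cont_near s0 (cB 0) e20.
have [d4 d40 D4] := cont_near s0 (cB 1) e20.
have [d d0 [h1 h2 h3 h4]] : exists2 d, 0 < d & [/\ d <= d1, d <= d2, d <= d3 & d <= d4].
  exists (Num.min (Num.min d1 d2) (Num.min d3 d4)); first by rewrite !lt_min d10 d20 d30.
  by split; rewrite !ge_min lexx ?orbT.
exists d => // s t ss st tt.
have [a1 a2 a3 a4] : [/\ s0 - d1 < s, t < s0 + d1, s0 - d2 < t & t < s0 + d2].
  by clear - ss st tt h1 h2; split; lra.
have [b1 b2 b3 b4] : [/\ s0 - d3 < s, s < s0 + d3, s0 - d4 < s & s < s0 + d4].
  by clear - ss st tt h3 h4; split; lra.
have [k k0 K] := D1 s t a1 st a2.
have BA i : `|B i s - B i s0| <= e2 -> `|B i s0| <= m ->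
    `|B i s * A t - B i s0 * A s0| <= e'.
  move=> hb hm.
  have -> : B i s * A t - B i s0 * A s0
    = B i s * (A t - A s0) + (B i s - B i s0) * A s0 by ring.
  apply: le_trans (ler_normD _ _) _.
  rewrite (normrM (B i s)) (normrM (B i s - _)).
  have ha : `|A t - A s0| <= e2 by exact: D2.
  have bm : `|B i s| <= m + 1.
    have -> : B i s = B i s0 + (B i s - B i s0) by ring.
    by apply: le_trans (ler_normD _ _) _; clear - hb hm e2m e'1; lra.
  have p1 : `|B i s| * `|A t - A s0| <= (m + 1) * e2 by apply: ler_pM.
  have p2 : `|B i s - B i s0| * `|A s0| <= e2 * m by apply: ler_pM.
  apply: le_trans (lerD p1 p2) _; rewrite -e2e -subr_ge0.
  by have -> : e2 * (2 * (m + 1)) - ((m + 1) * e2 + e2 * m) = e2 by [ring]; exact: ltW.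
exists k => //.
have step i : (i < 2)%N -> `|B i s - B i s0| <= e2 -> `|B i s0| <= m -> `|B i s0 * A s0| <= m ->
    `|crd i (T s0)| <= m ->
    `|crd i (g t) / (1 - crd 2 (g t)) - crd i (g s) / (1 - crd 2 (g s))
      - k * ((crd i (T s0) * (1 - crd 2 (g s0)) + crd i (g s0) * crd 2 (T s0))
        / (1 - crd 2 (g s0)) ^+ 2)| <= e * k.
  move=> i2 hb hm hm2 hT.
  have -> : crd i (g t) / (1 - crd 2 (g t)) - crd i (g s) / (1 - crd 2 (g s))
      - k * ((crd i (T s0) * (1 - crd 2 (g s0)) + crd i (g s0) * crd 2 (T s0))
        / (1 - crd 2 (g s0)) ^+ 2) =
      A t * (crd i (g t) - crd i (g s)) + (B i s * A t) * (crd 2 (g t) - crd 2 (g s))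
      - k * (A s0 * crd i (T s0) + (B i s0 * A s0) * crd 2 (T s0)).
    by rewrite /B /A; field; rewrite !n0.
  have := @direction_step (A t) (B i s * A t) (crd i (g t) - crd i (g s))
    (crd 2 (g t) - crd 2 (g s)) (crd i (T s0)) (crd 2 (T s0)) (A s0) (B i s0 * A s0) k e e' m.
  apply => //; try exact: ltW.
  - exact: (K i (ltnW i2)).
  - exact: K.
  - by apply: le_trans e2m; exact: D2.
  - exact: BA.
by split; apply: step => //; [exact: D3|exact: D4].
Qed.

Lemma framedE (H : V -> V) x k : dot x x = 1 -> x != e3 R -> dot (H x) x = 0 ->
  crd k (framed H x) =
  crd k (H x) + crd 2 (H x) / (1 - crd 2 x) * (crd k x - crd k (e3 R)).
Proof.
move=> x1 xe hx; have n0 : 1 - crd 2 x != 0 by rewrite gt_eqF // unit_e3.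
move: x1 hx; rewrite !dotE => x1 hx.
have uu : dot (x - e3 R) (x - e3 R) = 2 * (1 - crd 2 x).
  by rewrite dotE !crdL !crdv; nra.
have uH : dot (x - e3 R) (H x) = - crd 2 (H x).
  by rewrite dotE !crdL !crdv; nra.
by rewrite /framed /refl uu uH !crdL; field.
Qed.

(** The projection is conformal with the factor 1 / (1 - crd 2 x), and the cross product with [x] is
    a quarter turn of the tangent plane. So the frame components of a tangent [H x] are those of the
    projected direction, rescaled and turned by a quarter. *)
Lemma framed_dir (H : V -> V) x (eps : R) : dot x x = 1 -> x != e3 R ->
  dot (H x) x = 0 -> eps = 1 \/ eps = -1 ->
  let T := stereo_dir x (eps *: cross x (H x)) in
  (crd 0 (framed H x) = - (1 - crd 2 x) * eps * T.2) *
  (crd 1 (framed H x) = (1 - crd 2 x) * eps * T.1).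
Proof.
move=> x1 xe hx e1; have n0 : 1 - crd 2 x != 0 by rewrite gt_eqF // unit_e3.
have ee : eps * eps = 1 by case: e1 => ->; rewrite ?mulr1 ?mulrNN ?mulr1.
rewrite !framedE //; move: x1 hx; rewrite !dotE => x1 hx.
rewrite !crdv /stereo_dir /cross /= !crdZ !crdv.
have E2 : crd 2 x ^+ 2 = 1 - crd 0 x ^+ 2 - crd 1 x ^+ 2 by rewrite -x1; ring.
split.
  have -> : - (1 - crd 2 x) * eps * ((eps * (crd 2 x * crd 0 (H x) - crd 0 x * crd 2 (H x)) *
      (1 - crd 2 x) + crd 1 x * (eps * (crd 0 x * crd 1 (H x) - crd 1 x * crd 0 (H x))))
      / (1 - crd 2 x) ^+ 2) =
     (eps * eps) * (- ((crd 2 x * crd 0 (H x) - crd 0 x * crd 2 (H x)) * (1 - crd 2 x)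
      + crd 1 x * (crd 0 x * crd 1 (H x) - crd 1 x * crd 0 (H x))) / (1 - crd 2 x)) by field.
  rewrite ee mul1r subr0; apply: (mulIf n0); rewrite divfK // mulrDl mulrAC divfK //.
  have : crd 0 x * (crd 0 (H x) * crd 0 x + crd 1 (H x) * crd 1 x + crd 2 (H x) * crd 2 x) = 0.
    by rewrite hx mulr0.
  have : crd 0 (H x) * (crd 2 x ^+ 2 - (1 - crd 0 x ^+ 2 - crd 1 x ^+ 2)) = 0.
    by rewrite E2 subrr mulr0.
  lra.
have -> : (1 - crd 2 x) * eps * ((eps * (crd 1 x * crd 2 (H x) - crd 2 x * crd 1 (H x)) *
      (1 - crd 2 x) + crd 0 x * (eps * (crd 0 x * crd 1 (H x) - crd 1 x * crd 0 (H x))))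
      / (1 - crd 2 x) ^+ 2) =
     (eps * eps) * (((crd 1 x * crd 2 (H x) - crd 2 x * crd 1 (H x)) * (1 - crd 2 x)
      + crd 0 x * (crd 0 x * crd 1 (H x) - crd 1 x * crd 0 (H x))) / (1 - crd 2 x)) by field.
rewrite ee mul1r subr0; apply: (mulIf n0); rewrite divfK // mulrDl mulrAC divfK //.
have : crd 1 x * (crd 0 (H x) * crd 0 x + crd 1 (H x) * crd 1 x + crd 2 (H x) * crd 2 x) = 0.
  by rewrite hx mulr0.
have : crd 1 (H x) * (crd 2 x ^+ 2 - (1 - crd 0 x ^+ 2 - crd 1 x ^+ 2)) = 0.
  by rewrite E2 subrr mulr0.
lra.
Qed.

Lemma polar_quarter (w : P) t : polar w t -> polar (- w.2, w.1) (t + pi / 2).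
Proof.
by move=> [r r0 ->]; exists r; rewrite // cosDpihalf sinDpihalf mulrN.
Qed.

Lemma framed_polar (H : V -> V) x (eps : R) t : dot x x = 1 -> x != e3 R ->
  dot (H x) x = 0 -> eps = 1 \/ eps = -1 ->
  polar (stereo_dir x (eps *: cross x (H x))) t ->
  polar (fst2 (framed H x)) (t + (if eps == 1 then pi / 2 else pi / 2 + pi)).
Proof.
move=> x1 xe hx e1 pT; have n0 := unit_e3 x1 xe.
have [E0 E1] := framed_dir x1 xe hx e1; rewrite /= in E0 E1.
have /(polar_scale n0) := polar_quarter pT; rewrite /fst2 E0 E1.
case: e1 => -> /=; rewrite ?eqxx.
  by rewrite !mulr1 mulrN mulNr.
have -> : (-1 == 1 :> R) = false by apply/eqP; lra.
move=> /polar_opp[r r0 [p1 p2]]; exists r => //; rewrite [t + (_ + _)]addrA.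
congr pair; [apply: eq_trans p1|apply: eq_trans p2];
  rewrite /stereo_dir /=; ring.
Qed.

End Stereographic.

(** * Functions prescribed along curves *)

Section Curves.
Variable R : realType.
Local Notation V := 'rV[R]_3.
Local Notation P := (R * R)%type.

Definition clamp (s : R) : R := Num.max 0 (Num.min 1 s).

Lemma clamp01 s : 0 <= clamp s <= 1.
Proof. by rewrite /clamp le_max lexx ge_max ler01 ge_min lexx. Qed.

Lemma clampK s : 0 <= s <= 1 -> clamp s = s.
Proof. by move=> /andP[s0 s1]; rewrite /clamp min_r // max_r. Qed.

Lemma cont_clamp (l : R -> R) :
  (forall s, `[0, 1]%classic s -> {for s, continuous l}) ->
  continuous (fun s => l (clamp s)).
Proof.
move=> cl s; apply: (@continuous_comp R R R clamp l).
  apply: (@continuous_max R R (cst 0) (fun s => Num.min 1 s)); first exact: cvg_cst.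
  by apply: (@continuous_min R R (cst 1) id); [exact: cvg_cst|exact: cvg_id].
by apply: cl; rewrite itv01 clamp01.
Qed.

(** Compatible values along finitely many arcs form a bounded continuous function on their closed
    union, which Tietze's theorem extends. *)
Lemma paste n (g : 'I_n -> R -> V) (l : 'I_n -> R -> R) :
  (forall i, continuous (g i)) ->
  (forall i j s t, 0 <= s <= 1 -> 0 <= t <= 1 -> g i s = g j t ->
     l i s = l j t) ->
  (forall i s, `[0, 1]%classic s -> {for s, continuous (l i)}) ->
  exists2 L : V -> R, continuous L &
    forall i s, 0 <= s <= 1 -> L (g i s) = l i s.
Proof.
move=> cg wd cl.
pose A := \bigcup_(i in [set: 'I_n]) (g i @` `[0, 1]).
pose pick x (z : 'I_n * R) := 0 <= z.2 <= 1 /\ g z.1 z.2 = x.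
pose f x := if pselect (exists z, pick x z) is left e
  then l (projT1 (cid e)).1 (projT1 (cid e)).2 else 0.
have fE i s : 0 <= s <= 1 -> f (g i s) = l i s.
  move=> s01; rewrite /f; case: pselect => [e|]; last by case; exists (i, s).
  by case: (projT2 (cid e)) => z01 E; exact: wd.
have closedA (C : set R) : closed C ->
    closed (\bigcup_(i in [set: 'I_n]) (g i @` (`[0, 1] `&` [set s | C (l i (clamp s))]))).
  move=> cC; apply: closed_bigcup; [exact: finite_finset|move=> i _].
  apply: compact_closed; first exact: norm_hausdorff.
  apply: continuous_compact; first exact: continuous_subspaceT.
  apply: compact_closedI; first exact: segment_compact.
  have /continuous_closedP := cont_clamp (cl i); exact.
have cf : {within A, continuous (f : V -> R^o)}.
  apply/continuous_closedP => C cC; apply/closed_subspaceP.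
  exists (\bigcup_(i in [set: 'I_n]) (g i @` (`[0, 1] `&` [set s | C (l i (clamp s))]))).
    exact: closedA.
  apply/seteqP; split=> x [].
    move=> [i _ [s [s01 Cs] <-]] Ax; split=> //.
    rewrite itv01 in s01; suff : C (f (g i s)) by [].
    by rewrite fE //; move: Cs; rewrite /= clampK.
  move=> Cx [i _ [s s01 E]]; split; last by exists i => //; exists s.
  exists i => //; exists s => //; split=> //; rewrite itv01 in s01.
  suff : C (l i (clamp s)) by [].
  by rewrite clampK // -fE // E.
have [M M0 Mf] : exists2 M, 0 < M & forall x, A x -> `|f x| <= M.
  have bnd i : exists M, forall s, 0 <= s <= 1 -> `|l i s| <= M.
    have cn : continuous (fun s => `|l i (clamp s)|).
      by move=> s; apply: (@continuous_comp R R R _ (@Num.norm _ R));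
        [exact: (cont_clamp (cl i))|exact: norm_continuous].
    have [|c _ cm] := @EVT_max R (fun s => `|l i (clamp s)|) 0 1 ler01.
      exact: continuous_subspaceT.
    exists `|l i (clamp c)| => s s01; have := cm s; rewrite in_itv /= clampK //; exact.
  have [m mP] := choice bnd.
  exists (1 + \sum_i `|m i|); first by rewrite ltr_pwDl // sumr_ge0.
  move=> x [i _ [s s01 <-]]; rewrite itv01 in s01; rewrite fE //.
  apply: le_trans (mP i s s01) _; rewrite (bigD1 i) //=.
  apply: le_trans (ler_norm _) _; rewrite addrCA lerDl addr_ge0 ?sumr_ge0 //.
have [||L [fL cL _]] := @continuous_bounded_extension _ _ _ A _ f M M0 cf Mf.
- exact: pseudometric_normal.
- have -> : A = \bigcup_(i in [set: 'I_n]) (g i @` (`[0, 1] `&` [set s | setT (l i (clamp s))])).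
    by apply: eq_bigcupr => i _; rewrite setIT.
  exact: closedA.
exists L => // i s s01; rewrite -fE // fL // inE.
by exists i => //; exists s => //; rewrite itv01.
Qed.

Lemma sum_anglesE (zs : seq P) (th : P -> R) : sum_angles zs th = \sum_(z <- zs) th z.
Proof. by elim: zs => [|z zs IH] /=; rewrite ?big_nil ?big_cons ?IH. Qed.

End Curves.

(** * Systems of circles on the sphere and their outer sides *)

Section CurveSystem.
Variable R : realType.
Local Notation V := 'rV[R]_3.
Local Notation P := (R * R)%type.

(* The zero set of the radial part [h] of [H] is a union of circles [g i], such
   that the side of [g i] where [h] is positive contains the point [p] and all
   other circles. *)
Record curve_system (n : nat) (H : V -> V) (g : 'I_n -> R -> V) (p : V) : Prop := {
  cs_cont : forall i, continuous (g i);
  cs_unit : forall i s, dot (g i s) (g i s) = 1;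
  cs_period : forall i s, g i (s + 1) = g i s;
  cs_inj : forall i s t, s < t -> t < s + 1 -> g i s <> g i t;
  cs_disj : forall i j s t, i != j -> g i s <> g j t;
  cs_on : forall i s, dot (H (g i s)) (g i s) = 0;
  cs_zero : forall x, dot x x = 1 -> dot (H x) x = 0 -> exists i s, g i s = x;
  cs_dir : forall i, exists2 eps, eps = 1 \/ eps = -1 &
    has_direction3 (g i) (fun s => eps *: cross (g i s) (H (g i s)));
  cs_pole : dot p p = 1 /\ 0 < dot (H p) p;
  cs_outer : forall i, exists Y : set V,
    [/\ connected Y, forall y, Y y -> dot y y = 1 /\ forall s, g i s <> y,
        Y p, forall j s, j != i -> Y (g j s) &
        exists s, forall r, 0 < r -> exists y, [/\ Y y, ball (g i s) r y & 0 < dot (H y) y]];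
  cs_side : forall x, dot x x = 1 -> dot (H x) x = 0 ->
    (forall r, 0 < r -> exists y, [/\ dot y y = 1, ball x r y & 0 < dot (H y) y]) /\
    exists2 r, 0 < r & forall y z, dot y y = 1 -> dot z z = 1 ->
      ball x r y -> ball x r z -> 0 < dot (H y) y -> 0 < dot (H z) z ->
      exists W : set V, [/\ connected W, W y, W z &
        forall w, W w -> dot w w = 1 /\ 0 < dot (H w) w] }.

Lemma stereo_local (x : V) : crd 2 x != 1 -> {for x, continuous (@stereo R)}.
Proof.
move=> x2; have c k : {for x, continuous (fun y : V => crd k y)} by exact: crd_continuous.
have c2 : continuous (fun y : V => crd 2 y) by exact: crd_continuous.
have cs : continuous (fun y : V => 1 - crd 2 y) by contR.
have x2' : 1 - crd 2 x != 0 by rewrite subr_eq0 eq_sym.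
exact: (cvg_pair (cvgM (c 0%N) (cvgV x2' (cs x))) (cvgM (c 1%N) (cvgV x2' (cs x)))).
Qed.

Lemma stereo_inj (x y : V) : dot x x = 1 -> dot y y = 1 -> x != e3 R -> y != e3 R ->
  stereo x = stereo y -> x = y.
Proof. by move=> x1 y1 xe ye E; rewrite -(stereoK x1 xe) E stereoK. Qed.

Lemma unstereo_crd2 (w : P) : crd 2 (unstereo w) < 1.
Proof.
have n0 : 0 < 1 + sqn w by rewrite ltr_wpDr ?sqn_ge0.
by rewrite /unstereo crdZ crdv mulrC ltr_pdivrMr // mul1r; lra.
Qed.

Lemma unstereo_neq (w : P) : unstereo w != e3 R.
Proof.
by apply/eqP => /(congr1 (crd 2)); rewrite crdv => E; have := unstereo_crd2 w; rewrite E ltxx.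
Qed.

Lemma unstereoK (w : P) : stereo (unstereo w) = w.
Proof.
have n0 : 1 + sqn w != 0 by rewrite gt_eqF // ltr_wpDr ?sqn_ge0.
have E : 1 - crd 2 (unstereo w) = 2 / (1 + sqn w).
  by rewrite /unstereo crdZ crdv; field.
by rewrite /stereo E /unstereo !crdZ !crdv [RHS]surjective_pairing; congr pair; field.
Qed.

(** Points that the projected curve does not encircle; the pole, which lies at infinity, counts
    among them. *)
Definition outside (g : R -> V) (x : V) :=
  x = e3 R \/ unwound (fun s => stereo (g s)) (stereo x).

(** Winding numbers are locally constant off the curve. Near the pole this holds because far points
    of the plane are not encircled. *)
Lemma outside_const (g : R -> V) (Y : set V) : continuous g ->
  (forall s, dot (g s) (g s) = 1) -> (forall s, g s != e3 R) -> g 1 = g 0 ->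
  connected Y -> (forall y, Y y -> dot y y = 1 /\ forall s, g s <> y) ->
  forall x y, Y x -> Y y -> outside g x -> outside g y.
Proof.
move=> cg g1 ge g01 cY Yg; apply: connected_local_const => // x Yx.
have cc := cont_stereo cg g1 ge.
have c1 : stereo (g 1) = stereo (g 0) by rewrite g01.
have [-> |xe] := eqVneq x (e3 R).
  have [M MP] := unwound_far cc c1.
  have [M' M'0 MM] : exists2 M', 0 <= M' & M <= M'.
    by exists `|M|; [exact: normr_ge0|exact: ler_norm].
  (* On the sphere, the squared norm of the projection is (1 + crd 2 y) / (1 - crd 2 y). The
     condition says that it exceeds [M'], in a form that is meaningful at the pole. *)
  exists [set y : V | 0 < 1 + crd 2 y - M' * (1 - crd 2 y)].
    have c2 : continuous (fun y : V => crd 2 y) by exact: crd_continuous.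
    have : continuous (fun y : V => 1 + crd 2 y - M' * (1 - crd 2 y)) by contR.
    move=> /(_ (e3 R)) cf; apply: (@cvgr_gt _ _ _ _ _ _ cf).
    by rewrite /e3 !crdv subrr mulr0 subr0.
  move=> y z _ _ Uz Yz _; have [-> |ze] := eqVneq z (e3 R); [by left|right].
  have [z1 _] := Yg z Yz; have n0 := unit_e3 z1 ze.
  apply: MP; apply: le_lt_trans MM _.
  have -> : sqn (stereo z) = (1 + crd 2 z) / (1 - crd 2 z).
    rewrite /sqn /stereo /= !expr_div_n -mulrDl.
    have -> : crd 0 z ^+ 2 + crd 1 z ^+ 2 = (1 + crd 2 z) * (1 - crd 2 z).
      by rewrite dotE in z1; rewrite -[1 in RHS]z1; nra.
    by field; rewrite gt_eqF.
  by rewrite ltr_pdivlMr //; move: Uz => /=; lra.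
have [x1 xg] := Yg x Yx; have n0 := unit_e3 x1 xe.
have [|r r0 rP] := @unwound_local R _ (stereo x) cc c1.
  by move=> s _ /stereo_inj E; apply: (xg s); apply: E.
exists ([set y : V | crd 2 y < 1] `&` [set y | ball (stereo x) r (stereo y)]).
  apply: filterI.
    have cf : {for x, continuous (fun y : V => crd 2 y)} by exact: crd_continuous.
    by apply: (@cvgr_lt _ _ _ _ _ _ cf); lra.
  have /= cf := @stereo_local x ltac:(by rewrite lt_eqF //; lra).
  exact: (cf _ (nbhsx_ballx _ _ r0)).
move=> y z [/= y2 By] Yy [/= z2 Bz] Yz [ye|uy].
  by move: y2; rewrite ye /e3 crdv ltxx.
by right; exact: rP uy.
Qed.

Lemma periodic_rep (T : Type) (f : R -> T) : (forall s, f (s + 1) = f s) ->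
  forall s, exists2 s', 0 <= s' < 1 & f s' = f s.
Proof.
move=> fp s.
have fn (k : nat) t : f (t + k%:R) = f t.
  by elim: k => [|k IH]; rewrite ?addr0 // -natr1 addrA fp.
exists (s - (Num.floor s)%:~R); first by rewrite subr_ge0 floor_le_tmp ltrBlDl -intrD1 floorD1_gt.
case: (Num.floor s) => k; last rewrite NegzE mulrNz opprK; rewrite -pmulrn ?fn //.
by rewrite -(fn k) subrK.
Qed.

Lemma curve_shift n H (g : 'I_n -> R -> V) p (a : 'I_n -> R) : curve_system H g p ->
  curve_system H (fun i s => g i (a i + s)) p.
Proof.
case=> cg g1 gp gi gd on zr dir pole out side; split.
- move=> i; have ca : continuous (fun s : R => a i + s) by contR.
  exact: (cont_comp2 (cg i) ca).
- by move=> i s; exact: g1.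
- by move=> i s; rewrite addrA gp.
- by move=> i s t st ts; apply: gi; lra.
- by move=> i j s t ij; exact: gd.
- by move=> i s; exact: on.
- move=> x x1 /(zr x x1) [i [s <-]]; exists i, (s - a i).
  by rewrite addrC subrK.
- move=> i; have [eps e1 D] := dir i; exists eps => // s0 e e0.
  have [d d0 dP] := D (a i + s0) e e0; exists d => // s t h1 h2 h3.
  by apply: dP; lra.
- exact: pole.
- move=> i; have [Y [cY Yg Yp Yj [s sP]]] := out i; exists Y; split=> //.
  + by move=> y /Yg[? ?]; split.
  + by move=> j t /Yj.
  + by exists (s - a i) => r /sP; rewrite [a i + _]addrC subrK.
- exact: side.
Qed.

Section Evaluation.
Variables (n : nat) (H : V -> V) (g : 'I_n -> R -> V).
Hypotheses (cH : continuous H) (H0 : forall x, dot x x = 1 -> H x != 0).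
Hypothesis sys : curve_system H g (e3 R).

Let h (x : V) := dot (H x) x.

Lemma curve_neq_pole i s : g i s != e3 R.
Proof.
apply/eqP => E; have [_] := cs_pole sys; rewrite -E.
by rewrite (cs_on sys) ltxx.
Qed.

Let c i s := stereo (g i s).

Let cc i : continuous (c i).
Proof.
by apply: cont_stereo; [exact: (cs_cont sys)|exact: (cs_unit sys)|exact: curve_neq_pole].
Qed.

Let g01 i : g i 1 = g i 0. Proof. by rewrite -[1]add0r (cs_period sys). Qed.

Let c_inj i j s t : c i s = c j t -> g i s = g j t.
Proof. by apply: stereo_inj; rewrite ?(cs_unit sys) ?curve_neq_pole. Qed.

(** At one point of the circle, the outer region arrives through positive values of [h]. This
    propagates along the circle: positive points near a common point of it are joined by a connected
    set on which [h] is positive, and which therefore avoids the circle. *)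
Lemma positive_side i s : exists2 r, 0 < r & forall y, dot y y = 1 ->
  ball (g i s) r y -> 0 < h y -> outside (g i) y.
Proof.
have link W y z : connected W -> (forall w, W w -> dot w w = 1 /\ 0 < h w) ->
    W y -> W z -> outside (g i) y -> outside (g i) z.
  move=> cW Wh; apply: outside_const => //.
  - exact: cs_cont sys i.
  - exact: cs_unit sys i.
  - exact: curve_neq_pole.
  - move=> w /Wh[w1 hw]; split=> // t E; move: hw.
    by rewrite /h -E (cs_on sys) ltxx.
have zero t : dot (g i t) (g i t) = 1 /\ dot (H (g i t)) (g i t) = 0.
  by rewrite (cs_unit sys) (cs_on sys).
pose Q t := forall r, 0 < r ->
  exists y, [/\ dot y y = 1, ball (g i t) r y, 0 < h y & outside (g i) y].
suff Qs : Q s.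
  have [t1 t0] := zero s; have [_ [r r0 rP]] := cs_side sys t1 t0; exists r => // y y1 By hy.
  have [z [z1 Bz hz oz]] := Qs r r0.
  have [W [cW Wz Wy Wh]] := rP z y z1 y1 Bz By hz hy.
  exact: link cW Wh Wz Wy oz.
have [Y [cY Yg Ye _ [s1 s1P]]] := cs_outer sys i.
have Q1 : Q s1.
  move=> r /s1P[y [Yy By hy]]; have [y1 _] := Yg y Yy; exists y; split=> //.
  apply: outside_const cY Yg _ _ Ye Yy _ => //; last by left.
  - exact: cs_cont sys i.
  - exact: cs_unit sys i.
  - exact: curve_neq_pole.
apply: (@connected_local_const R [set: R] Q _ _ s1 s I I Q1).
  by apply/connected_intervalP.
move=> t _; have [t1 t0] := zero t; have [_ [r r0 rP]] := cs_side sys t1 t0.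
have r2 : 0 < r / 2 by lra.
exists [set u | ball (g i t) (r / 2) (g i u)].
  have cf : {for t, continuous (g i)} by exact: (cs_cont sys).
  by apply: cf; exact: nbhsx_ballx.
move=> u v /= Bu _ Bv _ Qu e e0.
have [y [y1 By hy oy]] := Qu _ r2.
have [v1 v0] := zero v; have [+ _] := cs_side sys v1 v0.
have er : 0 < Num.min e (r / 2) by rewrite lt_min e0.
move=> /(_ _ er) [z [z1 Bz hz]]; exists z; split=> //.
  by apply: le_ball Bz; rewrite ge_min lexx.
have Bz' : ball (g i v) (r / 2) z by apply: le_ball Bz; rewrite ge_min lexx orbT.
have [W [cW Wy Wz Wh]] := rP y z y1 z1
  (ltac:(by rewrite [r]splitr; exact: ball_triangle Bu By))
  (ltac:(by rewrite [r]splitr; exact: ball_triangle Bv Bz')) hy hz.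
exact: link cW Wh Wy Wz oy.
Qed.

End Evaluation.

End CurveSystem.

(** * The degree of a field from its circles of tangency *)

Section Evaluation.
Variable R : realType.
Local Notation V := 'rV[R]_3.
Local Notation P := (R * R)%type.

Lemma cont_stereo_dir (T : topologicalType) (x v : T -> V) : continuous x ->
  continuous v -> (forall s, 1 - crd 2 (x s) != 0) ->
  continuous (fun s => stereo_dir (x s) (v s)).
Proof.
move=> cx cv n0.
have x0 : continuous (fun s => crd 0 (x s)) by exact: cont_crd.
have x1 : continuous (fun s => crd 1 (x s)) by exact: cont_crd.
have x2 : continuous (fun s => crd 2 (x s)) by exact: cont_crd.
have v0 : continuous (fun s => crd 0 (v s)) by exact: cont_crd.
have v1 : continuous (fun s => crd 1 (v s)) by exact: cont_crd.
have v2 : continuous (fun s => crd 2 (v s)) by exact: cont_crd.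
have d2 : continuous (fun s => 1 - crd 2 (x s)) by contR.
have ci : continuous (fun s => ((1 - crd 2 (x s)) ^+ 2)^-1).
  by apply: contV; [move=> s; rewrite expf_neq0|exact: contX].
by rewrite /stereo_dir; apply: cont_pair; apply: (contM _ ci);
  apply: contD; exact: contM.
Qed.

Lemma cont_cross (T : topologicalType) (x v : T -> V) : continuous x ->
  continuous v -> continuous (fun s => cross (x s) (v s)).
Proof.
move=> cx cv.
have x0 : continuous (fun s => crd 0 (x s)) by exact: cont_crd.
have x1 : continuous (fun s => crd 1 (x s)) by exact: cont_crd.
have x2 : continuous (fun s => crd 2 (x s)) by exact: cont_crd.
have v0 : continuous (fun s => crd 0 (v s)) by exact: cont_crd.
have v1 : continuous (fun s => crd 1 (v s)) by exact: cont_crd.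
have v2 : continuous (fun s => crd 2 (v s)) by exact: cont_crd.
by apply: cont_vec3; contR.
Qed.

Record winding (H : V -> V) (eps : R) (g : R -> V) (z : P) (k : R) (thT th : R -> R) : Prop := {
  w_neq0 : k != 0;
  w_dir : lift_on `[0, 1] (fun s => stereo_dir (g s) (eps *: cross (g s) (H (g s)))) thT;
  w_dirk : thT 1 - thT 0 = k;
  w_pt : lift_on `[0, 1] (fun s => sub2 (stereo (g s)) z) th;
  w_ptk : th 1 - th 0 = k }.

Section Lowest.
Variables (n : nat) (H : V -> V) (g : 'I_n -> R -> V).
Hypotheses (cH : continuous H) (H0 : forall x, dot x x = 1 -> H x != 0).
Hypothesis sys : curve_system H g (e3 R).
Hypothesis low : forall i s, (stereo (g i 0)).2 <= (stereo (g i s)).2.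

Let h (x : V) := dot (H x) x.
Let c i s := stereo (g i s).

Let ge := curve_neq_pole sys.
Let g1 := cs_unit sys.

Let cc i : continuous (c i).
Proof. by apply: cont_stereo; [exact: (cs_cont sys)|exact: g1|exact: ge]. Qed.

Let c01 i : c i 1 = c i 0. Proof. by rewrite /c -[1]add0r (cs_period sys). Qed.

Let c_inj i j s t : c i s = c j t -> g i s = g j t.
Proof. by apply: stereo_inj; rewrite ?g1 ?ge. Qed.

(** The point [z] is taken slightly above the lowest point of the projected circle. Being close to
    that circle, it is outside all others. Its own circle winds around it, so it is not on the outer
    side, hence not on the positive one; and it is on no circle, so [h] is negative there. *)
Lemma winding_ex i : exists z eps k thT th, [/\ eps = 1 \/ eps = -1,
  winding H eps (g i) z k thT th,
  forall j, j != i -> unwound (c j) z & h (unstereo z) < 0].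
Proof.
have [eps e1 D] := cs_dir sys i.
pose T s := stereo_dir (g i s) (eps *: cross (g i s) (H (g i s))).
have cT : continuous T.
  have cg : continuous (g i) by exact: (cs_cont sys).
  have ch : continuous (fun s => H (g i s)) by exact: (cont_comp2 cH cg).
  have cX : continuous (fun s => eps *: cross (g i s) (H (g i s))).
    by apply: cont_vZ; [exact: cont_cst|exact: cont_cross].
  by apply: cont_stereo_dir => // s; rewrite gt_eqF // unit_e3 ?g1 ?ge.
have T0 s : T s != 0.
  apply/eqP => T0; have := H0 (g1 i s).
  have [f0 f1] := framed_dir (g1 i s) (ge i s) (cs_on sys i s) e1.
  have f2 := framedE 2 (g1 i s) (ge i s) (cs_on sys i s).
  have n0 : 1 - crd 2 (g i s) != 0 by rewrite gt_eqF // unit_e3 // g1.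
  have u0 : g i s - e3 R != 0 by rewrite subr_eq0 ge.
  have fr0 : framed H (g i s) = 0.
    apply: crdE; rewrite crd_0.
    - by rewrite f0 -/(T s) T0 /= mulr0.
    - by rewrite f1 -/(T s) T0 /= mulr0.
    - by rewrite f2 crdv; field.
  by rewrite -(reflK (H (g i s)) u0) -[refl _ (H _)]/(framed H (g i s)) fr0 refl0 eqxx.

have [||||k k0 [[thT lT dT] [e0 e00 E]]] := @rotation_index R (c i) T (@cc i) cT _ _ T0 _ _ (low i).
- by move=> s; rewrite /c (cs_period sys).
- by move=> s; rewrite /T (cs_period sys).
- by move=> s t st ts /c_inj; exact: (cs_inj sys).
- have cg : continuous (g i) by exact: (cs_cont sys).
  exact: (stereo_direction cg (g1 i) (ge i) D).
pose z e : P := ((c i 0).1, (c i 0).2 + e).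
have cz : continuous z.
  apply: cont_pair; first exact: cont_cst.
  by apply: contD; [exact: cont_cst|exact: cont_id].
have z0 : z 0 = c i 0 by rewrite /z addr0 -surjective_pairing.
have [r r0 rP] := positive_side sys i 0.
have far (j : 'I_n) : \forall e \near (0 : R), j != i -> unwound (c j) (z e).
  have [->|ji] := eqVneq j i.
    by apply: (@filterS _ (nbhs (0 : R)) _ setT) => [e _ //|]; exact: filterT.
  have [Y [cY Yg Ye Yj _]] := cs_outer sys j.
  have u0 : unwound (c j) (c i 0).
    have [E'|//] : outside (g j) (g i 0).
      apply: (outside_const _ _ _ _ cY Yg Ye (Yj i 0 _)).
      - exact: cs_cont sys j.
      - exact: g1.
      - exact: ge.
      - by rewrite -[1]add0r (cs_period sys).
      - by rewrite eq_sym.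
      - by left.
    by have := ge i 0; rewrite E' eqxx.
  have [|r' r'0 r'P] := @unwound_local R (c j) (c i 0) (@cc j) (c01 j).
    by move=> s _ /c_inj; exact: (cs_disj sys).
  have : \forall e \near (0 : R), ball (c i 0) r' (z e).
    have B0 : nbhs (z 0) (ball (c i 0) r') by rewrite z0; exact: nbhsx_ballx.
    exact: (cz 0 _ B0).
  by apply: filterS => e Be _; apply: r'P u0 => //; exact: ballxx.
have near_r : \forall e \near (0 : R), ball (g i 0) r (unstereo (z e)).
  have cu : continuous (fun e => unstereo (z e)) by exact: cont_unstereo.
  have u0 : unstereo (z 0) = g i 0 by rewrite z0 stereoK ?g1 ?ge.
  have B0 : nbhs (unstereo (z 0)) (ball (g i 0) r) by rewrite u0; exact: nbhsx_ballx.
  exact: (cu 0 _ B0).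
have : \forall e \near (0 : R), (forall j, j != i -> unwound (c j) (z e)) /\
    ball (g i 0) r (unstereo (z e)).
  have F := @filter_forall _ 'I_n (fun j e => j != i -> unwound (c j) (z e))
    _ (nbhs_filter (0 : R)) far.
  exact: (filterI F near_r).
move=> /nbhs_ballP[d /= d0 dP].
pose e := Num.min (d / 2) (e0 / 2).
have ee0 : 0 < e by rewrite lt_min; lra.
have ed : e <= d / 2 by rewrite ge_min lexx.
have ee : e < e0 by apply: (@le_lt_trans _ _ (e0 / 2)); [rewrite ge_min lexx orbT|lra].
have [|un Bz] := dP e; first by rewrite /ball /= sub0r normrN gtr0_norm //; lra.
have [th lth dth] := E e ee0 ee.
have not_u := unwound_not lth dth k0.
exists (z e), eps, k, thT, th; split=> //.
have u1 := unstereo_unit (z e); have ue := unstereo_neq (z e).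
have hz : h (unstereo (z e)) <> 0.
  move=> hz; have [j [s js]] := cs_zero sys u1 hz.
  have gp s' : g j (s' + 1) = g j s' by exact: (cs_period sys).
  have [s' s'01 js'] := periodic_rep gp s.
  have s01 : `[0, 1]%classic s' by rewrite itv01; case/andP: s'01 => -> /ltW.
  have cE : c j s' = z e by rewrite /c js' js unstereoK.
  have [ji|ji] := eqVneq j i.
    have [p _] := lth; have := p s' s01; rewrite -/(z e) -/(c i s') -ji cE.
    by move/polar_neq0; rewrite /sub2 !subrr eqxx.
  have [th' [p _] _] := un j ji; have := p s' s01; rewrite cE.
  by move/polar_neq0; rewrite /sub2 !subrr eqxx.
have [//|hp|] := ltrgtP (h (unstereo (z e))) 0; last by [].
have [E'|] := rP _ u1 Bz hp; first by move: ue; rewrite E' eqxx.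
by rewrite unstereoK.
Qed.

(** Along the circle i, the tangent and the vector from the root z_i both turn by k_i, while the
    vectors from the other roots do not turn in total. Hence the argument of the tangential part
    minus those of all factors takes equal values at both ends; pasting these functions gives the
    [L] of the model. *)
Lemma curve_eval_low (eps : R) : (0 < n)%N -> eps = 1 \/ eps = -1 ->
  exists M, forall N, (M < N)%N -> forall k, (1 < k)%N -> N = (n * (4 * k))%N ->
  deg3 N (fun s d => eps *: H (sph0 s d)) = if eps == 1 then 1 - n%:Z else n%:Z - 1.
Proof.
move=> n0 eps1.
have [z zP] := choice winding_ex; have [e eP] := choice zP.
have [k kP] := choice eP; have [thT tP] := choice kP; have [th hP] := choice tP.
pose zs := [seq z i | i <- enum 'I_n].
have zsn : size zs = n by rewrite size_map size_enum_ord.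
have zs_in i : z i \in zs by apply: map_f; rewrite mem_enum.
have zne i j : j != i -> z j != z i.
  move=> ji; apply/eqP => E; have [_ W _ _] := hP i; have [_ _ un _] := hP j.
  have := un i; rewrite eq_sym => /(_ ji); rewrite E.
  exact: unwound_not (w_pt W) (w_ptk W) (w_neq0 W).
have Th i w : exists th', w \in zs -> lift_on `[0, 1] (fun s => sub2 (c i s) w) th' /\
    th' 1 - th' 0 = if w == z i then k i else 0.
  have [/mapP[j _ ->]|//] := boolP (w \in zs); last by exists (th i).
  have [->|ji] := eqVneq j i.
    by have [_ W _ _] := hP i; exists (th i) => _; rewrite eqxx; split; [exact: w_pt W|exact: w_ptk W].
  rewrite (negbTE (zne i j ji)); have [_ _ un _] := hP j.
  have [|th' l p] := un i; first by rewrite eq_sym.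
  by exists th' => _; rewrite p subrr.
have [Ta TaP] : exists Ta : 'I_n -> P -> R -> R, forall i w, w \in zs ->
    lift_on `[0, 1] (fun s => sub2 (c i s) w) (Ta i w) /\
    Ta i w 1 - Ta i w 0 = if w == z i then k i else 0.
  have [|f fP] := @choice _ _ (fun i (T : P -> R -> R) => forall w, w \in zs ->
    lift_on `[0, 1] (fun s => sub2 (c i s) w) (T w) /\
    T w 1 - T w 0 = if w == z i then k i else 0); last by exists f.
  by move=> i; have [f fP] := choice (Th i); exists f.
(* The turn from the direction of the circle to the tangential part of [H]: a quarter, and half a
   turn more when the circle is run through in the other sense. *)
pose be i : R := if e i == 1 then pi / 2 else pi / 2 + pi.
pose l i s := thT i s + be i - sum_angles zs (fun w => Ta i w s).
have l01 i : l i 1 = l i 0.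
  apply/eqP; rewrite -subr_eq0; apply/eqP; rewrite /l !sum_anglesE.
  have -> : thT i 1 + be i - \sum_(w <- zs) Ta i w 1 - (thT i 0 + be i - \sum_(w <- zs) Ta i w 0)
    = (thT i 1 - thT i 0) - (\sum_(w <- zs) Ta i w 1 - \sum_(w <- zs) Ta i w 0) by ring.
  have [_ W _ _] := hP i; rewrite (w_dirk W) -sumrB.
  rewrite big_map big_enum (bigD1 i) //= big1 => [|j ji].
    by have [_ ->] := TaP i (z i) (zs_in i); rewrite eqxx addr0 subrr.
  by have [_ ->] := TaP i (z j) (zs_in j); rewrite (negbTE (zne i j ji)).
have wd i j s t : 0 <= s <= 1 -> 0 <= t <= 1 -> g i s = g j t -> l i s = l j t.
  move=> s01 t01; have [<-|ij] := eqVneq i j; last by move/(cs_disj sys ij).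
  have ord u v : 0 <= u <= 1 -> 0 <= v <= 1 -> u < v -> g i u = g i v -> l i u = l i v.
    move=> u01 v01 uv E; have [vu|vu] := ltP v (u + 1); first by have := cs_inj sys uv vu E.
    have -> : u = 0 by lra.
    by have -> : v = 1 by lra.
  by have [st|ts|->//] := ltgtP s t; [exact: ord|move=> E; apply/esym/ord].
have cl i s : `[0, 1]%classic s -> {for s, continuous (l i)}.
  move=> s01; have [_ W _ _] := hP i; have [_ cT] := w_dir W.
  apply: cvgB; first by apply: cvgD; [exact: cT|exact: cvg_cst].
  have : {subset zs <= zs} by [].
  elim: {-2}zs => [|w ws IH] ws_in /=; first exact: cvg_cst.
  apply: cvgD; last by apply: IH => v vw; apply: ws_in; rewrite inE vw orbT.
  by have [[_ cw] _] := TaP i w (ws_in w (mem_head _ _)); exact: cw.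
have [L cL LP] := @paste R n g l (@cs_cont _ _ _ _ _ sys) wd cl.
have [] := @eval_model R H zs L eps eps1 _ cH cL _ _ _.
- by rewrite zsn.
- by have [] := cs_pole sys.
- move=> x w x1 xe /mapP[i _ ->] E; have [_ _ _] := hP i.
  by rewrite -E stereoK.
- move=> x x1 hx; have [i [s sx]] := cs_zero sys x1 hx.
  have gp s' : g i (s' + 1) = g i s' by exact: (cs_period sys).
  have [s' s'01 sx'] := periodic_rep gp s.
  have s01 : 0 <= s' <= 1 by case/andP: s'01 => -> /ltW.
  have s01' : `[0, 1]%classic s' by rewrite itv01.
  rewrite -sx -sx' LP //; exists (fun w => Ta i w s').
    by move=> w /(TaP i w)[[p _] _]; exact: p.
  rewrite /l subrK; have [e1 W _ _] := hP i; have [p _] := w_dir W.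
  exact: (framed_polar (g1 i s') (ge i s') (cs_on sys i s') e1 (p s' s01')).
by rewrite zsn => M MP; exists M.
Qed.

End Lowest.

Theorem curve_eval n (H : V -> V) (g : 'I_n -> R -> V) (eps : R) : continuous H ->
  (forall x, dot x x = 1 -> H x != 0) -> curve_system H g (e3 R) -> (0 < n)%N ->
  eps = 1 \/ eps = -1 ->
  exists M, forall N, (M < N)%N -> forall k, (1 < k)%N -> N = (n * (4 * k))%N ->
  deg3 N (fun s d => eps *: H (sph0 s d)) = if eps == 1 then 1 - n%:Z else n%:Z - 1.
Proof.
move=> cH H0 sys.
have lowest i : exists a, forall s, (stereo (g i a)).2 <= (stereo (g i s)).2.
  have cc : continuous (fun s => stereo (g i s)).
    by apply: cont_stereo; [exact: (cs_cont sys)|exact: (cs_unit sys)|exact: (curve_neq_pole sys)].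
  have [|a _ am] := @EVT_min R (fun s => (stereo (g i s)).2) 0 1 ler01.
    apply: continuous_subspaceT; exact: (cont_comp2 (@cont_snd _ _) cc).
  exists a => s; have gp s' : g i (s' + 1) = g i s' by exact: (cs_period sys).
  have [s' /andP[s'0 s'1] <-] := periodic_rep gp s.
  by apply: am; rewrite in_itv /= s'0 ltW.
have [a aP] := choice lowest.
apply: (curve_eval_low cH H0 (curve_shift a sys)) => i s.
by rewrite addr0.
Qed.

End Evaluation.

(** * Degrees under reflections *)

Section Reflection.
Variable R : realType.
Local Notation V := 'rV[R]_3.
Local Notation P := (R * R)%type.

(* Composed with a rotation by [pi], a reflection is the antipodal map. *)
Lemma deg3_refl (v : V) (G : R -> R -> V) : dot v v = 1 ->
  continuous (uncurry2 G) -> (forall s d, G s d != 0) ->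
  (forall s d, G (s + 1) d = G s d) -> (forall s s', G s 0 = G s' 0) ->
  (forall s s', G s 1 = G s' 1) ->
  exists M, forall N, (M < N)%N ->
    deg3 N (fun s d => refl v (G s d)) = deg3 N (fun s d => - G s d).
Proof.
move=> v1 cG G0 Gp Gs Gn.
(* The reflection in [v] followed by the rotation of angle a about [v]: it changes the sign of the
   component along [v] and rotates the orthogonal plane. *)
pose A (a : R) (x : V) := cos a *: x - ((1 + cos a) * dot v x) *: v + sin a *: cross v x.
have AA a x : dot (A a x) (A a x) = dot x x.
  have cs := cos2Dsin2 a; rewrite /A !dotE !crdL /cross !crdv; rewrite dotE in v1.
  have s2 : sin a ^+ 2 = 1 - cos a ^+ 2 by rewrite -cs addrC addKr.
  set c := cos a in s2 *; set s := sin a in s2 *.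
  set v0 := crd 0 v in v1 *; set w1 := crd 1 v in v1 *; set v2 := crd 2 v in v1 *.
  set x0 := crd 0 x; set x1 := crd 1 x; set x2 := crd 2 x.
  set D := v0 * x0 + w1 * x1 + v2 * x2.
  have -> : forall c s : R, (c * x0 - (1 + c) * D * v0 + s * (w1 * x2 - v2 * x1)) *
     (c * x0 - (1 + c) * D * v0 + s * (w1 * x2 - v2 * x1)) +
     (c * x1 - (1 + c) * D * w1 + s * (v2 * x0 - v0 * x2)) *
     (c * x1 - (1 + c) * D * w1 + s * (v2 * x0 - v0 * x2)) +
     (c * x2 - (1 + c) * D * v2 + s * (v0 * x1 - w1 * x0)) *
     (c * x2 - (1 + c) * D * v2 + s * (v0 * x1 - w1 * x0)) =
     c ^+ 2 * (x0 * x0 + x1 * x1 + x2 * x2) - 2 * c * (1 + c) * D ^+ 2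
     + (1 + c) ^+ 2 * D ^+ 2 * (v0 * v0 + w1 * w1 + v2 * v2)
     + s ^+ 2 * ((v0 * v0 + w1 * w1 + v2 * v2) * (x0 * x0 + x1 * x1 + x2 * x2) - D ^+ 2).
    by move=> c' s'; rewrite /D; ring.
  by rewrite v1 s2; ring.
have cA : continuous (fun z : R * R * R => A (pi * z.2) (G z.1.1 z.1.2)).
  have cg : continuous (fun z : R * R * R => G z.1.1 z.1.2).
    by apply: (@cont_comp2 _ _ _ (uncurry2 G) (fun z : R * R * R => z.1)); last contP.
  have cp : continuous (fun z : R * R * R => pi * z.2 : R) by contR.
  have cc : continuous (fun z : R * R * R => cos (pi * z.2 : R)).
    by apply: cont_comp cp; exact: continuous_cos.
  have cs : continuous (fun z : R * R * R => sin (pi * z.2 : R)).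
    by apply: cont_comp cp; exact: continuous_sin.
  have cd : continuous (fun z : R * R * R => dot v (G z.1.1 z.1.2)).
    by apply: cont_dot; [exact: cont_cst|exact: cg].
  apply: cont_vD; last by apply: cont_vZ cs _; apply: cont_cross => //; exact: cont_cst.
  apply: cont_vD; first exact: cont_vZ.
  by apply: cont_vN; apply: cont_vZ; [contR|exact: cont_cst].
have [] := @deg3_homotopy R (fun s d t => A (pi * t) (G s d)).
- exact: cA.
- by move=> s d t _ _ _; rewrite -dot_gt0 AA dot_gt0.
- by move=> d t; rewrite -[1]add0r Gp.
- by move=> s s' t; rewrite (Gs s s').
- by move=> s s' t; rewrite (Gn s s').
move=> M MP; exists M => N /MP E; apply: eq_trans (eq_trans (esym E) _); apply: eq_deg3 => s d.
  rewrite /A mulr0 cos0 sin0 scale0r addr0 scale1r /refl v1 divr1.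
  by congr (_ - _ *: _); ring.
by rewrite /A mulr1 cospi sinpi scale0r addr0 subrr mul0r scale0r subr0 scaleN1r.
Qed.

Lemma refl_e1 (x : V) : refl (vec3 1 0 0) x = reflect0 x.
Proof. by apply: crdE; rewrite /refl /reflect0 !crdL !dotE !crdv; field. Qed.

Lemma mirror_between (p : V) : dot p p = 1 ->
  exists2 v : V, dot v v = 1 & refl v (e3 R) = p.
Proof.
move=> p1; have [->|pe] := eqVneq p (e3 R).
  exists (vec3 1 0 0); first by rewrite dotE !crdv; ring.
  by rewrite refl_e1; apply: crdE; rewrite /reflect0 !crdv ?oppr0.
have n0 := unit_e3 p1 pe; rewrite dotE in p1.
pose u := e3 R - p; have uu : dot u u = 2 * (1 - crd 2 p).
  by rewrite dotE !crdL !crdv; nra.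
have u0 : 0 < dot u u by rewrite uu mulr_gt0.
pose r := Num.sqrt (dot u u); have r0 : 0 < r by rewrite sqrtr_gt0.
have rr : r ^+ 2 = dot u u by rewrite sqr_sqrtr // ltW.
have rn : r != 0 by rewrite gt_eqF.
exists (r^-1 *: u).
  by rewrite dotZl dotZr -rr; field.
rewrite refl_scale ?invr_eq0 // /refl uu.
have -> : dot u (e3 R) = 1 - crd 2 p by rewrite dotE !crdL !crdv; ring.
by rewrite divff ?mulf_neq0 ?pnatr_eq0 ?gt_eqF // scale1r /u opprB addrC subrK.
Qed.

Lemma cross_refl (v x y : V) : dot v v = 1 ->
  cross (refl v x) (refl v y) = - refl v (cross x y).
Proof.
rewrite dotE => v1; apply: crdE; rewrite crdN /refl !crdL /cross !crdv !crdL !dotE !crdv !v1.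
all: set v0 := crd 0 v in v1 *; set w1 := crd 1 v in v1 *; set v2 := crd 2 v in v1 *.
all: set x0 := crd 0 x; set x1 := crd 1 x; set x2 := crd 2 x.
all: set y0 := crd 0 y; set y1 := crd 1 y; set y2 := crd 2 y.
all: rewrite !divr1; apply/eqP; rewrite -subr_eq0.
- have K : forall b : R, b = 2 * (x1 * y2 - x2 * y1) * (1 - (v0 * v0 + w1 * w1 + v2 * v2)) ->
    b == 0 by move=> b ->; rewrite v1 subrr mulr0.
  by apply: K; ring.
- have K : forall b : R, b = 2 * (x2 * y0 - x0 * y2) * (1 - (v0 * v0 + w1 * w1 + v2 * v2)) ->
    b == 0 by move=> b ->; rewrite v1 subrr mulr0.
  by apply: K; ring.
- have K : forall b : R, b = 2 * (x0 * y1 - x1 * y0) * (1 - (v0 * v0 + w1 * w1 + v2 * v2)) ->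
    b == 0 by move=> b ->; rewrite v1 subrr mulr0.
  by apply: K; ring.
Qed.

(** The constant is 1 + 2 * 3, where 3 bounds the scalar product coordinate by coordinate. *)
Lemma crd_refl_bound (v x : V) k e : dot v v = 1 -> (k < 3)%N ->
  (forall i, (i < 3)%N -> `|crd i x| <= e) -> `|crd k (refl v x)| <= 7 * e.
Proof.
move=> v1 k3 xe; have vi i : (i < 3)%N -> `|crd i v| <= 1.
  move=> i3; rewrite dotE in v1; rewrite -(@expr_le1 _ 2) // -normrX ger0_norm ?sqr_ge0 //.
  by case: i i3 => [|[|[|]]] // _; nra.
have e0 : 0 <= e by apply: le_trans (xe 0%N _); rewrite ?normr_ge0.
rewrite /refl v1 divr1 !crdL; apply: le_trans (ler_normB _ _) _.
have d : `|dot v x| <= 3 * e.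
  rewrite dotE; apply: le_trans (ler_normD _ _) _.
  have m i : (i < 3)%N -> `|crd i v * crd i x| <= e.
    move=> i3; rewrite normrM -[leRHS]mul1r; apply: ler_pM => //; [exact: vi|exact: xe].
  have := ler_normD (crd 0 v * crd 0 x) (crd 1 v * crd 1 x).
  have := m 0%N isT; have := m 1%N isT; have := m 2%N isT; lra.
have : `|2 * dot v x * crd k v| <= 2 * (3 * e) * 1.
  by rewrite !normrM; apply: ler_pM; rewrite ?mulr_ge0 ?vi // (ger0_norm (_ : 0 <= 2)) // ler_pM2l.
have := xe k k3; lra.
Qed.

Lemma cont_refl1 (v : V) : v != 0 -> continuous (refl v).
Proof. by move=> v0; apply: cont_refl => //; [exact: cont_cst|exact: cont_id]. Qed.

(** A reflection is an isometry that reverses cross products, so only the sign of the direction of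
    each circle changes. *)
Lemma curve_refl n (H : V -> V) (g : 'I_n -> R -> V) (v p : V) : dot v v = 1 ->
  curve_system H g p ->
  curve_system (fun x => refl v (H (refl v x))) (fun i s => refl v (g i s)) (refl v p).
Proof.
move=> v1; have v0 : v != 0 by rewrite -dot_gt0 v1.
have cv := cont_refl1 v0; have vK x : refl v (refl v x) = x by rewrite reflK.
have dv x y : dot (refl v x) (refl v y) = dot x y by rewrite refl_dot.
have dv' x : dot (refl v (H (refl v x))) x = dot (H (refl v x)) (refl v x).
  by rewrite -[in LHS](vK x) dv vK.
have dv2 x : dot (refl v x) (refl v x) = 1 <-> dot x x = 1 by rewrite dv.
have bl x r : 0 < r -> exists2 r', 0 < r' & forall y, ball x r' y -> ball (refl v x) r (refl v y).
  move=> r0; have : nbhs x [set y | ball (refl v x) r (refl v y)].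
    exact: (cv x _ (nbhsx_ballx _ _ r0)).
  by move=> /nbhs_ballP[r' /= r'0 rP]; exists r' => // y /rP.
have img (Y : set V) : connected Y -> connected (refl v @` Y).
  by move=> cY; apply: connected_continuous_connected => //; exact: continuous_subspaceT.
case=> cg g1 gp gi gd on zr dir [p1 hp] out side; split.
- by move=> i; apply: (cont_comp2 cv); exact: cg.
- by move=> i s; rewrite dv.
- by move=> i s; rewrite gp.
- by move=> i s t st ts /(congr1 (refl v)); rewrite !vK; exact: gi.
- by move=> i j s t ij /(congr1 (refl v)); rewrite !vK; exact: gd.
- by move=> i s; rewrite dv' vK.
- move=> x x1; rewrite dv' => /zr[|i [s E]]; first by rewrite dv.
  by exists i, s; rewrite E vK.
- move=> i; have [eps e1 D] := dir i; exists (- eps).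
    by case: e1 => ->; [right|left; rewrite opprK].
  move=> s0 e e0; have e7 : 0 < e / 7 by lra.
  have [d d0 dP] := D s0 _ e7; exists d => // s t h1 h2 h3.
  have [k k0 kP] := dP s t h1 h2 h3; exists k => // j j3.
  have rN x : refl v (- x) = - refl v x by rewrite -scaleN1r reflZ scaleN1r.
  have -> : crd j (refl v (g i t)) - crd j (refl v (g i s)) - k * crd j
      (- eps *: cross (refl v (g i s0)) (refl v (H (refl v (refl v (g i s0)))))) =
      crd j (refl v (g i t - g i s - k *: (eps *: cross (g i s0) (H (g i s0))))).
    rewrite vK cross_refl // 2!reflD !rN !reflZ crdD crdD 2!crdN !crdZ crdN.
    by ring.
  have -> : e * k = 7 * (e / 7 * k) by field.
  apply: crd_refl_bound => // l l3; rewrite !crdL.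
  by have := kP l l3; rewrite !crdL.
- by rewrite dv dv' vK.
- move=> i; have [Y [cY Yg Yp Yj [s sP]]] := out i; exists (refl v @` Y); split.
  + exact: img.
  + move=> _ [y /Yg[y1 yg] <-]; rewrite dv; split=> // t /(congr1 (refl v)).
    by rewrite !vK; exact: yg.
  + by exists p.
  + by move=> j t /Yj Y1; exists (g j t).
  + exists s => r /(bl (g i s))[r' r'0 rP]; have [y [Yy By hy]] := sP r' r'0.
    by exists (refl v y); split; [exists y|exact: rP|rewrite dv' vK].
- move=> x x1; rewrite dv' => hx; have [] := side (refl v x) _ hx; first by rewrite dv.
  move=> acc [r r0 rP]; split.
    move=> r1 /(bl (refl v x))[r' r'0 r'P]; have [y [y1 By hy]] := acc r' r'0.
    exists (refl v y); split; [by rewrite dv|by have := r'P y By; rewrite vK|by rewrite dv' vK].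
  have [r' r'0 r'P] := bl x r r0; exists r' => // y z y1 z1 By Bz; rewrite !dv' => hy hz.
  have [] := rP (refl v y) (refl v z) _ _ (r'P _ By) (r'P _ Bz) hy hz; rewrite ?dv //.
  move=> W [cW Wy Wz Wh]; exists (refl v @` W); split.
  + exact: img.
  + by exists (refl v y).
  + by exists (refl v z).
  + by move=> _ [w /Wh[w1 hw] <-]; rewrite dv dv' vK.
Qed.

(** A reflection moves the positive point [p] to the pole of the projection. The degrees with [- H]
    cover systems in which the other difference of two sheets is positive, and those with [reflect0]
    enter the second factorization of linking numbers. *)
Theorem degree_at_curves n (H : V -> V) (g : 'I_n -> R -> V) (p : V) : (0 < n)%N ->
  continuous H -> (forall x, dot x x = 1 -> H x != 0) -> curve_system H g p ->
  exists2 S : R -> R -> V, sphere_map S &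
    exists M, forall N, (M < N)%N -> forall k, (1 < k)%N -> N = (n * (4 * k))%N ->
    [/\ deg3 N (fun s d => H (S s d)) = n%:Z - 1 /\
        deg3 N (fun s d => - H (S s d)) = 1 - n%:Z,
        deg3 N (fun s d => reflect0 (H (S s d))) = 1 - n%:Z /\
        deg3 N (fun s d => reflect0 (- H (S s d))) = n%:Z - 1 &
        deg3 N (fun s d => - S s d) = 1].
Proof.
move=> n0 cH H0 sys; have [p1 _] := cs_pole sys; have [v v1 vp] := mirror_between p1.
have v0 : v != 0 by rewrite -dot_gt0 v1.
have vK x : refl v (refl v x) = x by rewrite reflK.
have rN x : refl v (- x) = - refl v x by rewrite -scaleN1r reflZ scaleN1r.
have n1 : (-1 == 1 :> R) = false by apply/eqP; lra.
pose H' x := refl v (H (refl v x)).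
have cH' : continuous H'.
  exact: (cont_comp2 (cont_refl1 v0) (cont_comp2 cH (cont_refl1 v0))).
have H'0 x : dot x x = 1 -> H' x != 0.
  by move=> x1; apply: refl_neq0 => //; apply: H0; rewrite refl_dot.
have sys' := curve_refl v1 sys; rewrite -{1}vp vK -/H' in sys'.
have [c0 u0 q0 s0 t0] := sph0_map R.
have cG (F : V -> V) : continuous F -> continuous (uncurry2 (fun s d => F (sph0 s d))).
  by move=> cF; exact: (cont_comp2 cF c0).
have cN (F : V -> V) : continuous F -> continuous (fun x => - F x) by move=> cF; exact: cont_vN.
exists (fun s d => refl v (sph0 s d)); first exact: refl_map (sph0_map R).
have [M1 E1] := curve_eval cH' H'0 sys' n0 (or_introl (erefl 1)).
have [M2 E2] := curve_eval cH' H'0 sys' n0 (or_intror (erefl (-1))).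
have [||||M3 E3] := @deg3_refl v (fun s d => H' (sph0 s d)) v1 (cG _ cH').
- by move=> s d; apply: H'0; exact: u0.
- by move=> s d; rewrite q0.
- by move=> s s'; rewrite (s0 s s').
- by move=> s s'; rewrite (t0 s s').
have [||||M4 E4] := @deg3_refl v (fun s d => - H' (sph0 s d)) v1 (cG _ (cN _ cH')).
- by move=> s d; rewrite oppr_eq0; apply: H'0; exact: u0.
- by move=> s d; rewrite q0.
- by move=> s s'; rewrite (s0 s s').
- by move=> s s'; rewrite (t0 s s').
have [||||M5 E5] := @deg3_refl v (fun s d => - sph0 s d) v1 (cG _ (cN _ (@cont_id _))).
- by move=> s d; rewrite oppr_eq0 -dot_gt0 u0.
- by move=> s d; rewrite q0.
- by move=> s s'; rewrite (s0 s s').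
- by move=> s s'; rewrite (t0 s s').
have e11 : dot (vec3 1 0 0) (vec3 1 0 0) = 1 :> R by rewrite dotE !crdv; ring.
have cHv : continuous (fun x => H (refl v x)) by exact: (cont_comp2 cH (cont_refl1 v0)).
have [||||M6 E6] := @deg3_refl (vec3 1 0 0) (fun s d => H (refl v (sph0 s d))) e11 (cG _ cHv).
- by move=> s d; apply: H0; rewrite refl_dot.
- by move=> s d; rewrite q0.
- by move=> s s'; rewrite (s0 s s').
- by move=> s s'; rewrite (t0 s s').
have [||||M7 E7] := @deg3_refl (vec3 1 0 0) (fun s d => - H (refl v (sph0 s d))) e11 (cG _ (cN _ cHv)).
- by move=> s d; rewrite oppr_eq0; apply: H0; rewrite refl_dot.
- by move=> s d; rewrite q0.
- by move=> s s'; rewrite (s0 s s').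
- by move=> s s'; rewrite (t0 s s').
exists (maxn (maxn (maxn M1 (maxn M2 M7)) M3) (maxn (maxn M4 M5) M6)) => N.
rewrite !gtn_max => /andP[/andP[/andP[N1 /andP[N2 N7]] N3] /andP[/andP[N4 N5] N6]] k k1 NE.
have HE s d : H (refl v (sph0 s d)) = refl v (H' (sph0 s d)) by rewrite /H' vK.
have d1 : deg3 N (fun s d => H (refl v (sph0 s d))) = n%:Z - 1.
  have -> : deg3 N (fun s d => H (refl v (sph0 s d))) =
      deg3 N (fun s d => refl v (H' (sph0 s d))) by exact: eq_deg3.
  rewrite (E3 N N3).
  have := E2 N N2 k k1 NE; rewrite n1 => <-.
  by apply: eq_deg3 => s d; rewrite scaleN1r.
have d2 : deg3 N (fun s d => - H (refl v (sph0 s d))) = 1 - n%:Z.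
  have -> : deg3 N (fun s d => - H (refl v (sph0 s d))) =
      deg3 N (fun s d => refl v (- H' (sph0 s d))).
    by apply: eq_deg3 => s d; rewrite HE rN.
  rewrite (E4 N N4); have := E1 N N1 k k1 NE; rewrite eqxx => <-.
  by apply: eq_deg3 => s d; rewrite scale1r opprK.
split=> //.
- split.
    rewrite -d2 -(E6 N N6); apply: eq_deg3 => s d; exact/esym/refl_e1.
  have -> : deg3 N (fun s d => reflect0 (- H (refl v (sph0 s d)))) =
      deg3 N (fun s d => refl (vec3 1 0 0) (- H (refl v (sph0 s d)))).
    by apply: eq_deg3 => s d; rewrite refl_e1.
  by rewrite (E7 N N7) -d1; apply: eq_deg3 => s d; rewrite opprK.
- have -> : deg3 N (fun s d => - refl v (sph0 s d)) = deg3 N (fun s d => refl v (- sph0 s d)).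
    by apply: eq_deg3 => s d; rewrite rN.
  rewrite (E5 N N5); have := @deg3_sph0 R N (n * k) 1 _ _ (or_introl (erefl 1)).
  rewrite eqxx => <-; last 2 first.
  + by apply: (leq_trans k1); rewrite leq_pmull.
  + by rewrite NE mulnCA.
  by apply: eq_deg3 => s d; rewrite scale1r opprK.
Qed.

End Reflection.

(** * Components of a link *)

Lemma connected_in_one (T : topologicalType) (I : finType) (K : I -> set T) (A : set T) :
  (forall i, closed (K i)) -> (forall i j x, A x -> K i x -> K j x -> i = j) ->
  connected A -> A !=set0 -> A `<=` \bigcup_i K i -> exists i, A `<=` K i.
Proof.
move=> cK dK cA [a Aa] AK; have [i _ Ki] := AK a Aa; exists i.
suff <- : A `&` K i = A by move=> x [].
apply: cA; first by exists a.
  exists (~` \bigcup_(j in [set j | j != i]) K j).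
    by apply: closed_openC; apply: closed_bigcup; [exact: finite_finset|move=> j _].
  apply/seteqP; split=> x [Ax Kx]; split=> //.
    by move=> [j /= ji Kj]; move: ji; rewrite (dK _ _ _ Ax Kx Kj) eqxx.
  have [j _ Kj] := AK x Ax; have [<-//|ji] := eqVneq j i.
  by case: Kx; exists j.
by exists (K i).
Qed.

(** Each piece of one decomposition is connected and covered by the disjoint closed pieces of the
    other, hence contained in one of them, and conversely. *)
Lemma match_components (T : topologicalType) (I : finType) (A B : I -> set T) :
  (forall i, closed (A i)) -> (forall i, closed (B i)) ->
  (forall i j x, A i x -> A j x -> i = j) -> (forall i j x, B i x -> B j x -> i = j) ->
  (forall i, connected (A i)) -> (forall i, connected (B i)) ->
  (forall i, A i !=set0) -> (forall i, B i !=set0) ->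
  \bigcup_i A i = \bigcup_i B i ->
  exists2 s : I -> I, injective s & forall i, A i = B (s i).
Proof.
move=> cA cB dA dB kA kB nA nB AB.
have sA i : exists j, A i `<=` B j.
  apply: connected_in_one => //; first by move=> j k x _; exact: dB.
  by rewrite -AB => x Ax; exists i.
have sB i : exists j, B i `<=` A j.
  apply: connected_in_one => //; first by move=> j k x _; exact: dA.
  by rewrite AB => x Bx; exists i.
have [s sP] := choice sA; have [r rP] := choice sB.
have rs i : r (s i) = i.
  by have [x Ax] := nA i; apply/esym/(dA _ _ x) => //; apply: rP; exact: sP.
exists s; first by move=> i j E; rewrite -(rs i) E rs.
by move=> i; apply/seteqP; split; [exact: sP|rewrite -{2}(rs i); exact: rP].
Qed.

(** * Linking numbers along an isotopy *)

Section Linking.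
Variable R : realType.
Local Notation V := 'rV[R]_3.
Local Notation X := (R * R * (R * R) * R)%type.

Lemma sphereE (x : V) : sphere x = (dot x x = 1). Proof. by []. Qed.

Lemma sphere_compact : compact (@sphere R).
Proof.
apply: bounded_closed_compact.
  exists 1; split; first exact: num_real.
  move=> M M1 x; rewrite sphereE dotE => x1.
  rewrite /Num.Def.normr /= mx_normrE; apply/bigmax_leP; split=> [|[i j] _ /=]; first by lra.
  rewrite (ord1 i); have -> : x 0 j = crd j x by rewrite /crd inord_val.
  apply: (@le_trans _ _ 1); last exact: ltW.
  rewrite -(@expr_le1 _ 2) // -normrX ger0_norm ?sqr_ge0 //.
  by case: j => -[|[|[|]]] //= _; nra.
have cd : continuous (fun x : V => dot x x) by apply: cont_dot; exact: cont_id.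
have -> : @sphere R = (fun x => dot x x) @^-1` [set 1] by [].
move/continuous_closedP : cd; apply; exact: closed_eq.
Qed.

(** The sphere is the union of the great circles through [e3]. *)
Lemma sphere_connected : connected (@sphere R).
Proof.
pose circle (phi t : R) : V := vec3 (sin t * cos phi) (sin t * sin phi) (cos t).
have -> : @sphere R = \bigcup_(phi in [set: R]) (circle phi @` [set: R]).
  apply/seteqP; split=> x.
    rewrite sphereE dotE => x1.
    have [r [phi [r1 x0 x1']]] : exists r phi, [/\ r ^+ 2 + crd 2 x ^+ 2 = 1,
        crd 0 x = r * cos phi & crd 1 x = r * sin phi].
      have [/eqP E|/polar_ex[phi [r r0 [e0 e1]]]] := boolP ((crd 0 x, crd 1 x) == 0).
        have [e0 e1] : crd 0 x = 0 /\ crd 1 x = 0 by case: E => -> ->.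
        by exists 0, 0; rewrite !mul0r; split=> //; rewrite -x1 e0 e1; ring.
      exists r, phi; split=> //; rewrite -x1 e0 e1.
      have := cos2Dsin2 phi => cs; have -> : r ^+ 2 = r ^+ 2 * (cos phi ^+ 2 + sin phi ^+ 2).
        by rewrite cs mulr1.
      by ring.
    have w0 : (crd 2 x, r) != 0.
      by apply/eqP => -[z2 r0]; move: r1; rewrite z2 r0 expr0n addr0 => /eqP;
        rewrite eq_sym oner_eq0.
    have [t [a a0 [ec es]]] := polar_ex w0.
    have a1 : a = 1.
      have : a ^+ 2 = 1.
        rewrite -r1 ec es; have cs := cos2Dsin2 t.
        by rewrite !exprMn -mulrDr [_ + cos _ ^+ 2]addrC cs mulr1.
      by move/eqP; rewrite sqrf_eq1 => /orP[]/eqP // a1; lra.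
    exists phi => //; exists t => //; apply: crdE; rewrite /circle !crdv.
    - by rewrite x0 es a1 mul1r.
    - by rewrite x1' es a1 mul1r.
    - by rewrite ec a1 mul1r.
  move=> [phi _ [t _ <-]]; rewrite sphereE dotE !crdv.
  have c1 := cos2Dsin2 phi; have c2 := cos2Dsin2 t.
  have -> : sin t * cos phi * (sin t * cos phi) + sin t * sin phi * (sin t * sin phi) + cos t * cos t
    = sin t ^+ 2 * (cos phi ^+ 2 + sin phi ^+ 2) + cos t ^+ 2 by ring.
  by rewrite c1 mulr1 addrC.
apply: bigcup_connected.
  exists (e3 R) => phi _; exists 0 => //.
  by rewrite /circle sin0 cos0 !mul0r.
move=> phi _; apply: connected_continuous_connected.
  by apply/connected_intervalP.
apply: continuous_subspaceT; rewrite /circle; apply: cont_vec3; last exact: continuous_cos.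
  by apply: contM; [exact: continuous_sin|exact: cont_cst].
by apply: contM; [exact: continuous_sin|exact: cont_cst].
Qed.

(** A continuous injection of the compact sphere into a Hausdorff space is a closed map, so its
    inverse on the image is continuous. *)
Lemma cont_inverse (T U : topologicalType) (phi : V -> U) (u : T -> V) :
  hausdorff_space U -> continuous phi ->
  (forall x y, sphere x -> sphere y -> phi x = phi y -> x = y) ->
  (forall t, sphere (u t)) -> continuous (fun t => phi (u t)) -> continuous u.
Proof.
move=> hU cphi inj us cu; apply/continuous_closedP => D cD.
have -> : u @^-1` D = (fun t => phi (u t)) @^-1` (phi @` (@sphere R `&` D)).
  apply/seteqP; split=> t; first by move=> Dt; exists (u t).
  by move=> [x [sx Dx] E]; rewrite /preimage /= -(inj _ _ sx (us t) E).
move/continuous_closedP : cu; apply; apply: compact_closed => //.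
apply: continuous_compact; first exact: continuous_subspaceT.
by apply: compact_closedI => //; exact: sphere_compact.
Qed.

Definition yjet (j : jet R) : V := j.1.2 + j.2 *: j.1.1.

Lemma jet_eq (j j' : jet R) : J1S2 j -> J1S2 j' -> j.1.1 = j'.1.1 -> yjet j = yjet j' -> j = j'.
Proof.
have z (i : jet R) : J1S2 i -> i.2 = dot i.1.1 (yjet i).
  by move=> [s1 t0]; rewrite /yjet dotDr dotZr t0 s1 add0r mulr1.
move=> J J' Ex Ey; have E2 : j.2 = j'.2 by rewrite (z j J) (z j' J') Ex Ey.
move: Ey; rewrite /yjet E2 Ex => /addIr Ep.
by case: j J Ex E2 Ep => [[? ?] ?] _ /= -> -> ->; case: j' J' => [[]].
Qed.

Definition jet_sheet (f : V -> R) (x : V) : V := yjet (jet1 f x).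

Lemma jet1_J1S2 (f : V -> R) x : sphere x -> J1S2 (jet1 f x).
Proof.
by move=> x1; split=> //=; rewrite /tangent /= dotDr dotNr dotZr x1 mulr1 subrr.
Qed.

(* A weave over the prism with [2 n] rungs, reduced to what determines linking
   numbers: one of its sheets meets both others along [n] nested circles. *)
Record circle_weave (n : nat) (L : set (jet R)) (f : 'I_3 -> V -> R) (c0 : 'I_3) : Prop := {
  cw_cont : forall a, continuous (jet1 (f a));
  cw_image : L = link_image (fun a => jet1 (f a));
  cw_disj : forall a b x, sphere x -> a != b -> jet_sheet (f a) x != jet_sheet (f b) x;
  cw_curves : forall a b, a != b -> a = c0 \/ b = c0 ->
    exists (g : 'I_n -> R -> V) (p : V),
      curve_system (fun x => jet_sheet (f a) x - jet_sheet (f b) x) g p \/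
      curve_system (fun x => jet_sheet (f b) x - jet_sheet (f a) x) g p }.

Lemma cont_sheet (f : V -> R) : continuous (jet1 f) -> continuous (jet_sheet f).
Proof.
move=> cf; have c1 : continuous (fun x => (jet1 f x).1) by exact: (cont_comp2 (@cont_fst _ _) cf).
have c2 : continuous (fun x => (jet1 f x).1.2) by exact: (cont_comp2 (@cont_snd _ _) c1).
have c3 : continuous (fun x => (jet1 f x).1.1) by exact: (cont_comp2 (@cont_fst _ _) c1).
have c4 : continuous (fun x => (jet1 f x).2) by exact: (cont_comp2 (@cont_snd _ _) cf).
exact: (cont_vD c2 (cont_vZ c4 c3)).
Qed.

Lemma circle_weave_degree n L f c0 a b : (0 < n)%N -> circle_weave n L f c0 ->
  a != b -> a = c0 \/ b = c0 ->
  let H x := jet_sheet (f a) x - jet_sheet (f b) x in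
  exists2 S : R -> R -> V, sphere_map S &
    exists M, forall N, (M < N)%N -> forall k, (1 < k)%N -> N = (n * (4 * k))%N ->
    [/\ `|deg3 N (fun s d => H (S s d))|%N = n.-1,
        `|deg3 N (fun s d => reflect0 (H (S s d)))|%N = n.-1 &
        `|deg3 N (fun s d => - S s d)|%N = 1%N].
Proof.
move=> n0 W ab c H; have [g [p sys]] := cw_curves W ab c.
have cH : continuous H.
  by apply: cont_vD; [|apply: cont_vN]; exact: (cont_sheet (@cw_cont _ _ _ _ W _)).
have H0 x : dot x x = 1 -> H x != 0 by move=> x1; rewrite subr_eq0; exact: (cw_disj W).
have absn : `|n%:Z - 1|%N = n.-1 by lia.
have absn' : `|1 - n%:Z|%N = n.-1 by lia.
case: sys => sys.
  have [S mS [M MP]] := degree_at_curves n0 cH H0 sys; exists S => //; exists M => N NM k k1 NE.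
  by have [[-> _] [-> _] ->] := MP N NM k k1 NE.
have HN : (fun x => jet_sheet (f b) x - jet_sheet (f a) x) = (fun x => - H x).
  by apply/funext => x; rewrite /H opprB.
rewrite HN in sys.
have [||S mS [M MP]] := degree_at_curves n0 _ _ sys.
- exact: cont_vN.
- by move=> x x1; rewrite oppr_eq0; exact: H0.
exists S => //; exists M => N NM k k1 NE.
have E : (fun s d => H (S s d)) = (fun s d => - - H (S s d)).
  by apply/funext => s; apply/funext => d; rewrite opprK.
have E' : (fun s d => reflect0 (H (S s d))) = (fun s d => reflect0 (- - H (S s d))).
  by apply/funext => s; apply/funext => d; rewrite opprK.
by have [[_ e1] [_ e2] e3] := MP N NM k k1 NE; rewrite E E' e1 e2 e3.
Qed.

Section Isotopy.
Variable Phi : R -> 'I_3 -> V -> jet R.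
Hypothesis cPhi : forall a, continuous (fun tx : R * V => Phi tx.1 a tx.2).
Hypothesis jPhi : forall t a x, 0 <= t <= 1 -> sphere x -> J1S2 (Phi t a x).
Hypothesis iPhi : forall t a b x y, 0 <= t <= 1 -> sphere x -> sphere y ->
  Phi t a x = Phi t b y -> a = b /\ x = y.

Let cPhi1 t a : continuous (Phi t a).
Proof.
apply: (@cont_comp2 _ _ _ (fun tx : R * V => Phi tx.1 a tx.2) (fun x => (t, x)) (cPhi (a := a))).
by apply: cont_pair; [exact: cont_cst|exact: cont_id].
Qed.

Let hjet : hausdorff_space (jet R). Proof. exact: norm_hausdorff. Qed.

Let closed_img (phi : V -> jet R) : continuous phi -> closed (phi @` @sphere R).
Proof.
move=> cphi; apply: compact_closed => //; apply: continuous_compact; last exact: sphere_compact.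
exact: continuous_subspaceT.
Qed.

Let connected_img (phi : V -> jet R) : continuous phi -> connected (phi @` @sphere R).
Proof.
move=> cphi; apply: connected_continuous_connected; first exact: sphere_connected.
exact: continuous_subspaceT.
Qed.

Let nonempty_img (phi : V -> jet R) : (phi @` @sphere R) !=set0.
Proof. by exists (phi (e3 R)), (e3 R) => //; rewrite sphereE dotE !crdv; ring. Qed.

Lemma end_components t n L f c0 : 0 <= t <= 1 -> circle_weave n L f c0 ->
  link_image (Phi t) = L ->
  exists2 s : 'I_3 -> 'I_3, injective s &
    forall a, Phi t a @` @sphere R = jet1 (f (s a)) @` @sphere R.
Proof.
move=> t01 W E; apply: (@match_components (jet R) 'I_3
  (fun a => Phi t a @` @sphere R) (fun a => jet1 (f a) @` @sphere R)).
- by move=> a; apply: closed_img; exact: cPhi1.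
- by move=> a; apply: closed_img; exact: (cw_cont W).
- by move=> a b j [x sx <-] [y sy] /esym /(iPhi t01 sx sy)[].
- move=> a b j [x sx <-] [y sy E']; apply/eqP/negPn/negP => ab.
  have yx : y = x by case: E'.
  have := cw_disj W sx ab; rewrite /jet_sheet -E' yx eqxx; exact.
- by move=> a; apply: connected_img; exact: cPhi1.
- by move=> a; apply: connected_img; exact: (cw_cont W).
- by move=> a; exact: nonempty_img.
- by move=> a; exact: nonempty_img.
- by rewrite -[LHS]/(link_image (Phi t)) E (cw_image W).
Qed.

(** At time 0 both chosen components are parametrized over the same map [S], so their linking number
    is n - 1 up to sign. At time 1 they are graphs over unknown maps to the sphere. Replacing the
    second of these maps by the standard one [S'] and comparing both factorizations shows that the
    degree of the difference along the first map is a multiple of m - 1. *)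
Lemma isotopy_divides n m L0 L1 f0 f1 c0 c1 : (0 < n)%N -> (0 < m)%N ->
  circle_weave n L0 f0 c0 -> circle_weave m L1 f1 c1 ->
  link_image (Phi 0) = L0 -> link_image (Phi 1) = L1 -> (m.-1 %| n.-1)%N.
Proof.
move=> n0 m0 W0 W1 E0 E1; have i0 : 0 <= (0 : R) <= 1 by rewrite lexx ler01.
have i1 : 0 <= (1 : R) <= 1 by rewrite lexx ler01.
have [s0 s0i S0] := end_components i0 W0 E0; have [s1 s1i S1] := end_components i1 W1 E1.
(* The distinguished sheet has to occur in the pair at both times. The component that is [c0] at
   time 0 and the one that is [c1] at time 1 form such a pair; if they coincide, any other component
   completes it. *)
have [a [b [ab a0 b1]]] : exists a b, [/\ a != b, s0 a = c0 \/ s0 b = c0 &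
    s1 a = c1 \/ s1 b = c1].
  pose a := invF s0i c0; pose b := invF s1i c1.
  have [ab|ab] := eqVneq a b; last by exists a, b; split; rewrite ?f_invF; auto.
  have [b' ab'] : exists b' : 'I_3, a != b'.
    have [->|] := eqVneq a ord0; last by exists ord0.
    by exists ord_max.
  exists a, b'; split; rewrite ?f_invF //; [by left|by left; rewrite ab f_invF].
have h0 : s0 a != s0 b by rewrite (inj_eq s0i).
have h1 : s1 a != s1 b by rewrite (inj_eq s1i).
have [S mS [M1 MP1]] := circle_weave_degree n0 W0 h0 a0.
have [S' mS' [M2 MP2]] := circle_weave_degree m0 W1 h1 b1.
have [cS uS pS sS nS] := mS.
(* the base points of the parametrized spheres of the isotopy *)
have lift c : exists2 u : R -> R -> V, (forall s d, sphere (u s d)) &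
    forall s d, Phi 0 c (u s d) = jet1 (f0 (s0 c)) (S s d).
  have ex z : exists x, sphere x /\ Phi 0 c x = jet1 (f0 (s0 c)) (S z.1 z.2).
    have : (jet1 (f0 (s0 c)) @` @sphere R) (jet1 (f0 (s0 c)) (S z.1 z.2)).
      by exists (S z.1 z.2) => //; exact: uS.
    by rewrite -S0 => -[x sx E]; exists x.
  have [u uP] := choice ex; exists (fun s d => u (s, d)) => s d; have := uP (s, d); by case.
have lift_map c (u : R -> R -> V) : (forall s d, sphere (u s d)) ->
    (forall s d, Phi 0 c (u s d) = jet1 (f0 (s0 c)) (S s d)) -> sphere_map u.
  move=> us uE; have inj := fun x y sx sy (E : Phi 0 c x = Phi 0 c y) =>
    (@iPhi 0 c c x y i0 sx sy E).2.
  split.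
  - apply: (@cont_inverse _ _ (Phi 0 c) _ hjet (@cPhi1 0 c) inj).
      by move=> z; exact: us.
    have -> : (fun z => Phi 0 c (uncurry2 u z)) = (fun z => jet1 (f0 (s0 c)) (uncurry2 S z)).
      by apply/funext => z; rewrite /uncurry2 uE.
    exact: (cont_comp2 (@cw_cont _ _ _ _ W0 _) cS).
  - by move=> s d; exact: us.
  - by move=> s d; apply: inj; rewrite ?uE ?pS.
  - by move=> s s'; apply: inj; rewrite ?uE // (sS s s').
  - by move=> s s'; apply: inj; rewrite ?uE // (nS s s').
have [u us uE] := lift a; have [v vs vE] := lift b.
have mu := lift_map a u us uE; have mv := lift_map b v vs vE.
pose x c (w : R -> R -> V) t s d := (Phi t c (w s d)).1.1.
pose y c (w : R -> R -> V) t s d := yjet (Phi t c (w s d)).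
pose q k s d s' d' t := linkq (x a u t s d) (y a u t s d) (x b v t s' d') (y b v t s' d') k.
have cj c (w : R -> R -> V) (T : topologicalType) (ft fs fd : T -> R) : sphere_map w ->
    continuous ft -> continuous fs -> continuous fd ->
    continuous (fun z => x c w (ft z) (fs z) (fd z)) /\
    continuous (fun z => y c w (ft z) (fs z) (fd z)).
  move=> [cw _ _ _ _] ct cs cd.
  have cwz : continuous (fun z => w (fs z) (fd z)).
    exact: (cont_comp2 cw (cont_pair cs cd)).
  have cj : continuous (fun z => Phi (ft z) c (w (fs z) (fd z))).
    exact: (@cont_comp2 _ _ _ (fun tx : R * V => Phi tx.1 c tx.2) _ (@cPhi c) (cont_pair ct cwz)).
  have j1 := cont_comp2 (@cont_fst _ _) cj.
  have j11 := cont_comp2 (@cont_fst _ _) j1.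
  have j12 := cont_comp2 (@cont_snd _ _) j1.
  have j2 := cont_comp2 (@cont_snd _ _) cj.
  by split; [exact: j11|exact: (cont_vD j12 (cont_vZ j2 j11))].
have [M3 E3] : exists M, forall N, (M < N)%N ->
    lnk N (fun k s d s' d' => q k s d s' d' 1) = lnk N (fun k s d s' d' => q k s d s' d' 0).
  apply: lnk_homotopy.
  - have p1 : continuous (fun z : X => z.1.1.1) by contP.
    have p2 : continuous (fun z : X => z.1.1.2) by contP.
    have p3 : continuous (fun z : X => z.1.2.1) by contP.
    have p4 : continuous (fun z : X => z.1.2.2) by contP.
    have p5 : continuous (fun z : X => z.2) by contP.
    have [cxa cya] := cj a u _ _ _ _ mu p5 p1 p2.
    have [cxb cyb] := cj b v _ _ _ _ mv p5 p3 p4.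
    have kx i : continuous (fun z : X => crd i (x a u z.2 z.1.1.1 z.1.1.2)) by exact: cont_crd.
    have ky i : continuous (fun z : X => crd i (y a u z.2 z.1.1.1 z.1.1.2)) by exact: cont_crd.
    have kx' i : continuous (fun z : X => crd i (x b v z.2 z.1.2.1 z.1.2.2)) by exact: cont_crd.
    have ky' i : continuous (fun z : X => crd i (y b v z.2 z.1.2.1 z.1.2.2)) by exact: cont_crd.
    move=> [|[|k]].
    + exact: (contD (ky 2%N) (contN (ky' 2%N))).
    + exact: (contD (ky 1%N) (contN (ky' 1%N))).
    + have ex := cont_comp (@continuous_expR R) (ky 0%N).
      have ex' := cont_comp (@continuous_expR R) (ky' 0%N).
      exact: (contD (contM ex (kx (2 - k)%N)) (contN (contM ex' (kx' (2 - k)%N)))).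
  - move=> s d s' d' t _ _ _ _ t01.
    have ja := jPhi a t01 (us s d); have jb := jPhi b t01 (vs s' d').
    apply: linkq_neq0; [by case: ja|by case: jb|].
    move=> [ex ey]; have /(iPhi t01 (us s d) (vs s' d'))[/eqP] := jet_eq ja jb ex ey.
    by rewrite (negbTE ab).
  - by move=> k s d s' d' t; rewrite /q /x /y (sm_period mu).
  - by move=> k s d s' d' t; rewrite /q /x /y (sm_period mv).
  - by move=> k s s2 d s' d' t [->|->]; rewrite /q /x /y ?(sm_south mu s s2) ?(sm_north mu s s2).
  - by move=> k s d s' s2 d' t [->|->]; rewrite /q /x /y ?(sm_south mv s' s2) ?(sm_north mv s' s2).
have ends t n' L f c0' (s' : 'I_3 -> 'I_3) c (w : R -> R -> V) : 0 <= t <= 1 -> circle_weave n' L f c0' ->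
    (forall c, Phi t c @` @sphere R = jet1 (f (s' c)) @` @sphere R) ->
    (forall s d, sphere (w s d)) ->
    forall s d, y c w t s d = jet_sheet (f (s' c)) (x c w t s d).
  move=> t01 W ES ws s d; have : (Phi t c @` @sphere R) (Phi t c (w s d)) by exists (w s d).
  rewrite ES => -[z sz E]; have xz : x c w t s d = z by rewrite /x -E.
  by rewrite /y -E /jet_sheet xz.
have x0 c w s d : (forall s d, Phi 0 c (w s d) = jet1 (f0 (s0 c)) (S s d)) -> x c w 0 s d = S s d.
  by move=> wE; rewrite /x wE.
have mx c w : sphere_map w -> (forall s d, sphere (w s d)) -> sphere_map (x c w 1).
  move=> mw ws; split.
  - have [] := cj c w _ _ _ _ mw (@cont_cst (R * R)%type R 1) (@cont_fst _ _) (@cont_snd _ _).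
    exact.
  - by move=> s d; have [] := jPhi c i1 (ws s d).
  - by move=> s d; rewrite /x (sm_period mw).
  - by move=> s s'; rewrite /x (sm_south mw s s').
  - by move=> s s'; rewrite /x (sm_north mw s s').
have cF n' L f c' c : circle_weave n' L f c' -> continuous (jet_sheet (f c)).
  by move=> W; apply: cont_sheet; exact: (cw_cont W).
have dF0 z : dot z z = 1 -> jet_sheet (f0 (s0 a)) z != jet_sheet (f0 (s0 b)) z.
  by move=> sz; exact: (cw_disj W0 sz h0).
have dF1 z : dot z z = 1 -> jet_sheet (f1 (s1 a)) z != jet_sheet (f1 (s1 b)) z.
  by move=> sz; exact: (cw_disj W1 sz h1).
have [M4 E4] := graph_link_l mS mS (cF _ _ _ _ (s0 a) W0) (cF _ _ _ _ (s0 b) W0) dF0.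
have [M5 E5] := graph_link_l (mx a u mu us) (mx b v mv vs)
  (cF _ _ _ _ (s1 a) W1) (cF _ _ _ _ (s1 b) W1) dF1.
have [M6 E6] := graph_link_l (mx a u mu us) mS'
  (cF _ _ _ _ (s1 a) W1) (cF _ _ _ _ (s1 b) W1) dF1.
have [M7 E7] := graph_link_r (mx a u mu us) mS'
  (cF _ _ _ _ (s1 a) W1) (cF _ _ _ _ (s1 b) W1) dF1.
have [K [k1 [k2 k3 k4] [k5 k6 k7] k8]] : exists K, [/\ (M1 < K)%N, [/\ (M2 < K)%N, (M3 < K)%N &
    (M4 < K)%N], [/\ (M5 < K)%N, (M6 < K)%N & (M7 < K)%N] & (1 < K)%N].
  clear - M1 M2 M3 M4 M5 M6 M7.
  by exists (M1 + M2 + M3 + M4 + M5 + M6 + M7 + 2)%N; do !split; lia.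
(* The evaluations at the two times ask for multiples of 4 n and of 4 m. *)
pose N := (n * (4 * (m * K)))%N.
have NE' : N = (m * (4 * (n * K)))%N by rewrite /N; lia.
have KN M : (M < K)%N -> (M < N)%N.
  by move=> /leq_trans; apply; rewrite /N !mulnA leq_pmull // !muln_gt0 n0 m0.
have k1m j : (0 < j)%N -> (1 < j * K)%N.
  by move=> j0; apply: leq_trans k8 _; rewrite leq_pmull.
have [d1 d2 d3] := MP1 N (KN _ k1) (m * K)%N (k1m _ m0) erefl.
have [e1 e2 e3] := MP2 N (KN _ k2) (n * K)%N (k1m _ n0) NE'.
have {}E3 := E3 N (KN _ k3); have {}E4 := E4 N (KN _ k4).
have {}E5 := E5 N (KN _ k5); have {}E6 := E6 N (KN _ k6); have {}E7 := E7 N (KN _ k7).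
have q0 : lnk N (fun k s d s' d' => q k s d s' d' 0) =
    lnk N (graph_link S S (jet_sheet (f0 (s0 a))) (jet_sheet (f0 (s0 b)))).
  congr lnk; apply/funext => k; apply/funext => s; apply/funext => d.
  apply/funext => s'; apply/funext => d'; rewrite /q /graph_link.
  by rewrite (ends _ _ _ _ _ s0 a u i0 W0) // (ends _ _ _ _ _ s0 b v i0 W0) // !x0.
have q1 : lnk N (fun k s d s' d' => q k s d s' d' 1) =
    lnk N (graph_link (x a u 1) (x b v 1) (jet_sheet (f1 (s1 a))) (jet_sheet (f1 (s1 b)))).
  congr lnk; apply/funext => k; apply/funext => s; apply/funext => d.
  apply/funext => s'; apply/funext => d'; rewrite /q /graph_link.
  by rewrite (ends _ _ _ _ _ s1 a u i1 W1) // (ends _ _ _ _ _ s1 b v i1 W1).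
have l0 := congr1 absz E4; rewrite abszM d1 d3 muln1 in l0.
have l1 := congr1 absz E5; rewrite abszM in l1.
have l2 := congr1 absz E6; rewrite abszM e3 muln1 in l2.
have l3 := congr1 absz E7; rewrite abszM e2 in l3.
(* In absolute values, n - 1 is the degree of the difference along the first map times the degree of
   the second map (up to the antipode), and the former is m - 1 times the degree of the first
   map. *)
by rewrite -l0 -q0 -E3 q1 l1 -l2 l3 -mulnA dvdn_mulr.
Qed.

End Isotopy.

(** The converse divisibility comes from the reversed isotopy. *)
Theorem isotopic_circle_weaves n m L0 L1 f0 f1 c0 c1 : (0 < n)%N -> (0 < m)%N ->
  circle_weave n L0 f0 c0 -> circle_weave m L1 f1 c1 ->
  legendrian_isotopic 3 L0 L1 -> n = m.
Proof.
move=> n0 m0 W0 W1 [Phi [sm emb E0 E1]].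
have cPhi a : continuous (fun tx : R * V => Phi tx.1 a tx.2) by exact: (sm a 0%N).
have jPhi t a x : 0 <= t <= 1 -> sphere x -> J1S2 (Phi t a x).
  by move=> /emb[_ + _ _ _]; exact.
have iPhi t a b x y : 0 <= t <= 1 -> sphere x -> sphere y -> Phi t a x = Phi t b y ->
    a = b /\ x = y by move=> /emb[_ _ + _ _]; exact.
have r01 (t : R) : 0 <= t <= 1 -> 0 <= 1 - t <= 1 by lra.
have d1 := isotopy_divides cPhi jPhi iPhi n0 m0 W0 W1 E0 E1.
have d2 : (n.-1 %| m.-1)%N.
  apply: (@isotopy_divides (fun t => Phi (1 - t)) _ _ _ m n L1 L0 f1 f0 c1 c0) => //.
  - move=> a; have cp : continuous (fun tx : R * V => (1 - tx.1, tx.2)).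
      by apply: cont_pair; [contR|exact: cont_snd].
    exact: (cont_comp2 (cPhi a) cp).
  - by move=> t a x /r01; exact: jPhi.
  - by move=> t a b x y /r01; exact: iPhi.
  - by rewrite subr0.
  - by rewrite subrr.
have : n.-1 == m.-1 by rewrite eqn_dvd d1 d2.
by move=> /eqP; lia.
Qed.

End Linking.

(** * Strict differentiability of smooth functions *)

Section Calculus.
Variable R : realType.
Local Notation V := 'rV[R]_3.

Lemma line_quotient (U W : normedModType R) (f : U -> W) (w v : U) (t : R) :
  (fun h : R => h^-1 *: (((fun s => f (w + s *: v)) \o shift t) (h *: (1 : R)) - f (w + t *: v))) =
  (fun h : R => h^-1 *: ((f \o shift (w + t *: v)) (h *: v) - f (w + t *: v))).
Proof.
apply/funext => h /=; congr (_ *: (f _ - _)).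
by rewrite [h *: 1]mulr1 scalerDl addrCA.
Qed.

Lemma line_derive (U W : normedModType R) (f : U -> W) (w v : U) (t : R) :
  derivable f (w + t *: v) v ->
  is_derive t 1 (fun s => f (w + s *: v)) ('D_v f (w + t *: v)).
Proof.
move=> d; apply: DeriveDef; first by rewrite /derivable line_quotient.
by rewrite /derive line_quotient.
Qed.

Lemma smooth_derivable (U W : normedModType R) (f : U -> W) x v : smooth f -> derivable f x v.
Proof. by move=> sf; have [] := sf 1%N. Qed.

Lemma smooth_derive_cont (U W : normedModType R) (f : U -> W) v : smooth f -> continuous ('D_v f).
Proof. by move=> sf; have [_] := sf 1%N; apply. Qed.

Lemma smooth_cont (U W : normedModType R) (f : U -> W) : smooth f -> continuous f.
Proof. by move=> sf; exact: (sf 0%N). Qed.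

Lemma mvt_bound (g dg : R -> R) (a b c e : R) :
  (forall t : R, is_derive t (1 : R) g (dg t)) ->
  (forall t, Num.min a b <= t <= Num.max a b -> `|dg t - c| <= e) ->
  `|g b - g a - c * (b - a)| <= e * `|b - a|.
Proof.
move=> dgP bnd.
have cg : continuous g.
  by move=> t; apply/differentiable_continuous/derivable1_diffP; have [] := dgP t.
have ord a' b' : a' <= b' -> (forall t, a' <= t <= b' -> `|dg t - c| <= e) ->
    `|g b' - g a' - c * (b' - a')| <= e * `|b' - a'|.
  move=> ab B.
  have [t tab ->] := MVT_segment ab (fun t _ => dgP t) (continuous_subspaceT cg).
  by rewrite -mulrBl normrM ler_wpM2r // B.
have [ab|ba] := leP a b; first by apply: ord => // t tab; apply: bnd; rewrite min_l ?max_r.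
rewrite distrC (_ : _ - _ = g a - g b - c * (a - b)); last by ring.
rewrite [`|b - a|]distrC; apply: ord => [|t tab]; first exact: ltW.
by apply: bnd; rewrite min_r ?max_l // ltW.
Qed.

Definition norm1 (u : V) : R := `|crd 0 u| + `|crd 1 u| + `|crd 2 u|.

Lemma norm1_ge0 u : 0 <= norm1 u.
Proof. by rewrite /norm1 !addr_ge0. Qed.

Lemma dot_norm1 (w u : V) (e : R) : (forall k, (k < 3)%N -> `|crd k w| <= e) ->
  `|dot w u| <= e * norm1 u.
Proof.
move=> we; rewrite dotE; apply: le_trans (ler_normD _ _) _.
rewrite /norm1 !mulrDr; apply: lerD; last by rewrite normrM ler_wpM2r // we.
apply: le_trans (ler_normD _ _) _.
by apply: lerD; rewrite normrM ler_wpM2r // we.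
Qed.

(** Increments between two moving points are compared with the differential [w] at [x], not only
    those that start from [x]. The norm is the sum of the absolute values of the coordinates, which
    suits estimates one coordinate at a time. *)
Definition strict_diff (f : V -> R) (x w : V) : Prop := forall e, 0 < e ->
  exists2 d, 0 < d & forall y z, ball x d y -> ball x d z ->
    `|f y - f z - dot w (y - z)| <= e * norm1 (y - z).

Definition axis k : V := delta_mx 0 (inord k).

Lemma crd_axis k j : (k < 3)%N -> (j < 3)%N -> crd j (axis k) = (j == k)%:R.
Proof.
move=> k3 j3; rewrite /crd mxE eqxx /=; congr (nat_of_bool _)%:R.
apply/eqP/eqP => [/(congr1 val)|->//]; rewrite /= !inordK //.
Qed.

Lemma ball_crd (x y : V) d : 0 < d -> ball x d y <-> forall k, (k < 3)%N -> `|crd k x - crd k y| < d.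
Proof.
move=> d0; rewrite -ball_normE /ball_ /= /Num.Def.normr /= mx_normrE; split.
  by move=> /bigmax_ltP[_ h] k k3; have := h (0, inord k) isT; rewrite /= !mxE.
move=> h; apply/bigmax_ltP; split=> // -[i j] _; rewrite (ord1 i) /= !mxE.
by have := h j (ltn_ord j); rewrite /crd inord_val.
Qed.

Lemma crd_grad (f : V -> R) x k : (k < 3)%N -> crd k (grad f x) = 'D_(axis k) f x.
Proof. by move=> k3; rewrite /crd mxE. Qed.

Lemma norm_sum3 (e a b c A B C : R) : `|a| <= e * A -> `|b| <= e * B -> `|c| <= e * C ->
  `|a + b + c| <= e * (A + B + C).
Proof.
move=> h1 h2 h3; rewrite !mulrDr; apply: le_trans (ler_normD _ _) _; apply: lerD h3.
by apply: le_trans (ler_normD _ _) _; exact: lerD.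
Qed.

(** Smoothness is given by directional derivatives. From one point to the other the coordinates are
    changed one at a time, and the mean value theorem applies to each of the continuous partial
    derivatives. *)
Lemma smooth_strict (f : V -> R) x : smooth f -> strict_diff f x (grad f x).
Proof.
move=> sf e e0.
have near k : exists2 d, 0 < d & forall y, ball x d y -> `|'D_(axis k) f y - 'D_(axis k) f x| <= e.
  have /cvgrPdist_le /(_ e e0) := @smooth_derive_cont _ _ f (axis k) sf x.
  move=> /nbhs_ballP[d d0 dP]; exists d; first exact: d0.
  by move=> y By; rewrite distrC; exact: dP.
have [d0 d00 D0] := near 0%N; have [d1 d10 D1] := near 1%N; have [d2 d20 D2] := near 2%N.
pose d := Num.min d0 (Num.min d1 d2).
have dp : 0 < d by rewrite !lt_min d00 d10.
have D k y : (k < 3)%N -> ball x d y -> `|'D_(axis k) f y - 'D_(axis k) f x| <= e.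
  move=> k3 By; case: k k3 => [|[|[|//]]] _; [apply: D0|apply: D1|apply: D2];
    by apply: le_ball By; rewrite !ge_min lexx ?orbT.
exists d => // y z By Bz.
have step k (w : V) (h : R) : (k < 3)%N -> ball x d w -> ball x d (w + h *: axis k) ->
    `|f (w + h *: axis k) - f w - 'D_(axis k) f x * h| <= e * `|h|.
  move=> k3 Bw Bw'; have := @mvt_bound (fun s => f (w + s *: axis k))
    (fun s => 'D_(axis k) f (w + s *: axis k)) 0 h ('D_(axis k) f x) e.
  rewrite scale0r addr0 subr0; apply.
    by move=> t; apply: line_derive; exact: smooth_derivable.
  move=> t th; apply: D => //; apply/ball_crd => // j j3.
  move: Bw Bw' => /ball_crd -/(_ dp j j3) h1 /ball_crd -/(_ dp j j3).
  rewrite !crdD !crdZ crd_axis //; case: (j == k); rewrite ?mulr0 ?mulr1 ?addr0 // => h2.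
  move: h1 h2; rewrite !ltr_norml; move: th; rewrite /Num.min /Num.max.
  by case: ltP => h0 /andP[t1 t2] /andP[a1 a2] /andP[a3 a4]; apply/andP; split; lra.
pose h k := crd k y - crd k z.
pose z1 := z + h 0%N *: axis 0; pose z2 := z1 + h 1%N *: axis 1.
have yE : y = z2 + h 2%N *: axis 2.
  by apply: crdE; rewrite /z2 /z1 /h !crdD !crdZ !crd_axis //=; ring.
have Bz1 : ball x d z1.
  apply/ball_crd => // j j3; move: By Bz => /ball_crd -/(_ dp j j3) h1 /ball_crd -/(_ dp j j3).
  rewrite /z1 /h crdD crdZ crd_axis //; case: j j3 h1 => [|[|[|//]]] _ h1 h2 /=;
    by rewrite ?mulr0 ?mulr1 ?addr0 // [crd _ z + _]addrC subrK.
have Bz2 : ball x d z2.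
  apply/ball_crd => // j j3; move: By Bz => /ball_crd -/(_ dp j j3) h1 /ball_crd -/(_ dp j j3).
  rewrite /z2 /z1 /h !crdD !crdZ !crd_axis //; case: j j3 h1 => [|[|[|//]]] _ h1 h2 /=;
    by rewrite ?mulr0 ?mulr1 ?addr0 // [crd _ z + _]addrC subrK.
have s0 := step 0%N z (h 0%N) isT Bz Bz1; have s1 := step 1%N z1 (h 1%N) isT Bz1 Bz2.
have s2 : `|f y - f z2 - 'D_(axis 2) f x * h 2%N| <= e * `|h 2%N|.
  by rewrite {1}yE; apply: step => //; rewrite -yE.
rewrite -/z1 in s0; rewrite -/z2 in s1.
have -> : f y - f z - dot (grad f x) (y - z) = (f z1 - f z - 'D_(axis 0) f x * h 0%N)
    + (f z2 - f z1 - 'D_(axis 1) f x * h 1%N) + (f y - f z2 - 'D_(axis 2) f x * h 2%N).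
  rewrite dotE !crd_grad // !crdD !crdN -/(h 0%N) -/(h 1%N) -/(h 2%N).
  generalize ('D_(axis 0) f x) ('D_(axis 1) f x) ('D_(axis 2) f x).
  by generalize (f y) (f z) (f z1) (f z2) (h 0%N) (h 1%N) (h 2%N) => *; ring.
have n1 : norm1 (y - z) = `|h 0%N| + `|h 1%N| + `|h 2%N|.
  by rewrite /norm1 !crdD !crdN.
by rewrite n1; exact: norm_sum3 s0 s1 s2.
Qed.

Lemma strict_sub (f g : V -> R) x u w : strict_diff f x u -> strict_diff g x w ->
  strict_diff (fun y => f y - g y) x (u - w).
Proof.
move=> sf sg e e0; have e2 : 0 < e / 2 by lra.
have [a a0 A] := sf _ e2; have [b b0 B] := sg _ e2.
exists (Num.min a b) => [|y z By Bz]; first by rewrite lt_min a0.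
have := A y z (le_ball (_ : Num.min a b <= a) By) (le_ball (_ : Num.min a b <= a) Bz).
have := B y z (le_ball (_ : Num.min a b <= b) By) (le_ball (_ : Num.min a b <= b) Bz).
rewrite !ge_min !lexx orbT => /(_ isT isT) h1 /(_ isT isT) h2.
have -> : f y - g y - (f z - g z) - dot (u - w) (y - z) =
  (f y - f z - dot u (y - z)) - (g y - g z - dot w (y - z)).
  by rewrite dotDl dotNl; ring.
apply: le_trans (ler_normB _ _) _; apply: le_trans (lerD h2 h1) _.
by rewrite -mulrDl -splitr.
Qed.

Lemma curve_strict (c : R -> V) (t0 e : R) : smooth c -> 0 < e ->
  exists2 d, 0 < d & forall s t, `|t0 - s| < d -> `|t0 - t| < d -> forall k, (k < 3)%N ->
    `|crd k (c t) - crd k (c s) - crd k (derive1 c t0) * (t - s)| <= e * `|t - s|.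
Proof.
move=> sc e0; have cD : continuous (derive1 c).
  by have -> : derive1 c = 'D_1 c by [apply/funext => t; rewrite derive1E]; exact: smooth_derive_cont.
have isd k (t : R) : is_derive t (1 : R) (fun s => crd k (c s)) (crd k (derive1 c t)).
  have dc := @smooth_derivable _ _ c t 1 sc.
  apply: DeriveDef; first by have /derivable_mxP := dc; exact.
  by rewrite derive1E (derive_mx dc) /crd mxE.
have near k : exists2 d, 0 < d & forall t, `|t0 - t| < d -> `|crd k (derive1 c t) - crd k (derive1 c t0)| <= e.
  have ck : continuous (fun t => crd k (derive1 c t)) by exact: cont_crd.
  have /cvgrPdist_le /(_ e e0) := ck t0.
  move=> /nbhs_ballP[d d0 dP]; exists d; first exact: d0.
  by move=> y By; rewrite distrC; exact: dP.
have [d0 d00 D0] := near 0%N; have [d1 d10 D1] := near 1%N; have [d2 d20 D2] := near 2%N.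
have [d dp [dd0 dd1 dd2]] : exists2 d, 0 < d & [/\ d <= d0, d <= d1 & d <= d2].
  by exists (Num.min d0 (Num.min d1 d2)); rewrite ?lt_min ?d00 ?d10 // !ge_min !lexx !orbT.
exists d => // s t hs ht k k3.
apply: (mvt_bound (isd k)) => r rst.
have hr : `|t0 - r| < d.
  clear - hs ht rst; move: hs ht rst; rewrite !ltr_norml ge_min le_max.
  by move=> /andP[? ?] /andP[? ?] /andP[/orP[?|?] /orP[?|?]]; apply/andP; split; lra.
case: k k3 => [|[|[|//]]] _; [apply: D0|apply: D1|apply: D2]; exact: lt_le_trans hr _.
Qed.

Lemma chain (f : V -> R) (c : R -> V) (t0 : R) w e : strict_diff f (c t0) w -> smooth c -> 0 < e ->
  exists2 d, 0 < d & forall t, `|t0 - t| < d ->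
    `|f (c t) - f (c t0) - dot w (derive1 c t0) * (t - t0)| <= e * `|t - t0|.
Proof.
move=> sf sc e0.
pose m := norm1 (derive1 c t0) + 3 + norm1 w.
have m0 : 0 < m by rewrite /m; have := norm1_ge0 (derive1 c t0); have := norm1_ge0 w; lra.
pose e1 := Num.min 1 (e / (2 * m)).
have e10 : 0 < e1 by rewrite lt_min ltr01 divr_gt0 // mulr_gt0.
have e1m : e1 * (2 * m) <= e.
  by rewrite -ler_pdivlMr ?mulr_gt0 // ge_min lexx orbT.
have e11 : e1 <= 1 by rewrite ge_min lexx.
have [d d0 D] := sf e1 e10; have [d' d'0 D'] := curve_strict t0 sc e10.
have : nbhs t0 [set t | ball (c t0) d (c t)].
  exact: (smooth_cont sc (nbhsx_ballx _ _ d0)).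
move=> /nbhs_ballP[d2 /= d20 D2].
exists (Num.min d' d2) => [|t]; first by rewrite lt_min d'0.
rewrite lt_min => /andP[t1 t2].
have t00 : `|t0 - t0| < d' by rewrite subrr normr0.
have B := D (c t) (c t0) (D2 t t2) (ballxx _ d0).
have K k := D' t0 t t00 t1 k.
have n1 : norm1 (c t - c t0) <= m * `|t - t0|.
  have q k : (k < 3)%N -> `|crd k (c t - c t0)| <= (`|crd k (derive1 c t0)| + 1) * `|t - t0|.
    move=> k3; rewrite crdD crdN.
    have -> : crd k (c t) - crd k (c t0) = (crd k (c t) - crd k (c t0) - crd k (derive1 c t0) * (t - t0))
      + crd k (derive1 c t0) * (t - t0) by ring.
    apply: le_trans (ler_normD _ _) _; rewrite [`|_ * _|]normrM mulrDl mul1r addrC lerD2l.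
    by apply: le_trans (K k k3) _; rewrite ler_piMl.
  rewrite /norm1; apply: le_trans (lerD (lerD (q 0%N isT) (q 1%N isT)) (q 2%N isT)) _.
  rewrite -!mulrDl ler_wpM2r // /m; have := norm1_ge0 w; rewrite {2}/norm1; lra.
have wd : `|dot w (c t - c t0) - dot w (derive1 c t0) * (t - t0)| <= norm1 w * (e1 * `|t - t0|).
  have -> : dot w (c t - c t0) - dot w (derive1 c t0) * (t - t0) =
    dot (c t - c t0 - (t - t0) *: derive1 c t0) w.
    by rewrite [RHS]dotC !dotDr !dotNr dotZr; ring.
  rewrite mulrC; apply: dot_norm1 => k k3; rewrite !crdD !crdN crdZ [(t - t0) * _]mulrC.
  exact: K.
have -> : f (c t) - f (c t0) - dot w (derive1 c t0) * (t - t0) =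
  (f (c t) - f (c t0) - dot w (c t - c t0)) + (dot w (c t - c t0) - dot w (derive1 c t0) * (t - t0)).
  by ring.
apply: le_trans (ler_normD _ _) _; apply: le_trans (lerD B wd) _.
apply: (@le_trans _ _ (e1 * (m * `|t - t0|) + norm1 w * (e1 * `|t - t0|))).
  by rewrite lerD2r ler_pM2l.
have -> : e1 * (m * `|t - t0|) + norm1 w * (e1 * `|t - t0|) = e1 * (m + norm1 w) * `|t - t0| by ring.
rewrite ler_wpM2r //; apply: le_trans e1m; rewrite ler_pM2l //.
by rewrite /m; have := norm1_ge0 (derive1 c t0); lra.
Qed.

End Calculus.

(** * The positive side of a zero set on the sphere *)

Section Sides.
Variable R : realType.
Local Notation V := 'rV[R]_3.

(* A rotation of the plane of two orthonormal vectors [x] and [v], by an angle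
   of tangent half [t]. *)
Definition swing (x v : V) (t : R) (u : V) : V :=
  u + (2 * t / (1 + t ^+ 2)) *: (dot u x *: v - dot u v *: x)
    - (2 * t ^+ 2 / (1 + t ^+ 2)) *: (dot u x *: x + dot u v *: v).

Section Swing.
Variables (x v : V).
Hypotheses (x1 : dot x x = 1) (v1 : dot v v = 1) (xv : dot x v = 0).

Lemma swing_unit t u : dot (swing x v t u) (swing x v t u) = dot u u.
Proof.
rewrite /swing !(dotDr, dotNr, dotZr, dotDl, dotNl, dotZl) x1 v1 xv.
rewrite (dotC v x) xv (dotC x u) (dotC v u).
by field; rewrite gt_eqF // ltr_wpDr // sqr_ge0.
Qed.

Lemma swing0 u : swing x v 0 u = u.
Proof. by rewrite /swing expr0n /= !(mulr0, mul0r, scale0r, addr0, subr0). Qed.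

Lemma cont_swing (T : topologicalType) (t : T -> R) (u : T -> V) :
  continuous t -> continuous u -> continuous (fun z => swing x v (t z) (u z)).
Proof.
move=> ct cu; have c1 : continuous (fun z => dot (u z) x) by apply: cont_dot => //; exact: cont_cst.
have c2 : continuous (fun z => dot (u z) v) by apply: cont_dot => //; exact: cont_cst.
have ci : continuous (fun z => (1 + t z ^+ 2)^-1).
  apply: contV; last by contR.
  by move=> z; rewrite gt_eqF // ltr_wpDr // sqr_ge0.
have ca : continuous (fun z => 2 * t z / (1 + t z ^+ 2)).
  by apply: (contM _ ci); contR.
have cb : continuous (fun z => 2 * t z ^+ 2 / (1 + t z ^+ 2)).
  by apply: (contM _ ci); contR.
have cx : continuous (fun _ : T => x) by exact: cont_cst.
have cv : continuous (fun _ : T => v) by exact: cont_cst.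
apply: cont_vD; last by apply: cont_vN; apply: cont_vZ cb _; apply: cont_vD; exact: cont_vZ.
apply: cont_vD => //; apply: cont_vZ ca _.
by apply: cont_vD; [exact: cont_vZ|apply: cont_vN; exact: cont_vZ].
Qed.

(** To first order the points near [x] move by twice [t] in the direction [v], since [t] is the
    tangent of half the angle. *)
Lemma swing_near e : 0 < e -> exists2 d, 0 < d & forall t u, 0 <= t -> t < d -> ball x d u ->
  forall k, (k < 3)%N -> `|crd k (swing x v t u - u) - 2 * t * crd k v| <= e * t.
Proof.
move=> e0.
have c1 : continuous (fun u : V => dot u x) by apply: cont_dot; [exact: cont_id|exact: cont_cst].
have c2 : continuous (fun u : V => dot u v) by apply: cont_dot; [exact: cont_id|exact: cont_cst].
have [e1 e10 [e11 e1e]] : exists2 e1, 0 < e1 & e1 <= 1 /\ 20 * e1 <= e.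
  exists (Num.min 1 (e / 20)); first by rewrite lt_min ltr01; lra.
  split; first by rewrite ge_min lexx.
  by rewrite [20 * _]mulrC -ler_pdivlMr // ge_min lexx orbT.
have /cvgrPdist_le /(_ e1 e10) /nbhs_ballP[d1 /= d10 D1] := c1 x.
have /cvgrPdist_le /(_ e1 e10) /nbhs_ballP[d2 /= d20 D2] := c2 x.
exists (Num.min e1 (Num.min d1 d2)) => [|t u t0]; first by rewrite !lt_min e10 d10.
rewrite lt_min => /andP[te _] Bu k k3.
have a : `|1 - dot u x| <= e1.
  by have := D1 u; rewrite x1; apply; apply: le_ball Bu; rewrite !ge_min lexx !orbT.
have b : `|dot u v| <= e1.
  have := D2 u; rewrite xv sub0r normrN; apply; apply: le_ball Bu.
  by rewrite !ge_min lexx !orbT.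
have comp (y : V) : dot y y = 1 -> `|crd k y| <= 1.
  move=> y1; rewrite dotE in y1; rewrite -(@expr_le1 _ 2) // -normrX ger0_norm ?sqr_ge0 //.
  by case: k k3 => [|[|[|]]] // _; nra.
have cx := comp x x1; have cv := comp v v1.
have q0 : 0 < 1 + t ^+ 2 by rewrite ltr_wpDr // sqr_ge0.
have qi : 0 < (1 + t ^+ 2)^-1 by rewrite invr_gt0.
have qi1 : (1 + t ^+ 2)^-1 <= 1 by rewrite invf_le1 // lerDl sqr_ge0.
have E : crd k (swing x v t u - u) - 2 * t * crd k v =
   (1 + t ^+ 2)^-1 * (2 * t * ((dot u x - 1 - t ^+ 2) * crd k v - dot u v * crd k x
      - t * (dot u x * crd k x + dot u v * crd k v))).
  rewrite /swing !crdL; field; by rewrite gt_eqF.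
rewrite E normrM (gtr0_norm qi) normrM (ger0_norm (_ : 0 <= 2 * t)); last by lra.
set w := (X in 2 * t * `|X|).
suff w10 : `|w| <= 10 * e1.
  apply: (@le_trans _ _ (1 * (2 * t * (10 * e1)))).
    by apply: ler_pM => //; [exact: ltW|apply: mulr_ge0 => //; lra|apply: ler_pM => //; lra].
  rewrite mul1r; have -> : 2 * t * (10 * e1) = 20 * e1 * t by ring.
  exact: ler_wpM2r.
have t1 : `|t| <= e1 by rewrite ger0_norm // ltW.
have t2 : `|t ^+ 2| <= e1.
  rewrite normrX expr2; apply: le_trans (_ : e1 * 1 <= _); last by rewrite mulr1.
  by apply: ler_pM => //; exact: le_trans t1 _.
have dx : `|dot u x| <= 2.
  have -> : dot u x = 1 - (1 - dot u x) by ring.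
  by apply: le_trans (ler_normB _ _) _; rewrite normr1; lra.
have p1 : `|(dot u x - 1 - t ^+ 2) * crd k v| <= 2 * e1 * 1.
  rewrite normrM; apply: ler_pM => //; apply: le_trans (ler_normB _ _) _.
  by rewrite distrC; lra.
have p2 : `|dot u v * crd k x| <= e1 * 1 by rewrite normrM; apply: ler_pM.
have p3 : `|t * (dot u x * crd k x + dot u v * crd k v)| <= e1 * 3.
  rewrite normrM; apply: ler_pM => //; apply: le_trans (ler_normD _ _) _; rewrite !normrM.
  have h1 : `|dot u x| * `|crd k x| <= 2 * 1 by apply: ler_pM.
  have h2 : `|dot u v| * `|crd k v| <= e1 * 1 by apply: ler_pM.
  lra.
rewrite /w; apply: le_trans (ler_normB _ _) _; have := ler_normB ((dot u x - 1 - t ^+ 2) * crd k v) (dot u v * crd k x).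
lra.
Qed.

Lemma swing_up (f : V -> R) w : strict_diff f x w -> 0 < dot w v ->
  exists2 d, 0 < d & forall t u, 0 < t -> t < d -> ball x d u -> f u < f (swing x v t u).
Proof.
move=> sf wv; pose m := norm1 w + norm1 v + 3.
have m0 : 0 < m by rewrite /m; have := norm1_ge0 w; have := norm1_ge0 v; lra.
have [e e0 [e1 em]] : exists2 e, 0 < e & e <= 1 /\ e * (2 * m) <= dot w v.
  exists (Num.min 1 (dot w v / (2 * m))); first by rewrite lt_min ltr01 divr_gt0 // mulr_gt0.
  split; first by rewrite ge_min lexx.
  by rewrite -ler_pdivlMr ?mulr_gt0 // ge_min lexx orbT.
have [d1 d10 D1] := sf _ e0; have [d2 d20 D2] := swing_near e0.
have : nbhs (x, 0 : R) [set z : V * R | ball x d1 (swing x v z.2 z.1)].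
  have cs : continuous (fun z : V * R => swing x v z.2 z.1).
    by apply: cont_swing; [exact: cont_snd|exact: cont_fst].
  have B : nbhs (swing x v 0 x) (ball x d1) by rewrite swing0; exact: nbhsx_ballx.
  exact: (cs (x, 0) _ B).
move=> /nbhs_ballP[d3 /= d30 D3].
exists (Num.min d1 (Num.min d2 d3)) => [|t u t0]; first by rewrite !lt_min d10 d20.
rewrite !lt_min => /andP[t1 /andP[t2 t3]] Bu.
have B1 : ball x d1 u by apply: le_ball Bu; rewrite !ge_min lexx.
have B2 : ball x d2 u by apply: le_ball Bu; rewrite !ge_min lexx !orbT.
have B3 : ball x d3 u by apply: le_ball Bu; rewrite !ge_min lexx !orbT.
have B4 : ball x d1 (swing x v t u).
  apply: (D3 (u, t)); split=> //=; rewrite /ball /= sub0r normrN gtr0_norm //.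
have F := D1 _ _ B4 B1; have K k := D2 t u (ltW t0) t2 B2 k.
set y := swing x v t u - u in F K.
have n1 : norm1 y <= 2 * t * norm1 v + 3 * e * t.
  have q k : (k < 3)%N -> `|crd k y| <= 2 * t * `|crd k v| + e * t.
    move=> k3; have -> : crd k y = 2 * t * crd k v + (crd k y - 2 * t * crd k v) by ring.
    apply: le_trans (ler_normD _ _) _; apply: lerD; last exact: K.
    by rewrite normrM (ger0_norm (_ : 0 <= 2 * t)) //; lra.
  rewrite /norm1; have := q 0%N isT; have := q 1%N isT; have := q 2%N isT; lra.
have wy : `|dot w y - 2 * t * dot w v| <= e * t * norm1 w.
  have -> : dot w y - 2 * t * dot w v = dot (y - (2 * t) *: v) w.
    by rewrite [RHS]dotC dotDr dotNr dotZr.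
  by apply: dot_norm1 => k k3; rewrite crdD crdN crdZ; exact: K.
have n0 := norm1_ge0 w; have nv := norm1_ge0 v.
have e2 : e * norm1 y <= e * (2 * t * norm1 v + 3 * e * t) by rewrite ler_pM2l.
have e3' : e * (2 * t * norm1 v + 3 * e * t) <= e * t * (2 * norm1 v + 3).
  have -> : e * (2 * t * norm1 v + 3 * e * t) = e * t * (2 * norm1 v + 3 * e) by ring.
  by rewrite ler_wpM2l ?mulr_ge0 ?(ltW e0) ?(ltW t0) //; lra.
have : 2 * t * dot w v > e * t * norm1 w + e * t * (2 * norm1 v + 3).
  have -> : e * t * norm1 w + e * t * (2 * norm1 v + 3) = t * (e * (norm1 w + 2 * norm1 v + 3)) by ring.
  have -> : 2 * t * dot w v = t * (2 * dot w v) by ring.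
  rewrite ltr_pM2l //; apply: (@le_lt_trans _ _ (e * (2 * m))); last by lra.
  by rewrite ler_pM2l // /m; lra.
move: F wy; rewrite !ler_norml => /andP[F1 F2] /andP[w1 w2]; lra.
Qed.

End Swing.

(** Radial projection to the sphere, cut off near the origin so as to be continuous everywhere. *)
Definition nrm (u : V) : V := (Num.max (1 / 2) (Num.sqrt (dot u u)))^-1 *: u.

Lemma cont_nrm : continuous nrm.
Proof.
have cd : continuous (fun u : V => dot u u) by apply: cont_dot; exact: cont_id.
have cs : continuous (fun u : V => Num.sqrt (dot u u)).
  exact: (cont_comp (@sqrt_continuous R) cd).
apply: cont_vZ; last exact: cont_id.
apply: contV; last by apply: cont_max => //; exact: cont_cst.
by move=> u; rewrite gt_eqF // lt_max divr_gt0.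
Qed.

Lemma nrm_unit u : 1 / 4 < dot u u -> dot (nrm u) (nrm u) = 1.
Proof.
move=> u4; have r2 : 1 / 2 <= Num.sqrt (dot u u).
  have -> : 1 / 2 = Num.sqrt ((1 / 2) ^+ 2) :> R by rewrite sqrtr_sqr gtr0_norm // divr_gt0.
  by rewrite ler_sqrt; lra.
have r0 : Num.sqrt (dot u u) != 0 by rewrite gt_eqF //; lra.
have u0 : 0 < dot u u by lra.
by rewrite /nrm max_r // dotZl dotZr mulrA -invfM -expr2 sqr_sqrtr ?mulVf ?gt_eqF ?ltW.
Qed.

Lemma nrm_id u : dot u u = 1 -> nrm u = u.
Proof. by move=> u1; rewrite /nrm u1 sqrtr1 max_r ?invr1 ?scale1r //; lra. Qed.

Lemma segment_image (F : R -> V) : continuous F -> connected (F @` `[0, 1]).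
Proof.
move=> cF; apply: connected_continuous_connected; last exact: continuous_subspaceT.
by apply/connected_intervalP; exact: interval_is_interval.
Qed.

(** Swinging towards [v] increases [f], so a fixed swing makes [f] positive on a whole neighbourhood
    of [x]. Two positive points near [x] are swung by that amount, along paths on which [f] only
    grows, and then joined by the swung image of the projected segment between them. *)
Lemma positive_local (f : V -> R) x v w : continuous f -> dot x x = 1 -> dot v v = 1 ->
  dot x v = 0 -> strict_diff f x w -> 0 < dot w v -> f x = 0 ->
  (forall r, 0 < r -> exists y, [/\ dot y y = 1, ball x r y & 0 < f y]) /\
  exists2 r, 0 < r & forall y z, dot y y = 1 -> dot z z = 1 ->
    ball x r y -> ball x r z -> 0 < f y -> 0 < f z ->
    exists W : set V, [/\ connected W, W y, W z &
      forall w, W w -> dot w w = 1 /\ 0 < f w].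
Proof.
move=> cf x1 v1 xv sf wv fx; have [d d0 D] := swing_up x1 v1 xv sf wv.
have csw t : continuous (swing x v t) by apply: cont_swing; [exact: cont_cst|exact: cont_id].
have cst u : continuous (fun t => swing x v t u) by apply: cont_swing; [exact: cont_id|exact: cont_cst].
split.
  move=> r r0; have : nbhs 0 [set t | ball x r (swing x v t x)].
    have B : nbhs (swing x v 0 x) (ball x r) by rewrite swing0; exact: nbhsx_ballx.
    exact: (cst x 0 _ B).
  move=> /nbhs_ballP[d' /= d'0 D'].
  have [t t0 [td td']] : exists2 t, 0 < t & t < d /\ t < d'.
    exists (Num.min (d / 2) (d' / 2)); first by rewrite lt_min; lra.
    by rewrite !gt_min; split; apply/orP; [left|right]; lra.
  exists (swing x v t x); split; first by rewrite swing_unit.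
    by apply: D'; rewrite /ball /= sub0r normrN gtr0_norm.
  by rewrite -fx; apply: D => //; exact: ballxx.
pose t := d / 2; have t0 : 0 < t by rewrite /t; lra.
have td : t < d by rewrite /t; lra.
have : nbhs x [set u | 1 / 4 < dot u u /\ 0 < f (swing x v t (nrm u))].
  have c1 : continuous (fun u : V => dot u u) by apply: cont_dot; exact: cont_id.
  have c2 : continuous (fun u => f (swing x v t (nrm u))).
    exact: (cont_comp2 cf (cont_comp2 (csw t) cont_nrm)).
  have h1 : \forall u \near x, 1 / 4 < dot u u.
    by apply: (@cvgr_gt _ _ _ _ _ _ (c1 x)); rewrite x1; lra.
  have h2 : \forall u \near x, 0 < f (swing x v t (nrm u)).
    apply: (@cvgr_gt _ _ _ _ _ _ (c2 x)); rewrite nrm_id //.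
    by rewrite -fx; apply: D => //; exact: ballxx.
  exact: filterI h1 h2.
move=> /nbhs_ballP[d' /= d'0 D'].
exists (Num.min d d') => [|y z y1 z1 By Bz fy fz]; first by rewrite lt_min d0.
have r0 : 0 < Num.min d d' by rewrite lt_min d0.
have up u : dot u u = 1 -> ball x (Num.min d d') u -> 0 < f u ->
    forall s, `[0, 1]%classic s -> dot (swing x v (s * t) u) (swing x v (s * t) u) = 1 /\
      0 < f (swing x v (s * t) u).
  move=> u1 Bu fu s; rewrite itv01 => /andP[s0 s1]; rewrite swing_unit //; split=> //.
  have [->|sn] := eqVneq s 0; first by rewrite mul0r swing0.
  have sp : 0 < s by rewrite lt0r sn.
  apply: lt_trans fu _; apply: D; first exact: mulr_gt0.
    by apply: le_lt_trans td; rewrite ler_piMl // ltW.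
  by apply: le_ball Bu; rewrite ge_min lexx.
pose seg s := (1 - s) *: y + s *: z.
have cseg : continuous seg.
  have cs : continuous (fun s : R => s) by move=> s; exact: cvg_id.
  have c1s : continuous (fun s : R => 1 - s) by move=> s; apply: cvgB; [exact: cvg_cst|exact: cvg_id].
  have cy : continuous (fun _ : R => y) by move=> s; exact: cvg_cst.
  have cz : continuous (fun _ : R => z) by move=> s; exact: cvg_cst.
  exact: (cont_vD (cont_vZ c1s cy) (cont_vZ cs cz)).
have Bseg s : `[0, 1]%classic s -> ball x d' (seg s).
  rewrite itv01 => /andP[s0 s1]; apply/ball_crd => // k k3.
  have md : Num.min d d' <= d' by rewrite ge_min lexx orbT.
  have /ball_crd -/(_ d'0 k k3) := le_ball md By.
  have /ball_crd -/(_ d'0 k k3) := le_ball md Bz.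
  rewrite /seg crdD !crdZ !ltr_norml => /andP[a1 a2] /andP[a3 a4].
  clear - s0 s1 a1 a2 a3 a4; apply/andP.
  by case: (lerP (crd k y) (crd k z)) => yz; split; nra.
pose Wy := (fun s => swing x v (s * t) y) @` `[0, 1].
pose Wz := (fun s => swing x v (s * t) z) @` `[0, 1].
pose Wm := (fun s => swing x v t (nrm (seg s))) @` `[0, 1].
have cst' : continuous (fun s : R => s * t) by apply: contM; [exact: cont_id|exact: cont_cst].
have i0 : `[0, 1]%classic (0 : R) by rewrite itv01; lra.
have i1 : `[0, 1]%classic (1 : R) by rewrite itv01; lra.
have yt : Wy (swing x v t y) by exists 1 => //; rewrite mul1r.
have zt : Wz (swing x v t z) by exists 1 => //; rewrite mul1r.
have ym : Wm (swing x v t y) by exists 0 => //; rewrite /seg subr0 scale1r scale0r addr0 nrm_id.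
have zm : Wm (swing x v t z) by exists 1 => //; rewrite /seg subrr scale1r scale0r add0r nrm_id.
exists ((Wy `|` Wm) `|` Wz); split.
- apply: connectedU; first by exists (swing x v t z); split=> //; right.
    apply: connectedU; first by exists (swing x v t y).
      exact: segment_image (cont_comp2 (cst y) cst').
    exact: segment_image (cont_comp2 (cont_comp2 (csw t) cont_nrm) cseg).
  exact: segment_image (cont_comp2 (cst z) cst').
- by left; left; exists 0 => //; rewrite mul0r swing0.
- by right; exists 0 => //; rewrite mul0r swing0.
move=> u [[[s si <-]|[s si <-]]|[s si <-]].
- exact: up.
- have [q4 fp] := D' _ (Bseg s si); split=> //.
  by rewrite swing_unit // nrm_unit.
- exact: up.
Qed.

End Sides.

(** * Six directions on three lines *)

Section Rays.
Variable R : realType.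
Local Notation V := 'rV[R]_3.

Lemma det3E (x u v : V) : det3 x u v = dot x (cross u v).
Proof.
have i0 : inord 0 = ord0 :> 'I_3 by apply/val_inj; rewrite /= inordK.
have i1 : inord 1 = lift ord0 ord0 :> 'I_3 by apply/val_inj; rewrite /= inordK.
have i2 : inord 2 = lift ord0 (lift ord0 ord0) :> 'I_3 by apply/val_inj; rewrite /= inordK.
rewrite dotE /cross !crdv /crd i0 i1 i2.
rewrite /det3 (expand_det_row _ ord0) !big_ord_recl big_ord0 /cofactor.
rewrite !(expand_det_row _ ord0) !big_ord_recl !big_ord0 /cofactor !det_mx11 !mxE /=.
have l1 : lift (lift ord0 ord0) ord0 = ord0 :> 'I_3 by exact/val_inj.
have l2 : lift (lift ord0 ord0) (lift ord0 ord0) = lift ord0 (lift ord0 ord0) :> 'I_3 by exact/val_inj.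
have l3 : lift (lift ord0 (lift ord0 ord0)) ord0 = ord0 :> 'I_3 by exact/val_inj.
have l4 : lift (lift ord0 (lift ord0 ord0)) (lift ord0 ord0) = lift ord0 ord0 :> 'I_3 by exact/val_inj.
have l5 : lift (lift ord0 ord0) ord0 = ord0 :> 'I_2 by exact/val_inj.
rewrite ?l5 ?l1 ?l2 ?l3 ?l4 /bump /= ?addn0 ?add0n ?expr0 ?expr1 ?sqrrN ?expr1n.
ring.
Qed.

Lemma crossZ (a b : R) (u v : V) : cross (a *: u) (b *: v) = (a * b) *: cross u v.
Proof. by apply: crdE; rewrite /cross [RHS]crdZ !crdv !crdZ; ring. Qed.

Lemma two_of_three (a b c d : 'I_3) : a != d -> b != d -> c != d ->
  [\/ a = b, a = c | b = c].
Proof.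
move: a b c d; do 4![case=> [[|[|[|//]]] ?] //=]; move=> // *;
  first [by apply: Or31; exact/val_inj|by apply: Or32; exact/val_inj|by apply: Or33; exact/val_inj].
Qed.

Lemma pigeon (I : eqType) (k : I -> 'I_3) (c : 'I_3) (P : I -> Prop) (x y z : I) :
  (forall i j, P i -> P j -> k i = k j -> i = j) -> (forall i, P i -> k i != c) ->
  P x -> P y -> P z -> x != y -> x != z -> y != z -> False.
Proof.
move=> inj kc Px Py Pz xy xz yz.
by have [/inj E|/inj E|/inj E] := two_of_three (kc _ Px) (kc _ Py) (kc _ Pz);
  move: xy xz yz; rewrite E // eqxx.
Qed.

Lemma line_coord (a0 a1 a2 b0 b1 b2 v0 v1 v2 : R) :
  a0 * v0 + a1 * v1 + a2 * v2 = 0 -> b0 * v0 + b1 * v1 + b2 * v2 = 0 ->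
  ((a1 * b2 - a2 * b1) * (a1 * b2 - a2 * b1) + (a2 * b0 - a0 * b2) * (a2 * b0 - a0 * b2)
    + (a0 * b1 - a1 * b0) * (a0 * b1 - a1 * b0)) * v0 =
  ((a1 * b2 - a2 * b1) * v0 + (a2 * b0 - a0 * b2) * v1 + (a0 * b1 - a1 * b0) * v2)
    * (a1 * b2 - a2 * b1).
Proof.
move=> xv wv; apply/eqP; rewrite -subr_eq0; apply/eqP.
transitivity ((a0 * v0 + a1 * v1 + a2 * v2) * (a0 * (b0 * b0 + b1 * b1 + b2 * b2)
        - b0 * (a0 * b0 + a1 * b1 + a2 * b2))
      + (b0 * v0 + b1 * v1 + b2 * v2) * (b0 * (a0 * a0 + a1 * a1 + a2 * a2)
        - a0 * (a0 * b0 + a1 * b1 + a2 * b2))); first by ring.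
by rewrite xv wv !mul0r addr0.
Qed.

Lemma cross_line (x w v : V) : dot x v = 0 -> dot w v = 0 ->
  dot (cross x w) (cross x w) *: v = dot (cross x w) v *: cross x w.
Proof.
rewrite !dotE => xv wv; apply: crdE; rewrite !crdZ /cross !crdv.
- rewrite (line_coord xv wv); ring.
- have a1 : crd 1 x * crd 1 v + crd 2 x * crd 2 v + crd 0 x * crd 0 v = 0 by rewrite -[RHS]xv; ring.
  have b1 : crd 1 w * crd 1 v + crd 2 w * crd 2 v + crd 0 w * crd 0 v = 0.
    by rewrite -[RHS]wv; ring.
  by apply: etrans (etrans (line_coord a1 b1) _); ring.
- have a1 : crd 2 x * crd 2 v + crd 0 x * crd 0 v + crd 1 x * crd 1 v = 0 by rewrite -[RHS]xv; ring.
  have b1 : crd 2 w * crd 2 v + crd 0 w * crd 0 v + crd 1 w * crd 1 v = 0.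
    by rewrite -[RHS]wv; ring.
  by apply: etrans (etrans (line_coord a1 b1) _); ring.
Qed.

(** The cyclic order makes the six rays distinct, and three lines carry only six rays, so the
    opposite of the first one occurs. On either side of the line of these two there is at most one
    ray of each of the other two lines; by counting, the opposite ray has index 3. *)
Lemma six_rays (x : V) (w : 'I_3 -> V) (u : 'I_6 -> V) (k : 'I_6 -> 'I_3) :
  (forall i, dot x (u i) = 0 /\ u i != 0) -> (forall i, dot (w (k i)) (u i) = 0) ->
  (forall c c' v, c != c' -> dot x v = 0 -> dot (w c) v = 0 -> dot (w c') v = 0 -> v = 0) ->
  (forall i j : 'I_6, (0 < i)%N -> (i < j)%N -> ccw x (u ord0) (u i) (u j)) ->
  [/\ k (inord 3) = k ord0, k (inord 1) != k ord0, k (inord 2) != k ord0 &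
      exists2 l, 0 < l & u (inord 3) = - l *: u ord0].
Proof.
move=> ux uw ind cc.
pose l c := cross x (w c).
have dl c v : dot x v = 0 -> dot (w c) v = 0 -> dot (l c) (l c) *: v = dot (l c) v *: l c.
  exact: cross_line.
have lx c : dot x (l c) = 0 by rewrite dotE /l /cross !crdv; ring.
have lw c : dot (w c) (l c) = 0 by rewrite dotE /l /cross !crdv; ring.
have lw' c c' : dot (w c') (l c) = - dot (w c) (l c') by rewrite !dotE /l /cross !crdv; ring.
have l0 c : l c != 0.
  have [c' cc'] : exists c', c != c'.
    by have [->|h] := eqVneq c ord0; [exists ord_max|exists ord0].
  apply/eqP => lc0; have [i Ei] : exists i, k i = k ord0 by exists ord0.
  have l'0 : l c' = 0.
    apply: (ind c c') => //.
    by rewrite -[dot _ _]opprK -lw' lc0 dotE !crd_0 !mulr0 !addr0 oppr0.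
  have /eqP : l (k ord0) = 0.
    have [<-//|h] := eqVneq c (k ord0); apply: (ind c (k ord0)) => //.
    by rewrite -[dot _ _]opprK -lw' lc0 dotE !crd_0 !mulr0 !addr0 oppr0.
  move=> /eqP k0; have [d kd] : exists d, k ord0 != d.
    by have [->|h] := eqVneq (k ord0) ord0; [exists ord_max|exists ord0].
  have all0 d' : l d' = 0.
    have [->//|h] := eqVneq d' (k ord0); apply: (ind (k ord0) d'); rewrite 1?eq_sym //.
    by rewrite -[dot _ _]opprK -lw' k0 dotE !crd_0 !mulr0 !addr0 oppr0.
  have wall d' v : dot x v = 0 -> dot (w d') v * dot x x = 0.
    rewrite !dotE; have := congr1 (crd 0) (all0 d'); have := congr1 (crd 1) (all0 d').
    have := congr1 (crd 2) (all0 d'); rewrite /l /cross !crdv !crd_0.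
    set a0 := crd 0 x; set a1 := crd 1 x; set a2 := crd 2 x.
    set b0 := crd 0 (w d'); set b1 := crd 1 (w d'); set b2 := crd 2 (w d').
    set v0 := crd 0 v; set v1 := crd 1 v; set v2 := crd 2 v => e2 e1 e0 xv.
    transitivity ((a0 * v0 + a1 * v1 + a2 * v2) * (a0 * b0 + a1 * b1 + a2 * b2)
      + (a0 * b1 - a1 * b0) * (a0 * v1 - a1 * v0) + (a2 * b0 - a0 * b2) * (a2 * v0 - a0 * v2)
      + (a1 * b2 - a2 * b1) * (a1 * v2 - a2 * v1)); first by ring.
    by rewrite xv e0 e1 e2 !mul0r !addr0.
  have [xu u0] := ux ord0; have xx : dot x x != 0.
    rewrite gt_eqF // dot_gt0; apply/eqP => x0.
    have := cc (inord 1) (inord 2); rewrite !inordK // => /(_ isT isT).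
    by rewrite /ccw !det3E x0 !dotE !crd_0 !mul0r !addr0 !ltxx => -[[]|[]|[]].
  have wu d' : dot (w d') (u ord0) = 0.
    by apply: (mulIf xx); rewrite mul0r wall.
  by move: u0; rewrite (ind _ _ _ kd xu (wu _) (wu _)) eqxx.
have [mu muE] : exists mu : 'I_6 -> R, forall i, mu i != 0 /\ u i = mu i *: l (k i).
  have ex i : exists m, m != 0 /\ u i = m *: l (k i).
    have ll : dot (l (k i)) (l (k i)) != 0 by rewrite gt_eqF // dot_gt0.
    have [xu u0] := ux i; have E := dl (k i) (u i) xu (uw i).
    exists (dot (l (k i)) (u i) / dot (l (k i)) (l (k i))); split; last first.
      by apply: (scalerI ll); rewrite E scalerA mulrC divfK.
    rewrite mulf_neq0 ?invr_eq0 //; apply: contraNneq u0 => z.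
    by apply/eqP/(scalerI ll); rewrite E z scale0r scaler0.
  by have [m mP] := choice ex; exists m.
pose Dt c c' := dot x (cross (l c) (l c')).
have detE i j : det3 x (u i) (u j) = mu i * mu j * Dt (k i) (k j).
  have [_ ->] := muE i; have [_ ->] := muE j.
  by rewrite det3E crossZ dotZr.
have Dcc c : Dt c c = 0 by rewrite /Dt dotE /cross !crdv; ring.
have Dan c c' : Dt c c' = - Dt c' c by rewrite /Dt !dotE /cross !crdv; ring.
pose p i j := 0 < mu i * mu j * Dt (k i) (k j).
have pan i j : p i j -> p j i -> False.
  by rewrite /p Dan mulrN [mu j * _]mulrC; lra.
have pk i j : k i = k j -> p i j -> False by rewrite /p => ->; rewrite Dcc mulr0 ltxx.
have ccp (i j : 'I_6) : (0 < i)%N -> (i < j)%N ->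
    [\/ p ord0 i /\ p i j, p i j /\ p j ord0 | p j ord0 /\ p ord0 i].
  by move=> i0 ij; have := cc i j i0 ij; rewrite /ccw !detE.
(* same line and same side is impossible *)
have same (i j m : 'I_6) : k i = k j -> 0 < mu i * mu j -> p i m -> p j m.
  move=> kij mm; rewrite /p kij => h; have [mi _] := muE i; have [mj _] := muE j.
  have i2 : 0 < mu i ^+ 2 by rewrite exprn_even_gt0.
  rewrite -(pmulr_rgt0 _ i2); have := mulr_gt0 mm h.
  by congr (0 < _); ring.
have same' (i j m : 'I_6) : k i = k j -> 0 < mu i * mu j -> p m i -> p m j.
  move=> kij mm; rewrite /p kij => h; have [mi _] := muE i; have [mj _] := muE j.
  have i2 : 0 < mu i ^+ 2 by rewrite exprn_even_gt0.
  rewrite -(pmulr_rgt0 _ i2); have := mulr_gt0 mm h.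
  by congr (0 < _); ring.
have no_ij (i j : 'I_6) : (i < j)%N -> k i = k j -> 0 < mu i * mu j -> False.
  move=> ij kij mm; have mm' : 0 < mu j * mu i by rewrite mulrC.
  have [i0|i0] := posnP i.
    have Ei : i = ord0 by exact/val_inj.
    move: kij mm mm'; rewrite Ei => kij mm mm'; rewrite Ei in ij.
    have [m m0 mj] : exists2 m : 'I_6, (0 < m)%N & m != j.
      have [->|h] := eqVneq j (inord 1); last by exists (inord 1); rewrite ?inordK // eq_sym.
      by exists (inord 2); rewrite ?inordK //; apply/eqP => /(congr1 val); rewrite /= !inordK.
    have [jm|mj'|E] := ltngtP j m; last by move: mj; rewrite (val_inj E) eqxx.
      have [[a b]|[a b]|[a b]] := ccp j m ij jm.
      - exact: pk kij a.
      - by apply: (pan m ord0) => //; exact: same (esym kij) mm' a.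
      - exact: pk kij b.
    have [[a b]|[a b]|[a b]] := ccp m j m0 mj'.
    - by apply: (pan m j) => //; exact: same kij mm a.
    - exact: pk (esym kij) b.
    - exact: pk (esym kij) a.
  have [[a b]|[a b]|[a b]] := ccp i j i0 ij.
  - exact: pk kij b.
  - exact: pk kij a.
  - by apply: (pan ord0 i) => //; exact: same (esym kij) mm' a.
have opp_mu (i j : 'I_6) : i != j -> k i = k j -> mu i * mu j < 0.
  move=> ij kij; have [mi _] := muE i; have [mj _] := muE j.
  rewrite lt_neqAle mulf_neq0 //= leNgt; apply/negP => mm.
  have [h|h|h] := ltngtP i j; last by move: ij; rewrite (val_inj h) eqxx.
    exact: no_ij h kij mm.
  by apply: no_ij h (esym kij) _; rewrite mulrC.
pose ray i := (k i, 0 < mu i).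
have ray_inj : injective ray.
  move=> i j [kij mij]; apply/eqP/negPn/negP => /opp_mu /(_ kij).
  have [mi _] := muE i; have [mj _] := muE j.
  rewrite ltNge => /negP; apply; case: (ltrP 0 (mu i)) mij => h /esym.
    by move=> h'; rewrite mulr_ge0 // ltW.
  by move=> /negbT; rewrite -leNgt => h'; rewrite mulr_le0.
have ray_bij : exists m, ray m = (k ord0, ~~ (0 < mu ord0)).
  have cardE : #|{: 'I_6}| = #|{: 'I_3 * bool}| by rewrite card_prod card_bool !card_ord.
  have [g _ gK] := inj_card_bij ray_inj (eq_leq (esym cardE)).
  by exists (g (k ord0, ~~ (0 < mu ord0))).
have [m [km sm]] := ray_bij.
have m0 : m != ord0 by apply: contraTneq isT => E; move: sm; rewrite E; case: (0 < mu ord0).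
have mp : (0 < m)%N by rewrite lt0n; apply: contra m0 => /eqP E; apply/eqP/val_inj.
have other (i : 'I_6) : i != ord0 -> i != m -> k i != k ord0.
  move=> i0 im; apply/eqP => ki; have a := opp_mu _ _ i0 ki.
  have b := opp_mu _ _ im (etrans ki (esym km)); have c := opp_mu _ _ m0 km.
  have [mi _] := muE i; have i2 : 0 < mu i ^+ 2 by rewrite exprn_even_gt0.
  have : 0 < (mu i * mu ord0) * (mu i * mu m) by rewrite nmulr_rgt0.
  have -> : mu i * mu ord0 * (mu i * mu m) = mu i ^+ 2 * (mu m * mu ord0) by ring.
  by rewrite pmulr_rgt0 //; lra.
have left (i : 'I_6) : (0 < i)%N -> (i < m)%N -> p ord0 i.
  move=> i0 im; have [[a b]//|[a b]|[a b]//] := ccp i m i0 im.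
  by case: (pk m ord0 km b).
have right (i : 'I_6) : (m < i)%N -> p i ord0.
  move=> mi; have [[a b]|[a b]//|[a b]//] := ccp m i mp mi.
  by case: (pk ord0 m (esym km) a).
have linj (i j : 'I_6) : (0 < i)%N /\ (i < m)%N -> (0 < j)%N /\ (j < m)%N -> k i = k j -> i = j.
  move=> [i0 im] [j0 jm] kij; apply/eqP/negPn/negP => /opp_mu /(_ kij) mm.
  have := left i i0 im; have := left j j0 jm; rewrite /p kij => a b.
  have := mulr_gt0 a b; have [z _] := muE ord0.
  have -> : mu ord0 * mu j * Dt (k ord0) (k j) * (mu ord0 * mu i * Dt (k ord0) (k j)) =
    (mu ord0 * Dt (k ord0) (k j)) ^+ 2 * (mu i * mu j) by ring.
  have := sqr_ge0 (mu ord0 * Dt (k ord0) (k j)); nra.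
have rinj (i j : 'I_6) : (m < i)%N -> (m < j)%N -> k i = k j -> i = j.
  move=> im jm kij; apply/eqP/negPn/negP => /opp_mu /(_ kij) mm.
  have := right i im; have := right j jm; rewrite /p kij => a b.
  have := mulr_gt0 a b.
  have -> : mu j * mu ord0 * Dt (k j) (k ord0) * (mu i * mu ord0 * Dt (k j) (k ord0)) =
    (mu ord0 * Dt (k j) (k ord0)) ^+ 2 * (mu i * mu j) by ring.
  have := sqr_ge0 (mu ord0 * Dt (k j) (k ord0)); nra.
have dif (a b : nat) : (a < 6)%N -> (b < 6)%N -> a != b -> inord a != inord b :> 'I_6.
  by move=> a6 b6 ab; apply/eqP => /(congr1 val); rewrite /= !inordK //; exact/eqP.
have mE : m = inord 3.
  apply/val_inj; rewrite /= inordK //; have [lt|gt|//] := ltngtP m 3%N.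
    case: (@pigeon 'I_6 k (k ord0) (fun i => (m < i)%N) (inord 3) (inord 4) (inord 5));
      rewrite ?inordK ?dif //; try lia.
      move=> i mi; apply: other; first by rewrite -(inj_eq val_inj) /=; lia.
      by rewrite -(inj_eq val_inj) /=; lia.
  case: (@pigeon 'I_6 k (k ord0) (fun i => (0 < i)%N /\ (i < m)%N) (inord 1) (inord 2) (inord 3));
    rewrite ?inordK ?dif //; try lia.
  move=> i [i0 im]; apply: other; rewrite -(inj_eq val_inj) /=; lia.
have n0 (a : nat) : (0 < a < 6)%N -> inord a != ord0 :> 'I_6.
  by move=> h; rewrite -(inj_eq val_inj) /= inordK; lia.
split; first by rewrite -mE.
- by apply: other; rewrite ?mE ?n0 ?dif.
- by apply: other; rewrite ?mE ?n0 ?dif.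
have c := opp_mu _ _ m0 km; have [z0 e0] := muE ord0; have [_ em] := muE m.
exists (- (mu m / mu ord0)).
  have m2 : 0 < mu ord0 ^+ 2 by rewrite exprn_even_gt0.
  rewrite oppr_gt0; suff : mu m / mu ord0 * mu ord0 ^+ 2 < 0 by rewrite pmulr_llt0.
  by have -> : mu m / mu ord0 * mu ord0 ^+ 2 = mu m * mu ord0 by [field].
by rewrite -mE em km e0 opprK scalerA divfK.
Qed.

End Rays.

(** * Smoothness of 1-jets and the constant isotopy *)

Section Smoothness.
Variable R : realType.
Local Notation V := 'rV[R]_3.

Lemma Ck_cst (U W : normedModType R) k (c : W) : Ck k (fun _ : U => c).
Proof.
elim: k c => [|k IH] c; first by move=> x; exact: cvg_cst.
split=> [x v|v]; first exact: derivable_cst.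
have -> : 'D_v (fun _ : U => c) = (fun _ => 0); last exact: IH.
by apply/funext => x; rewrite derive_cst.
Qed.

Lemma Ck_add (U W : normedModType R) k (f g : U -> W) : Ck k f -> Ck k g ->
  Ck k (fun x => f x + g x).
Proof.
elim: k f g => [|k IH] f g.
  by move=> cf cg x; apply: cvgD; [exact: cf|exact: cg].
move=> [df Df] [dg Dg]; split=> [x v|v]; first exact: derivableD.
have -> : 'D_v (fun x => f x + g x) = (fun x => 'D_v f x + 'D_v g x).
  by apply/funext => x; exact: deriveD.
by apply: IH; [exact: Df|exact: Dg].
Qed.

Lemma Ck_opp (U W : normedModType R) k (f : U -> W) : Ck k f -> Ck k (fun x => - f x).
Proof.
elim: k f => [|k IH] f; first by move=> cf x; apply: cvgN; exact: cf.
move=> [df Df]; split=> [x v|v]; first exact: derivableN.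
have -> : 'D_v (fun x => - f x) = (fun x => - 'D_v f x).
  by apply/funext => x; exact: deriveN.
by apply: IH; exact: Df.
Qed.

Lemma smooth_derive (U W : normedModType R) (f : U -> W) v : smooth f -> smooth ('D_v f).
Proof. by move=> sf k; have [_] := sf k.+1; apply. Qed.

Lemma smooth_mul (U : normedModType R) (f g : U -> R) : smooth f -> smooth g ->
  smooth (fun x => f x * g x).
Proof.
move=> + + k; elim: k f g => [|k IH] f g sf sg.
  by move=> x; apply: cvgM; [exact: (sf 0%N)|exact: (sg 0%N)].
have df x v := @smooth_derivable R U R f x v sf.
have dg x v := @smooth_derivable R U R g x v sg.
split=> [x v|v]; first exact: derivableM.
have -> : 'D_v (fun x => f x * g x) = (fun x => f x * 'D_v g x + g x * 'D_v f x).
  by apply/funext => x; exact: deriveM.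
by apply: Ck_add; apply: IH => //; exact: smooth_derive.
Qed.

Lemma pair_quotient (U W W' : normedModType R) (f : U -> W) (g : U -> W') x v :
  derivable f x v -> derivable g x v ->
  (fun h : R => h^-1 *: (((fun y => (f y, g y)) \o shift x) (h *: v) - (f x, g x))) @ 0^' -->
  ('D_v f x, 'D_v g x).
Proof. by move=> df dg; exact: (cvg_pair df dg). Qed.

Lemma derive_pair (U W W' : normedModType R) (f : U -> W) (g : U -> W') x v :
  derivable f x v -> derivable g x v ->
  'D_v (fun y => (f y, g y)) x = ('D_v f x, 'D_v g x).
Proof. by move=> df dg; apply: (cvg_lim (@norm_hausdorff _ _)); exact: pair_quotient. Qed.

Lemma derivable_pair (U W W' : normedModType R) (f : U -> W) (g : U -> W') x v :
  derivable f x v -> derivable g x v -> derivable (fun y => (f y, g y)) x v.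
Proof.
by move=> df dg; apply/cvg_ex; exists ('D_v f x, 'D_v g x); exact: pair_quotient.
Qed.

Lemma Ck_pair (U W W' : normedModType R) k (f : U -> W) (g : U -> W') : Ck k f -> Ck k g ->
  Ck k (fun x => (f x, g x)).
Proof.
elim: k f g => [|k IH] f g; first by move=> cf cg; exact: cont_pair.
move=> [df Df] [dg Dg]; split=> [x v|v]; first exact: derivable_pair.
have -> : 'D_v (fun x => (f x, g x)) = (fun x => ('D_v f x, 'D_v g x)).
  by apply/funext => x; exact: derive_pair.
by apply: IH; [exact: Df|exact: Dg].
Qed.

Lemma Ck_row (U : normedModType R) k (F : U -> V) :
  (forall j, Ck k (fun x => F x 0 j)) -> Ck k F.
Proof.
elim: k F => [|k IH] F cF.
  apply: cont_rV => j j3; exact: cF.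
have dF x v : derivable F x v.
  by apply/derivable_mxP => i j; rewrite (ord1 i); have [d _] := cF j; exact: d.
split=> // v; apply: IH => j.
have -> : (fun x => 'D_v F x 0 j) = 'D_v (fun x => F x 0 j).
  by apply/funext => x; rewrite (derive_mx (dF x v)) mxE.
by have [_] := cF j; apply.
Qed.

Lemma smooth_coord (j : 'I_3) : smooth (fun x : V => x 0 j).
Proof.
case=> [|k].
  have -> : (fun x : V => x 0 j) = crd j by apply/funext => x; rewrite /crd inord_val.
  exact: crd_continuous.
have did (x v : V) : derivable (fun y : V => y) x v by exact: derivable_id.
split=> [x v|v]; first by have /derivable_mxP := did x v; apply.
have -> : 'D_v (fun x : V => x 0 j) = (fun _ => v 0 j); last exact: Ck_cst.
apply/funext => x; have := derive_mx (did x v); rewrite derive_id => /matrixP /(_ 0 j).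
by rewrite mxE.
Qed.

Lemma Ck_snd (U W T : normedModType R) k (F : U -> W) : Ck k F -> Ck k (fun tx : T * U => F tx.2).
Proof.
elim: k F => [|k IH] F; first by move=> cF; exact: (cont_comp2 cF (@cont_snd _ _)).
move=> [dF DF]; split=> [x v|v]; first exact: (dF x.2 v.2).
exact: (IH _ (DF v.2)).
Qed.

Lemma smooth_sum3 (U : normedModType R) (f : 'I_3 -> U -> R) : (forall i, smooth (f i)) ->
  smooth (fun x => \sum_i f i x).
Proof.
move=> sf k; have -> : (fun x => \sum_i f i x) =
    (fun x => f ord0 x + (f (lift ord0 ord0) x + f (lift ord0 (lift ord0 ord0)) x)).
  by apply/funext => x; rewrite !big_ord_recl big_ord0 addr0.
by apply: Ck_add; [exact: sf|apply: Ck_add; exact: sf].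
Qed.

Lemma smooth_jet1 (f : V -> R) : smooth f -> smooth (jet1 f).
Proof.
move=> sf k; apply: Ck_pair; last exact: sf.
apply: Ck_pair; first by apply: Ck_row => j; exact: smooth_coord.
have sg j : smooth (fun x => grad f x 0 j).
  have -> : (fun x => grad f x 0 j) = 'D_(delta_mx 0 j) f by apply/funext => x; rewrite mxE.
  exact: smooth_derive.
apply: Ck_row => j.
have -> : (fun x => (grad f x - dot x (grad f x) *: x) 0 j) =
    (fun x => grad f x 0 j + - (dot x (grad f x) * x 0 j)).
  by apply/funext => x; rewrite !mxE.
apply: Ck_add; first exact: sg.
apply: Ck_opp; apply: smooth_mul; last exact: smooth_coord.
by apply: smooth_sum3 => i; apply: smooth_mul; [exact: smooth_coord|exact: sg].
Qed.

(** Linearity in the direction is not part of the definition of [smooth]; it follows from strict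
    differentiability. *)
Lemma derive_dot (f : V -> R) x v : smooth f -> 'D_v f x = dot (grad f x) v.
Proof.
move=> sf; apply: (cvg_lim (@norm_hausdorff _ _)); apply/cvgrPdist_le => e e0.
have e1 : 0 < e / (norm1 v + 1) by rewrite divr_gt0 // ltr_wpDl ?norm1_ge0.
have [d d0 D] := smooth_strict x sf e1.
have : nbhs (0 : R) [set h : R | ball x d (h *: v + x)].
  have ch : continuous (fun h : R => h *: v + x).
    by apply: cont_vD; [apply: cont_vZ; [exact: cont_id|exact: cont_cst]|exact: cont_cst].
  have B : nbhs (0 *: v + x) (ball x d) by rewrite scale0r add0r; exact: nbhsx_ballx.
  exact: (ch 0 _ B).
move=> /nbhs_ballP[d' /= d'0 D']; apply/nbhs_ballP; exists d' => //= h Bh h0.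
have F := D _ _ (D' h Bh) (ballxx x d0); rewrite addrK dotZr in F.
rewrite /= -[h^-1 *: _]/(h^-1 * _) distrC.
have -> : h^-1 * (f (h *: v + x) - f x) - dot (grad f x) v =
    h^-1 * (f (h *: v + x) - f x - h * dot (grad f x) v) by rewrite [RHS]mulrBr mulKf.
rewrite normrM normrV ?unitfE // ler_pdivrMl ?normr_gt0 //; apply: le_trans F _.
have -> : norm1 (h *: v) = `|h| * norm1 v by rewrite /norm1 !crdZ !normrM -!mulrDr.
rewrite mulrCA ler_wpM2l // mulrAC ler_pdivrMr ?ltr_wpDl ?norm1_ge0 //.
by rewrite ler_wpM2l ?(ltW e0) // lerDl.
Qed.

Lemma weave_embedding (f : 'I_3 -> V -> R) : (forall a, smooth (f a)) ->
  (forall a b x, sphere x -> a != b -> jet_sheet (f a) x != jet_sheet (f b) x) ->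
  legendrian_embedding (fun a => jet1 (f a)).
Proof.
move=> sf disj.
have sx : smooth (fun x : V => x) by move=> k; apply: Ck_row => j; exact: smooth_coord.
have sp a : smooth (fun x => grad (f a) x - dot x (grad (f a) x) *: x).
  move=> k; have := smooth_jet1 (sf a) k.
  suff P : forall (F : V -> jet R), Ck k F -> Ck k (fun x => (F x).1.2) by exact: P.
  elim: k => [|k IH] F; first by move=> cF; exact: (cont_comp2 (@cont_snd _ _) (cont_comp2 (@cont_fst _ _) cF)).
  move=> [dF DF]; have q x v : (fun h : R => h^-1 *: (((fun x => (F x).1.2) \o shift x) (h *: v) - (F x).1.2)) @ 0^'
      --> ('D_v F x).1.2.
    have c2 : continuous (fun j : jet R => j.1.2) by exact: (cont_comp2 (@cont_snd _ _) (@cont_fst _ _)).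
    exact: (cvg_comp _ _ (dF x v) (c2 _)).
  split=> [x v|v]; first by apply/cvg_ex; exists ('D_v F x).1.2; exact: q.
  have -> : 'D_v (fun x => (F x).1.2) = (fun x => ('D_v F x).1.2).
    by apply/funext => x; apply: (cvg_lim (@norm_hausdorff _ _)); exact: q.
  exact: (IH _ (DF v)).
have DJ a x v : 'D_v (jet1 (f a)) x =
    (v, 'D_v (fun x => grad (f a) x - dot x (grad (f a) x) *: x) x, 'D_v (f a) x).
  rewrite /jet1 derive_pair; last 2 first.
  - by apply: derivable_pair; [exact: derivable_id|exact: smooth_derivable (sp a)].
  - exact: smooth_derivable (sf a).
  by rewrite derive_pair ?derive_id //; exact: smooth_derivable (sp a).
split.
- by move=> a; exact: smooth_jet1.
- by move=> a x; exact: jet1_J1S2.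
- move=> a b x y x1 y1 E; have xy : x = y by case: E.
  split=> //; apply/eqP/negPn/negP => ab.
  by have := disj a b x x1 ab; rewrite /jet_sheet E -xy eqxx.
- move=> a x v _ _ v0; rewrite DJ; apply: contra v0 => /eqP E.
  by apply/eqP; case: E.
- move=> a x v x1 xv; rewrite DJ /contact /= derive_dot //.
  by rewrite dotDl dotNl dotZl xv mulr0 subr0.
Qed.

Lemma constant_isotopy (f : 'I_3 -> V -> R) : (forall a, smooth (f a)) ->
  (forall a b x, sphere x -> a != b -> jet_sheet (f a) x != jet_sheet (f b) x) ->
  legendrian_isotopic 3 (link_image (fun a => jet1 (f a))) (link_image (fun a => jet1 (f a))).
Proof.
move=> sf disj; exists (fun _ a => jet1 (f a)); split=> //.
  by move=> a k; apply: Ck_snd; exact: smooth_jet1.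
by move=> t _; exact: weave_embedding.
Qed.

End Smoothness.

(** * The sheets of a weave along its edges and at its vertices *)

Section Weave.
Variable R : realType.
Local Notation V := 'rV[R]_3.

Lemma small_zero (x : R) : (forall e, 0 < e -> `|x| <= e) -> x = 0.
Proof.
move=> h; apply/eqP/negPn/negP => x0; have n0 : 0 < `|x| / 2 by rewrite divr_gt0 // normr_gt0.
by have := h _ n0; rewrite ler_pdivlMr //; lra.
Qed.

(** Edges are controlled on [0, 1] only, so derivatives at the ends are tested from one side. *)
Lemma near_in01 (t0 d : R) : 0 <= t0 <= 1 -> 0 < d ->
  exists t, [/\ 0 <= t <= 1, t != t0 & `|t0 - t| < d].
Proof.
move=> /andP[t00 t01] d0; have [h|h] := leP t0 (1 / 2).
  have [r r0 [r1 r2]] : exists2 r, 0 < r & r < d /\ r <= 1 / 2.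
    exists (Num.min (d / 2) (1 / 2)); first by rewrite lt_min; lra.
    by rewrite gt_min ge_min lexx orbT; split=> //; apply/orP; left; lra.
  exists (t0 + r); split; [lra|by rewrite -subr_eq0 addrAC subrr add0r gt_eqF|].
  by rewrite opprD addrA subrr sub0r normrN gtr0_norm.
have [r r0 [r1 r2]] : exists2 r, 0 < r & r < d /\ r <= 1 / 2.
  exists (Num.min (d / 2) (1 / 2)); first by rewrite lt_min; lra.
  by rewrite gt_min ge_min lexx orbT; split=> //; apply/orP; left; lra.
exists (t0 - r); split; [lra|by rewrite -subr_eq0 addrAC subrr add0r oppr_eq0 gt_eqF|].
by rewrite opprB addrC subrK gtr0_norm.
Qed.

Lemma tangent_zero (f : V -> R) (c : R -> V) (t0 : R) w : strict_diff f (c t0) w -> smooth c ->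
  0 <= t0 <= 1 -> (forall t, 0 <= t <= 1 -> f (c t) = 0) -> dot w (derive1 c t0) = 0.
Proof.
move=> sf sc t01 f0; apply: small_zero => e e0; have [d d0 D] := chain sf sc e0.
have [t [tt tn td]] := near_in01 t01 d0; have := D t td.
rewrite (f0 t tt) (f0 t0 t01) subrr sub0r normrN normrM ler_pM2r //.
by rewrite normr_gt0 subr_eq0.
Qed.

Lemma strict_dot (x : V) : strict_diff (fun y : V => dot y y - 1) x (2 *: x).
Proof.
move=> e e0; have e2 : 0 < e / 2 by lra.
exists (e / 2) => // y z /ball_crd -/(_ e2) By /ball_crd -/(_ e2) Bz.
have -> : dot y y - 1 - (dot z z - 1) - dot (2 *: x) (y - z) = dot (y + z - 2 *: x) (y - z).
  by rewrite !dotE !crdL; ring.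
apply: dot_norm1 => k k3; rewrite !crdL.
have -> : crd k y + crd k z - 2 * crd k x = - ((crd k x - crd k y) + (crd k x - crd k z)) by ring.
rewrite normrN; apply: le_trans (ler_normD _ _) _.
by have := By k k3; have := Bz k k3; lra.
Qed.

Lemma unit_velocity (c : R -> V) t0 : smooth c -> 0 <= t0 <= 1 ->
  (forall t, 0 <= t <= 1 -> sphere (c t)) -> dot (c t0) (derive1 c t0) = 0.
Proof.
move=> sc t01 us; have := tangent_zero (strict_dot (c t0)) sc t01.
rewrite dotZl => h; have /eqP := h (fun t tt => ltac:(by rewrite [dot _ _](us t tt) subrr)).
by rewrite mulf_eq0 pnatr_eq0 /= => /eqP.
Qed.

Lemma reverse_velocity (c c' : R -> V) : smooth c -> smooth c' ->
  (forall t, 0 <= t <= 1 -> c' t = c (1 - t)) -> derive1 c' 0 = - derive1 c 1.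
Proof.
move=> sc sc' E.
have K k : (k < 3)%N -> crd k (derive1 c' 0) + crd k (derive1 c 1) = 0.
  move=> k3; apply: small_zero => e e0; have e2 : 0 < e / 2 by lra.
  have [d d0 D] := curve_strict 1 sc e2; have [d' d'0 D'] := curve_strict 0 sc' e2.
  have [t [t01 tn]] : exists t, [/\ 0 <= t <= 1, t != 0 & `|0 - t| < Num.min d d'].
    by apply: near_in01; rewrite ?lexx ?ler01 // lt_min d0.
  rewrite lt_min sub0r normrN => /andP[td td'].
  have a := D 1 (1 - t) ltac:(by rewrite subrr normr0) ltac:(by rewrite opprB addrC subrK) k k3.
  have b := D' 0 t ltac:(by rewrite subrr normr0) ltac:(by rewrite sub0r normrN) k k3.
  rewrite (E t t01) (E 0) ?lexx ?ler01 // !subr0 in b.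
  have t0 : 0 < `|t| by rewrite normr_gt0.
  have tm : `|1 - t - 1| = `|t| by rewrite addrAC subrr sub0r normrN.
  rewrite tm in a; rewrite -(ler_pM2r t0) -normrM.
  have -> : (crd k (derive1 c' 0) + crd k (derive1 c 1)) * t =
    (crd k (c (1 - t)) - crd k (c 1) - crd k (derive1 c 1) * (1 - t - 1))
    - (crd k (c (1 - t)) - crd k (c 1) - crd k (derive1 c' 0) * t) by ring.
  apply: le_trans (ler_normB _ _) _; apply: le_trans (lerD a b) _.
  by rewrite -mulrDl -splitr.
by apply: crdE; rewrite crdN; apply/eqP; rewrite -addr_eq0; apply/eqP/K.
Qed.

Definition others (c : 'I_3) : 'I_3 * 'I_3 := (ordS c, ordS (ordS c)).

Lemma othersP (a b c : 'I_3) : a != b -> a != c -> b != c ->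
  (a, b) = others c \/ (b, a) = others c.
Proof.
by move: a b c; do 3![case=> [[|[|[|//]]] ?] //=]; move=> // *;
  first [by left; congr pair; exact/val_inj|by right; congr pair; exact/val_inj].
Qed.

Lemma ord3_ind (P : 'I_3 -> Prop) : P ord0 -> P (ordS ord0) -> P (ordS (ordS ord0)) ->
  forall i, P i.
Proof.
move=> p0 p1 p2 [[|[|[|//]]] h].
- by rewrite (_ : Ordinal h = ord0) //; exact/val_inj.
- by rewrite (_ : Ordinal h = ordS ord0) //; exact/val_inj.
- by rewrite (_ : Ordinal h = ordS (ordS ord0)) //; exact/val_inj.
Qed.

Lemma all_equal3 (g : 'I_3 -> R) (c c' : 'I_3) : c != c' ->
  g (others c).1 = g (others c).2 -> g (others c').1 = g (others c').2 ->
  forall a, g a = g ord0.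
Proof.
move=> + + + a; have s3 : ordS (ordS (ordS (ord0 : 'I_3))) = ord0 by exact/val_inj.
move: c c' a; do 3!apply: ord3_ind; rewrite /others /= ?s3 ?eqxx // => _ e1 e2.
all: by rewrite ?e1 ?e2 // -?e1 -?e2 // -?e1.
Qed.

Lemma third (a b : 'I_3) : a != b ->
  exists c, [/\ c != a, c != b & forall d, [\/ d = a, d = b | d = c]].
Proof.
have T : forall a b : 'I_3, a != b -> [exists c : 'I_3, [&& c != a, c != b &
    [forall d : 'I_3, [|| d == a, d == b | d == c]]]].
  move=> a' b' ab; apply/existsP.
  have [c h1 h2] : exists2 c : 'I_3, c != a' & c != b'.
    move: a' b' ab; do 2![case=> [[|[|[|//]]] ?] //=]; move=> // *;
    first [by exists ord0|by exists (inord 1); rewrite -(inj_eq val_inj) /= inordK|by exists ord_max].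
  exists c; rewrite h1 h2 /=; apply/forallP => d.
  have [|/= d1] := eqVneq d a' => //; have [|/= d2] := eqVneq d b' => //.
  by have [E|E|E] := @two_of_three d c b' a' d1 h1 ltac:(by rewrite eq_sym); rewrite ?E ?eqxx // in d2 h2 *.
move=> /T /existsP[c /and3P[h1 h2 /forallP h3]]; exists c; split=> // d.
by have /or3P[/eqP|/eqP|/eqP] := h3 d; [apply: Or31|apply: Or32|apply: Or33].
Qed.

Variables (G : three_graph) (gamma : G -> R -> V) (f : 'I_3 -> V -> R).
Hypothesis hex : forall d : G, fingraph.order rot d = 6%N.
Hypothesis tau_rot : forall d : G, tau1 (rot d) = ~~ tau1 d.
Hypothesis emb : smooth_embedding gamma.
Hypothesis sf : forall a, smooth (f a).
Hypothesis low : forall x, sphere x -> edges gamma (@tau1 G) x <->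
  (exists a b, [/\ a != b, f a x = f b x & forall c, f a x <= f c x]).
Hypothesis high : forall x, sphere x -> edges gamma (predC (@tau1 G)) x <->
  (exists a b, [/\ a != b, f a x = f b x & forall c, f c x <= f a x]).
Hypothesis transv : forall a b x, sphere x -> a != b -> f a x = f b x ->
  exists2 v, tangent x v & 'D_v (f a) x != 'D_v (f b) x.
Hypothesis transv3 : forall x, sphere x -> (forall a b, f a x = f b x) ->
  forall v, tangent x v -> (forall a b, 'D_v (f a) x = 'D_v (f b) x) -> v = 0.

Let smg d : smooth (gamma d). Proof. by have [+ _ _ _ _] := emb; apply. Qed.
Let on_sphere d t : 0 <= t <= 1 -> sphere (gamma d t).
Proof. by move=> t01; have [_ h _ _ _] := emb; have [] := h d t t01. Qed.
Let speed d t : 0 <= t <= 1 -> derive1 (gamma d) t != 0.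
Proof. by move=> t01; have [_ h _ _ _] := emb; have [] := h d t t01. Qed.
Let gopp d t : 0 <= t <= 1 -> gamma (opp d) t = gamma d (1 - t).
Proof. by move=> t01; have [_ h _ _ _] := emb; have [] := h d t t01. Qed.
Let vert d e : gamma d 0 = gamma e 0 <-> fconnect rot d e.
Proof. by have [_ _ h _ _] := emb. Qed.
Let inner d e s t : 0 < s < 1 -> 0 <= t <= 1 -> gamma d s = gamma e t ->
  (e = d /\ t = s) \/ (e = opp d /\ t = 1 - s).
Proof. by have [_ _ _ h _] := emb; exact: h. Qed.

Let i0 : 0 <= (0 : R) <= 1. Proof. lra. Qed.
Let i1 : 0 <= (1 : R) <= 1. Proof. lra. Qed.
Let oc (t : R) : 0 < t < 1 -> 0 <= t <= 1. Proof. lra. Qed.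

(** Labels alternate around a vertex, so it lies on edges of both kinds: the two lowest sheets agree
    there, and so do the two highest. *)
Lemma vertex_triple d a b : f a (gamma d 0) = f b (gamma d 0).
Proof.
set x := gamma d 0; have sx : sphere x by exact: on_sphere.
have rx : gamma (rot d) 0 = x by apply/esym/vert; exact: fconnect1.
have both (P : Prop) : (forall e, gamma e 0 = x -> tau1 e -> forall e', gamma e' 0 = x -> ~~ tau1 e' -> P) -> P.
  move=> h; have [t|t] := boolP (tau1 d); first by apply: (h d erefl t (rot d)); rewrite ?tau_rot ?t.
  by apply: (h (rot d) rx _ d); rewrite ?tau_rot.
apply: both => e ex te e' ex' te'.
have [|a1 [b1 [ab1 eq1 mi]]] := (low sx).1; first by exists e, 0; split.
have [|a2 [b2 [ab2 eq2 ma]]] := (high sx).1; first by exists e', 0; split.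
have E : f a1 x = f a2 x.
  have [c [c1 c2 all3]] := third ab1.
  have v2 d' : d' = a1 \/ d' = b1 -> f d' x = f a1 x by case=> ->.
  have [h|h|h] := all3 a2; [by rewrite h|by rewrite h|].
  have [h'|h'|h'] := all3 b2; [by rewrite eq2 h'|by rewrite eq2 h'|].
  by move: ab2; rewrite h h' eqxx.
have all_eq c : f c x = f a1 x by apply/le_anti; rewrite mi E ma.
by rewrite (all_eq a) (all_eq b).
Qed.

(** An inner point of an edge lies on no edge of the other label, so exactly two sheets agree there;
    [c] is the third one. *)
Lemma edge_third d t : 0 < t < 1 -> exists c, forall a b,
  f a (gamma d t) = f b (gamma d t) <-> a = b \/ (a != c /\ b != c).
Proof.
move=> t01; set x := gamma d t; have sx : sphere x by exact/on_sphere/oc.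
suff [a [b [ab fab nab]]] : exists a b, [/\ a != b, f a x = f b x &
    ~ forall c, f c x = f a x].
  have [c [ca cb all3]] := third ab; exists c.
  have fc : f c x <> f a x.
    by move=> fc; apply: nab => d'; have [->|->|->] := all3 d'.
  move=> a' b'; split; last first.
    case=> [->//|[a'c b'c]].
    by have [->|->|E] := all3 a'; have [->|->|E'] := all3 b'; rewrite ?fab //;
      move: a'c b'c; rewrite ?E ?E' eqxx.
  have [->|h] := eqVneq a' b'; [by left|move=> E; right].
  split; apply/eqP => F; rewrite F in E h.
    have [E'|E'|E'] := all3 b'; [by case: fc; rewrite E E'|by case: fc; rewrite E E' fab|].
    by move: h; rewrite E' eqxx.
  have [E'|E'|E'] := all3 a'; [by case: fc; rewrite -E E'|by case: fc; rewrite -E E' fab|].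
  by move: h; rewrite E' eqxx.
have other e s : 0 <= s <= 1 -> gamma e s = x -> tau1 e = tau1 d.
  by move=> s01 E; have [[->]//|[-> _]] := inner t01 s01 (esym E); rewrite ?tau1_opp.
have [td|td] := boolP (tau1 d).
  have [|a [b [ab fab mi]]] := (low sx).1; first by exists d, t; split; [|exact: oc|].
  exists a, b; split=> // all_eq.
  have [|e [s [/= te s01 E]]] := (high sx).2.
    by exists a, b; split=> // c; rewrite all_eq.
  by move: te; rewrite /= (other e s s01 E) td.
have [|a [b [ab fab ma]]] := (high sx).1; first by exists d, t; split; [|exact: oc|].
exists a, b; split=> // all_eq.
have [|e [s [te s01 E]]] := (low sx).2.
  by exists a, b; split=> // c; rewrite all_eq.
by move: td; rewrite -(other e s s01 E) te.
Qed.

(** The open edge is connected, and covered by closed sets, one for each pair of sheets that may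
    agree, which are disjoint on it. *)
Lemma edge_kappa d : exists c, forall t, 0 < t < 1 -> forall a b,
  f a (gamma d t) = f b (gamma d t) <-> a = b \/ (a != c /\ b != c).
Proof.
pose K (c : 'I_3) := \bigcap_(ab in [set ab : 'I_3 * 'I_3 | ab.1 != c /\ ab.2 != c])
  [set t : R | f ab.1 (gamma d t) - f ab.2 (gamma d t) = 0].
have uniqK c c' t : 0 < t < 1 -> (forall a b,
    f a (gamma d t) = f b (gamma d t) <-> a = b \/ (a != c /\ b != c)) -> K c' t -> c = c'.
  move=> t01 h Kt; apply/eqP/negPn/negP => cc'.
  have [e [e1 e2 _]] := third cc'.
  have /subr0_eq/h : f c (gamma d t) - f e (gamma d t) = 0 by apply: (Kt (c, e)).
  by case=> [E|[]]; [move: e1; rewrite E eqxx|rewrite eqxx].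
have [] := @connected_in_one R 'I_3 K [set t | 0 < t < 1].
- move=> c; apply: closed_bigI => -[a b] _ /=.
  have cab : continuous (fun t => f a (gamma d t) - f b (gamma d t)).
    have ca := cont_comp2 (smooth_cont (sf a)) (smooth_cont (smg d)).
    have cb := cont_comp2 (smooth_cont (sf b)) (smooth_cont (smg d)).
    exact: (contD ca (contN cb)).
  by move/continuous_closedP : cab => /(_ _ (@closed_eq R 0)).
- move=> c c' t t01 Kc Kc'; have [c0 h] := edge_third d t01.
  by rewrite -(uniqK _ _ _ t01 h Kc) -(uniqK _ _ _ t01 h Kc').
- apply/connected_intervalP; have -> : [set t : R | 0 < t < 1] = [set` `]0, 1[%R].
    by apply/seteqP; split=> t /=; rewrite in_itv.
  exact: interval_is_interval.
- by exists (1 / 2) => /=; lra.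
- move=> t t01; have [c h] := edge_third d t01; exists c => // -[a b] [/= ac bc].
  by apply/eqP; rewrite subr_eq0; apply/eqP/h; right.
move=> c cP; exists c => t t01; have [c0 h] := edge_third d t01.
by rewrite -(uniqK _ _ _ t01 h (cP t t01)).
Qed.

(** Labels tell the heights of the sheets that cross along an edge; this names, among the three
    functions, the one that takes no part in the crossing. *)
Definition kappa d := projT1 (cid (edge_kappa d)).

Lemma kappaP d t a b : 0 < t < 1 ->
  f a (gamma d t) = f b (gamma d t) <-> a = b \/ (a != kappa d /\ b != kappa d).
Proof. by move=> t01; exact: (projT2 (cid (edge_kappa d))). Qed.

Lemma kappa_eq d t a b : 0 <= t <= 1 -> a != kappa d -> b != kappa d ->
  f a (gamma d t) = f b (gamma d t).
Proof.
move=> /andP[t0 t1] ak bk; have [->|tn0] := eqVneq t 0; first exact: vertex_triple.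
have [->|tn1] := eqVneq t 1.
  by rewrite -[1]subr0 -gopp //; exact: vertex_triple.
by apply/kappaP; [rewrite !lt_neqAle eq_sym tn0 tn1 t0|right].
Qed.

Lemma kappa_opp d : kappa (opp d) = kappa d.
Proof.
have h2 : 0 < (1 / 2 : R) < 1 by lra.
have E : gamma (opp d) (1 / 2) = gamma d (1 / 2) by rewrite gopp ?oc //; congr gamma; lra.
apply/eqP/negPn/negP => ne; have [e [e1 e2 _]] := third ne.
have : f (kappa (opp d)) (gamma d (1 / 2)) = f e (gamma d (1 / 2)) by apply/kappaP => //; right.
rewrite -E => /kappaP -/(_ h2)[E'|[]]; last by rewrite eqxx.
by move: e1; rewrite -E' eqxx.
Qed.

Lemma zero_point x a b : sphere x -> a != b -> f a x = f b x ->
  exists d t, [/\ 0 <= t < 1, gamma d t = x & t = 0 \/ (a != kappa d /\ b != kappa d)].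
Proof.
move=> sx ab fab; have [c [ca cb all3]] := third ab.
have [d [t [t01 E]]] : exists d t, 0 <= t <= 1 /\ gamma d t = x.
  have [h|h] := leP (f a x) (f c x).
    have [|d [t [_ t01 E]]] := (low sx).2; last by exists d, t.
    by exists a, b; split=> // e; have [->|->|->] := all3 e; rewrite ?fab // -fab.
  have [|d [t [_ t01 E]]] := (high sx).2; last by exists d, t.
  by exists a, b; split=> // e; have [->|->|->] := all3 e; rewrite ?fab // -fab ltW.
move: t01 => /andP[t0 t1]; have [tE|tn1] := eqVneq t 1.
  exists (opp d), 0; split; [lra| |by left].
  by rewrite gopp // subr0 -tE.
exists d, t; have t1' : t < 1 by rewrite lt_neqAle tn1.
split=> //; first by rewrite t0.
have [->|tn0] := eqVneq t 0; [by left|right].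
have t01 : 0 < t < 1 by rewrite lt0r tn0 t0.
by move: fab; rewrite -E => /(kappaP _ _ _ t01)[E'|//]; move: ab; rewrite E' eqxx.
Qed.

Definition slope a b x : V := grad (f a) x - grad (f b) x.
(** Its radial part is the difference of the functions; where that vanishes, it has the same
    products with tangent vectors as the difference of the gradients. *)
Definition sheets a b x : V := jet_sheet (f a) x - jet_sheet (f b) x.

Lemma strict_slope a b x : strict_diff (fun y => f a y - f b y) x (slope a b x).
Proof. by apply: strict_sub; exact: smooth_strict. Qed.

Lemma sheets_dot a b x v : dot x v = 0 -> f a x = f b x ->
  dot (sheets a b x) v = dot (slope a b x) v.
Proof.
move=> xv fab; rewrite /sheets /slope /jet_sheet /yjet /= fab.
by rewrite !(dotDl, dotNl, dotZl) xv; ring.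
Qed.

Lemma sheets_radial a b x : dot x x = 1 -> dot (sheets a b x) x = f a x - f b x.
Proof.
move=> x1; rewrite /sheets /jet_sheet /yjet /=.
by rewrite !(dotDl, dotNl, dotZl) x1 (dotC x (grad (f a) x)) (dotC x (grad (f b) x)); ring.
Qed.

Lemma sheets_neq0 a b x : a != b -> dot x x = 1 -> sheets a b x != 0.
Proof.
move=> ab x1; apply/eqP => E; have := sheets_radial a b x1; rewrite E dotE !crd_0 !mul0r !addr0.
move=> /esym/subr0_eq fab; have [v xv] := transv x1 ab fab.
rewrite !derive_dot // -subr_eq0 -[- dot _ _]dotNl -dotDl -/(slope a b x).
by rewrite -sheets_dot // E dotE !crd_0 !mul0r !addr0 eqxx.
Qed.

Lemma cont_sheets a b : continuous (sheets a b).
Proof.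
have c e : continuous (jet_sheet (f e)).
  by apply: cont_sheet; exact: smooth_cont (smooth_jet1 (sf e)).
exact: (cont_vD (c a) (cont_vN (c b))).
Qed.

Lemma velocity_tangent d t : 0 <= t <= 1 -> dot (gamma d t) (derive1 (gamma d) t) = 0.
Proof. by move=> t01; apply: unit_velocity => // s s01; exact: on_sphere. Qed.

Lemma velocity_slope d t a b : 0 <= t <= 1 -> a != kappa d -> b != kappa d ->
  dot (slope a b (gamma d t)) (derive1 (gamma d) t) = 0.
Proof.
move=> t01 ak bk; apply: tangent_zero (strict_slope a b _) (smg d) t01 _ => s s01.
by rewrite (kappa_eq s01 ak bk) subrr.
Qed.

(** The velocities of the six edges lie on the three lines along which two of the differentials
    agree. These lines are distinct as the three tangent planes meet in a point only. So a curve of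
    coincidence goes straight on through the vertex. *)
Lemma vertex_rays d : [/\ kappa (iter 3 rot d) = kappa d, kappa (rot d) != kappa d,
  kappa (rot (rot d)) != kappa d &
  exists2 l, 0 < l & derive1 (gamma (iter 3 rot d)) 0 = - l *: derive1 (gamma d) 0].
Proof.
pose x := gamma d 0; have sx : sphere x by exact: on_sphere.
have gx i : gamma (iter i rot d) 0 = x by apply/esym/vert; exact: fconnect_iter.
have := @six_rays R x (fun c => slope (others c).1 (others c).2 x)
  (fun i => derive1 (gamma (iter i rot d)) 0) (fun i => kappa (iter i rot d)).
rewrite !inordK //=; case=> //.
- move=> i; split; last exact: speed.
  by have := velocity_tangent (iter i rot d) i0; rewrite gx.
- move=> i; rewrite -(gx i); apply: velocity_slope => //;
    by case: (kappa _) => [[|[|[|//]]] ?].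
- move=> c c' v cc' xv h h'; apply: (transv3 sx (vertex_triple d) xv) => a b; rewrite !derive_dot //.
  move: h h'; rewrite /slope !dotDl !dotNl => /subr0_eq h /subr0_eq h'.
  have all_eq := @all_equal3 (fun e => dot (grad (f e) x) v) c c' cc' h h'.
  by rewrite (all_eq a) (all_eq b).
move=> i j i0' ij; have [_ _ _ _ cc] := emb.
by have := cc d i j; rewrite i0' ij hex ltn_ord => /(_ isT isT).
Qed.

Lemma side_local a b x : a != b -> dot x x = 1 -> f a x = f b x ->
  (forall r, 0 < r -> exists y, [/\ dot y y = 1, ball x r y & 0 < dot (sheets a b y) y]) /\
  exists2 r, 0 < r & forall y z, dot y y = 1 -> dot z z = 1 ->
    ball x r y -> ball x r z -> 0 < dot (sheets a b y) y -> 0 < dot (sheets a b z) z ->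
    exists W : set V, [/\ connected W, W y, W z &
      forall w, W w -> dot w w = 1 /\ 0 < dot (sheets a b w) w].
Proof.
move=> ab x1 fab; pose H := sheets a b x.
have H0 : 0 < dot H H by rewrite dot_gt0 sheets_neq0.
have xH : dot x H = 0 by rewrite dotC sheets_radial // fab subrr.
pose r := Num.sqrt (dot H H); have r0 : 0 < r by rewrite sqrtr_gt0.
have rr : r ^+ 2 = dot H H by rewrite sqr_sqrtr // ltW.
have rn : r != 0 by rewrite gt_eqF.
have cd : continuous (fun y => f a y - f b y).
  exact: (contD (smooth_cont (sf a)) (contN (smooth_cont (sf b)))).
have [] := @positive_local R _ x (r^-1 *: H) _ cd x1 _ _ (strict_slope a b x).
- by rewrite dotZl dotZr -rr; field.
- by rewrite dotZr xH mulr0.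
- by rewrite dotZr -sheets_dot // mulr_gt0 ?invr_gt0.
- by rewrite fab subrr.
move=> acc [e e0 lc]; split.
  by move=> s /acc[y [y1 By fy]]; exists y; split=> //; rewrite sheets_radial.
exists e => // y z y1 z1 By Bz; rewrite !sheets_radial // => fy fz.
have [W [cW Wy Wz Wp]] := lc y z y1 z1 By Bz fy fz; exists W; split=> // w /Wp[w1 fw].
by split=> //; rewrite sheets_radial.
Qed.

(** The velocity and the cross product are both orthogonal to the point and to [sheets a b], hence
    parallel. Neither vanishes, so their scalar product keeps its sign along the edge. *)
Lemma arc_direction d a b : a != b -> a != kappa d -> b != kappa d ->
  exists2 eps, eps = 1 \/ eps = -1 & forall t, 0 <= t <= 1 -> exists2 l, 0 < l &
    derive1 (gamma d) t = l *: (eps *: cross (gamma d t) (sheets a b (gamma d t))).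
Proof.
move=> ab ak bk; pose X t := cross (gamma d t) (sheets a b (gamma d t)).
pose D t := dot (X t) (derive1 (gamma d) t).
have line t : 0 <= t <= 1 -> dot (X t) (X t) *: derive1 (gamma d) t = D t *: X t.
  move=> t01; apply: cross_line; first exact: velocity_tangent.
  rewrite sheets_dot ?velocity_slope ?velocity_tangent //; exact: kappa_eq.
have X0 t : 0 <= t <= 1 -> 0 < dot (X t) (X t).
  move=> t01; have u1 := on_sphere d t01.
  have -> : dot (X t) (X t) = dot (gamma d t) (gamma d t) * dot (sheets a b (gamma d t)) (sheets a b (gamma d t))
      - dot (sheets a b (gamma d t)) (gamma d t) ^+ 2.
    by rewrite /X !dotE /cross !crdv; ring.
  rewrite sheets_radial // (kappa_eq t01 ak bk) subrr expr0n subr0 [dot (gamma d t) _]u1 mul1r.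
  by rewrite dot_gt0 sheets_neq0.
have D0 t : 0 <= t <= 1 -> D t != 0.
  move=> t01; apply/eqP => z; have := line t t01; rewrite z scale0r => /eqP.
  by rewrite scaler_eq0 gt_eqF ?X0 //= (negbTE (speed d t01)).
have cD : continuous D.
  have cg := smooth_cont (smg d).
  apply: cont_dot; first by apply: cont_cross => //; exact: (cont_comp2 (@cont_sheets a b) cg).
  have -> : derive1 (gamma d) = 'D_1 (gamma d) by apply/funext => t; rewrite derive1E.
  exact: smooth_derive_cont (smg d).
have sgn t : 0 <= t <= 1 -> 0 < D 0 * D t.
  move=> /andP[t0 t1]; rewrite lt_neqAle eq_sym mulf_neq0 ?D0 ?t0 ?t1 ?lexx ?ler01 //=.
  rewrite leNgt; apply/negP => neg_; have [] := @IVT R D 0 t 0 t0.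
  - exact: continuous_subspaceT.
  - rewrite ge_min le_max; case: (ltrgt0P (D 0)) neg_ => s0 h; last by rewrite s0 mul0r ltxx in h.
      by move: h; rewrite pmulr_rlt0 // => /ltW ->; rewrite orbT.
    by move: h; rewrite nmulr_rlt0 // => /ltW ->; rewrite orbT.
  move=> s; rewrite in_itv /= => /andP[s0 st] Ds.
  by have := D0 s; rewrite s0 (le_trans st t1) Ds eqxx => /(_ isT).
exists (if 0 < D 0 then 1 else -1); first by case: ifP; [left|right].
move=> t t01; have p := sgn t t01; have x0 := X0 t t01; have xn : dot (X t) (X t) != 0 by rewrite gt_eqF.
have E : derive1 (gamma d) t = (D t / dot (X t) (X t)) *: X t.
  by apply: (scalerI xn); rewrite line // scalerA mulrC divfK.
case: ifP p => [s0|/negbT s0] p.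
  by exists (D t / dot (X t) (X t)); [rewrite divr_gt0 // -(pmulr_rgt0 _ s0)|rewrite scale1r].
have s1 : D 0 < 0 by rewrite lt_neqAle D0 ?lexx ?ler01 // leNgt.
exists (- (D t / dot (X t) (X t))); last by rewrite scaleN1r scalerN scaleNr opprK.
by rewrite oppr_gt0 ltr_pdivrMr // mul0r -(nmulr_rgt0 _ s1).
Qed.

(** The edge leaves the vertex transversally to the zero set of the difference: its velocity already
    annihilates the difference of the two sheets other than [kappa d], and only the zero vector
    would annihilate both. The opposite edge leaves in the opposite direction. *)
Lemma cross_sign d a b : a != b -> kappa d = a \/ kappa d = b ->
  exists2 r, 0 < r & forall t t', 0 < t < r -> 0 < t' < r ->
    (f a (gamma d t) - f b (gamma d t)) *
    (f a (gamma (iter 3 rot d) t') - f b (gamma (iter 3 rot d) t')) < 0.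
Proof.
move=> ab kd; set d' := iter 3 rot d; pose x := gamma d 0; have sx : sphere x by exact: on_sphere.
have dx : gamma d' 0 = x by apply/esym/vert; exact: fconnect_iter.
pose w := slope a b x; pose v := derive1 (gamma d) 0; pose D := dot w v.
have [_ _ _ [l l0 lE]] := vertex_rays d; rewrite -/d' -/v in lE.
have D0 : D != 0.
  apply/eqP => DE; have [c [ca cb _]] := third ab.
  have ck : c != kappa d by case: kd => ->.
  have h : dot (grad (f (others c).1) x) v = dot (grad (f (others c).2) x) v.
    have E : dot (grad (f a) x) v = dot (grad (f b) x) v.
      by apply/eqP; rewrite -subr_eq0 -dotNl -dotDl; apply/eqP.
    by have [<-|<-] := @othersP a b c ab ltac:(by rewrite eq_sym) ltac:(by rewrite eq_sym).
  have h' : dot (grad (f (others (kappa d)).1) x) v = dot (grad (f (others (kappa d)).2) x) v.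
    apply/eqP; rewrite -subr_eq0 -dotNl -dotDl; apply/eqP.
    by apply: velocity_slope => //; case: (kappa d) => [[|[|[|//]]] ?].
  have all_eq := @all_equal3 (fun e => dot (grad (f e) x) v) c (kappa d) ck h h'.
  have v0 : v = 0.
    apply: (transv3 sx (vertex_triple d) (velocity_tangent d i0)) => a' b'.
    by rewrite !derive_dot // all_eq [RHS]all_eq.
  by have := speed d i0; rewrite -/v v0 eqxx.
have zero : f a x - f b x = 0 by rewrite (vertex_triple d a b) subrr.
have near e : gamma e 0 = x -> dot w (derive1 (gamma e) 0) != 0 ->
    exists2 r, 0 < r & forall t, 0 < t < r ->
    0 < (f a (gamma e t) - f b (gamma e t)) * dot w (derive1 (gamma e) 0).
  move=> ex q0; set q := dot w _ in q0 *; have e0 : 0 < `|q| / 2 by rewrite divr_gt0 // normr_gt0.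
  have sd : strict_diff (fun y => f a y - f b y) (gamma e 0) w.
    by rewrite ex; exact: strict_slope.
  have [r r0 rP] := chain sd (smg e) e0; exists r => // t /andP[t0 tr].
  have := rP t; rewrite sub0r normrN gtr0_norm // => /(_ tr); rewrite ex zero !subr0 -/q (gtr0_norm t0).
  set F := f a _ - _; rewrite ler_norml => /andP[h1 h2].
  have [q1|q1|q1] := ltrgt0P q; last by rewrite q1 eqxx in q0.
    by rewrite (gtr0_norm q1) in h1 h2; rewrite pmulr_lgt0 //; nra.
  by rewrite (ltr0_norm q1) in h1 h2; rewrite nmulr_lgt0 //; nra.
have [r r0 rP] := near d erefl D0.
have D'0 : dot w (derive1 (gamma d') 0) != 0.
  by rewrite lE dotZr mulf_neq0 // oppr_eq0 gt_eqF.
have [r' r'0 rP'] := near d' dx D'0.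
exists (Num.min r r') => [|t t' /andP[t0]]; first by rewrite lt_min r0.
rewrite lt_min => /andP[tr _] /andP[t'0]; rewrite lt_min => /andP[_ t'r].
have := rP t; have := rP' t'; rewrite t0 tr t'0 t'r => /(_ isT) p1 /(_ isT) p2.
have := mulr_gt0 p2 p1; rewrite lE dotZr -/D.
set F := f a (gamma d t) - _; set F' := f a (gamma d' t') - _.
have -> : F * D * (F' * (- l * D)) = (F * F') * (- (l * D ^+ 2)) by ring.
have p : 0 < l * D ^+ 2 by rewrite mulr_gt0 // exprn_even_gt0.
by rewrite nmulr_lgt0 ?oppr_lt0.
Qed.

End Weave.

(** * Joining arcs into a curve *)

Section Concatenation.
Variable R : realType.
Local Notation V := 'rV[R]_3.
Variable A : int -> R -> V.
Hypotheses (sA : forall k, smooth (A k)) (jA : forall k, A k 1 = A (k + 1) 0).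

(** Arcs are indexed by all integers, so that a closed curve becomes a periodic function on the
    whole line. *)
Definition concat (s : R) : V := A (Num.floor s) (s - (Num.floor s)%:~R).

Lemma concatE k s : k%:~R <= s -> s <= k%:~R + 1 -> concat s = A k (s - k%:~R).
Proof.
move=> ks sk; have [sE|sn] := eqVneq s (k%:~R + 1).
  have f : Num.floor s = k + 1.
    by apply: floor_def; rewrite sE !intrD lexx /= ltrDl ltr01.
  by rewrite /concat f sE intrD subrr addrAC subrr add0r jA.
have f : Num.floor s = k.
  by apply: floor_def; rewrite ks intrD /= lt_neqAle sn.
by rewrite /concat f.
Qed.

Lemma concat_cont : continuous concat.
Proof.
move=> s; pose k := Num.floor s; pose kr : R := k%:~R.
have ks : kr <= s by exact: floor_le_tmp.
have sk : s < kr + 1 by have := floorD1_gt s; rewrite intrD.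
have k1 : (k - 1)%:~R = kr - 1 :> R by rewrite intrB.
have cmax : continuous (fun t : R => Num.max t kr).
  by move=> t; apply: (@continuous_max R R id (cst kr)); [exact: cvg_id|exact: cvg_cst].
have cmin : continuous (fun t : R => Num.min t kr).
  by move=> t; apply: (@continuous_min R R id (cst kr)); [exact: cvg_id|exact: cvg_cst].
(* On two neighbouring unit intervals the curve is the arc before, stopped at the joint, plus the
   arc after, started there, minus the common value. *)
pose P t := A (k - 1) (Num.min t kr - (kr - 1)) + A k (Num.max t kr - kr) - A k 0.
have cc (q : R) : continuous (fun _ : R => q) by move=> t; exact: cvg_cst.
have cP : continuous P.
  have c1 : continuous (fun t => A (k - 1) (Num.min t kr - (kr - 1))).
    exact: (cont_comp2 (smooth_cont (@sA (k - 1))) (contD cmin (@cc (- (kr - 1))))).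
  have c2 : continuous (fun t => A k (Num.max t kr - kr)).
    exact: (cont_comp2 (smooth_cont (@sA k)) (contD cmax (@cc (- kr)))).
  have c3 : continuous (fun _ : R => - A k 0) by move=> t; exact: cvg_cst.
  exact: (cont_vD (cont_vD c1 c2) c3).
have E t : kr - 1 <= t -> t <= kr + 1 -> concat t = P t.
  move=> t1 t2; rewrite /P; have [tk|tk] := leP t kr.
    by rewrite subrr addrK (@concatE (k - 1)) ?k1 // subrK.
  have -> : kr - (kr - 1) = 1 by ring.
  rewrite jA subrK addrAC subrr add0r.
  by rewrite (@concatE k) // ltW.
have near : \forall t \near s, concat t = P t.
  have d0 : 0 < Num.min 1 (kr + 1 - s) by rewrite lt_min ltr01 subr_gt0.
  apply/nbhs_ballP; exists (Num.min 1 (kr + 1 - s)) => //= t.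
  rewrite /ball /= lt_min !ltr_norml => /andP[/andP[a1 a2] /andP[a3 a4]].
  by apply: E; lra.
have Es : concat s = P s by apply: E; lra.
rewrite /continuous_at Es; apply: cvg_trans (cP s).
by apply: near_eq_cvg; near do apply/esym.
Unshelve. all: end_near.
Qed.

Lemma concat_period (m : int) : (forall k, A (k + m) = A k) ->
  forall s, concat (s + m%:~R) = concat s.
Proof.
move=> Am s; pose k := Num.floor s.
have ks : k%:~R <= s by exact: floor_le_tmp.
have sk : s < k%:~R + 1 by have := floorD1_gt s; rewrite intrD.
rewrite (@concatE (k + m)) ?intrD; [|lra|lra].
by rewrite Am (@concatE k) ?(ltW sk) //; congr (A k _); ring.
Qed.

Definition near3 (u T : V) (e : R) : Prop := exists2 k, 0 < k &
  forall i, (i < 3)%N -> `|crd i u - k * crd i T| <= e * k.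

Lemma near3D u u' T e : near3 u T e -> near3 u' T e -> near3 (u + u') T e.
Proof.
move=> [k k0 K] [k' k'0 K']; exists (k + k'); first exact: addr_gt0.
move=> i i3; rewrite crdD; have -> : crd i u + crd i u' - (k + k') * crd i T =
  (crd i u - k * crd i T) + (crd i u' - k' * crd i T) by ring.
by apply: le_trans (ler_normD _ _) _; rewrite mulrDr lerD ?K ?K'.
Qed.

Lemma arc_near3 (c : R -> V) t0 l T e : smooth c -> 0 < l -> derive1 c t0 = l *: T -> 0 < e ->
  exists2 d, 0 < d & forall s t, s < t -> `|t0 - s| < d -> `|t0 - t| < d -> near3 (c t - c s) T e.
Proof.
move=> sc l0 cT e0; have el : 0 < e * l by exact: mulr_gt0.
have [d d0 D] := curve_strict t0 sc el; exists d => // s t st hs ht.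
have ts : 0 < t - s by rewrite subr_gt0.
exists (l * (t - s)); first exact: mulr_gt0.
move=> i i3; have := D s t hs ht i i3; rewrite cT crdZ (gtr0_norm ts) crdD crdN.
have -> : l * crd i T * (t - s) = l * (t - s) * crd i T by ring.
by rewrite mulrA.
Qed.

Variable T : R -> V.
Hypothesis dirA : forall k t, 0 <= t <= 1 -> exists2 l, 0 < l & derive1 (A k) t = l *: T (k%:~R + t).

(** A secant across a joint is the sum of one on each side. Both are nearly positive multiples of
    the same vector, and such vectors are stable under sums. *)
Lemma concat_direction : has_direction3 concat T.
Proof.
move=> s0 e e0; pose k := Num.floor s0.
have ks : k%:~R <= s0 by exact: floor_le_tmp.
have sk : s0 < k%:~R + 1 by have := floorD1_gt s0; rewrite intrD.
have [l l0 lE] : exists2 l, 0 < l & derive1 (A k) (s0 - k%:~R) = l *: T s0.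
  have [|l l0 lE] := @dirA k (s0 - k%:~R); first lra.
  by exists l => //; rewrite lE; congr (_ *: T _); ring.
have [d d0 D] := arc_near3 (@sA k) l0 lE e0.
have arc j s t : j%:~R <= s -> s < t -> t <= j%:~R + 1 ->
    concat t - concat s = A j (t - j%:~R) - A j (s - j%:~R).
  by move=> js st tj; rewrite !(@concatE j) //; lra.
have sh (a b c : R) : `|a - c - (b - c)| = `|a - b| by congr `|_|; ring.
have [sE|sn] := eqVneq s0 k%:~R; last first.
  have ks' : k%:~R < s0 by rewrite lt_neqAle eq_sym sn.
  exists (Num.min d (Num.min (s0 - k%:~R) (k%:~R + 1 - s0))) => [|s t].
    by rewrite !lt_min d0 !subr_gt0 ks'.
  set r := Num.min d _ => h1 h2 h3.
  have [r1 r2 r3] : [/\ r <= d, r <= s0 - k%:~R & r <= k%:~R + 1 - s0].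
    by rewrite /r !ge_min !lexx !orbT.
  clearbody r.
  have : near3 (concat t - concat s) (T s0) e.
    rewrite (@arc k) //; [|lra|lra].
    by apply: D; rewrite ?sh ?ltrD2r // ltr_norml; apply/andP; split; lra.
  by move=> [q q0 Q]; exists q => // i /Q; rewrite crdD crdN.
have [l' l'0 lE'] : exists2 l, 0 < l & derive1 (A (k - 1)) 1 = l *: T s0.
  have [|l' l'0 lE'] := @dirA (k - 1) 1; first lra.
  by exists l' => //; rewrite lE' intrB subrK -sE.
have [d' d'0 D'] := arc_near3 (@sA (k - 1)) l'0 lE' e0.
exists (Num.min 1 (Num.min d d')) => [|s t]; first by rewrite !lt_min ltr01 d0.
set r := Num.min 1 _ => h1 h2 h3.
have [r1 r2 r3] : [/\ r <= 1, r <= d & r <= d'].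
  by rewrite /r !ge_min !lexx !orbT.
clearbody r; rewrite sE in h1 h3.
have up u v : k%:~R <= u -> u < v -> v < k%:~R + r -> near3 (concat v - concat u) (T s0) e.
  move=> a1 a2 a3; rewrite (@arc k) //; [|lra].
  by apply: D; rewrite ?sh ?ltrD2r // sE ltr_norml; apply/andP; split; lra.
have down u v : k%:~R - r < u -> u < v -> v <= k%:~R -> near3 (concat v - concat u) (T s0) e.
  move=> a1 a2 a3; have k1 : (k - 1)%:~R = k%:~R - 1 :> R by rewrite intrB.
  rewrite (@arc (k - 1)) // ?k1; [|lra|lra].
  by apply: D'; rewrite ?ltrD2r // ltr_norml; apply/andP; split; lra.
have : near3 (concat t - concat s) (T s0) e.
  have [tk|tk] := leP t k%:~R; first exact: down.
  have [ks2|ks2] := leP k%:~R s; first exact: up.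
  rewrite -[concat t](subrK (concat k%:~R)) -addrA.
  by apply: near3D; [apply: up|apply: down].
by move=> [q q0 Q]; exists q => // i /Q; rewrite crdD crdN.
Qed.

End Concatenation.

Local Close Scope classical_set_scope.

(** * Circles around the faces of the prism and their colours *)

Section LadderDarts.
Variable n : nat.
Hypothesis n_gt0 : (0 < n)%N.
Local Notation L := (ladder n).
Local Notation I := 'I_(2 * n).

Lemma ordS_val (i : I) : val (ordS i) = if i.+1 == (2 * n)%N then 0%N else i.+1.
Proof.
rewrite /=; case: eqP => [->|h]; first by rewrite modnn.
by rewrite modn_small //; have := ltn_ord i; lia.
Qed.

Lemma ord_pred_val (i : I) : val (ord_pred i) = if i == 0%N :> nat then (2 * n).-1 else i.-1.
Proof.
have ii := ltn_ord i; rewrite /=; case: eqP => [->|h]; first by rewrite add0n modn_small; lia.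
have -> : ((i + 2 * n).-1 = i.-1 + 2 * n)%N by lia.
by rewrite modnDr modn_small; lia.
Qed.

Lemma ordS_neq (i : I) : ordS i != i.
Proof.
apply/eqP => /(congr1 val); rewrite ordS_val /= => E.
by have := ltn_ord i; move: E; case: eqP => h1 h2; lia.
Qed.

Lemma odd_ordS (i : I) : odd (ordS i) = ~~ odd i.
Proof.
rewrite ordS_val; case: eqP => [E|_] //=.
have : odd i.+1 = false by rewrite E mul2n odd_double.
by move=> /= /negbFE ->.
Qed.

Lemma iter_pred_val k (i : I) : (k < 2 * n)%N ->
  val (iter k (@ord_pred _) i) = if (k <= i)%N then (i - k)%N else (i + 2 * n - k)%N.
Proof.
elim: k => [|k IH] k2; first by rewrite leq0n subn0.
rewrite iterS ord_pred_val (IH (ltnW k2)); have := ltn_ord i.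
by case: (leqP k i) => h1 h2; case: (leqP k.+1 i) => h3; case: eqP => h4; lia.
Qed.

(** Of the two copies of the edge of [d], the one on the left of [d], away from its right face.
    Every edge of the 3-graph arises from exactly one dart in this way, up to its direction. *)
Definition edge_of (d : L) : ladder3 n := (d, ladder_white d).

(** Half a turn around a hexagonal point continues an edge straight on, and the copies away from a
    face thereby follow its boundary. So the curves of coincidence are circles, one around each face
    of the prism. *)
Lemma edge_face_next d : iter 3 rot (opp (edge_of d)) = edge_of (face_next d).
Proof.
have wo := ladder_white_opp d.
have wr (e : L) : ladder_white (rot e) = ladder_white e by exact: ladder_white_rot.
rewrite /edge_of /face_next wr wo /= /double_opp /= /double_rot /= wo.
have -> : (ladder_white d == ~~ ladder_white d) = false by case: ladder_white.
by rewrite /= wo eqxx /= wr wo; case: (ladder_white d).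
Qed.

Lemma edge_rot d : rot (rot (edge_of d)) = edge_of (rot d).
Proof.
have wr (e : L) : ladder_white (rot e) = ladder_white e by exact: ladder_white_rot.
rewrite /edge_of wr /= /double_rot /= eqxx /= wr; by case: (ladder_white d).
Qed.

Lemma edge_of_cases (x : ladder3 n) : exists d, edge_of d = x \/ edge_of d = opp x.
Proof.
case: x => d b; have [E|h] := eqVneq b (ladder_white d).
  by exists d; left; rewrite /edge_of E.
exists (opp d); right; have := ladder_white_opp d; rewrite /edge_of => -> /=.
by rewrite /double_opp /=; congr pair; case: b h; case: ladder_white.
Qed.

Lemma edge_of_opp d d' : edge_of d' <> opp (edge_of d).
Proof.
move=> [E1 E2]; have := ladder_white_opp d; rewrite -[opp d]E1 E2.
by case: ladder_white.
Qed.

Definition vtx (x : ladder3 n) : bool * I := x.1.1.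

Lemma vtx_rot k x : vtx (iter k rot x) = vtx x.
Proof.
elim: k => // k <-; rewrite iterS; move: (iter k _ x) => [[[c i] s] b].
by rewrite /vtx /= /double_rot /=; case: ifP.
Qed.

(** Two rotations of the doubled graph amount to one of the ladder with the same label, so that
    every dart is connected to the first copy of the rung at its vertex. *)
Lemma vtx_connect x y : vtx x = vtx y -> fconnect rot x y.
Proof.
have two (d : L) b : rot (rot ((d, b) : ladder3 n)) = (rot d, b).
  have wr : ladder_white (rot d) = ladder_white d by exact: ladder_white_rot.
  rewrite /= /double_rot /=; case: (eqVneq b (ladder_white d)) => [->|h] /=.
    by rewrite wr; case: (ladder_white d).
  by case: b (ladder_white d) h => [] [].
have evens k (d : L) b : fconnect rot ((d, b) : ladder3 n) (iter k rot d, b).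
  elim: k => //= k IH; apply: connect_trans IH _; rewrite -two.
  exact: connect_trans (fconnect1 _ _) (fconnect1 _ _).
have norm1 (d : L) : fconnect rot ((d, true) : ladder3 n) ((d.1, None), true).
  suff [k <-] : exists k, iter k rot d = (d.1, None) by exact: evens.
  by case: d => [[[] i] [[]|]]; [exists 2%N|exists 1%N|exists 0%N|exists 1%N|exists 2%N|exists 0%N].
have norm z : fconnect rot z ((vtx z, None), true).
  case: z => d []; first exact: norm1.
  apply: connect_trans (fconnect1 _ _) _.
  by rewrite -(vtx_rot 1); exact: (norm1 (rot ((d, false) : ladder3 n)).1).
move=> E; have sym := fconnect_sym (@rot_inj (ladder3 n)).
by apply: connect_trans (norm x) _; rewrite E sym.
Qed.

(* The four darts whose right face is the square between the rungs [q] and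
   [q + 1]. *)
Definition square (q : I) (r : nat) : L := iter r (@face_next L) (true, ordS q, None).

Lemma square1 q : square q 1 = (false, ordS q, Some false). Proof. by []. Qed.
Lemma square2 q : square q 2 = (false, q, None).
Proof. by rewrite /square /= /face_next /= ordSK. Qed.
Lemma square3 q : square q 3 = (true, q, Some true).
Proof. by rewrite -[LHS]/(face_next (square q 2)) square2. Qed.
Lemma square4 q : square q 4 = square q 0.
Proof. by rewrite -[LHS]/(face_next (square q 3)) square3. Qed.

Lemma square_period q r : square q (r + 4) = square q r.
Proof. by rewrite /square iterD -[iter 4 _ _]/(square q 4) square4. Qed.

Lemma square_mod q r : square q r = square q (r %% 4).
Proof.
rewrite {1}(divn_eq r 4); elim: (r %/ 4)%N => [|k IH]; first by rewrite add0n.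
by rewrite mulSn -addnA addnC square_period.
Qed.

Lemma square_vtx q r r' : (r < 4)%N -> (r' < 4)%N -> (square q r).1 = (square q r').1 -> r = r'.
Proof.
have SN := ordS_neq q; have NS : q == ordS q = false by rewrite eq_sym; apply/negbTE.
case: r => [|[|[|[|//]]]] _; case: r' => [|[|[|[|//]]]] _;
  rewrite ?square1 ?square2 ?square3 //= => -[] // /eqP; rewrite ?NS ?(negbTE SN) //.
Qed.

Lemma square_pos q r : (square q r).1.2 = q \/ (square q r).1.2 = ordS q.
Proof.
rewrite square_mod; have := ltn_pmod r (isT : (0 < 4)%N).
case: (r %% 4)%N => [|[|[|[|//]]]] _; rewrite ?square1 ?square2 ?square3 /=; auto.
Qed.

Definition pole_dart (i : I) : L := (true, i, Some false).

Lemma pole_next i : face_next (pole_dart i) = pole_dart (ord_pred i).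
Proof. by []. Qed.

Lemma iter_pole k i : iter k (@face_next L) (pole_dart i) = pole_dart (iter k (@ord_pred _) i).
Proof. by elim: k => //= k ->. Qed.

Section Colours.
Variable K : ladder3 n -> 'I_3.
Hypothesis K_opp : forall x, K (opp x) = K x.
Hypothesis K_3 : forall x, K (iter 3 rot x) = K x.
Hypothesis K_2 : forall x, K (rot (rot x)) != K x.

(** [K] stands for [kappa]. Being constant along the circle around a face, it colours the faces of
    the prism, and the three faces at a vertex have different colours. *)
Definition colour (d : L) : 'I_3 := K (edge_of d).

Lemma colour_next d : colour (face_next d) = colour d.
Proof. by rewrite /colour -edge_face_next K_3 K_opp. Qed.

Lemma colour_rot d : colour (rot d) != colour d.
Proof. by rewrite /colour -edge_rot. Qed.

Lemma colour_square q r : colour (square q r) = colour (square q 0).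
Proof. by elim: r => // r IH; rewrite -IH; exact: (colour_next (square q r)). Qed.

Definition sq (q : I) : 'I_3 := colour (square q 0).
Definition pole (i : I) : 'I_3 := colour (pole_dart i).

Lemma colour_tt i : colour (true, i, Some true) = sq i.
Proof. by rewrite -square3 colour_square. Qed.
Lemma colour_tN i : colour (true, i, None) = sq (ord_pred i).
Proof. by rewrite /sq /square /= ord_predK. Qed.
Lemma colour_fN i : colour (false, i, None) = sq i.
Proof. by rewrite -square2 colour_square. Qed.
Lemma colour_ff i : colour (false, i, Some false) = sq (ord_pred i).
Proof. by rewrite -[i in LHS]ord_predK -square1 colour_square. Qed.

Lemma sq_pred i : sq i != sq (ord_pred i).
Proof. by rewrite -colour_tt -colour_tN; exact: (colour_rot (true, i, None)). Qed.
Lemma pole_sq i : pole i != sq i.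
Proof. by rewrite -colour_tt; exact: (colour_rot (true, i, Some true)). Qed.
Lemma pole_sq' i : pole i != sq (ord_pred i).
Proof. by rewrite -colour_tN eq_sym; exact: (colour_rot (true, i, Some false)). Qed.

Lemma three_colours (a b c d : 'I_3) : a != d -> b != d -> c != d -> a != c -> b != c -> a = b.
Proof.
move: a b c d; do 4![case=> [[|[|[|//]]] ?] //=]; move=> // *; exact/val_inj.
Qed.

(** The outer polar face, like the inner one, touches two consecutive squares of different colours;
    so both have the third colour. *)
Lemma colour_ft i : colour (false, i, Some true) = pole i.
Proof.
apply: (@three_colours _ _ (sq (ord_pred i)) (sq i)).
- by rewrite -colour_fN eq_sym; exact: (colour_rot (false, i, Some true)).
- exact: pole_sq.
- by rewrite eq_sym sq_pred.
- by rewrite -colour_ff; exact: (colour_rot (false, i, Some false)).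
- exact: pole_sq'.
Qed.

Let lt0 : (0 < 2 * n)%N. Proof. by rewrite muln_gt0. Qed.
Definition i0 : I := Ordinal lt0.

Lemma ord_walk (P : I -> Prop) : P i0 -> (forall i, P i -> P (ordS i)) -> forall i, P i.
Proof.
move=> p0 pS i; have : forall m (mi : (m < 2 * n)%N), P (Ordinal mi).
  elim=> [|m IH] mi; first by rewrite (_ : Ordinal mi = i0) //; exact/val_inj.
  have m' := ltnW mi; have := pS _ (IH m').
  rewrite (_ : ordS (Ordinal m') = Ordinal mi) //.
  by apply/val_inj; rewrite ordS_val /=; case: eqP => //; lia.
by move=> h; have := h i (ltn_ord i); rewrite (_ : Ordinal _ = i) //; exact/val_inj.
Qed.

Lemma pole_const i : pole i = pole i0.
Proof.
move: i; apply: ord_walk => // i <-.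
by rewrite -[i in RHS]ordSK /pole -[in RHS]pole_next colour_next.
Qed.

(** Two colours are left beside the polar one, and they alternate along the ring of squares. *)
Lemma sq_parity c : c != pole i0 -> exists b, forall i, (sq i == c) = (odd i == b).
Proof.
move=> cN; exists (sq i0 != c).
have alt i : (sq (ordS i) == c) = ~~ (sq i == c).
  have a := sq_pred (ordS i); rewrite ordSK in a.
  have b := pole_sq i; have b' := pole_sq (ordS i); rewrite !pole_const in b b'.
  have [E|h] := eqVneq (sq i) c; first by apply/negbTE; rewrite -E.
  apply/eqP; apply: (@three_colours _ _ (sq i) (pole i0)) => //; rewrite eq_sym //.
apply: ord_walk => [|i IH]; first by rewrite /=; case: (sq i0 == c).
by rewrite alt IH odd_ordS; case: (odd i); case: (sq i0 != c).
Qed.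

Lemma colour_pole_dart i : colour (pole_dart i) = pole i0.
Proof. exact: pole_const. Qed.

Lemma colour_squareP d c : c != pole i0 -> colour d = c ->
  exists q r, sq q = c /\ square q r = d.
Proof.
move=> cN; case: d => [[[] i] [[]|]] E.
- by exists i, 3%N; rewrite square3 -colour_tt.
- by move: cN; rewrite -E colour_pole_dart eqxx.
- by exists (ord_pred i), 0%N; rewrite -colour_tN /square /= ord_predK.
- by move: cN; rewrite -E colour_ft pole_const eqxx.
- by exists (ord_pred i), 1%N; rewrite square1 ord_predK -colour_ff.
- by exists i, 2%N; rewrite square2 -colour_fN.
Qed.

Lemma vertex_squareP (v : bool * I) c : c != pole i0 ->
  exists q r, sq q = c /\ (square q r).1 = v.
Proof.
case: v => b i cN; have [E|h] := eqVneq (sq i) c.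
  by case: b; [exists i, 3%N; rewrite square3|exists i, 2%N; rewrite square2].
have E : sq (ord_pred i) = c.
  have p := pole_sq i; rewrite pole_const in p.
  have p' := pole_sq' i; rewrite pole_const in p'.
  by apply: (@three_colours _ _ (sq i) (pole i0)); rewrite ?cN // eq_sym // sq_pred.
case: b; [exists (ord_pred i), 0%N|exists (ord_pred i), 1%N];
  by rewrite ?square1 /square /= ord_predK.
Qed.

End Colours.
End LadderDarts.

Local Open Scope classical_set_scope.

(** The number of steps back from 2 i + b to 2 j + b on the cycle of length 2 n. As it is even, it
    stays at least two steps short of a full turn. *)
Lemma backward_distance (n i j : nat) (b : bool) : (i < n)%N -> (j < n)%N ->
  exists k, [/\ (k.+1 < 2 * n)%N,
    (if k <= 2 * i + b then 2 * i + b - k else 2 * i + b + 2 * n - k)%N = (2 * j + b)%N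
    & j <> i -> (0 < k)%N].
Proof.
move=> h1 h2; have [h|h] := leqP j i.
  by exists (2 * (i - j))%N; case: b; split; try case: ifP; lia.
by exists (2 * (i + n - j))%N; case: b; split; try case: ifP; lia.
Qed.

(** * The circles of a weave over the prism *)

Section LadderWeave.
Variable R : realType.
Local Notation V := 'rV[R]_3.
Variables (n : nat) (gamma : ladder3 n -> R -> V) (f : 'I_3 -> V -> R).
Hypothesis n_gt0 : (0 < n)%N.
Hypothesis emb : smooth_embedding gamma.
Hypothesis sf : forall a, smooth (f a).
Hypothesis low : forall x, sphere x -> edges gamma (@tau1 (ladder3 n)) x <->
  (exists a b, [/\ a != b, f a x = f b x & forall c, f a x <= f c x]).
Hypothesis high : forall x, sphere x -> edges gamma (predC (@tau1 (ladder3 n))) x <->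
  (exists a b, [/\ a != b, f a x = f b x & forall c, f c x <= f a x]).
Hypothesis transv : forall a b x, sphere x -> a != b -> f a x = f b x ->
  exists2 v, tangent x v & 'D_v (f a) x != 'D_v (f b) x.
Hypothesis transv3 : forall x, sphere x -> (forall a b, f a x = f b x) ->
  forall v, tangent x v -> (forall a b, 'D_v (f a) x = 'D_v (f b) x) -> v = 0.

Let hex (d : ladder3 n) : fingraph.order rot d = 6%N. Proof. exact: double_order. Qed.
Let tau_rot (d : ladder3 n) : tau1 (rot d) = ~~ tau1 d. Proof. by []. Qed.
Let smg d : smooth (gamma d). Proof. by have [+ _ _ _ _] := emb; apply. Qed.
Let on_sphere d t : 0 <= t <= 1 -> sphere (gamma d t).
Proof. by move=> t01; have [_ h _ _ _] := emb; have [] := h d t t01. Qed.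
Let speed d t : 0 <= t <= 1 -> derive1 (gamma d) t != 0.
Proof. by move=> t01; have [_ h _ _ _] := emb; have [] := h d t t01. Qed.
Let gopp d t : 0 <= t <= 1 -> gamma (opp d) t = gamma d (1 - t).
Proof. by move=> t01; have [_ h _ _ _] := emb; have [] := h d t t01. Qed.
Let vert d e : gamma d 0 = gamma e 0 <-> fconnect rot d e.
Proof. by have [_ _ h _ _] := emb. Qed.
Let inner d e s t : 0 < s < 1 -> 0 <= t <= 1 -> gamma d s = gamma e t ->
  (e = d /\ t = s) \/ (e = opp d /\ t = 1 - s).
Proof. by have [_ _ _ h _] := emb; exact: h. Qed.
Let e0 : 0 <= (0 : R) <= 1. Proof. lra. Qed.
Let e1 : 0 <= (1 : R) <= 1. Proof. lra. Qed.

Local Notation K := (kappa emb sf low high).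
Let rays d : [/\ K (iter 3 rot d) = K d, K (rot d) != K d, K (rot (rot d)) != K d &
  exists2 l, 0 < l & derive1 (gamma (iter 3 rot d)) 0 = - l *: derive1 (gamma d) 0].
Proof. by apply: vertex_rays. Qed.
Let K_opp d : K (opp d) = K d. Proof. by apply: kappa_opp. Qed.
Let K_3 d : K (iter 3 rot d) = K d. Proof. by have [] := rays d. Qed.
Let K_2 d : K (rot (rot d)) != K d. Proof. by have [] := rays d. Qed.
Let K_P d t a b : 0 < t < 1 ->
  f a (gamma d t) = f b (gamma d t) <-> a = b \/ (a != K d /\ b != K d).
Proof. by apply: kappaP. Qed.

Let K_eq d t a b : 0 <= t <= 1 -> a != K d -> b != K d -> f a (gamma d t) = f b (gamma d t).
Proof. by apply: kappa_eq. Qed.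

Local Notation I := 'I_(2 * n).
Local Notation D d := (gamma (edge_of d)).

Lemma vertex_eq (d d' : ladder n) : D d 0 = D d' 0 <-> d.1 = d'.1.
Proof.
split=> [/vert h|h]; last by apply/vert; exact: vtx_connect.
have := vtx_rot (findex rot (edge_of d) (edge_of d')) (edge_of d).
by rewrite iter_findex // /vtx /= => ->.
Qed.

Lemma edge_point (d d' : ladder n) u u' : 0 <= u < 1 -> 0 <= u' < 1 -> D d u = D d' u' ->
  (d = d' /\ u = u') \/ [/\ u = 0, u' = 0 & d.1 = d'.1].
Proof.
move=> /andP[u0 u1] /andP[u0' u1'] E.
have [z|nz] := eqVneq u 0; last first.
  have v : 0 < u < 1 by rewrite lt_neqAle eq_sym nz u0 u1.
  have v' : 0 <= u' <= 1 by rewrite u0' ltW.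
  have [[h ->]|[h _]] := inner v v' E; first by left; split=> //; exact/esym/(congr1 fst h).
  by have := @edge_of_opp n d d' h.
have [z'|nz'] := eqVneq u' 0.
  by right; split=> //; move: E; rewrite z z' => /vertex_eq.
have v : 0 < u' < 1 by rewrite lt_neqAle eq_sym nz' u0' u1'.
have v' : 0 <= u <= 1 by rewrite u0 ltW.
have [[h ->]|[h _]] := inner v v' (esym E); first by left; split=> //; exact: (congr1 fst h).
by have := @edge_of_opp n d' d h.
Qed.

Lemma edge_joint (d : ladder n) : D d 1 = D (face_next d) 0.
Proof.
rewrite -edge_face_next; have <- : gamma (opp (edge_of d)) 0 = gamma (edge_of d) 1.
  by rewrite gopp // subr0.
by apply/vert; exact: fconnect_iter.
Qed.

Section FaceLoop.
Variables (d0 : ladder n) (m : nat).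
Hypothesis m_gt0 : (0 < m)%N.
Local Notation B r := (iter r (@face_next (ladder n)) d0).
Hypothesis B_m : B m = d0.
Hypothesis B_inj : forall r r', (r < m)%N -> (r' < m)%N -> (B r).1 = (B r').1 -> r = r'.

Lemma boundary_mod r : B r = B (r %% m).
Proof.
rewrite {1}(divn_eq r m) addnC iterD; congr iter.
by elim: (r %/ m)%N => // k IH; rewrite mulSn addnC iterD B_m.
Qed.

Definition loop_arc (k : int) : R -> V := D (B `|(k %% m)%Z|%N).

Lemma loop_arc_next k : loop_arc k 1 = loop_arc (k + 1) 0.
Proof.
rewrite /loop_arc edge_joint; congr (D _ 0).
have m0 : m%:Z != 0 by rewrite eqz_nat -lt0n.
rewrite -[RHS]/(B _) -[face_next (B _)]/(B `|(k %% m)%Z|%N.+1) boundary_mod; congr (B _).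
have E : (k %% m)%Z = Posz `|(k %% m)%Z|%N by rewrite gez0_abs // modz_ge0.
by rewrite -modzDml {2}E -PoszD addn1 modz_nat.
Qed.

Definition loop : R -> V := concat loop_arc.

Lemma loopE r u : 0 <= u <= 1 -> loop (r%:R + u) = D (B r) u.
Proof.
move=> /andP[u0 u1]; have E : (Posz r)%:~R = r%:R :> R by [].
rewrite /loop (@concatE _ _ _ (Posz r)) ?E.
- by rewrite addrAC subrr add0r /loop_arc modz_nat /= -boundary_mod.
- exact: loop_arc_next.
- by rewrite lerDl.
- by rewrite lerD2l.
Qed.

Lemma loop_at s : exists k r u,
  [/\ (r < m)%N, 0 <= u < 1, loop s = D (B r) u & s = k%:~R * m%:R + (r%:R + u)].
Proof.
have m0 : m%:Z != 0 by rewrite eqz_nat -lt0n.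
set k := Num.floor s; have E : (k %% m)%Z = Posz `|(k %% m)%Z|%N by rewrite gez0_abs // modz_ge0.
exists (k %/ m)%Z, `|(k %% m)%Z|%N, (s - k%:~R); split=> //.
- by rewrite -ltz_nat -E ltz_pmod.
- have := floor_le s; have := lt_succ_floor s; rewrite -/k intrD => h1 h2.
  by apply/andP; split; lra.
- have -> : (`|(k %% m)%Z|%N)%:R = ((k %% m)%Z)%:~R :> R by rewrite [in RHS]E.
  have := congr1 (fun z : int => z%:~R : R) (divz_eq k m).
  by rewrite /= intrD intrM -[m%:~R]/(m%:R : R) => ->; ring.
Qed.

Lemma loop_cont : continuous loop.
Proof. by apply: concat_cont => k; [exact: smg|exact: loop_arc_next]. Qed.

Lemma loop_period s : loop (s + m%:R) = loop s.
Proof.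
have h k : loop_arc (k + Posz m) = loop_arc k by rewrite /loop_arc modzDr.
by rewrite /loop -[m%:R]/((Posz m)%:~R); exact: (concat_period loop_arc_next h s).
Qed.

Lemma loop_unit s : dot (loop s) (loop s) = 1.
Proof.
by have [k [r [u [_ /andP[u0 u1] -> _]]]] := loop_at s; apply: on_sphere; rewrite u0 ltW.
Qed.

Lemma loop_inj s t : s < t -> t < s + m%:R -> loop s <> loop t.
Proof.
move=> st tm; have [k [r [u [rm u01 -> sE]]]] := loop_at s.
have [k' [r' [u' [rm' u01' -> tE]]]] := loop_at t.
move=> /(edge_point u01 u01') h.
have [rE uE] : r = r' /\ u = u'.
  by case: h => [[bE ->]|[-> -> bE]]; split=> //; apply: B_inj => //; rewrite bE.
have m0 : 0 < m%:R :> R by rewrite ltr0n.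
have dE : t - s = (k' - k)%:~R * m%:R by rewrite sE tE rE uE intrD intrN; ring.
have k1 : 0 < (k' - k)%:~R :> R.
  by rewrite -(pmulr_lgt0 _ m0) -dE subr_gt0.
have k2 : (k' - k)%:~R < 1 :> R.
  by rewrite -(ltr_pM2r m0) -dE mul1r; lra.
by move: k1 k2; rewrite ltr0z ltrz1; move: (k' - k) => [[|z]|z].
Qed.

Lemma loop_direction (T : V -> V) :
  (forall r u, 0 <= u <= 1 -> exists2 l, 0 < l & derive1 (D (B r)) u = l *: T (D (B r) u)) ->
  has_direction3 loop (fun s => T (loop s)).
Proof.
move=> h; apply: concat_direction => [k|k|k t t01].
- exact: smg.
- exact: loop_arc_next.
have [l l0 E] := h `|(k %% m)%Z|%N t t01; exists l => //; rewrite [LHS]E; congr (_ *: T _).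
rewrite /loop (@concatE _ _ _ k); rewrite ?lerDl ?lerD2l ?(andP t01).1 ?(andP t01).2 //.
- by rewrite addrAC subrr add0r.
- exact: loop_arc_next.
Qed.

End FaceLoop.

Lemma direction_scale (g T : R -> V) (c : R) : 0 < c -> has_direction3 g T ->
  has_direction3 (fun s => g (c * s)) (fun s => T (c * s)).
Proof.
move=> c0 h s0 e e_gt0; have [d d0 H] := h (c * s0) e e_gt0.
exists (d / c) => [|s t h1 h2 h3]; first by rewrite divr_gt0.
have dc : d = c * (d / c) by rewrite mulrCA divff ?mulr1 ?gt_eqF.
apply: H; first by rewrite dc -mulrBr ltr_pM2l.
  by rewrite ltr_pM2l.
by rewrite dc -mulrDr ltr_pM2l.
Qed.

Section Directions.
Variables a b : 'I_3.
Hypothesis ab : a != b.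

Definition arc_dir (d : ladder n) (eps : R) := forall t, 0 <= t <= 1 -> exists2 l, 0 < l &
  derive1 (D d) t = l *: (eps *: cross (D d t) (sheets f a b (D d t))).

(** By [rays] the next arc continues straight on, so at the joint both velocities are positive
    multiples of one vector. *)
Lemma arc_dir_next d eps eps' : eps = 1 \/ eps = -1 -> eps' = 1 \/ eps' = -1 ->
  arc_dir d eps -> arc_dir (face_next d) eps' -> eps = eps'.
Proof.
move=> s s' h h'; have [l l0 E] := h _ e1; have [l' l0' E'] := h' _ e0.
have [_ _ _ [k k0 +]] := rays (opp (edge_of d)); rewrite edge_face_next.
rewrite (@reverse_velocity _ (D d) (gamma (opp (edge_of d)))) => [|||t t01]; try exact: smg; last exact: gopp.
rewrite E E' -edge_joint; set X := cross _ _.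
have X0 : X != 0.
  by apply: contra_neq (speed (edge_of d) e1) => X0; rewrite E -/X X0 !scaler0.
rewrite scaleNr scalerN opprK !scalerA => /eqP; rewrite -subr_eq0 -scalerBl scaler_eq0 (negbTE X0) orbF subr_eq0.
move=> /eqP; case: s => ->; case: s' => -> // H; exfalso.
- by have : 0 < k * l by [rewrite mulr_gt0]; lra.
- by have : 0 < k * l by [rewrite mulr_gt0]; lra.
Qed.

Lemma face_dir d : (forall r, a != K (edge_of (iter r (@face_next _) d)) /\
    b != K (edge_of (iter r (@face_next _) d))) ->
  exists2 eps, eps = 1 \/ eps = -1 & forall r, arc_dir (iter r (@face_next _) d) eps.
Proof.
move=> hK; have dirs r : exists2 eps, eps = 1 \/ eps = -1 & arc_dir (iter r (@face_next _) d) eps.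
  have [Ka Kb] := hK r; by apply: arc_direction Ka Kb.
have [eps s h] := dirs 0%N; exists eps => //; elim=> // r IH.
have [eps' s' h'] := dirs r.+1; by rewrite (arc_dir_next s s' IH h').
Qed.

End Directions.

Local Notation c0 := (pole K (i0 n_gt0)).

Let col_sq q r : colour K (square q r) = sq K q. Proof. by apply: colour_square. Qed.
Let col_pole i : colour K (pole_dart i) = c0. Proof. by apply: colour_pole_dart. Qed.

Definition circle (q : I) (s : R) : V := loop (square q 0) 4 (4 * s).

Lemma circleE q r u : 0 <= u <= 1 -> circle q ((r%:R + u) / 4) = D (square q r) u.
Proof.
move=> u01; rewrite /circle (_ : 4 * _ = r%:R + u); last by field.
by apply: loopE => //; exact: square4.
Qed.

Lemma circle_at q s : exists r u, [/\ (r < 4)%N, 0 <= u < 1 & circle q s = D (square q r) u].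
Proof.
have [|k [r [u [h1 h2 h3 _]]]] := @loop_at (square q 0) 4 _ (4 * s); first by [].
by exists r, u.
Qed.

Lemma circle_cont q : continuous (circle q).
Proof.
move=> s; apply: (@continuous_comp _ _ _ (fun s : R => 4 * s) (loop (square q 0) 4)).
  exact: mulrl_continuous.
by apply: loop_cont => //; exact: square4.
Qed.

Lemma circle_unit q s : dot (circle q s) (circle q s) = 1.
Proof. by apply: loop_unit => //; exact: square4. Qed.

Lemma circle_period q s : circle q (s + 1) = circle q s.
Proof. by rewrite /circle mulrDr mulr1; apply: loop_period => //; exact: square4. Qed.

Lemma circle_inj q s t : s < t -> t < s + 1 -> circle q s <> circle q t.
Proof.
move=> st ts; apply: loop_inj => //; try exact: square4.
- by move=> r r'; apply: square_vtx.
- by lra.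
- by lra.
Qed.

Definition pole_circle (q : I) : R -> V := loop (pole_dart q) (2 * n).

Lemma iter_ord_pred (q : I) : iter (2 * n) (@ord_pred _) q = q.
Proof.
suff h k : k = (2 * n).-1.+1 -> iter k (@ord_pred (2 * n)) q = q.
  by apply: h; rewrite prednK // muln_gt0.
move=> ->; rewrite iterS -[RHS]ordSK; congr ord_pred; apply/val_inj.
rewrite iter_pred_val ?ordS_val //=; last by lia.
by move: (ltn_ord q); move: (nat_of_ord q) => z; clear; case: ifP => h1; case: eqP => h2; lia.
Qed.

Lemma pole_period q : iter (2 * n) (@face_next (ladder n)) (pole_dart q) = pole_dart q.
Proof. by rewrite iter_pole iter_ord_pred. Qed.

Lemma pole_circleE q k u : 0 <= u <= 1 ->
  pole_circle q (k%:R + u) = D (pole_dart (iter k (@ord_pred _) q)) u.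
Proof.
move=> u01; rewrite -iter_pole; apply: loopE => //; last exact: pole_period.
by rewrite muln_gt0.
Qed.

Lemma pole_circle_cont q : continuous (pole_circle q).
Proof. by apply: loop_cont; rewrite ?muln_gt0 //; exact: pole_period. Qed.

Section Circles.
Variables (a b c : 'I_3) (par : bool).
Hypotheses (ab : a != b) (ac : a != c) (bc : b != c).
Hypothesis abP : a = c0 \/ b = c0.
Hypothesis parE : forall i, (sq K i == c) = (odd i == par).

Let cN : c != c0. Proof. by case: abP => <-; rewrite eq_sym. Qed.

Lemma circle_index_subproof (j : 'I_n) : (2 * j + par < 2 * n)%N.
Proof. by move: (ltn_ord j); clear -par; case: par; lia. Qed.
Definition circle_index j : I := Ordinal (circle_index_subproof j).
Local Notation Q := circle_index.

Let oddQ j : odd (Q j) = par. Proof. by rewrite /= oddD mul2n odd_double; case: par. Qed.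
Let sqQ j : sq K (Q j) = c. Proof. by apply/eqP; rewrite parE oddQ. Qed.

Lemma index_of q : sq K q = c -> exists j, q = Q j.
Proof.
move=> /eqP; rewrite parE => /eqP oq; have h : (q./2 < n)%N.
  by move: (ltn_ord q) (odd_double_half q); rewrite -mul2n; clear; lia.
exists (Ordinal h); apply/val_inj => /=.
by have := odd_double_half q; rewrite oq -mul2n addnC.
Qed.

Lemma circle_on j s : f a (circle (Q j) s) = f b (circle (Q j) s).
Proof.
have [r [u [_ /andP[u0 u1] ->]]] := circle_at (Q j) s.
by apply: K_eq; rewrite ?u0 ?(ltW u1) //; rewrite -/(colour K _) col_sq sqQ.
Qed.

Lemma circle_disj i j s t : i != j -> circle (Q i) s <> circle (Q j) t.
Proof.
move=> ij; have [r [u [_ h1 ->]]] := circle_at (Q i) s.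
have [r' [u' [_ h2 ->]]] := circle_at (Q j) t.
move=> /(edge_point h1 h2) h; have E : (square (Q i) r).1.2 = (square (Q j) r').1.2.
  by case: h => [[-> _]|[_ _ ->]].
have o := oddQ i; have o' := oddQ j; have Sinj := can_inj (@ordSK (2 * n)).
have QQ : Q i = Q j.
  case: (square_pos (Q i) r) (square_pos (Q j) r') E => [->|->] [->|->] //.
  - by move=> E; move: o; rewrite E odd_ordS // o'; case: par.
  - by move=> E; move: o'; rewrite -E odd_ordS // o; case: par.
  - exact: Sinj.
case/negP: ij; apply/eqP/val_inj; move: (congr1 val QQ) => /= /addIn/eqP.
by rewrite eqn_mul2l /= => /eqP.
Qed.

Lemma circle_zero x : sphere x -> f a x = f b x -> exists j s, circle (Q j) s = x.
Proof.
move=> sx E; have [d [t [/andP[t0 t1] dx h]]] : exists d t, [/\ 0 <= t < 1, gamma d t = x & t = 0 \/ (a != K d /\ b != K d)].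
  by apply: zero_point.
suff [q [r [u [qc u01 <-]]]] : exists q r u, [/\ sq K q = c, 0 <= u <= 1 & D (square q r) u = x].
  by have [j ->] := index_of qc; exists j, ((r%:R + u) / 4); exact: circleE.
case: h => [tz|[Ka Kb]].
  have [q [r [qc rE]]] : exists q r, sq K q = c /\ (square q r).1 = vtx d.
    by apply: vertex_squareP cN.
  exists q, r, 0; split=> //; rewrite -dx tz; apply/vert; apply: vtx_connect.
  by rewrite /vtx /= rE.
have Kd : K d = c.
  have [z [za zb zP]] := third ab.
  have zc : c = z by case: (zP c) => // h; [move: ac|move: bc]; rewrite h eqxx.
  by rewrite zc; case: (zP (K d)) => // h; [move: Ka|move: Kb]; rewrite h eqxx.
have [e eP] := edge_of_cases d.
have Ke : colour K e = c by rewrite /colour; case: eP => ->; rewrite ?K_opp.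
have [q [r [qc rE]]] : exists q r, sq K q = c /\ square q r = e by apply: colour_squareP cN Ke.
case: eP => eE; [exists q, r, t|exists q, r, (1 - t)]; split=> //; rewrite ?rE ?eE ?t0 ?(ltW t1) //.
  by apply/andP; split; lra.
by rewrite gopp ?subKr //; apply/andP; split; lra.
Qed.

Lemma circle_dir j : exists2 eps, eps = 1 \/ eps = -1 & has_direction3 (circle (Q j))
  (fun s => eps *: cross (circle (Q j) s) (sheets f a b (circle (Q j) s))).
Proof.
have [r|eps e1' h] := @face_dir a b ab (square (Q j) 0).
  by rewrite -[iter r _ _]/(square (Q j) r) -/(colour K _) col_sq sqQ.
exists eps => //; apply: (@direction_scale (loop (square (Q j) 0) 4)
  (fun s => eps *: cross (loop (square (Q j) 0) 4 s) (sheets f a b (loop (square (Q j) 0) 4 s)))) => //.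
have L (T : V -> V) : (forall r u, 0 <= u <= 1 -> exists2 l, 0 < l &
    derive1 (D (square (Q j) r)) u = l *: T (D (square (Q j) r) u)) ->
    has_direction3 (loop (square (Q j) 0) 4) (fun s => T (loop (square (Q j) 0) 4 s)).
  by move=> hT; apply: loop_direction => //; try exact: square4; try exact: hT.
by apply: (L (fun x => eps *: cross x (sheets f a b x))) => r u u01; exact: h.
Qed.

Local Notation hh x := (f a x - f b x).

(** The sheet left out on a polar edge is [c0], which is one of [a] and [b]; so these two do not
    agree inside the edge. *)
Lemma pole_nonzero i u : 0 < u < 1 -> hh (D (pole_dart i) u) != 0.
Proof.
move=> u01; rewrite subr_eq0; apply/eqP => /(K_P _ _ _ u01)[/eqP|[h1 h2]].
  by rewrite (negbTE ab).
by move: h1 h2; rewrite -/(colour K _) col_pole; case: abP => <-; rewrite eqxx.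
Qed.

Lemma pole_constant i u u' : 0 < u < 1 -> 0 < u' < 1 ->
  0 < hh (D (pole_dart i) u) * hh (D (pole_dart i) u').
Proof.
wlog uu : u u' / u <= u' => [H|] h h'.
  by case: (leP u u') => [l|/ltW l]; [exact: H|rewrite mulrC; exact: H].
have n1 := pole_nonzero i h; have n2 := pole_nonzero i h'.
case: (ltrP 0 (hh (D (pole_dart i) u) * hh (D (pole_dart i) u'))) => // le0; exfalso.
pose phi t := hh (D (pole_dart i) t).
have cphi : continuous phi.
  have cc e : continuous (fun t => f e (D (pole_dart i) t)).
    by move=> t; apply: continuous_comp; [exact: (smg _ 0)|exact: (sf _ 0)].
  by move=> t; apply: cvgB; exact: cc.
have lt0 : phi u * phi u' < 0 by rewrite lt_neqAle le0 mulf_neq0.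
have [|x] := @IVT R phi u u' 0 uu (continuous_subspaceT cphi) _.
  rewrite ge_min le_max; case: (ltgtP (phi u) 0) => [l|l|E].
  - by move: lt0; rewrite nmulr_rlt0 // => /ltW ->; rewrite orbT.
  - by move: lt0; rewrite pmulr_rlt0 // => /ltW ->; rewrite orbT.
  - by move: lt0; rewrite E mul0r ltxx.
rewrite in_itv /= => /andP[x1 x2] /eqP; apply/negP; apply: pole_nonzero.
by move: h h' => /andP[? ?] /andP[? ?]; apply/andP; split; lra.
Qed.

Definition pole_value i := hh (D (pole_dart i) (1 / 2)).

(** Between two consecutive polar edges the polar circle crosses, transversally, the circle of a
    square along which [a] and [b] agree. *)
Lemma pole_alternate i : (0 < pole_value (ordS i)) = ~~ (0 < pole_value i).
Proof.
suff : pole_value (ordS i) * pole_value i < 0.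
  move: (pole_value _) (pole_value _) => x y; case: (ltgtP x 0) => [l|l|->].
  - by rewrite nmulr_llt0 // => ->.
  - by rewrite pmulr_llt0 // => /ltW; rewrite leNgt => /negbTE.
  - by rewrite mulr0 ltxx.
set e := opp (edge_of (pole_dart (ordS i))).
have Ke : K e = a \/ K e = b.
  rewrite /e K_opp -/(colour K _) col_pole; by case: abP => ->; [left|right].
have [r r0 h] : exists2 r, 0 < r & forall t t', 0 < t < r -> 0 < t' < r ->
    hh (gamma e t) * hh (gamma (iter 3 rot e) t') < 0 by exact: (cross_sign hex tau_rot transv3 ab Ke).
have [t t0 [t1 tr]] : exists2 t, 0 < t & t < 1 /\ t < r.
  exists (Num.min (r / 2) (1 / 2)); first by rewrite lt_min; apply/andP; split; lra.
  by rewrite !gt_min; split; apply/orP; [right|left]; lra.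
have tt : 0 < t < r by rewrite t0.
have := h t t tt tt; rewrite /e edge_face_next pole_next ordSK gopp; last by rewrite !ltW.
move=> xy; rewrite -(nmulr_rgt0 _ xy) mulrACA mulr_gt0 //.
  by apply: pole_constant; apply/andP; split; lra.
by apply: pole_constant; apply/andP; split; lra.
Qed.

Lemma pole_sign i : (0 < pole_value i) = (0 < pole_value (i0 n_gt0)) (+) odd i.
Proof.
move: i; apply: (@ord_walk n n_gt0 (fun i => (0 < pole_value i) = (0 < pole_value (i0 n_gt0)) (+) odd i)) => [|i IH]; first by rewrite /= addbF.
by rewrite pole_alternate IH odd_ordS // addbN.
Qed.

Let j0 : 'I_n := Ordinal n_gt0.
Hypothesis value_gt0 : 0 < pole_value (Q j0).

Lemma pole_positive j u : 0 < u < 1 -> 0 < hh (D (pole_dart (Q j)) u).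
Proof.
move=> u01; have v : 0 < pole_value (Q j) by rewrite pole_sign oddQ -(oddQ j0) -pole_sign.
by rewrite -(pmulr_lgt0 _ v); apply: pole_constant => //; apply/andP; split; lra.
Qed.

Lemma pole_reach i j : exists k, [/\ (k.+1 < 2 * n)%N, iter k (@ord_pred _) (Q i) = Q j
  & j != i -> (0 < k)%N].
Proof.
have [k [k1 k2 k3]] := backward_distance par (ltn_ord i) (ltn_ord j).
exists k; split=> [//||ji].
  by apply/val_inj; rewrite iter_pred_val //= ltnW.
by apply: k3 => /ord_inj E; rewrite E eqxx in ji.
Qed.

(** The arc of the polar circle leaves the square [Q i] at one corner and stops before its other
    corner, and it meets each of the other circles at a corner. The union over [j] is thus connected
    and avoids the circle of [Q i], while it comes near to it through positive values. *)
Definition outer_part i j : set V := pole_circle (Q i) @` [set s | 0 < s < (2 * n)%:R - 1] `|`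
  (if j == i then set0 else range (circle (Q j))).

Definition outer i : set V := \bigcup_(j in setT) outer_part i j.

Let n2 : 1 <= n%:R :> R. Proof. by rewrite ler1n. Qed.
Let nE : (2 * n)%:R = 2 * n%:R :> R. Proof. by rewrite natrM. Qed.

Lemma vertex_meet j : D (pole_dart (Q j)) 0 = circle (Q j) (3 / 4).
Proof.
have -> : 3 / 4 = (3%:R + 0) / 4 :> R by rewrite addr0.
by rewrite circleE //; apply/vertex_eq; rewrite square3.
Qed.

Lemma reach_arc k : (k.+1 < 2 * n)%N -> k%:R + 1 <= (2 * n)%:R - 1 :> R.
Proof.
move=> h; have : k.+2%:R <= (2 * n)%:R :> R by rewrite ler_nat.
by rewrite -2!natr1; lra.
Qed.

Lemma outer_connected i : connected (outer i).
Proof.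
have arc : connected (pole_circle (Q i) @` [set s | 0 < s < (2 * n)%:R - 1]).
  apply: connected_continuous_connected.
    by apply/connected_intervalP => x y /= /andP[x0 x1] /andP[y0 y1] z /andP[xz zy];
      rewrite (lt_le_trans x0 xz) (le_lt_trans zy y1).
  by apply: continuous_subspaceT; exact: pole_circle_cont.
apply: bigcup_connected.
  exists (pole_circle (Q i) (1 / 2)) => j _; left; exists (1 / 2) => //=.
  by rewrite nE; have nn := n2; apply/andP; split; lra.
move=> j _; rewrite /outer_part; case: (eqVneq j i) => [_|ji]; first by rewrite setU0.
apply: connectedU => //; last first.
  apply: connected_continuous_connected; first by apply/connected_intervalP.
  by apply: continuous_subspaceT; exact: circle_cont.
have [k [kn kE kj]] := pole_reach i j; exists (pole_circle (Q i) (k%:R + 0)); split.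
  exists (k%:R + 0) => //=; have := reach_arc kn; have : 0 < k%:R :> R by rewrite ltr0n kj.
  by move=> h1 h2; apply/andP; split; lra.
by rewrite pole_circleE // kE vertex_meet; exists (3 / 4).
Qed.

Lemma outer_avoids i y : outer i y -> dot y y = 1 /\ forall s, circle (Q i) s <> y.
Proof.
move=> [j _ [[t /= /andP[t0 t1] <-]|]]; last first.
  case: (eqVneq j i) => // ji [t _ <-]; split; first exact: circle_unit.
  by move=> s; apply: circle_disj; rewrite eq_sym.
split; first by apply: loop_unit; rewrite ?muln_gt0 //; exact: pole_period.
move=> s; have [r' [u' [r4 u01' ->]]] := circle_at (Q i) s.
have [|k [r [u [rm u01 E tE]]]] := @loop_at (pole_dart (Q i)) (2 * n) _ t; first by rewrite muln_gt0.
rewrite -/(pole_circle _) in E; rewrite E iter_pole => /(edge_point u01' u01)[[dE _]|[_ uz vE]].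
  by have := col_sq (Q i) r'; rewrite dE col_pole sqQ => h; move: cN; rewrite h eqxx.
have k0 : k = 0.
  move: u01 => /andP[u0 u1]; have m0 : 0 < (2 * n)%:R :> R by rewrite nE; have nn := n2; lra.
  have rm' : r%:R + 1 <= (2 * n)%:R :> R by rewrite natr1 ler_nat.
  have r0 : 0 <= r%:R :> R by exact: ler0n.
  have h1 : k%:~R < 1 :> R by rewrite -(ltr_pM2r m0) mul1r; lra.
  have h2 : -1 < k%:~R :> R by rewrite -(ltr_pM2r m0) mulN1r; lra.
  have h1' : k < 1 by rewrite -(ltrz1 R).
  have h2' : -1 < k by rewrite -(ltr_int R) rmorphN1.
  by move: h1' h2'; clear; lia.
(* A common vertex would be a corner of [Q i]. The polar circle passes these after 0 and after 2 n -
   1 steps, and both are excluded. *)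
have r0 : (0 < r)%N by rewrite -(ltr_nat R); move: t0; rewrite tE k0 uz mul0r add0r addr0.
have r1 : (r.+1 < 2 * n)%N.
  by rewrite -(ltr_nat R) -natr1; move: t1; rewrite tE k0 uz mul0r add0r addr0; lra.
have pos : iter r (@ord_pred _) (Q i) = (square (Q i) r').1.2 by rewrite vE.
have vp : val (iter r (@ord_pred _) (Q i)) =
    (if (r <= Q i)%N then (Q i - r)%N else (Q i + 2 * n - r)%N) by rewrite iter_pred_val.
have vs : val (ordS (Q i)) = (if (Q i).+1 == (2 * n)%N then 0%N else (Q i).+1) by rewrite ordS_val.
move: vp; rewrite pos; case: (square_pos (Q i) r') => ->; last rewrite vs.
  rewrite -[val (Q i)]/(nat_of_ord (Q i)); move: (ltn_ord (Q i)) r0 r1.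
  by move: (nat_of_ord (Q i)) => z; clear; case: ifP; lia.
move: (ltn_ord (Q i)) r0 r1; move: (nat_of_ord (Q i)) => z; clear.
by case: eqP => h1; case: ifP => h2; lia.
Qed.

Lemma outer_near i r : 0 < r -> exists y, [/\ outer i y, ball (circle (Q i) (3 / 4)) r y & 0 < hh y].
Proof.
move=> r0; have := @pole_circle_cont (Q i) 0 _ (nbhsx_ballx _ _ r0).
have E0 : pole_circle (Q i) 0 = circle (Q i) (3 / 4).
  by rewrite -[0]addr0 -[X in X + 0]/(0%:R : R) pole_circleE // vertex_meet.
rewrite E0 => /nbhs_ballP[e /= e_gt0 he].
have [u u0 [u1 ue]] : exists2 u, 0 < u & u < 1 /\ u < e.
  exists (Num.min (e / 2) (1 / 2)); first by rewrite lt_min; apply/andP; split; lra.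
  by rewrite !gt_min; split; apply/orP; [right|left]; lra.
exists (pole_circle (Q i) u); split.
- by exists i => //; left; exists u => //=; rewrite nE; have nn := n2; apply/andP; split; lra.
- by apply: he; rewrite /ball /= sub0r normrN gtr0_norm.
- rewrite -[u]add0r -[X in X + u]/(0%:R : R) pole_circleE; last by rewrite !ltW.
  by apply: pole_positive; rewrite u0.
Qed.

Lemma circle_system :
  curve_system (sheets f a b) (fun j => circle (Q j)) (D (pole_dart (Q j0)) (1 / 2)).
Proof.
have half : ((0 : R) <= 1 / 2) && ((1 / 2 : R) <= 1) by rewrite divr_ge0 //=; lra.
have half' : ((0 : R) < 1 / 2) && ((1 / 2 : R) < 1) by rewrite divr_gt0 //=; lra.
have zeroP x : dot x x = 1 -> dot (sheets f a b x) x = 0 -> f a x = f b x.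
  by move=> x1; rewrite sheets_radial // => /eqP; rewrite subr_eq0 => /eqP.
constructor.
- by move=> i; exact: circle_cont.
- by move=> i s; exact: circle_unit.
- by move=> i s; exact: circle_period.
- by move=> i s t; exact: circle_inj.
- by move=> i j s t; exact: circle_disj.
- by move=> i s; rewrite sheets_radial ?circle_unit // circle_on subrr.
- by move=> x x1 /(zeroP _ x1); exact: circle_zero.
- exact: circle_dir.
- have p1 : dot (D (pole_dart (Q j0)) (1 / 2)) (D (pole_dart (Q j0)) (1 / 2)) = 1 by exact: on_sphere.
  by split=> //; rewrite sheets_radial.
- move=> i; exists (outer i); split.
  + exact: outer_connected.
  + exact: outer_avoids.
  + have [k [kn kE _]] := pole_reach i j0; exists i => //; left; exists (k%:R + 1 / 2).
      have := reach_arc kn; have : 0 <= k%:R :> R by exact: ler0n.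
      by move=> h1 h2 /=; apply/andP; split; lra.
    by rewrite pole_circleE // kE.
  + by move=> j s ji; exists j => //; right; rewrite (negbTE ji); exists s.
  + exists (3 / 4) => r r0; have [y [h1 h2 h3]] := outer_near i r0.
    by exists y; split=> //; rewrite sheets_radial //; have [] := outer_avoids h1.
- move=> x x1 /(zeroP _ x1) E; by apply: side_local.
Qed.

End Circles.

(** Two sheets agree along the circles whose colour is the third index. If [c0] is one of the two,
    this third index is a colour of squares and there are [n] circles; the remaining pair agrees
    along the polar circles instead. The sign of the difference on a polar edge decides which of the
    two differences forms the system. *)
Lemma ladder_circle_weave : circle_weave n (link_image (fun a => jet1 (f a))) f c0.
Proof.
constructor=> [a| |a b x sx ab|a b ab abP]; first exact: (smooth_jet1 (sf a) 0).
- by [].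
- by rewrite -subr_eq0; apply: sheets_neq0.
have [c [ca cb _]] := third ab; rewrite eq_sym in ca; rewrite eq_sym in cb.
have cN : c != c0 by case: abP => <-; rewrite eq_sym.
have [par parE] : exists par, forall i, (sq K i == c) = (odd i == par) by apply: sq_parity cN.
have ba : b != a by rewrite eq_sym.
have abP' : b = c0 \/ a = c0 by case: abP; [right|left].
pose q := circle_index par (Ordinal n_gt0).
exists (fun j => circle (circle_index par j)), (D (pole_dart q) (1 / 2)).
case: (ltgtP (pole_value a b q) 0) => [v|v|v].
- right; apply: circle_system ba cb ca abP' parE _.
  by rewrite /pole_value -opprB oppr_gt0.
- by left; apply: circle_system ab ca cb abP parE v.
- have h : ((0 : R) < 1 / 2) && ((1 / 2 : R) < 1) by rewrite divr_gt0 //=; lra.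
  by have := pole_nonzero ab abP q h; rewrite -/(pole_value a b q) v eqxx.
Qed.

End LadderWeave.

Local Close Scope classical_set_scope.

(** * Points and lines of a finite projective plane *)

Section Plane.
Variable F : finFieldType.
Local Notation V := 'rV[F]_3.
Local Notation q := #|F|.
Local Notation sub := {vspace V}.

Lemma q_gt1 : (1 < q)%N.
Proof. exact: finNzRing_gt1. Qed.

Lemma point_sub (P Q : sub) : \dim P = 1%N -> \dim Q = 1%N -> (P <= Q)%VS -> P = Q.
Proof. by move=> p1 q1 PQ; apply/eqP; rewrite eqEdim PQ p1 q1. Qed.

Lemma join_dim (P Q : sub) : \dim P = 1%N -> \dim Q = 1%N -> P != Q -> \dim (P + Q) = 2.
Proof.
move=> p1 q1 PQ; have := dimv_sum_cap P Q; rewrite p1 q1.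
suff -> : \dim (P :&: Q) = 0%N by rewrite addn0.
apply/eqP; rewrite -leqn0 leqNgt; apply: contra PQ => c0.
have cP : (P :&: Q)%VS = P by apply/eqP; rewrite eqEdim capvSl p1.
by apply/eqP/point_sub => //; rewrite -cP capvSr.
Qed.

Lemma joinE (P Q l : sub) : \dim P = 1%N -> \dim Q = 1%N -> P != Q -> \dim l = 2 ->
  (P <= l)%VS -> (Q <= l)%VS -> l = (P + Q)%VS.
Proof.
move=> p1 q1 PQ l2 Pl Ql; apply/esym/eqP.
by rewrite eqEdim subv_add Pl Ql join_dim // l2.
Qed.

Lemma meet_dim (l m : sub) : \dim l = 2 -> \dim m = 2 -> l != m -> \dim (l :&: m) = 1%N.
Proof.
move=> l2 m2 lm; have := dimv_sum_cap l m; rewrite l2 m2.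
have s3 : (\dim (l + m) <= 3)%N.
  by have := dimvS (subvf (l + m)%VS); rewrite dimvf dim_matrix.
have : (2 < \dim (l + m))%N.
  rewrite ltnNge; apply: contra lm => s2.
  have E : l = (l + m)%VS by apply/eqP; rewrite eqEdim addvSl l2.
  by apply/eqP/esym/eqP; rewrite eqEdim m2 l2 andbT [in X in (_ <= X)%VS]E addvSr.
lia.
Qed.

Lemma meetE (P l m : sub) : \dim P = 1%N -> \dim l = 2 -> \dim m = 2 -> l != m ->
  (P <= l)%VS -> (P <= m)%VS -> P = (l :&: m)%VS.
Proof. by move=> p1 l2 m2 lm Pl Pm; apply: point_sub; rewrite ?meet_dim // subv_cap Pl Pm. Qed.

Definition points (U : sub) : {set sub} := [set P | (\dim P == 1%N) && (P <= U)%VS].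

Lemma card_nonzero (U : sub) : #|[set v : V | (v \in U) && (v != 0)]| = (q ^ \dim U).-1.
Proof.
have := cardsD1 (0 : V) [set v | v \in U]; rewrite inE mem0v /= => E.
have <- : #|[set v : V | v \in U]| = (q ^ \dim U)%N.
  by rewrite cardsE; exact: (@card_vspace F V (Vector.class V) U).
rewrite E /=; apply: eq_card => v; rewrite !inE andbC //.
Qed.

(** The nonzero vectors are sorted by the point they span, each of which contains q - 1 of them. *)
Lemma card_points (U : sub) : (#|points U| * q.-1)%N = (q ^ \dim U).-1.
Proof.
rewrite -card_nonzero -[RHS]sum1_card.
rewrite (partition_big (fun v : V => <[v]>%VS) (mem (points U))) /=; last first.
  by move=> v; rewrite !inE dim_vline => /andP[vU ->].
rewrite -[LHS]sum_nat_const; apply: eq_bigr => P; rewrite inE => /andP[/eqP p1 PU].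
have <- : (q ^ \dim P).-1 = q.-1 by rewrite p1 expn1.
rewrite -card_nonzero -sum1_card; apply: eq_bigl => v; rewrite !inE.
apply/andP/andP => [[vP v0]|[/andP[vU v0] /eqP <-]]; last by rewrite memv_line.
split; first by rewrite v0 andbT; exact: (subvP PU).
by rewrite eqEdim -memvE vP dim_vline v0 p1.
Qed.

Lemma card_line (l : sub) : \dim l = 2 -> #|points l| = q.+1.
Proof.
move=> l2; have := card_points l; rewrite l2; have := q_gt1; case: q => [|[|k]] //= _.
by move=> E; apply/eqP; rewrite -(eqn_pmul2r (ltn0Sn k)) E; apply/eqP; lia.
Qed.

Lemma card_plane : #|points fullv| = (q ^ 2 + q + 1)%N.
Proof.
have := card_points fullv; rewrite dimvf dim_matrix; have := q_gt1; case: q => [|[|k]] //= _.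
by move=> E; apply/eqP; rewrite -(eqn_pmul2r (ltn0Sn k)) E; apply/eqP; nia.
Qed.

Definition pencil (P : sub) : {set sub} := [set l | (\dim l == 2) && (P <= l)%VS].

(** The lines through [P] correspond to the points of a line that misses [P]. *)
Lemma card_pencil (P : sub) : \dim P = 1%N -> #|pencil P| = q.+1.
Proof.
move=> p1; pose l := (P^C)%VS.
have l2 : \dim l = 2 by rewrite dimv_compl dimvf dim_matrix p1.
have Pl : ~~ (P <= l)%VS.
  apply/negP => Pl; have := capv_compl P; have -> : (P :&: P^C)%VS = P.
    by apply/capv_idPl.
  by move=> P0; move: p1; rewrite P0 dimv0.
rewrite -(card_line l2); have -> : pencil P = (fun Q : sub => (P + Q)%VS) @: points l.
  apply/setP => m; rewrite inE; apply/andP/imsetP => [[/eqP m2 Pm]|[Q]].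
    have lm : l != m by apply: contraNneq Pl => ->.
    have c1 := meet_dim l2 m2 lm.
    exists (l :&: m)%VS; first by rewrite inE c1 eqxx capvSl.
    by apply: joinE; rewrite ?capvSr //; apply: contraNneq Pl => ->; exact: capvSl.
  rewrite inE => /andP[/eqP q1 Ql] ->; rewrite addvSl join_dim //.
  by apply: contraNneq Pl => ->.
rewrite card_in_imset // => Q Q'; rewrite !inE => /andP[/eqP q1 Ql] /andP[/eqP q1' Ql'] E.
have PQ : P != Q by apply: contraNneq Pl => ->.
have m2 := join_dim p1 q1 PQ; have lm : l != (P + Q)%VS.
  by apply: contraNneq Pl => ->; exact: addvSl.
rewrite (meetE q1 l2 m2 lm Ql (addvSr _ _)) (meetE q1' l2 m2 lm Ql') //.
by rewrite E addvSr.
Qed.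

Lemma off_line (l : sub) : \dim l = 2 -> #|points fullv :\: points l| = (q ^ 2)%N.
Proof.
move=> l2; rewrite cardsD; have -> : points fullv :&: points l = points l.
  by apply/setP => P; rewrite !inE subvf andbT; case: (\dim P == 1%N).
by rewrite card_plane card_line //; lia.
Qed.

End Plane.

(** * Closed walks and traces of matrix powers *)

Section Walks.
Variables (T : finType) (w : T -> T -> rat).

(** The entries of the powers of the matrix [w]. *)
Fixpoint walks (k : nat) (x y : T) : rat :=
  if k is k'.+1 then \sum_z w x z * walks k' z y else (x == y)%:R.

Fixpoint weight (x : T) (s : seq T) : rat :=
  if s is y :: s' then w x y * weight y s' else 1.

Lemma weightE x s m : size s = m ->
  weight x s = \prod_(k < m) w (nth x (x :: s) k) (nth x s k).
Proof.
move=> <-; elim: s x => [|y s IH] x; first by rewrite big_ord0.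
rewrite big_ord_recl /= IH; congr (_ * _); apply: eq_bigr => i _ /=.
by congr w; apply: set_nth_default => //=; rewrite ltnS ltnW.
Qed.

Lemma weight_rcons x s y : weight x (rcons s y) = weight x s * w (last x s) y.
Proof. by elim: s x => [|z s IH] x /=; rewrite ?mulr1 ?mul1r // IH mulrA. Qed.

Lemma walks_sum k x y : walks k.+1 x y = \sum_(s : k.-tuple T) weight x (rcons s y).
Proof.
elim: k x => [|k IH] x.
  rewrite (big_pred1 [tuple]) => [|s]; last by apply/esym/eqP; exact: tuple0.
  rewrite /= (bigD1 y) //= eqxx big1 ?addr0 // => z /negbTE ->; exact: mulr0.
rewrite -[LHS]/(\sum_z w x z * walks k.+1 z y).
rewrite (reindex (fun p : T * k.-tuple T => [tuple of p.1 :: p.2])) /=; last first.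
  exists (fun t : k.+1.-tuple T => (thead t, [tuple of behead t])).
    by move=> [z s] _; congr pair; apply/val_inj.
  by move=> t _; apply/val_inj; rewrite /= [in RHS](tuple_eta t).
rewrite -(pair_bigA _ (fun z s => w x z * weight z (rcons (val s) y))) /=.
by apply: eq_bigr => z _; have := IH z; rewrite /= => ->; rewrite mulr_sumr.
Qed.

(** The trace of a power as a sum over cyclic sequences; [ord_pred] closes the cycle, as the step
    into position 0 starts from the last position. *)
Lemma closed_walks m : \sum_x walks m.+1 x x =
  \sum_(f : {ffun 'I_m.+1 -> T}) \prod_(k < m.+1) w (f (ord_pred k)) (f k).
Proof.
rewrite (reindex (fun t : m.+1.-tuple T => [ffun i => tnth t i])) /=; last first.
  exists (fun f : {ffun 'I_m.+1 -> T} => [tuple f i | i < m.+1]).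
    by move=> t _; apply: eq_from_tnth => i; rewrite tnth_mktuple ffunE.
  by move=> f _; apply/ffunP => i; rewrite ffunE tnth_mktuple.
rewrite (reindex (fun p : T * m.-tuple T => [tuple of p.1 :: p.2])) /=; last first.
  exists (fun t : m.+1.-tuple T => (thead t, [tuple of behead t])).
    by move=> [z s] _; congr pair; apply/val_inj.
  by move=> t _; apply/val_inj; rewrite /= [in RHS](tuple_eta t).
rewrite -(pair_bigA _ (fun x (s : m.-tuple T) => \prod_(k < m.+1)
   w ([ffun i => tnth [tuple of x :: s] i] (ord_pred k)) ([ffun i => tnth [tuple of x :: s] i] k))) /=.
apply: eq_bigr => x _; have := walks_sum m x x; rewrite /= => ->; apply: eq_bigr => s _.
rewrite weight_rcons (weightE _ (size_tuple s)) mulrC big_ord_recl; congr (_ * _).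
  rewrite !ffunE !(tnth_nth x) /=; congr (w _ _).
  by rewrite modn_small // (last_nth x) size_tuple.
apply: eq_bigr => k _; rewrite !ffunE !(tnth_nth x) /=; congr (w _ _).
by congr nth; rewrite add0n modnDr modn_small // ltnS ltnW.
Qed.

End Walks.

(** * Traces of the two transfer matrices *)

Section Trace.
Variables (T : finType) (C : eqType) (v : pred T) (r : T -> C) (q : nat).
Hypothesis card_v : #|[set x | v x]| = (q ^ 2)%N.
Hypothesis card_class : forall x, v x -> #|[set y | v y & r y == r x]| = q.

Definition class_weight (x y : T) : rat :=
  (v x && v y)%:R * (q%:R * (x == y)%:R + 1 - (r x == r y)%:R).

Let s1 : \sum_(z | v z) 1 = q%:R ^+ 2 :> rat.
Proof. by rewrite sumr_const -cardsE card_v natrX. Qed.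
Let sc x : v x -> \sum_(z | v z) (r z == r x)%:R = q%:R :> rat.
Proof.
move=> vx; rewrite -[in RHS](card_class vx) -sum1_card natr_sum.
rewrite (eq_bigl (fun z => v z && (r z == r x))); last by move=> z; rewrite inE.
by rewrite big_mkcondr /=; apply: eq_bigr => z _; case: eqP.
Qed.
Let se x (g : T -> rat) : v x -> \sum_(z | v z) (x == z)%:R * g z = g x.
Proof.
move=> vx; rewrite (bigD1 x) //= eqxx mul1r big1 ?addr0 // => z /andP[_ zx].
by rewrite eq_sym (negbTE zx) mul0r.
Qed.

(* The weight is [q I + J - R], where [J] is the all-ones matrix and [R] the
   matrix of the relation "same class", so that J^2 = q^2 J, JR = RJ = qJ and
   R^2 = qR. *)
Lemma walks_class k x y : v x -> v y -> walks class_weight k.+1 x y =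
  q%:R ^+ (2 * k) - q%:R ^+ k * (r x == r y)%:R + q%:R ^+ k.+1 * (x == y)%:R.
Proof.
elim: k x y => [|k IH] x y vx vy.
  rewrite /= (bigD1 y) //= eqxx mulr1 big1 => [|z /negbTE ->]; last by rewrite mulr0.
  by rewrite /class_weight vx vy mul1r muln0 !expr0 expr1; ring.
rewrite -[LHS]/(\sum_z class_weight x z * walks class_weight k.+1 z y).
move: (walks class_weight k.+1) IH => W IH.
rewrite (bigID v) /= [X in _ + X]big1 ?addr0; last first.
  by move=> z /negbTE vz; rewrite /class_weight vz andbF !mul0r.
pose A : rat := q%:R ^+ (2 * k); pose B : rat := q%:R ^+ k; pose D : rat := q%:R ^+ k.+1.
transitivity (\sum_(z | v z) (q%:R * ((x == z)%:R * (A - B * (r z == r y)%:R + D * (z == y)%:R))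
   + A * 1 + - B * (r z == r y)%:R + D * ((y == z)%:R * 1)
   + - A * (r z == r x)%:R + B * (r x == r y)%:R * (r z == r x)%:R
   + - D * ((y == z)%:R * (r z == r x)%:R))).
  apply: eq_bigr => z vz; rewrite IH // /class_weight vx vz mul1r -/A -/B -/D.
  rewrite (eq_sym y z) (eq_sym (r x) (r z)).
  have E : (r z == r x)%:R * (r z == r y)%:R = (r x == r y)%:R * (r z == r x)%:R :> rat.
    by case: eqP => [->|]; rewrite ?mul1r ?mulr1 ?mul0r ?mulr0.
  transitivity (q%:R * ((x == z)%:R * (A - B * (r z == r y)%:R + D * (z == y)%:R))
   + A * 1 + - B * (r z == r y)%:R + D * ((z == y)%:R * 1)
   + - A * (r z == r x)%:R + B * ((r z == r x)%:R * (r z == r y)%:R)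
   + - D * ((z == y)%:R * (r z == r x)%:R)); first by ring.
  by rewrite E; ring.
rewrite !big_split /= -!mulr_sumr !(se (fun=> 1)) // !se // !sc // s1 (eq_sym (r y)).
have E : (2 * k.+1 = 2 * k + 2)%N by lia.
by rewrite E exprD (exprS _ k.+1) /A /B /D (exprS _ k); ring.
Qed.

Lemma trace_class k : \sum_x walks class_weight k.+1 x x =
  q%:R ^+ 2 * (q%:R ^+ (2 * k) - q%:R ^+ k + q%:R ^+ k.+1).
Proof.
rewrite (bigID v) /= [X in _ + X]big1 ?addr0; last first.
  by move=> x /negbTE vx; apply: big1 => z _; rewrite /class_weight vx !mul0r.
rewrite -[LHS]/(\sum_(x | v x) walks class_weight k.+1 x x).
under eq_bigr => x vx do rewrite walks_class // !eqxx !mulr1.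
by rewrite sumr_const -cardsE card_v -[LHS]mulr_natl natrX.
Qed.

End Trace.

Section TraceId.
Variables (T : finType) (v : pred T).

Definition id_weight (x y : T) : rat := (v x && v y)%:R * (x == y)%:R.

Lemma trace_id k : \sum_x walks id_weight k.+1 x x = #|[set x | v x]|%:R.
Proof.
rewrite -sum1_card natr_sum [RHS]big_mkcond /=; apply: eq_bigr => x _.
rewrite inE; elim: k => [|k IH].
  rewrite /= (bigD1 x) //= eqxx mulr1 big1 => [|z /negbTE ->]; last by rewrite mulr0.
  by rewrite /id_weight eqxx andbb; case: (v x); rewrite /= ?mulr1 addr0.
have step W : W x x = (if v x then 1 else 0) ->
    \sum_z id_weight x z * W z x = (if v x then 1 else 0) :> rat.
  move=> Wx; rewrite (bigD1 x) //= [X in _ + X]big1 ?addr0; last first.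
    by move=> z zx; rewrite /id_weight eq_sym (negbTE zx) mulr0 mul0r.
  by rewrite Wx /id_weight eqxx andbb; case: (v x); rewrite ?mulr1 ?mul0r.
exact: step IH.
Qed.

End TraceId.

(** * Flags in prescribed relative positions *)

Section Flags.
Variable F : finFieldType.
Local Notation q := #|F|.
Local Notation sub := {vspace 'rV[F]_3}.
Implicit Types (f N S E O : flag F) (P l : sub).

Definition pt f : sub := (val f).1.
Definition ln f : sub := (val f).2.
Lemma pt1 f : \dim (pt f) = 1%N. Proof. by have := valP f; rewrite /is_flag => /and3P[/eqP h _ _]. Qed.
Lemma ln2 f : \dim (ln f) = 2. Proof. by have := valP f; rewrite /is_flag => /and3P[_ /eqP h _]. Qed.
Lemma pt_ln f : (pt f <= ln f)%VS. Proof. by have := valP f; rewrite /is_flag => /and3P[]. Qed.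
Lemma flag_eq f f' : pt f = pt f' -> ln f = ln f' -> f = f'.
Proof.
by move=> h1 h2; apply/val_inj; rewrite [LHS]surjective_pairing [RHS]surjective_pairing;
  congr pair.
Qed.
Lemma flag_ex P l : \dim P = 1%N -> \dim l = 2 -> (P <= l)%VS -> exists f, pt f = P /\ ln f = l.
Proof.
move=> p1 l2 Pl; have h : is_flag (P, l) by rewrite /is_flag /= p1 l2 Pl.
by exists (exist _ (P, l) h).
Qed.

(** The condition on two regions separated by a doubled edge. The bigon between them has to carry
    the point of [f] and the line of [f'], and must differ from [f] in the line and from [f'] in the
    point. *)
Definition transverse f f' := [&& (pt f <= ln f')%VS, pt f != pt f' & ln f != ln f'].

Lemma card_flags (A : {set sub}) (B : sub -> {set sub}) m :
  (forall P, P \in A -> \dim P = 1%N) ->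
  (forall P l, P \in A -> l \in B P -> \dim l = 2 /\ (P <= l)%VS) ->
  (forall P, P \in A -> #|B P| = m) ->
  #|[set f | (pt f \in A) && (ln f \in B (pt f))]| = (#|A| * m)%N.
Proof.
move=> hA hB hm; rewrite -(card_imset _ val_inj).
have -> : [set val x | x in [set f | (pt f \in A) && (ln f \in B (pt f))]] =
    [set x : sub * sub | (x.1 \in A) && (x.2 \in B x.1)].
  apply/setP => -[P l]; apply/imsetP/idP => [[f]|]; rewrite inE /=.
    move=> /andP[h1 h2] E; have [-> ->] : P = pt f /\ l = ln f.
      by split; [exact: (congr1 fst E)|exact: (congr1 snd E)].
    by rewrite inE /= h1 h2.
  move=> /andP[h1 h2]; have [l2 Pl] := hB _ _ h1 h2.
  have [f [fP fl]] := flag_ex (hA _ h1) l2 Pl.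
  exists f; first by rewrite inE fP fl h1 h2.
  by rewrite -fP -fl; exact/esym/surjective_pairing.
rewrite -sum1_card (eq_bigl (fun x : sub * sub => (x.1 \in A) && (x.2 \in B x.1))); last first.
  by move=> x; rewrite inE.
rewrite -(pair_big_dep (mem A) (fun P l => l \in B P) (fun _ _ => 1%N)) /=.
rewrite -sum_nat_const; apply: eq_bigr => P PA; by rewrite sum1_card hm.
Qed.

Lemma card_flag : #|{: flag F}| = ((q ^ 2 + q + 1) * q.+1)%N.
Proof.
rewrite -cardsT -card_plane -(@card_flags (points fullv) (@pencil F)).
- by apply: eq_card => f; rewrite !inE pt1 ln2 subvf pt_ln.
- by move=> P; rewrite inE => /andP[/eqP].
- by move=> P l _; rewrite inE => /andP[/eqP].
- by move=> P; rewrite inE => /andP[/eqP p1 _]; exact: card_pencil.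
Qed.

Section TwoFlags.
Variables N S : flag F.
Local Notation a := (pt N).
Local Notation L := (ln N).
Local Notation a' := (pt S).
Local Notation L' := (ln S).

(** [N] and [S] are the flags at the poles, [O] and [O'] those at two consecutive squares of odd
    position, and [E] is that at the square between them. *)
Definition odd_ok O := transverse N O && transverse S O.
Definition even_ok O O' E :=
  [&& transverse E N, transverse E S, transverse O E & transverse O' E].
Definition transfer O O' : rat := (odd_ok O && odd_ok O')%:R * #|[set E | even_ok O O' E]|%:R.

Definition opposite := ~~ (a <= L')%VS && ~~ (a' <= L)%VS.

(** The line of [O] passes through both polar points and the point of [E] lies on both polar lines.
    If the polar flags are neither equal nor opposite, this forces one of the forbidden equalities
    with a polar flag. *)
Lemma transfer_zero O O' : N != S -> ~~ opposite -> transfer O O' = 0.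
Proof.
move=> NS nop; rewrite /transfer.
have [|] := boolP (odd_ok O && odd_ok O'); last by rewrite mul0r.
move=> /andP[/andP[/and3P[h1 h2 h3] /and3P[g1 g2 g3]] _].
suff -> : [set E | even_ok O O' E] = finset.set0 by rewrite cards0 mulr0.
apply/setP => E; rewrite !inE; apply/negP => /and4P[/and3P[e1 e2 e3] /and3P[i1 i2 i3] _ _].
have aa : a != a'.
  apply: contra_neq (NS) => aE; apply: flag_eq => //; apply/eqP/negPn/negP => LL.
  have := meetE (pt1 E) (ln2 N) (ln2 S) LL e1 i1.
  have aL' : (a <= L')%VS by rewrite aE pt_ln.
  by rewrite -(meetE (pt1 N) (ln2 N) (ln2 S) LL (pt_ln N) aL') => h; rewrite h eqxx in e2.
have LL : L != L'.
  apply: contraNneq h3 => LE; have aL : (a' <= L)%VS by rewrite LE pt_ln.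
  by rewrite (joinE (pt1 N) (pt1 S) aa (ln2 N) (pt_ln N) aL)
    (joinE (pt1 N) (pt1 S) aa (ln2 O) h1 g1).
have eE := meetE (pt1 E) (ln2 N) (ln2 S) LL e1 i1.
move: nop; rewrite negb_and !negbK => /orP[h|h].
  by move: e2; rewrite eE -(meetE (pt1 N) (ln2 N) (ln2 S) LL (pt_ln N) h) eqxx.
by move: i2; rewrite eE -(meetE (pt1 S) (ln2 N) (ln2 S) LL h (pt_ln S)) eqxx.
Qed.

Hypothesis op : opposite.
Let aL' : ~~ (a <= L')%VS. Proof. by case/andP: op. Qed.
Let aL : ~~ (a' <= L)%VS. Proof. by case/andP: op. Qed.
Let aa : a != a'. Proof. by apply: contraNneq aL => <-; exact: pt_ln. Qed.
Let LL : L != L'. Proof. by apply: contraNneq aL => ->; exact: pt_ln. Qed.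
Local Notation r := (a + a')%VS.
Local Notation e := (L :&: L')%VS.
Let r2 : \dim r = 2. Proof. exact: join_dim (pt1 N) (pt1 S) aa. Qed.
Let e1 : \dim e = 1%N. Proof. exact: meet_dim (ln2 N) (ln2 S) LL. Qed.
Let er : ~~ (e <= r)%VS.
Proof.
apply/negP => h; have ea : a != e by apply: contraNneq aL' => ->; exact: capvSr.
case/negP: aL; rewrite (joinE (pt1 N) e1 ea (ln2 N) (pt_ln N) (capvSl _ _)).
by rewrite -(joinE (pt1 N) e1 ea r2 (addvSl _ _) h) addvSr.
Qed.

Let odd_ln O : odd_ok O -> ln O = r.
Proof. by move=> /andP[/and3P[h1 _ _] /and3P[g1 _ _]]; exact: joinE (pt1 N) (pt1 S) aa (ln2 O) h1 g1. Qed.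

(** All odd flags have the line [r], and all even ones the point [e], which is off [r]. So [E] joins
    [e] to the point of [O]; if [O'] had another point, the line of [E] would have to be [r], which
    is forbidden. *)
Lemma transfer_opposite O O' : transfer O O' = id_weight odd_ok O O'.
Proof.
rewrite /transfer /id_weight; have [|] := boolP (odd_ok O && odd_ok O'); last by rewrite !mul0r.
move=> /andP[gO gO']; rewrite !mul1r; congr (_%:R).
have rO := odd_ln gO; have rO' := odd_ln gO'.
have sub1 E : even_ok O O' E -> pt E = e.
  by move=> /and4P[/and3P[h _ _] /and3P[g _ _] _ _]; exact: meetE (pt1 E) (ln2 N) (ln2 S) LL h g.
have [OE|OO] := eqVneq O O'; last first.
  apply/eqP; rewrite cards_eq0; apply/eqP/setP => E; rewrite !inE; apply/negP => /and4P[_ _].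
  move=> /and3P[h1 _ h3] /and3P[g1 _ _]; have oo : pt O != pt O'.
    by apply: contra_neq OO => h; apply: flag_eq; rewrite // rO rO'.
  case/negP: h3; apply/eqP; rewrite (joinE (pt1 O) (pt1 O') oo (ln2 E) h1 g1).
  by apply: joinE (pt1 O) (pt1 O') oo (ln2 O) (pt_ln O) _; rewrite rO -rO' pt_ln.
subst O'; have /andP[/and3P[h1 h2 h3] /and3P[g1 g2 g3]] := gO.
have or : (pt O <= r)%VS by rewrite -rO pt_ln.
have eo : e != pt O by apply: contraNneq er => ->.
have m2 := join_dim e1 (pt1 O) eo.
have [E0 [pE lE]] := flag_ex e1 m2 (addvSl _ _).
apply/eqP/cards1P; exists E0; apply/setP => E; rewrite !inE; apply/idP/eqP => [h|->].
  apply: flag_eq; rewrite ?pE ?lE; first exact: sub1.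
  have h' := h; move: h' => /and4P[_ _ /and3P[g _ _] _].
  by apply: joinE e1 (pt1 O) eo (ln2 E) _ g; rewrite -(sub1 E h) pt_ln.
have side f : (e <= ln f)%VS -> (pt f <= r)%VS -> pt f != pt O -> r != ln f -> ln E0 != ln f.
  move=> s1 s2 s3 s4; rewrite lE; apply: contra_neq s4 => h.
  have s5 : (pt O <= ln f)%VS by rewrite -h addvSr.
  rewrite (joinE (pt1 f) (pt1 O) s3 (ln2 f) (pt_ln f) s5).
  exact: joinE (pt1 f) (pt1 O) s3 r2 s2 or.
have tO : transverse O E0.
  rewrite /transverse pE lE addvSr eq_sym eo rO /=; apply: contraNneq er => ->; exact: addvSl.
rewrite /even_ok tO /transverse pE capvSl capvSr /=; apply/and3P; split=> //; last first.
  apply/andP; split; first by apply: contraNneq aL => h; rewrite -h; exact: capvSl.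
  apply: side => //; [exact: capvSr|exact: addvSr|].
  by apply: contraNneq aL' => <-; exact: addvSl.
apply/andP; split; first by apply: contraNneq aL' => h; rewrite -h; exact: capvSr.
apply: side => //; [exact: capvSl|exact: addvSl|].
by apply: contraNneq aL => <-; exact: addvSr.
Qed.

Lemma card_odd_opposite : #|[set O | odd_ok O]| = q.-1.
Proof.
have cl := card_line r2.
have -> : q.-1 = (#|points r :\ a :\ a'| * 1)%N.
  have h1 : a \in points r by rewrite inE pt1 addvSl.
  have h2 : a' \in points r :\ a by rewrite !inE pt1 addvSr eq_sym aa.
  by rewrite muln1; have := cardsD1 a (points r); rewrite cl h1 (cardsD1 a') h2 => -[->].
rewrite -(@card_flags _ (fun=> [set r])).
- apply: eq_card => O; rewrite !inE pt1 /=; apply/idP/idP.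
    move=> gO; have rO := odd_ln gO; move: gO => /andP[/and3P[h1 h2 h3] /and3P[g1 g2 g3]].
    by rewrite rO eqxx -rO pt_ln !(eq_sym (pt O)) h2 g2.
  move=> /andP[/and3P[g2 h2 _] /eqP rO].
  rewrite /odd_ok /transverse rO addvSl addvSr !(eq_sym _ (pt O)) h2 g2 /=; apply/andP; split.
    by apply: contraNneq aL => ->; exact: addvSr.
  by apply: contraNneq aL' => ->; exact: addvSl.
- by move=> P; rewrite !inE => /and3P[_ _ /andP[/eqP]].
- by move=> P l; rewrite !inE => /and3P[_ _ /andP[_ h]] /eqP ->.
- by move=> P _; rewrite cards1.
Qed.

End TwoFlags.

(** There are q^2 points off the line of [N], and through each of them q lines that avoid the point
    of [N]. *)
Lemma card_opposite N : #|[set S | opposite N S]| = (q ^ 3)%N.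
Proof.
rewrite expnSr -(off_line (ln2 N)) -(@card_flags _ (fun P => pencil P :\ (pt N + P)%VS)).
- apply: eq_card => S; rewrite inE; have [h|h] := boolP (pt S <= ln N)%VS.
    by rewrite /opposite h andbF !inE pt1 h.
  rewrite /opposite h !inE pt1 (negbTE h) ln2 subvf pt_ln /= !andbT.
  congr (~~ _); have aa : pt N != pt S by apply: contraNneq h => <-; exact: pt_ln.
  apply/idP/eqP => [g|->]; last exact: addvSl.
  exact: joinE (pt1 N) (pt1 S) aa (ln2 S) g (pt_ln S).
- by move=> P; rewrite !inE => /andP[_ /andP[/eqP]].
- by move=> P l _; rewrite !inE => /andP[_ /andP[/eqP]].
move=> P; rewrite !inE => /andP[h /andP[/eqP p1 _]]; rewrite p1 /= in h.
have aP : pt N != P by apply: contraNneq h => <-; exact: pt_ln.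
have := cardsD1 (pt N + P)%VS (pencil P); rewrite (card_pencil p1) inE addvSr.
by rewrite (join_dim (pt1 N) p1 aP) /= add1n => -[].
Qed.

Section OneFlag.
Variable N : flag F.
Local Notation a := (pt N).
Local Notation L := (ln N).
Local Notation ok := (odd_ok N N).

Let okE O : ok O = transverse N O. Proof. by rewrite /odd_ok andbb. Qed.
Let off O : transverse N O -> ~~ (pt O <= L)%VS.
Proof.
move=> /and3P[h1 h2 h3]; apply: contra_neqN h3 => h.
rewrite (joinE (pt1 N) (pt1 O) h2 (ln2 N) (pt_ln N) h).
exact/esym/(joinE (pt1 N) (pt1 O) h2 (ln2 O) h1 (pt_ln O)).
Qed.
Let odd_ln O : transverse N O -> ln O = (a + pt O)%VS.
Proof. by move=> /and3P[h1 h2 h3]; exact: joinE (pt1 N) (pt1 O) h2 (ln2 O) h1 (pt_ln O). Qed.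

Lemma card_odd_same : #|[set O | ok O]| = (q ^ 2)%N.
Proof.
rewrite -(off_line (ln2 N)) -[RHS]muln1 -(@card_flags _ (fun P => [set (a + P)%VS])).
- apply: eq_card => O; rewrite !inE pt1 subvf okE /= andbT.
  apply/idP/andP => [h|[h /eqP rO]]; first by rewrite (off h) (odd_ln h).
  rewrite /transverse rO addvSl /=; apply/andP; split; first by apply: contraNneq h => <-; exact: pt_ln.
  by apply: contraNneq h => ->; exact: addvSr.
- by move=> P; rewrite !inE => /andP[_ /andP[/eqP]].
- move=> P l; rewrite !inE => /andP[h /andP[/eqP p1 _]] /eqP ->; rewrite p1 /= in h.
  split; last exact: addvSr.
  by apply: join_dim (pt1 N) p1 _; apply: contraNneq h => <-; exact: pt_ln.
- by move=> P _; rewrite cards1.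
Qed.

Lemma card_odd_class O : ok O -> #|[set O' | ok O' & ln O' == ln O]| = q.
Proof.
rewrite okE => gO; have /and3P[h1 h2 h3] := gO.
have -> : q = (#|points (ln O) :\ a| * 1)%N.
  by have := cardsD1 a (points (ln O)); rewrite (card_line (ln2 O)) inE pt1 h1 muln1 /= add1n => -[].
rewrite -[in RHS](@card_flags _ (fun=> [set ln O])).
- apply: eq_card => O'; rewrite !inE pt1 okE /=; apply/andP/andP => [[g /eqP E]|[/andP[g1 g2] /eqP E]].
    by rewrite E eqxx -E pt_ln; move: g => /and3P[_ g _]; rewrite eq_sym g.
  by rewrite /transverse E h1 h3 eqxx eq_sym g1.
- by move=> P; rewrite !inE => /andP[_ /andP[/eqP]].
- by move=> P l; rewrite !inE => /andP[_ /andP[_ h]] /eqP ->; rewrite ln2.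
- by move=> P _; rewrite cards1.
Qed.

(** An odd flag amounts to a point off [L], its line joining this point to [a]; the classes are
    those lines. For [O = O'], the point of [E] is any of the q points of [L] other than [a]. For
    different odd flags, the line of [E] joins their points and meets [L] in the point of [E]; this
    works unless both points are on one line through [a]. *)
Lemma transfer_same O O' : transfer N N O O' = class_weight ok ln q O O'.
Proof.
rewrite /transfer /class_weight; have [|] := boolP (ok O && ok O'); last by rewrite !mul0r.
rewrite !okE => /andP[gO gO']; rewrite !mul1r.
have rO := odd_ln gO; have rO' := odd_ln gO'.
have oL := off gO; have oL' := off gO'.
have /and3P[h1 h2 h3] := gO; have /and3P[h1' h2' h3'] := gO'.
have good E o : \dim o = 1%N -> pt E != a -> (pt E <= L)%VS -> (o <= ln E)%VS -> ~~ (o <= L)%VS -> transverse E N.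
  move=> o1 e1 e2 e3 e4; rewrite /transverse e2 e1 /=.
  by apply: contraNneq e4 => <-.
have good' E f : transverse N f -> pt E != a -> (pt E <= L)%VS -> (pt f <= ln E)%VS -> transverse f E.
  move=> gf e1 e2 e3; have fL := off gf; have /and3P[f1 f2 f3] := gf.
  rewrite /transverse e3 /=; apply/andP; split; first by apply: contraNneq fL => ->.
  apply: contra_neq f3 => h; have ae : a != pt E by rewrite eq_sym.
  rewrite (joinE (pt1 N) (pt1 E) ae (ln2 N) (pt_ln N) e2).
  by rewrite -(joinE (pt1 N) (pt1 E) ae (ln2 f) f1) // h pt_ln.
have [OE|OO] := eqVneq O O'.
  subst O'; rewrite eqxx mulr1 addrK; congr (_%:R).
  have -> : q = (#|points L :\ a| * 1)%N.
    by have := cardsD1 a (points L); rewrite (card_line (ln2 N)) inE pt1 pt_ln muln1 /= add1n => -[].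
  have eo P : (P <= L)%VS -> P != pt O by move=> h; apply: contraNneq oL => <-.
  rewrite -[in RHS](@card_flags _ (fun P => [set (P + pt O)%VS])).
  - apply: eq_card => E; rewrite !inE pt1 /=; apply/idP/idP.
      move=> /and4P[/and3P[e1 e2 e3] _ /and3P[e4 e5 e6] _]; rewrite e2 e1 /=; apply/eqP.
      exact: joinE (pt1 E) (pt1 O) (eo _ e1) (ln2 E) (pt_ln E) e4.
    move=> /andP[/andP[e1 e2] /eqP e3]; have e4 : (pt O <= ln E)%VS by rewrite e3 addvSr.
    by rewrite /even_ok (good E _ (pt1 O)) // good'.
  - by move=> P; rewrite !inE => /andP[_ /andP[/eqP]].
  - move=> P l; rewrite !inE => /andP[_ /andP[/eqP p1 h]] /eqP ->; split; last exact: addvSl.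
    exact: join_dim p1 (pt1 O) (eo _ h).
  - by move=> P _; rewrite cards1.
rewrite mulr0 add0r.
have oo : ln O = ln O' \/ ln O != ln O' -> pt O != pt O'.
  by move=> _; apply: contra_neq OO => h; apply: flag_eq => //; rewrite rO rO' h.
have {}oo : pt O != pt O' by apply: oo; case: eqP; [left|right].
have [rr|rr] := eqVneq (ln O) (ln O').
  rewrite subrr; apply/eqP; rewrite pnatr_eq0 cards_eq0; apply/eqP/setP => E; rewrite !inE.
  apply/negP => /and4P[_ _ /and3P[e1 _ e3] /and3P[e4 _ _]]; case/negP: e3; apply/eqP.
  rewrite (joinE (pt1 O) (pt1 O') oo (ln2 E) e1 e4).
  by apply: joinE (pt1 O) (pt1 O') oo (ln2 O) (pt_ln O) _; rewrite rr pt_ln.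
rewrite subr0; set m := (pt O + pt O')%VS.
have m2 : \dim m = 2 by exact: join_dim (pt1 O) (pt1 O') oo.
have om : (pt O <= m)%VS by exact: addvSl.
have om' : (pt O' <= m)%VS by exact: addvSr.
have mL : m != L by apply: contraNneq oL => <-.
have am : ~~ (a <= m)%VS.
  apply: contra_neqN rr => h.
  by rewrite rO rO' -(joinE (pt1 N) (pt1 O) h2 m2 h om) -(joinE (pt1 N) (pt1 O') h2' m2 h om').
have e1 := meet_dim m2 (ln2 N) mL.
have [E0 [pE lE]] := flag_ex e1 m2 (capvSl _ _).
have p1 : pt E0 != a by rewrite pE; apply: contraNneq am => <-; exact: capvSl.
have p2 : (pt E0 <= L)%VS by rewrite pE capvSr.
rewrite -[1]/(1%:R); congr (_%:R); apply/eqP/cards1P; exists E0; apply/setP => E; rewrite !inE.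
apply/idP/eqP => [|->].
  move=> /and4P[/and3P[g1 g2 g3] _ /and3P[g4 _ _] /and3P[g5 _ _]].
  have mE : ln E = m by exact: joinE (pt1 O) (pt1 O') oo (ln2 E) g4 g5.
  apply: flag_eq; rewrite ?pE ?lE //.
  by apply: meetE (pt1 E) m2 (ln2 N) mL _ g1; rewrite -mE pt_ln.
have lO : (pt O <= ln E0)%VS by rewrite lE.
have lO' : (pt O' <= ln E0)%VS by rewrite lE.
by rewrite /even_ok (good E0 _ (pt1 O) p1 p2 lO oL) (good' _ _ gO p1 p2 lO) (good' _ _ gO' p1 p2 lO').
Qed.

End OneFlag.

(** For every [N] the flag [S] is either [N] itself, or one of the q^3 opposite flags, or
    contributes 0. *)
Lemma sum_closed_walks m :
  \sum_(NS : flag F * flag F) \sum_O walks (transfer NS.1 NS.2) m.+1 O O =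
  ((q ^ 2 + q + 1) * q.+1)%:R *
    (q%:R ^+ 2 * (q%:R ^+ (2 * m) - q%:R ^+ m + q%:R ^+ m.+1) + q%:R ^+ 3 * (q%:R - 1)).
Proof.
rewrite -card_flag -(pair_bigA _ (fun N S => \sum_O walks (transfer N S) m.+1 O O)) /=.
rewrite -sum1_card natr_sum mulr_suml; apply: eq_bigr => N _; rewrite mul1r.
have ext w w' : w =2 w' -> \sum_(O : flag F) walks w m.+1 O O = \sum_(O : flag F) walks w' m.+1 O O.
  move=> E; apply: eq_bigr => O _; move: {2 4}O => O'; elim: m.+1 O => // k IH O /=.
  by apply: eq_bigr => z _; rewrite E IH.
rewrite (bigD1 N) //=; congr (_ + _).
  rewrite (ext _ _ (transfer_same N)); apply: trace_class; first exact: card_odd_same.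
  by move=> O; exact: card_odd_class.
rewrite (bigID (opposite N)) /= [X in _ + X]big1 ?addr0; last first.
  move=> S /andP[SN nop]; rewrite (ext _ (fun _ _ => 0)).
    by apply: big1 => O _ /=; apply: big1 => z _; rewrite mul0r.
  by move=> O O'; rewrite transfer_zero // eq_sym.
rewrite (eq_bigl (fun S => opposite N S)) => [|S]; last first.
  have [op|] := boolP (opposite N S); rewrite ?andbF // andbT.
  by apply: contraTneq op => ->; rewrite /opposite pt_ln.
rewrite (eq_bigr (fun=> q%:R - 1)) => [|S op]; last first.
  rewrite (ext _ _ (transfer_opposite op)) trace_id card_odd_opposite //.
  by have := q_gt1 F; case: q => // k _; rewrite -natr1 addrK.
by rewrite sumr_const -cardsE card_opposite -[LHS]mulr_natl natrX.
Qed.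

End Flags.

(** * The faces of the prism *)

Section Regions.
Variable n : nat.
Local Notation L := (ladder n).
Local Notation I := 'I_(2 * n).

Lemma half_subproof (i : I) : (i./2 < n)%N.
Proof. by have := ltn_ord i; have := odd_double_half i; rewrite -mul2n; lia. Qed.
Definition half_ord (i : I) : 'I_n := Ordinal (half_subproof i).
Lemma double_subproof (b : bool) (k : 'I_n) : (2 * k + b < 2 * n)%N.
Proof. by have := ltn_ord k; case: b; lia. Qed.
Definition double_ord b k : I := Ordinal (double_subproof b k).

(** The two poles, [true] being the inner one, and the squares, given by the parity of their
    position and its half. *)
Definition region := (bool + bool * 'I_n)%type.
Definition square_region (i : I) : region := inr (odd i, half_ord i).
Definition region_of (d : L) : region := let: (c, i, s) := d in
  match s with
  | None => square_region (if c then ord_pred i else i)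
  | Some true => if c then square_region i else inl false
  | Some false => if c then inl true else square_region (ord_pred i)
  end.
Hypothesis n_gt0 : (0 < n)%N.

Lemma double_half (i : I) : double_ord (odd i) (half_ord i) = i.
Proof. by apply/val_inj; rewrite /= mul2n addnC odd_double_half. Qed.
Lemma odd_double_ord b k : odd (double_ord b k) = b.
Proof. by rewrite /= oddD mul2n odd_double; case: b. Qed.
Lemma half_double b k : half_ord (double_ord b k) = k.
Proof. by apply/val_inj; rewrite /= addnC mul2n half_bit_double. Qed.
Lemma ord_pred_odd k : ord_pred (double_ord true k) = double_ord false k.
Proof. by apply/val_inj; rewrite ord_pred_val //= addn1 addn0. Qed.
Lemma ord_pred_even k : ord_pred (double_ord false k) = double_ord true (ord_pred k).
Proof.
have kn := ltn_ord k; apply/val_inj; rewrite ord_pred_val //= addn0 muln_eq0 /=.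
have [k0|k0] := eqVneq (k : nat) 0%N; first by rewrite k0 add0n modn_small; lia.
have -> : ((k + n).-1 = k.-1 + n)%N by lia.
by rewrite modnDr modn_small; lia.
Qed.

Definition region_dart (r : region) : L := match r with
  | inl true => (true, i0 n_gt0, Some false)
  | inl false => (false, i0 n_gt0, Some true)
  | inr (b, k) => (true, double_ord b k, Some true)
  end.

Lemma region_next d : region_of (face_next d) = region_of d.
Proof. by case: d => [[[] i] [[]|]]; rewrite /region_of /= ?ordSK ?ord_predK. Qed.

Lemma region_connect d : fconnect (@face_next L) d (region_dart (region_of d)).
Proof.
have inj : injective (@face_next L) by move=> x y /rot_inj/(can_inj (@oppK L)).
have sq q r k : (r + k = 3)%N -> fconnect (@face_next L) (square q r) (region_dart (square_region q)).
  move=> rk; rewrite /= double_half -square3 -rk addnC /square iterD; exact: fconnect_iter.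
case: d => [[[] i] [[]|]].
- by rewrite -[X in fconnect _ X]square3; exact: (sq i 3%N 0%N).
- suff -> : region_dart (region_of ((true, i, Some false) : L)) = iter i (@face_next L) (pole_dart i).
    exact: fconnect_iter.
  rewrite iter_pole /=; congr (_, _, _); apply/val_inj.
  by rewrite iter_pred_val //= leqnn subnn.
- by rewrite -[in X in fconnect _ X](ord_predK i); exact: (sq (ord_pred i) 0%N 3%N).
- rewrite fconnect_sym //; move: i; apply: (@ord_walk n n_gt0 (fun i =>
    fconnect (@face_next L) (region_dart (inl false)) ((false, i, Some true) : L))) => [|i h].
    exact: connect0.
  exact: connect_trans h (fconnect1 _ _).
- by rewrite -[in X in fconnect _ X](ord_predK i) -square1; exact: (sq (ord_pred i) 1%N 2%N).
- by rewrite -[X in fconnect _ X]square2; exact: (sq i 2%N 1%N).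
Qed.

End Regions.

(** * Framed flags as configurations on the faces of the prism *)

Section FlagModuliLadder.
Variables (n : nat) (F : finFieldType).
Hypothesis n_gt0 : (0 < n)%N.
Local Notation L := (ladder n).
Local Notation G := (ladder3 n).
Local Notation w := ladder_white.
Local Notation rdart := (region_dart n_gt0).

(** Of the two copies of [d], this one has on its right the region on the right of [d], and
    [bigon_side] has the bigon. *)
Definition region_side (d : L) : G := (d, ~~ w d).
Definition bigon_side (d : L) : G := (d, w d).

Let wo (d : L) : w (opp d) = ~~ w d. Proof. exact: ladder_white_opp. Qed.
Let wr (d : L) : w (rot d) = w d. Proof. exact: ladder_white_rot. Qed.

Lemma region_side_next d : face_next (region_side d) = region_side (face_next d).
Proof.
rewrite /region_side /face_next wr wo /= /double_opp /= /double_rot /= wo eqxx.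
by rewrite negbK.
Qed.

Lemma bigon_side_next d : face_next (bigon_side d) = bigon_side (opp d).
Proof.
rewrite /bigon_side /face_next wo /= /double_opp /= /double_rot /= wo.
by case: (w d).
Qed.

Let face_inj : injective (@face_next G).
Proof. by move=> x y /rot_inj/(can_inj (@oppK G)). Qed.

Lemma right_face_connect (x y : G) : fconnect (@face_next G) x y -> right_face x = right_face y.
Proof.
move=> h; apply/val_inj/setP => z; rewrite !inE.
exact: (same_connect (fconnect_sym face_inj) h).
Qed.

Lemma right_face_eq (x y : G) : right_face x = right_face y -> fconnect (@face_next G) x y.
Proof.
move=> /(congr1 val) E; have : y \in face_set y by rewrite inE connect0.
by rewrite -[face_set y]E inE.
Qed.

Lemma right_face_ex (A : face G) : exists x, right_face x = A.
Proof. by have /imsetP[x _ E] := valP A; exists x; apply/val_inj. Qed.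

Lemma right_face_region d : right_face (region_side d) = right_face (region_side (rdart (region_of d))).
Proof.
rewrite -(iter_findex (region_connect n_gt0 d)); elim: (findex _ _ _) => //= k ->.
by rewrite -region_side_next; apply: right_face_connect; exact: fconnect1.
Qed.

Lemma right_face_bigon d : right_face (bigon_side (opp d)) = right_face (bigon_side d).
Proof. by rewrite -bigon_side_next; apply/esym/right_face_connect; exact: fconnect1. Qed.

Lemma left_region d : left_face (region_side d) = right_face (bigon_side (opp d)).
Proof. by rewrite /left_face /bigon_side wo. Qed.
Lemma left_bigon d : left_face (bigon_side d) = right_face (region_side (opp d)).
Proof. by rewrite /left_face /region_side wo negbK. Qed.

Implicit Type phi : {ffun face G -> flag F}.
Definition region_flag phi d := phi (right_face (region_side d)).
Definition bigon_flag phi d := phi (right_face (bigon_side d)).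

(** Of the two copies of an edge, one requires the bigon and a region to differ in the point alone,
    the other requires the bigon and the other region to differ in the line alone. So the bigon is
    determined by its two neighbours. *)
Lemma framedP phi : reflect (forall d : L, w d ->
    [/\ pt (bigon_flag phi d) = pt (region_flag phi d),
        ln (bigon_flag phi d) = ln (region_flag phi (opp d)),
        pt (region_flag phi d) != pt (region_flag phi (opp d)) &
        ln (region_flag phi d) != ln (region_flag phi (opp d))])
  (framed_flag_moduli phi).
Proof.
rewrite /framed_flag_moduli; apply: (iffP forallP) => h.
  move=> d wd; have := h (bigon_side d); rewrite left_bigon /= wd.
  have := h (bigon_side (opp d)); rewrite left_bigon oppK right_face_bigon /= wo wd /=.
  rewrite -/(region_flag phi d) -/(region_flag phi (opp d)) -/(bigon_flag phi d).
  move=> /andP[/eqP e1 e2] /andP[e3 /eqP e4]; split.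
  - exact: esym e1.
  - exact: esym e4.
  - by apply: contra_neq e3 => E; exact: etrans (esym E) e1.
  - by apply: contra_neq e2 => E; exact: etrans E e4.
have main (d : L) : (if w d then differ1 (region_flag phi (opp d)) (bigon_flag phi d)
    else differ2 (region_flag phi (opp d)) (bigon_flag phi d)) /\
   (if w d then differ1 (bigon_flag phi d) (region_flag phi (opp d))
    else differ2 (bigon_flag phi d) (region_flag phi (opp d))).
  have sym1 (f g : flag F) : differ1 f g = differ1 g f.
    by rewrite /differ1 (eq_sym (val f).1) (eq_sym (val f).2).
  have sym2 (f g : flag F) : differ2 f g = differ2 g f.
    by rewrite /differ2 (eq_sym (val f).1) (eq_sym (val f).2).
  rewrite (sym1 (bigon_flag phi d)) (sym2 (bigon_flag phi d)).
  case: ifP => wd.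
    have [e1 e2 e3 e4] := h d wd; suff -> : differ1 (region_flag phi (opp d)) (bigon_flag phi d) by [].
    by rewrite /differ1 -!/(pt _) -!/(ln _) e1 e2 eqxx andbT eq_sym.
  have wd' : w (opp d) by rewrite wo wd.
  have [] := h (opp d) wd'; rewrite oppK {1 2}/bigon_flag right_face_bigon -/(bigon_flag phi d).
  move=> e1 e2 e3 e4; suff -> : differ2 (region_flag phi (opp d)) (bigon_flag phi d) by [].
  by rewrite /differ2 -!/(pt _) -!/(ln _) e1 e2 eqxx.
move=> [d b]; have [E|E] := eqVneq b (w d).
  by rewrite E -/(bigon_side d) left_bigon; case: (main d).
have -> : b = ~~ w d by case: b (w d) E => [] [].
rewrite -/(region_side d) left_region /=; have [_] := main (opp d).
by rewrite oppK wo /bigon_flag /region_flag; case: (w d).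
Qed.

Local Notation conf := {ffun region n -> flag F}.
Implicit Type t : conf.
Definition good t := [forall d : L, w d ==> transverse (t (region_of d)) (t (region_of (opp d)))].
Definition conf_of phi : conf := [ffun r => region_flag phi (rdart r)].

Lemma conf_ofE phi d : conf_of phi (region_of d) = region_flag phi d.
Proof. by rewrite ffunE /region_flag -right_face_region. Qed.

Lemma conf_of_good phi : framed_flag_moduli phi -> good (conf_of phi).
Proof.
move=> /framedP h; apply/forallP => d; apply/implyP => wd; rewrite !conf_ofE.
have [e1 e2 e3 e4] := h d wd; rewrite /transverse e3 e4 -e1 -e2 pt_ln //.
Qed.

Lemma conf_of_inj : {in @framed_flag_moduli G F &, injective conf_of}.
Proof.
move=> phi psi /framedP h /framedP h' E.
have RE (d : L) : region_flag phi d = region_flag psi d by rewrite -!conf_ofE E.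
have BE (d : L) : w d -> bigon_flag phi d = bigon_flag psi d.
  move=> wd; have [e1 e2 _ _] := h d wd; have [e1' e2' _ _] := h' d wd.
  by apply: flag_eq; rewrite ?e1 ?e2 ?e1' ?e2' RE.
apply/ffunP => A; have [[d b] <-] := right_face_ex A.
have [Eb|Eb] := eqVneq b (w d); last first.
  have -> : b = ~~ w d by case: b (w d) Eb => [] [].
  exact: RE.
rewrite Eb -/(bigon_side d); have [wd|wd] := boolP (w d); first exact: BE.
by rewrite -right_face_bigon; apply: BE; rewrite wo.
Qed.

Lemma conf_of_onto t : good t -> exists2 phi, framed_flag_moduli phi & conf_of phi = t.
Proof.
move=> /forallP gt.
(* At a black dart the value is a default; [g] below evaluates [mid] at white darts only. *)
have mid_ex (d : L) : exists f, w d -> pt f = pt (t (region_of d)) /\ ln f = ln (t (region_of (opp d))).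
  have [wd|_] := boolP (w d); last by exists (t (inl true)).
  have /implyP/(_ wd)/and3P[h _ _] := gt d.
  by have [f fP] := flag_ex (pt1 _) (ln2 _) h; exists f.
have [mid midP] := boolp.choice mid_ex.
pose g (x : G) : flag F := if x.2 == w x.1 then mid (if w x.1 then x.1 else opp x.1) else t (region_of x.1).
have gN x : g (face_next x) = g x.
  case: x => d b; have [E|E] := eqVneq b (w d).
    rewrite E -/(bigon_side d) bigon_side_next /g /= !eqxx wo.
    by case: (w d) => //=; congr mid; exact: (@oppK L d).
  have -> : b = ~~ w d by case: b (w d) E => [] [].
  rewrite -/(region_side d) region_side_next /g /= region_next.
  by case: (w (face_next d)); case: (w d).
have gC x y : fconnect (@face_next G) x y -> g x = g y.
  by move=> h; rewrite -(iter_findex h); elim: (findex _ _ _) => //= k ->; rewrite gN.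
pose phi : {ffun face G -> flag F} :=
  [ffun A => if [pick x | right_face x == A] is Some x then g x else t (inl true)].
have phiE x : phi (right_face x) = g x.
  rewrite ffunE; case: pickP => [y /eqP/right_face_eq/gC //|/(_ x)]; by rewrite eqxx.
have RE (d : L) : region_flag phi d = t (region_of d).
  by rewrite /region_flag phiE /g /=; case: (w d).
exists phi; last first.
  apply/ffunP => r; rewrite ffunE RE; congr (t _).
  case: r => [[]|[b k]] //=; by rewrite /square_region odd_double_ord half_double.
apply/framedP => d wd; rewrite !RE /bigon_flag phiE /g /= eqxx wd.
have [-> ->] := midP d wd; have /implyP/(_ wd)/and3P[_ e3 e4] := gt d; by split.
Qed.

Lemma card_framed : #|framed_flag_moduli (G := G) (k := F)| = #|[set t | good t]|.
Proof.
rewrite -(card_in_imset conf_of_inj); apply: eq_card => t; rewrite inE; apply/imsetP/idP.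
  by move=> [phi h ->]; exact: conf_of_good.
by move=> /conf_of_onto[phi h <-]; exists phi.
Qed.

(** The edges are grouped around the even square of index k, whose neighbours in the ring are the
    odd squares of index [ord_pred k] and k. The conditions on odd flags are repeated, which gives
    each k the shape of one entry of [transfer]. *)
Lemma goodE t : good t = [forall k : 'I_n,
  [&& odd_ok (t (inl true)) (t (inl false)) (t (inr (true, ord_pred k))),
      odd_ok (t (inl true)) (t (inl false)) (t (inr (true, k))) &
      even_ok (t (inl true)) (t (inl false)) (t (inr (true, ord_pred k))) (t (inr (true, k)))
        (t (inr (false, k)))]].
Proof.
have sd b k : square_region (double_ord b k) = inr (b, k).
  by rewrite /square_region odd_double_ord half_double.
pose P d := transverse (t (region_of d)) (t (region_of (opp d))).
have c1 k : P (true, double_ord false k, None) =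
    transverse (t (inr (true, ord_pred k))) (t (inr (false, k))).
  by rewrite /P /region_of /= ord_pred_even // !sd.
have c2 k : P (true, double_ord false k, Some true) = transverse (t (inr (false, k))) (t (inl true)).
  by rewrite /P /region_of /= !sd.
have c3 k : P (true, double_ord false k, Some false) =
    transverse (t (inl true)) (t (inr (true, ord_pred k))).
  by rewrite /P /region_of /= ord_pred_even // !sd.
have c4 k : P (false, double_ord true k, None) = transverse (t (inr (true, k))) (t (inr (false, k))).
  by rewrite /P /region_of /= ord_pred_odd // !sd.
have c5 k : P (false, double_ord true k, Some true) = transverse (t (inl false)) (t (inr (true, k))).
  by rewrite /P /region_of /= ordSK !sd.
have c6 k : P (false, double_ord true k, Some false) = transverse (t (inr (false, k))) (t (inl false)).
  by rewrite /P /region_of /= ord_pred_odd // !sd.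
apply/forallP/forallP => [h k|h [[c i] s]].
  have hP (d : L) : w d -> P d by exact/implyP/h.
  have w1 (s : option bool) (k' : 'I_n) : w ((true, double_ord false k', s) : L) by rewrite /w odd_double_ord.
  have w0 (s : option bool) (k' : 'I_n) : w ((false, double_ord true k', s) : L) by rewrite /w odd_double_ord.
  have p3 : P (true, double_ord false (ordS k), Some false) by apply: hP; exact: w1.
  rewrite c3 ordSK in p3.
  rewrite /odd_ok /even_ok -c1 -c2 -c3 -c4 -!c5 -c6 p3 !hP //.
rewrite -/(P _); apply/implyP => wd; rewrite -(double_half i) in wd *.
move: (half_ord i) (odd i) wd => k b; rewrite /w /= odd_double_ord.
have /and3P[/andP[a1 a2] /andP[b1 b2] /and4P[e1 e2 e3 e4]] := h k.
by case: c; case: b => // _; case: s => [[]|]; rewrite ?c1 ?c2 ?c3 ?c4 ?c5 ?c6.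
Qed.

End FlagModuliLadder.

(** For given polar and odd flags the even ones are chosen independently, so the sum over them
    distributes into a product of entries of [transfer], the weight of a closed walk through the odd
    flags. *)
Lemma count_framed (m : nat) (F : finFieldType) :
  #|framed_flag_moduli (G := ladder3 m.+1) (k := F)|%:R =
  \sum_(NS : flag F * flag F) \sum_O walks (transfer NS.1 NS.2) m.+1 O O :> rat.
Proof.
rewrite (card_framed F (ltn0Sn m)) -sum1_card natr_sum big_mkcond /=.
pose C := (flag F * flag F * ({ffun 'I_m.+1 -> flag F} * {ffun 'I_m.+1 -> flag F}))%type.
pose u (x : C) : {ffun region m.+1 -> flag F} := [ffun r => match r with
  | inl b => if b then x.1.1 else x.1.2
  | inr (b, k) => if b then x.2.1 k else x.2.2 k end].
rewrite (reindex u) /=; last first.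
  exists (fun t => ((t (inl true), t (inl false)),
     ([ffun k => t (inr (true, k))], [ffun k => t (inr (false, k))]))).
    move=> [[N S] [U W]] _; congr (_, _, (_, _)); rewrite ?ffunE //.
      by apply/ffunP => k; rewrite !ffunE.
    by apply/ffunP => k; rewrite !ffunE.
  by move=> t _; apply/ffunP => -[[]|[[] k]]; rewrite !ffunE.
rewrite -(pair_bigA _ (fun NS OE => if u (NS, OE) \in [set t | good t] then 1%:R else 0)) /=.
apply: eq_bigr => -[N S] _ /=; rewrite closed_walks.
rewrite -(pair_bigA _ (fun O E => if u (N, S, (O, E)) \in [set t | good t] then 1%:R else 0)) /=.
apply: eq_bigr => O _.
transitivity (\sum_(E : {ffun 'I_m.+1 -> flag F}) \prod_(k < m.+1)
   ([&& odd_ok N S (O (ord_pred k)), odd_ok N S (O k) & even_ok N S (O (ord_pred k)) (O k) (E k)])%:R : rat).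
  apply: eq_bigr => E _; rewrite inE goodE // !ffunE /=.
  case: ifPn => [/forallP h|/forallPn[k hk]].
    by rewrite big1 // => k _; have := h k; rewrite !ffunE => ->.
  by rewrite (bigD1 k) //=; move: hk; rewrite !ffunE => /negbTE ->; rewrite mul0r.
rewrite -(bigA_distr_bigA (fun k e => ([&& odd_ok N S (O (ord_pred k)), odd_ok N S (O k) &
  even_ok N S (O (ord_pred k)) (O k) e])%:R : rat)).
apply: eq_bigr => k _; rewrite /transfer -sum1_card natr_sum mulr_sumr [RHS]big_mkcond /=.
apply: eq_bigr => e _; rewrite inE; case: (odd_ok _ _ _); case: (odd_ok _ _ _) => /=; case: even_ok; rewrite ?mul1r ?mul0r //.
Qed.

(** * The order of the projective linear group *)

Section ProjectiveGroup.
Variable F : finFieldType.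
Local Notation q := #|F|.
Local Notation GL := ('GL_3[F])%g.

Lemma elementary_unit (i j : 'I_3) : i != j -> (1%:M + delta_mx i j : 'M[F]_3) \in unitmx.
Proof.
move=> ij; have /mulmx1_unit[] // : (1%:M + delta_mx i j : 'M[F]_3) *m (1%:M - delta_mx i j) = 1%:M.
rewrite mulmxBr mulmx1 mulmxDl mul1mx mul_delta_mx_0 ?(eq_sym j) //.
by rewrite addr0 addrK.
Qed.

Lemma scalar_commute (A : 'M[F]_3) :
  (forall i j, i != j -> A *m delta_mx i j = delta_mx i j *m A) -> A = (A 0 0)%:M.
Proof.
move=> h.
have e (i j k l : 'I_3) : i != j -> A k i * (l == j)%:R = (k == i)%:R * A j l.
  move=> ij; have := congr1 (fun M : 'M[F]_3 => M k l) (h i j ij).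
  rewrite !mxE (bigD1 i) //= big1 => [|z zi]; last by rewrite !mxE (negbTE zi) mulr0.
  rewrite (bigD1 j) //= big1 => [|z zj]; last by rewrite !mxE (negbTE zj) andbF mul0r.
  by rewrite !mxE !eqxx !addr0 andbT.
have diag (i j : 'I_3) : A i i = A j j.
  have [->//|ij] := eqVneq i j.
  by have := e i j i j ij; rewrite !eqxx mulr1 mul1r.
have off (k i : 'I_3) : k != i -> A k i = 0.
  by move=> ki; rewrite eq_sym in ki; have := e i k k k ki; rewrite eqxx (eq_sym k) (negbTE ki) mulr1 mul0r.
apply/matrixP => k i; rewrite mxE; have [->|ki] := eqVneq k i; first by rewrite mulr1n (diag i 0).
by rewrite mulr0n off.
Qed.

(** A central element commutes with the invertible matrices [1%:M + delta_mx i j], hence with the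
    elementary ones. *)
Lemma center_scalar (x : {'GL_3[F]}) : x \in 'Z(GL)%g = (GLval x == (GLval x 0 0)%:M).
Proof.
apply/idP/eqP => [|E].
  rewrite inE => /andP[_ /centP cx]; apply: scalar_commute => i j ij.
  pose u : {'GL_3[F]} := FinRing.Unit (elementary_unit ij : (_ : 'M[F]_3.-1.+1) \is a GRing.unit).
  have uE : GLval u = 1%:M + delta_mx i j by [].
  have E : GLval x *m (1%:M + delta_mx i j) = (1%:M + delta_mx i j) *m GLval x.
    exact: (congr1 (@GLval _ _) (cx u (finset.in_setT _) : (x * u = u * x)%g)).
  by move: E; rewrite mulmxDr mulmxDl mulmx1 mul1mx => /addrI.
rewrite inE finset.in_setT /=; apply/centP => y _; apply/val_inj.
have h : GLval x *m GLval y = GLval y *m GLval x by rewrite E scalar_mxC.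
exact: h.
Qed.

Lemma card_center : #|'Z(GL)%g| = q.-1.
Proof.
rewrite -(@card_in_imset _ _ (fun x : {'GL_3[F]} => GLval x 0 0)); last first.
  move=> x y; rewrite !center_scalar => /eqP Ex /eqP Ey E; apply/val_inj.
  by rewrite -[val x]/(GLval x) -[val y]/(GLval y) Ex Ey E.
rewrite -(cardC1 (0 : F)); apply: eq_card => a; rewrite !inE; apply/imsetP/idP.
  move=> [x]; rewrite center_scalar => /eqP Ex ->; apply/eqP => z.
  by have : GLval x \in unitmx := GL_unitmx x; rewrite unitmxE Ex z det_scalar expr0n unitr0.
move=> a0; have au : (a%:M : 'M[F]_3) \in unitmx by rewrite unitmxE det_scalar unitrX // unitfE.
pose u : {'GL_3[F]} := FinRing.Unit (au : (_ : 'M[F]_3.-1.+1) \is a GRing.unit).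
have uE : GLval u = a%:M by [].
by exists u; rewrite ?center_scalar uE mxE ?eqxx.
Qed.

Lemma card_PGL3 : (#|PGL3 F|%:R : rat) = q%:R ^+ 3 * (q%:R ^+ 3 - 1) * (q%:R ^+ 2 - 1).
Proof.
have q1 : (1 < q)%N := finNzRing_gt1 F.
rewrite /PGL3 card_quotient ?gFnorm // -divgS ?center_sub //.
have dv : (#|'Z(GL)%g| %| #|GL|)%N by apply: cardSg; exact: center_sub.
have z0 : (#|'Z(GL)%g|%:R : rat) != 0 by rewrite card_center pnatr_eq0; lia.
have -> : ((#|GL| %/ #|'Z(GL)%g|)%:R : rat) = #|GL|%:R / #|'Z(GL)%g|%:R.
  by apply: (canRL (mulfK z0)); rewrite -natrM divnK.
apply: (canLR (mulfK z0)); rewrite card_center card_GL //.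
rewrite (_ : 'C(3, 2) = 3%N) // /index_iota /= !big_cons big_nil muln1 !natrM !natrB ?expn_gt0 ?(ltnW q1) // ?natrX ?expr1.
have -> : (q.-1%:R : rat) = q%:R - 1 by rewrite -subn1 natrB // ltnW.
by ring.
Qed.

End ProjectiveGroup.

(** The number of flags, (q^2 + q + 1)(q + 1), cancels against factors of the order of the group.
    Powers with integer exponents are used since 2 n - 3 and n - 2 are negative for n = 1. *)
Lemma count_quotient (q : nat) (m : nat) : (1 < q)%N ->
  ((q ^ 2 + q + 1) * q.+1)%:R * (q%:R ^+ 2 * (q%:R ^+ (2 * m) - q%:R ^+ m + q%:R ^+ m.+1) + q%:R ^+ 3 * (q%:R - 1))
    / (q%:R ^+ 3 * (q%:R ^+ 3 - 1) * (q%:R ^+ 2 - 1)) =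
  (q%:R ^ (2 * (m.+1)%:Z - 3) - q%:R ^ ((m.+1)%:Z - 2) + q%:R ^ ((m.+1)%:Z - 1) + q%:R - 1)
    / (q%:R - 1) ^+ 2 :> rat.
Proof.
move=> q1; have x1 : 1 < q%:R :> rat by rewrite ltr1n.
rewrite natrM !natrD natrX -[q.+1%:R]natr1 -[1%:R]/(1 : rat); move: (q%:R : rat) x1 => x x1.
have x0 : x != 0 by rewrite gt_eqF //; lra.
have e1 : x ^ (2 * (m.+1)%:Z - 3) = x ^+ (2 * m) / x.
  have -> : 2 * (m.+1)%:Z - 3 = (2 * m)%:Z - 1 by lia.
  by rewrite expfzDr.
have e2 : x ^ ((m.+1)%:Z - 2) = x ^+ m / x.
  have -> : (m.+1)%:Z - 2 = m%:Z - 1 by lia.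
  by rewrite expfzDr.
have e3 : x ^ ((m.+1)%:Z - 1) = x ^+ m.
  by have -> : (m.+1)%:Z - 1 = m%:Z by lia.
rewrite e1 e2 e3 (exprS x m); move: (x ^+ (2 * m)) (x ^+ m) => A B.
have n1 : x - 1 != 0 by rewrite gt_eqF //; lra.
have n2 : x + 1 != 0 by rewrite gt_eqF //; lra.
have n3 : x ^+ 2 + x + 1 != 0 by rewrite gt_eqF //; nra.
have -> : x ^+ 3 - 1 = (x - 1) * (x ^+ 2 + x + 1) by ring.
have -> : x ^+ 2 - 1 = (x - 1) * (x + 1) by ring.
by field; rewrite n1 n2 n3 x0.
Qed.

Theorem theorem1p5 (n : nat) (n_gt0 : (0 < n)%N) :
  (forall F : finFieldType,
     orbifold_count (ladder3 n) F =
     (#|F|%:R ^ (2 * n%:Z - 3) - #|F|%:R ^ (n%:Z - 2) + #|F|%:R ^ (n%:Z - 1)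
        + #|F|%:R - 1) / (#|F|%:R - 1) ^+ 2) /\
  (forall (R : realType) (Lambda : nat -> set (jet R)),
     (forall j : nat, (0 < j)%N -> legendrian_weave (ladder3 j) (Lambda j)) ->
     forall m : nat, (0 < m)%N ->
       legendrian_isotopic 3 (Lambda n) (Lambda m) <-> n = m).
Proof.
split=> [F|R Lambda hL m m_gt0].
  case: n n_gt0 => // k _; rewrite /orbifold_count count_framed sum_closed_walks card_PGL3.
  exact: count_quotient (finNzRing_gt1 F).
have weave j : (0 < j)%N -> exists f c, circle_weave j (Lambda j) f c /\ forall a, smooth (f a).
  move=> j0; have [gamma [f [[emb sf] low high [tr tr3] ->]]] := hL j j0.
  by exists f; eexists; split; first exact: (ladder_circle_weave j0 emb sf low high tr tr3).
split=> [iso|<-].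
  have [f [c [cw _]]] := weave n n_gt0; have [f' [c' [cw' _]]] := weave m m_gt0.
  exact: isotopic_circle_weaves n_gt0 m_gt0 cw cw' iso.
(* For n = m both links are the same set, and the constant isotopy of its sheets is taken. *)
have [f [c [cw sf]]] := weave n n_gt0; rewrite (cw_image cw).
by apply: constant_isotopy => // a b x; exact: (cw_disj cw).
Qed.
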